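(* A generic birational map of $\mathbb{P}^2(\mathbb{C})$ of degree $3$ is determined by the position of its $5$ fixed points and of its $5$ indeterminacy points with their multiplicities.
   Context: $\mathring{\mathrm{B}}\mathrm{ir}_3\subset\mathbb{P}^{29}(\mathbb{C})$ is the set of triples (up to scalar) $f=(f_0:f_1:f_2)$ of homogeneous polynomials of degree $3$ in $\mathbb{C}[x_0,x_1,x_2]$ without common factor defining a birational map of $\mathbb{P}^2(\mathbb{C})$; it is irreducible. The indeterminacy points of $f$ are the common zeros of the $f_i$ (set $\mathrm{Ind}\,f$); a fixed point of $f$ is a point $p\notin\mathrm{Ind}\,f\cup\mathrm{Ind}\,f^{-1}$ with $f(p)=p$. To $f$ is associated the foliation $\mathcal{F}(f)$ of $\mathbb{P}^2(\mathbb{C})$ defined by the $1$-form $(x_1f_2-x_2f_1)\mathrm{d}x_0+(x_2f_0-x_0f_2)\mathrm{d}x_1+(x_0f_1-x_1f_0)\mathrm{d}x_2$; when this form has no codimension one zeros, the singular points of $\mathcal{F}(f)$ are the fixed and indeterminacy points of $f$. The multiplicity of such a point $p$ is its multiplicity as a singularity of $\mathcal{F}(f)$: if in local coordinates $(u,v)$ at $p$ the foliation is given by $a\,\mathrm{d}u+b\,\mathrm{d}v$ with isolated zero, it is $\dim_{\mathbb{C}}\mathcal{O}_p/(a,b)$. For generic $f\in\mathring{\mathrm{B}}\mathrm{ir}_3$ there are $5$ fixed points, all of multiplicity $1$, and $5$ indeterminacy points, one of multiplicity $4$ and four of multiplicity $1$. ''Generic'' means belonging to a suitable nonempty Zariski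 open subset $U$ of $\mathring{\mathrm{B}}\mathrm{ir}_3$, and ''determined'' means: if $f,g\in U$ have the same set of fixed points, the same set of indeterminacy points and the same multiplicities at these points, then $f=g$. *)

(* Defs.v *)
From HB Require Import structures.
From mathcomp Require Import all_boot all_order all_algebra.
From mathcomp Require Import fraction.
From mathcomp Require Import complex.
From mathcomp Require Import reals.
From mathcomp Require Import mpoly.

Set Implicit Arguments.
Unset Strict Implicit.
Unset Printing Implicit Defensive.

Import GRing.Theory.
Local Open Scope ring_scope.

Local Notation "x %:F" := (tofrac x).

(* A point of the projective plane over K is a nonzero row vector p : 'rV[K]_3,
   taken up to proj_eq. A rational self-map of the plane is given by a triple
   of homogeneous polynomials of the same degree without common factor, taken
   up to triple_eq. *)

Definition proj_eq (K : fieldType) (n : nat) (p q : 'rV[K]_n) : Prop :=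
  exists2 c : K, c != 0 & q = c *: p.

Definition triple (K : fieldType) : Type := 3.-tuple {mpoly K[3]}.

Definition triple_eq (K : fieldType) (f g : triple K) : Prop :=
  exists2 c : K, c != 0 & forall i, tnth g i = c *: tnth f i.

Definition no_common_factor (K : fieldType) (f : triple K) : Prop :=
  forall d : {mpoly K[3]},
    (forall i, exists q, tnth f i = d * q) -> d \is a GRing.unit.

Definition rational_map (K : fieldType) (d : nat) (f : triple K) : Prop :=
  (forall i, tnth f i \is d.-homog) /\ no_common_factor f.

Definition comp_triple (K : fieldType) (f g : triple K) : triple K :=
  [tuple tnth f i \mPo g | i < 3].

Definition represents_id (K : fieldType) (f : triple K) : Prop :=
  exists2 h : {mpoly K[3]}, h != 0 & forall i, tnth f i = h * 'X_i.

(* g is the inverse of f, written without common factor; such a g is unique up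
   to triple_eq. *)
Definition inverse_map (K : fieldType) (f g : triple K) : Prop :=
  [/\ exists m, rational_map m g,
      represents_id (comp_triple f g) & represents_id (comp_triple g f)].

Definition Bir3 (K : fieldType) (f : triple K) : Prop :=
  rational_map 3 f /\ exists g, inverse_map f g.

Definition eval_triple (K : fieldType) (f : triple K) (p : 'rV[K]_3) :
    'rV[K]_3 :=
  \row_i (tnth f i).@[p 0].

Definition indeterminacy (K : fieldType) (f : triple K) (p : 'rV[K]_3) : Prop :=
  p != 0 /\ eval_triple f p = 0.

Definition fixed_point (K : fieldType) (f : triple K) (p : 'rV[K]_3) : Prop :=
  [/\ p != 0, ~ indeterminacy f p,
      exists2 g, inverse_map f g & ~ indeterminacy g p
    & proj_eq p (eval_triple f p)].

(* The coefficients of dx_0, dx_1, dx_2 in the 1-form defining F(f); indices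
   are taken modulo 3. *)
Definition foliation_form (K : fieldType) (f : triple K) : triple K :=
  [tuple 'X_(i + 1) * tnth f (i + 2) - 'X_(i + 2) * tnth f (i + 1) | i < 3].

(* The affine chart x_k = 1, whose coordinates are the two x_i with i != k in
   increasing order. *)
Definition dehomog (K : fieldType) (k : 'I_3) (P : {mpoly K[3]}) :
    {mpoly K[2]} :=
  P \mPo [tuple if unlift k i is Some j then 'X_j else 1 | i < 3].

Definition affine_point (K : fieldType) (k : 'I_3) (p : 'rV[K]_3) :
    'I_2 -> K :=
  fun j => p 0 (lift k j) / p 0 k.

(* The local ring of the affine plane at x, inside the field of rational
   functions. *)
Definition local_ring (K : fieldType) (x : 'I_2 -> K)
    (r : {fraction {mpoly K[2]}}) : Prop :=
  exists g h : {mpoly K[2]}, h.@[x] != 0 /\ r = g%:F / h%:F.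

Definition local_ideal (K : fieldType) (x : 'I_2 -> K) (a b : {mpoly K[2]})
    (r : {fraction {mpoly K[2]}}) : Prop :=
  exists s t, [/\ local_ring x s, local_ring x t & r = s * a%:F + t * b%:F].

Definition lin_comb (K : fieldType) (n : nat) (c : 'I_n -> K)
    (e : 'I_n -> {fraction {mpoly K[2]}}) : {fraction {mpoly K[2]}} :=
  \sum_(i < n) ((c i)%:MP)%:F * e i.

(* dim_K O_x / (a, b) = n: the classes of some e_0, ..., e_(n-1) in O_x form a
   basis of the quotient. *)
Definition local_dim (K : fieldType) (x : 'I_2 -> K) (a b : {mpoly K[2]})
    (n : nat) : Prop :=
  exists e : 'I_n -> {fraction {mpoly K[2]}},
    [/\ forall i, local_ring x (e i),
        forall r, local_ring x r ->
          exists c : 'I_n -> K, local_ideal x a b (r - lin_comb c e)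
      & forall c : 'I_n -> K,
          local_ideal x a b (lin_comb c e) -> forall i, c i = 0].

(* n is the multiplicity of p as a singularity of F(f). In the chart x_k = 1
   one has dx_k = 0, so that the form is a du + b dv with u, v the two
   remaining coordinates; n does not depend on k. No n exists when the zero at
   p is not isolated. *)
Definition multiplicity (K : fieldType) (f : triple K) (p : 'rV[K]_3)
    (n : nat) : Prop :=
  exists2 k : 'I_3, p 0 k != 0 &
    local_dim (affine_point k p)
      (dehomog k (tnth (foliation_form f) (lift k ord0)))
      (dehomog k (tnth (foliation_form f) (lift k ord_max))) n.

(* s lists without repetition the points of the plane satisfying P. *)
Definition enumerates (K : fieldType) (n : nat) (P : 'rV[K]_3 -> Prop)
    (s : 'I_n -> 'rV[K]_3) : Prop :=
  [/\ forall i, s i != 0,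
      forall i j, proj_eq (s i) (s j) -> i = j
    & forall p, p != 0 -> (P p <-> exists i, proj_eq (s i) p)].

Definition cubic_monomials : 10.-tuple 'X_{1..3} :=
  [tuple [multinom [tuple 3; 0; 0]]; [multinom [tuple 2; 1; 0]];
         [multinom [tuple 2; 0; 1]]; [multinom [tuple 1; 2; 0]];
         [multinom [tuple 1; 1; 1]]; [multinom [tuple 1; 0; 2]];
         [multinom [tuple 0; 3; 0]]; [multinom [tuple 0; 2; 1]];
         [multinom [tuple 0; 1; 2]]; [multinom [tuple 0; 0; 3]]]%N.

(* Homogeneous coordinates on the P^29 of triples of cubic forms. *)
Definition coefficients (K : fieldType) (f : triple K) : 'rV[K]_(3 * 10) :=
  mxvec (\matrix_(i < 3, j < 10) (tnth f i)@_(tnth cubic_monomials j)).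

(* U is the trace on Bir3 of the complement of a Zariski closed subset of
   P^29, namely the zero locus of a set S of homogeneous polynomials. *)
Definition open_in_Bir3 (K : fieldType) (U : triple K -> Prop) : Prop :=
  exists S : {mpoly K[3 * 10]} -> Prop,
    (forall F, S F -> exists d, F \is d.-homog) /\
    (forall f, U f <->
       Bir3 f /\ exists2 F, S F & F.@[coefficients f 0] != 0).

Definition has_generic_singularities (K : fieldType) (f : triple K) : Prop :=
  (exists2 s : 'I_5 -> 'rV[K]_3, enumerates (fixed_point f) s
     & forall i, multiplicity f (s i) 1) /\
  (exists2 t : 'I_5 -> 'rV[K]_3, enumerates (indeterminacy f) t
     & multiplicity f (t ord0) 4 /\
       forall i, i != ord0 -> multiplicity f (t i) 1).

Definition same_singularities (K : fieldType) (f g : triple K) : Prop :=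
  [/\ forall p, fixed_point f p <-> fixed_point g p,
      forall p, indeterminacy f p <-> indeterminacy g p
    & forall p, fixed_point f p \/ indeterminacy f p ->
        forall n, multiplicity f p n <-> multiplicity g p n].

(* Main.v *)
(* Every map considered has a base point p = (al : be : 1) which is double on all cubics of the net.
   A syzygy of degree one then brings f, up to a linear change in the target, to the form
   (t1 S, - t0 S, C), where t0, t1 are the coordinates of the pencil of lines through p and S, C are
   a conic and a cubic of degree one along these lines. Hence the four other base points lie over the
   roots of a binary quartic [qq], and the fixed points lie on a conic parametrised by the pencil,
   over the roots of a binary quintic [R5].

   If g has the same singularities, then p is its singularity of multiplicity 4. Since the components
   of g vanish doubly at p and vanish at the other base points, they are combinations of those of f,
   that is g = M f, and the fixed points are eigenvectors of M. Points of a smooth conic are in general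
   position, so M is scalar.

   Nondegeneracy of the singularities is expressed by saying that linear functionals killing an ideal
   attached to f kill (nearly) all forms of a certain degree. This holds as soon as some determinant
   of coefficients does not vanish, and the determinants are shown not to vanish at an explicit map
   [f0], by cofactors expressing monomials in terms of generators of the ideals. *)

Require Import Defs.
From Stdlib Require Import BinInt.
From HB Require Import structures.
From mathcomp Require Import all_boot all_order all_algebra.
From mathcomp Require Import perm complex reals fraction mpoly ring ssrZ.
From mathcomp Require boolp.

Set Implicit Arguments.
Unset Strict Implicit.
Unset Printing Implicit Defensive.

Import Order.TTheory GRing.Theory Num.Theory.
Local Open Scope ring_scope.

(** * Values of polynomials *)

Section PolynomialValues.
Variable K : numClosedFieldType.

(** The double base point comes from rationality. The inverse parametrises the cubics s f_i - f_j,
    which f carries to lines, and a cubic with a nonconstant rational parametrisation is singular.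
    Since the members of the pencil have boundedly many critical points, two of them are singular at
    the same point, and then so are f_i and f_j. The pencils of (f_0, f_1) and (f_0, f_2) share f_0,
    whose singular point is unique, so one point serves all three components. The syzygy reflects
    that f maps each line through p into a line with some normal n(t), and that the inverse recovers
    from y the only t with n(t) . y = 0. So n(t) . y is, as a form in t, a power of one linear form;
    linearity in y forces the power to be one. Nondegeneracy is quantified over arbitrary
    functionals because several tests are instances: evaluation at a further zero, the coefficient
    of e^2 along a line at p, and combinations of evaluations at many points. The inverse is written
    out from the normal form; this proves [f0] birational and keeps fixed points away from the
    indeterminacy of the inverse. *)

Lemma poly0_of_values (p : {poly K}) : (forall x, p.[x] = 0) -> p = 0.
Proof.
move=> p0; apply/eqP/negPn/negP => pn0.
have := @max_poly_roots _ p [seq i%:R | i <- iota 0 (size p)] pn0.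
rewrite size_map size_iota ltnn => H; suff : false by [].
apply: H; first by apply/allP => x _; rewrite /root p0.
by rewrite map_inj_uniq ?iota_uniq // => i j /eqP; rewrite eqr_nat => /eqP.
Qed.

Lemma poly_eq_of_values (p q : {poly K}) : (forall x, p.[x] = q.[x]) -> p = q.
Proof.
move=> pq; apply/eqP; rewrite -subr_eq0; apply/eqP/poly0_of_values => x.
by rewrite hornerD hornerN pq subrr.
Qed.

Lemma exists_nonroot (p : {poly K}) : p != 0 -> exists x, p.[x] != 0.
Proof.
by case/closed_nonrootP => x; exists x.
Qed.

Lemma mpoly_gen_ind (R : comNzRingType) (n : nat) (P : {mpoly R[n]} -> Prop) :
  (forall c, P c%:MP) -> (forall i, P 'X_i) ->
  (forall p q, P p -> P q -> P (p + q)) ->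
  (forall p q, P p -> P q -> P (p * q)) -> forall p, P p.
Proof.
move=> PC PX PD PM; elim/mpolyind => [|c m p _ _ Pp]; first by rewrite -mpolyC0.
apply: (PD _ _) => //; rewrite -mul_mpolyC; apply: (PM _ _) => //.
rewrite mpolyXE_id; elim/big_ind: _ => [|a b|i _]; [exact: (PC 1)|exact: (PM _ _)|].
elim: (m i) => [|k IH]; first by rewrite expr0; exact: (PC 1).
by rewrite exprS; apply: (PM _ _).
Qed.

(** Restriction to the curve parametrised by [g]. As an element of [{poly K}] it has a degree, roots
    and Taylor coefficients. *)
Definition along (n : nat) (g : 'I_n -> {poly K}) (P : {mpoly K[n]}) : {poly K} :=
  mmap polyC g P.

HB.instance Definition _ n (g : 'I_n -> {poly K}) :=
  GRing.RMorphism.copy (along g) (mmap polyC g).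

Lemma alongC n (g : 'I_n -> {poly K}) c : along g c%:MP = c%:P.
Proof. exact: mmapC. Qed.

Lemma alongX n (g : 'I_n -> {poly K}) i : along g 'X_i = g i.
Proof. by rewrite /along mmapX mmap1U. Qed.

Lemma alongZ n (g : 'I_n -> {poly K}) c P : along g (c *: P) = c *: along g P.
Proof. by rewrite /along mmapZ mul_polyC. Qed.

Lemma horner_along n (g : 'I_n -> {poly K}) (P : {mpoly K[n]}) x :
  (along g P).[x] = P.@[fun i => (g i).[x]].
Proof.
elim/mpoly_gen_ind: P => [c|i|p q Hp Hq|p q Hp Hq].
- by rewrite alongC hornerC mevalC.
- by rewrite alongX mevalXU.
- by rewrite rmorphD hornerD Hp Hq mevalD.
- by rewrite rmorphM hornerM Hp Hq mevalM.
Qed.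

Lemma deriv_along n (g : 'I_n -> {poly K}) (P : {mpoly K[n]}) :
  (along g P)^`() = \sum_i along g P^`M(i) * (g i)^`().
Proof.
elim/mpoly_gen_ind: P => [c|i|p q Hp Hq|p q Hp Hq].
- rewrite alongC derivC big1 // => i _.
  by rewrite mderivC rmorph0 mul0r.
- rewrite alongX (bigD1 i) //= big1 => [|j ji].
    rewrite addr0 mderivX mnm1E eqxx scale1r.
    by rewrite -{1}[U_(i)%MM]add0m addmK mpolyX0 rmorph1 mul1r.
  by rewrite mderivX mnm1E eq_sym (negPf ji) scale0r rmorph0 mul0r.
- rewrite rmorphD derivD Hp Hq -big_split; apply: eq_bigr => i _ /=.
  by rewrite mderivD rmorphD mulrDl.
- rewrite rmorphM derivM Hp Hq mulr_suml mulr_sumr -big_split.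
  apply: eq_bigr => i _ /=.
  by rewrite mderivM rmorphD !rmorphM mulrDl; congr (_ + _); ring.
Qed.

Lemma coef1_along n (g : 'I_n -> {poly K}) (P : {mpoly K[n]}) :
  (along g P)`_1 = \sum_i P^`M(i).@[fun j => (g j)`_0] * (g i)`_1.
Proof.
have -> : (along g P)`_1 = ((along g P)^`()).[0].
  by rewrite horner_coef0 coef_deriv mulr1n.
rewrite deriv_along horner_sum; apply: eq_bigr => i _.
rewrite hornerM horner_along !horner_coef0 coef_deriv mulr1n; congr (_ * _).
by apply: meval_eq => j; rewrite horner_coef0.
Qed.

(** On the ray through [x] only one power survives; the values of this identity give [meval_scale],
    its derivative at 1 gives Euler's identity. *)
Lemma along_homog n d (P : {mpoly K[n]}) (x : 'I_n -> K) : P \is d.-homog ->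
  along (fun i => x i *: 'X) P = P.@[x] *: 'X^d.
Proof.
move=> /dhomogP hP; rewrite [in LHS](mpolyE P) rmorph_sum mevalE scaler_suml.
rewrite !big_seq; apply: eq_bigr => m /hP md; rewrite /= alongZ -scalerA.
congr (_ *: _); rewrite /along mmapX /mmap1.
rewrite (eq_bigr (fun i => (x i ^+ m i)%:P * 'X^(m i))) => [|i _].
  by rewrite big_split /= -rmorph_prod /= mul_polyC prodrXr; congr (_ *: 'X^_); rewrite -[RHS]md [RHS]mdegE.
by rewrite -mul_polyC exprMn -rmorphXn.
Qed.

Lemma meval_scale n d (P : {mpoly K[n]}) (x : 'I_n -> K) c : P \is d.-homog ->
  P.@[fun i => c * x i] = c ^+ d * P.@[x].
Proof.
move=> hP; have := congr1 (horner^~ c) (along_homog x hP).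
rewrite horner_along hornerZ hornerXn mulrC => <-.
by apply: meval_eq => i; rewrite hornerZ hornerX mulrC.
Qed.

Lemma euler_homog n d (P : {mpoly K[n]}) (x : 'I_n -> K) : P \is d.-homog ->
  \sum_i P^`M(i).@[x] * x i = d%:R * P.@[x].
Proof.
move=> hP; have := congr1 (fun p => p^`().[1]) (along_homog x hP).
rewrite /= deriv_along horner_sum derivZ derivXn hornerZ hornerMn hornerXn.
rewrite expr1n mulr_natr mulrC mulr_natr => <-; apply: eq_bigr => i _.
rewrite hornerM horner_along derivZ derivX hornerZ hornerC mulr1.
by congr (_ * _); apply: meval_eq => j; rewrite hornerZ hornerX mulr1.
Qed.

(** Uniqueness of digits in base [D], so that the Kronecker substitution below separates
    monomials. *)
Lemma digits_inj n D (a b : 'I_n -> nat) : (forall i, a i < D)%N ->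
  (forall i, b i < D)%N ->
  (\sum_i a i * D ^ i = \sum_i b i * D ^ i)%N -> a =1 b.
Proof.
elim: n a b => [|n IH] a b aD bD; first by move=> _ [].
rewrite !big_ord_recl !expn0 !muln1 => E.
have D0 : (0 < D)%N by apply: leq_ltn_trans (aD ord0).
have shift (c : 'I_n.+1 -> nat) :
    (\sum_(i < n) c (lift ord0 i) * D ^ lift ord0 i =
     (\sum_(i < n) c (lift ord0 i) * D ^ i) * D)%N.
  by rewrite big_distrl; apply: eq_bigr => i _; rewrite /= /bump add1n expnSr mulnA.
rewrite !shift in E.
have E0 : a ord0 = b ord0.
  by have := congr1 (modn^~ D) E; rewrite /= ![(_ + _ * D)%N]addnC !modnMDl !modn_small.
have {}E := congr1 (divn^~ D) E.
rewrite /= ![(_ + _ * D)%N]addnC !divnMDl // !divn_small // !addn0 in E.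
have EE := IH (a \o lift ord0) (b \o lift ord0) (fun i => aD _) (fun i => bD _) E.
move=> i; case: (unliftP ord0 i) => [j ->|->//]; exact: EE.
Qed.

(* Kronecker substitution: X_i is replaced by a large enough power of one variable. *)
Lemma mpoly0_of_values n (P : {mpoly K[n]}) : (forall x, P.@[x] = 0) -> P = 0.
Proof.
move=> P0; pose D := msize P.
pose g := fun i : 'I_n => 'X^(D ^ i) : {poly K}.
have E : along g P = 0.
  by apply: poly0_of_values => x; rewrite horner_along P0.
apply/mpolyP => m; rewrite mcoeff0; apply/eqP; apply: contraT.
rewrite -mcoeff_msupp => mP.
have := congr1 (fun p : {poly K} => p`_(\sum_i m i * D ^ i)%N) E.
rewrite /along /mmap coef_sum coef0 (bigD1_seq m) ?msupp_uniq //=.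
have val (m' : 'X_{1..n}) : mmap1 g m' = 'X^(\sum_i m' i * D ^ i)%N.
  rewrite /mmap1 /g -prodrXr; apply: eq_bigr => i _.
  by rewrite -exprM mulnC.
rewrite [X in _ + X]big_seq_cond [X in _ + X]big1 ?addr0 => [|m' /andP[m'P m'm]].
  by rewrite val coefCM coefXn eqxx mulr1 => /eqP; rewrite mcoeff_eq0 mP.
rewrite val coefCM coefXn; case: eqP => [H|]; last by rewrite mulr0.
case/eqP: m'm; apply/mnmP; apply: (@digits_inj _ D _ _ _ _ (esym H)).
  move=> i; apply: leq_ltn_trans (msize_mdeg_lt m'P).
  by rewrite mdegE (bigD1 i) //= leq_addr.
move=> i; apply: leq_ltn_trans (msize_mdeg_lt mP).
by rewrite mdegE (bigD1 i) //= leq_addr.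
Qed.

Lemma mpoly_eq_of_values n (P Q : {mpoly K[n]}) :
  (forall x, P.@[x] = Q.@[x]) -> P = Q.
Proof.
move=> PQ; apply/eqP; rewrite -subr_eq0; apply/eqP/mpoly0_of_values => x.
by rewrite mevalB PQ subrr.
Qed.

Lemma exists_nonzero n (P : {mpoly K[n]}) : P != 0 -> exists x, P.@[x] != 0.
Proof.
move=> P0; have [//|H] := boolp.EM (exists x, P.@[x] != 0).
case/eqP: P0; apply: mpoly0_of_values => x.
by apply/eqP/negPn/negP => Hx; apply: H; exists x.
Qed.

End PolynomialValues.

(** * Conditions open in the coefficients *)

Section Elimination.
Variable K : numClosedFieldType.
Implicit Types (f : triple K).

Definition cubic f := forall i, tnth f i \is 3.-homog.

(** Agreement is asked on cubic triples only, because [coefficients] reads just the ten cubic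
    monomials of each component. The degree is recorded since open sets are cut out by homogeneous
    polynomials. *)
Definition polyfun (e : nat) (phi : triple K -> K) :=
  exists2 F : {mpoly K[3 * 10]}, F \is e.-homog &
    forall f, cubic f -> phi f = F.@[coefficients f 0].

Lemma polyfun_ext e phi psi : polyfun e psi ->
  (forall f, cubic f -> phi f = psi f) -> polyfun e phi.
Proof. by case=> F hF FE E; exists F => // f hf; rewrite E // FE. Qed.

Lemma polyfun0 e : polyfun e (fun=> 0).
Proof. by exists 0; [exact: dhomog0|move=> f _; rewrite meval0]. Qed.

Lemma polyfunC c : polyfun 0 (fun=> c).
Proof.
exists c%:MP; last by move=> f _; rewrite mevalC.
by rewrite -[c%:MP]mulr1 mul_mpolyC; apply: dhomogZ; exact: dhomog1.
Qed.

Lemma polyfunD e phi psi : polyfun e phi -> polyfun e psi ->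
  polyfun e (fun f => phi f + psi f).
Proof.
move=> [F hF FE] [G hG GE]; exists (F + G); first exact: dhomogD.
by move=> f hf; rewrite mevalD FE // GE.
Qed.

Lemma polyfunM e e' phi psi : polyfun e phi -> polyfun e' psi ->
  polyfun (e + e') (fun f => phi f * psi f).
Proof.
move=> [F hF FE] [G hG GE]; exists (F * G); first exact: dhomogM.
by move=> f hf; rewrite mevalM FE // GE.
Qed.

Lemma polyfunZ e c phi : polyfun e phi -> polyfun e (fun f => c * phi f).
Proof. by move=> h; rewrite -[e]add0n; apply: polyfunM => //; exact: polyfunC. Qed.

Lemma polyfun_sum e (I : Type) (r : seq I) (Q : pred I) (phi : I -> triple K -> K) :
  (forall i, polyfun e (phi i)) -> polyfun e (fun f => \sum_(i <- r | Q i) phi i f).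
Proof.
move=> h; elim: r => [|i r IH].
  by apply: polyfun_ext (polyfun0 e) _ => f _; rewrite big_nil.
case Qi: (Q i); last by apply: polyfun_ext IH _ => f _; rewrite big_cons Qi.
by apply: polyfun_ext (polyfunD (h i) IH) _ => f _; rewrite big_cons Qi.
Qed.

Lemma polyfun_prod e n (phi : 'I_n -> triple K -> K) :
  (forall i, polyfun e (phi i)) -> polyfun (n * e) (fun f => \prod_i phi i f).
Proof.
elim: n phi => [|n IH] phi h.
  by apply: polyfun_ext (polyfunC 1) _ => f _; rewrite big_ord0.
rewrite mulSn; apply: polyfun_ext (polyfunM (h ord0) (IH (phi \o lift ord0) _)) _.
  by move=> i; apply: h.
by move=> f _; rewrite big_ord_recl.
Qed.

(** The Leibniz terms are forms of one degree because all entries share the degree [e]; this is why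
    families are later brought to a uniform degree. *)
Lemma polyfun_det e n (A : triple K -> 'M[K]_n) :
  (forall i j, polyfun e (fun f => A f i j)) -> polyfun (n * e) (fun f => \det (A f)).
Proof.
move=> h.
apply: polyfun_ext (@polyfun_sum (n * e) _ (index_enum _) xpredT
  (fun (s : 'S_n) f => (-1) ^+ s * \prod_i A f i (s i)) _) _ => // s.
by apply: polyfunZ; apply: polyfun_prod => i; apply: h.
Qed.

Definition polyfam (e : nat) (P : triple K -> {mpoly K[3]}) :=
  forall m, polyfun e (fun f => (P f)@_m).

Lemma polyfam_const P : polyfam 0 (fun=> P).
Proof. by move=> m; exact: polyfunC. Qed.

Lemma cubic_monomialsP (m : 'X_{1..3}) : mdeg m = 3 -> m \in cubic_monomials.
Proof.
pose o1 : 'I_3 := lift ord0 ord0; pose o2 : 'I_3 := lift ord0 (lift ord0 ord0).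
rewrite mdegE !big_ord_recl big_ord0 -/o1 -/o2 => H.
have -> : m = [multinom [tuple m ord0; m o1; m o2]].
  apply/mnmP => i; rewrite multinomE (tnth_nth 0%N) /=.
  case: i => [[|[|[|//]]] hi] /=; congr (m _); exact: val_inj.
move: H; case: (m ord0) => [|[|[|[|//]]]]; case: (m o1) => [|[|[|[|//]]]];
  by case: (m o2) => [|[|[|[|//]]]].
Qed.

Lemma polyfam_coord i : polyfam 1 (fun f => tnth f i).
Proof.
move=> m; have [m3|m3] := eqVneq (mdeg m) 3; last first.
  apply: polyfun_ext (polyfun0 1) _ => f hf.
  by apply: dhomog_nemf_coeff (hf i) _.
have /tnthP[j ->] := cubic_monomialsP m3.
exists 'X_(mxvec_index i j); first by rewrite dhomogX /= mdeg1.
by move=> f _; rewrite mevalXU mxvecE mxE.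
Qed.

Lemma polyfamD e P Q : polyfam e P -> polyfam e Q -> polyfam e (fun f => P f + Q f).
Proof.
move=> hP hQ m; apply: polyfun_ext (polyfunD (hP m) (hQ m)) _ => f _.
by rewrite mcoeffD.
Qed.

Lemma polyfamM e e' P Q : polyfam e P -> polyfam e' Q ->
  polyfam (e + e') (fun f => P f * Q f).
Proof.
move=> hP hQ m.
apply: polyfun_ext; last by move=> f _; rewrite mcoeffM; reflexivity.
by apply: polyfun_sum => k; apply: polyfunM; [apply: hP|apply: hQ].
Qed.

Lemma polyfamMl e p P : polyfam e P -> polyfam e (fun f => p * P f).
Proof. by move=> h; rewrite -[e]add0n; apply: polyfamM => //; exact: polyfam_const. Qed.

Lemma polyfamB e P Q : polyfam e P -> polyfam e Q -> polyfam e (fun f => P f - Q f).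
Proof.
move=> hP hQ m; apply: polyfun_ext (polyfamD hP (polyfamMl (-1) hQ) m) _ => f _.
by rewrite mulN1r.
Qed.

Lemma polyfam_sum e (I : Type) (r : seq I) (P : I -> triple K -> {mpoly K[3]}) :
  (forall i, polyfam e (P i)) -> polyfam e (fun f => \sum_(i <- r) P i f).
Proof.
move=> h m; apply: polyfun_ext (polyfun_sum r xpredT (fun i => h i m)) _ => f _.
by rewrite raddf_sum.
Qed.

Lemma polyfam_deriv e i P : polyfam e P -> polyfam e (fun f => (P f)^`M(i)).
Proof.
move=> hP m; apply: polyfun_ext (polyfunZ (m i).+1%:R (hP (m + U_(i))%MM)) _ => f _.
by rewrite mcoeff_deriv mulr_natl.
Qed.

Lemma polyfam_coef e m P : polyfam e P -> polyfam e (fun f => ((P f)@_m)%:MP).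
Proof.
move=> hP k; have [->|k0] := eqVneq k 0%MM.
  by apply: polyfun_ext (hP m) _ => f _; rewrite mcoeffC eqxx mulr1.
apply: polyfun_ext (polyfun0 e) _ => f _.
by rewrite mcoeffC (negPf k0) mulr0.
Qed.

Lemma cubicE (P : {mpoly K[3]}) : P \is 3.-homog ->
  P = \sum_(j < 10) P@_(tnth cubic_monomials j) *: 'X_[tnth cubic_monomials j].
Proof.
move=> hf; apply/mpolyP => m; rewrite raddf_sum /=.
have [m3|m3] := eqVneq (mdeg m) 3; last first.
  rewrite (dhomog_nemf_coeff hf m3) big1 // => j _.
  rewrite mcoeffZ mcoeffX; case: eqP => [E|]; last by rewrite mulr0.
  case/eqP: m3; rewrite -E; move: (mem_tnth j cubic_monomials).
  rewrite !inE; do 9?[case/orP]; move/eqP->; by rewrite mdegE !big_ord_recl big_ord0.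
have /tnthP[j ->] := cubic_monomialsP m3.
rewrite (bigD1 j) //= mcoeffZ mcoeffX eqxx mulr1 big1 ?addr0 // => k kj.
rewrite mcoeffZ mcoeffX (inj_eq _) ?(negPf kj) ?mulr0 //.
by apply/tuple_uniqP.
Qed.

Lemma polyfam_comp i (q : 3.-tuple {mpoly K[3]}) : polyfam 1 (fun f => tnth f i \mPo q).
Proof.
move=> m; apply: (@polyfun_ext _ _ (fun f => \sum_(j < 10)
    ('X_[tnth cubic_monomials j] \mPo q)@_m * (tnth f i)@_(tnth cubic_monomials j))).
  by apply: polyfun_sum => j; apply: polyfunZ; apply: polyfam_coord.
move=> f hf; rewrite [in LHS](cubicE (hf i)) rmorph_sum raddf_sum /=.
by apply: eq_bigr => j _; rewrite comp_mpolyZ mcoeffZ mulrC.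
Qed.

(** Lets cofactors be replaced by their parts of complementary degree, which keeps combinations of
    forms homogeneous. *)
Lemma pihomogM d N (C P : {mpoly K[3]}) : P \is d.-homog -> (d <= N)%N ->
  pihomog mdeg N (C * P) = pihomog mdeg (N - d) C * P.
Proof.
move=> hP dN; pose k := (maxn (msize C) N).+1.
have CE : C = \sum_(i < k) pihomog mdeg i C.
  by apply: pihomog_partitionE; rewrite leqW // leq_max leqnn.
rewrite [in LHS]CE mulr_suml raddf_sum /=.
have lk : (N - d < k)%N by rewrite ltnS leq_max leq_subr orbT.
rewrite (bigD1 (Ordinal lk)) //= big1 ?addr0 => [|i iN].
  by rewrite pihomog_dE // -{2}(subnK dN); apply: dhomogM; rewrite ?pihomogP.
have hh : pihomog mdeg i C * P \is (i + d).-homog.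
  by apply: dhomogM => //; exact: pihomogP.
apply: (pihomog_ne0 _ hh).
by apply: contraNneq iN => E; apply/eqP/val_inj; rewrite /= -E addnK.
Qed.

Definition functional (L : {mpoly K[3]} -> K) :=
  forall a P Q, L (a *: P + Q) = a * L P + L Q.

Lemma functional0 L : functional L -> L 0 = 0.
Proof.
move=> h; have := h 1 0 0; rewrite scaler0 addr0 mul1r.
by move/eqP; rewrite -subr_eq0 opprD addNKr oppr_eq0 => /eqP.
Qed.

Lemma functional_sum L (I : Type) (r : seq I) (c : I -> K) (P : I -> {mpoly K[3]}) :
  functional L -> L (\sum_(i <- r) c i *: P i) = \sum_(i <- r) c i * L (P i).
Proof.
move=> h; elim: r => [|i r IH]; first by rewrite !big_nil functional0.
by rewrite !big_cons h IH.
Qed.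

(* The rows of the matrix are combinations of the P_j with constant cofactors; modulo E they
   specialise to the monomials ms at f0, whence determinant 1 there. *)
Lemma elimination (J : finType) e (P : J -> triple K -> {mpoly K[3]})
    (dg : J -> nat) N (ms : seq 'X_{1..3}) (f0 : triple K) (E : {mpoly K[3]}) (dE : nat) :
  (forall j, polyfam e (P j)) ->
  (forall j f, cubic f -> P j f \is (dg j).-homog) ->
  (forall j, dg j <= N)%N -> cubic f0 -> uniq ms ->
  E \is dE.-homog -> (dE <= N)%N -> (forall Q m, m \in ms -> (Q * E)@_m = 0) ->
  (forall m, m \in ms -> mdeg m = N /\
     exists (C : J -> {mpoly K[3]}) Q, 'X_[m] = \sum_j C j * P j f0 + Q * E) ->
  exists phi : triple K -> K, [/\ exists d, polyfun d phi, phi f0 != 0 &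
    forall f, cubic f -> phi f != 0 -> forall L, functional L ->
      (forall C j, L (C * P j f) = 0) ->
      (forall m, mdeg m = N -> m \notin ms -> L 'X_[m] = 0) ->
      forall m, mdeg m = N -> L 'X_[m] = 0].
Proof.
move=> hP dP dN c0 ums hE dEN E0 hms; pose n := size ms; pose mm (i : 'I_n) := nth 0%MM ms i.
have mmP i : mm i \in ms by apply: mem_nth.
have mm_inj : injective mm.
  by move=> i j /eqP; rewrite nth_uniq // => /eqP/val_inj.
have /fin_all_exists[C CE] : forall i, exists C : J -> {mpoly K[3]}, exists Q,
    'X_[mm i] = \sum_j C j * P j f0 + Q * E by move=> i; case: (hms _ (mmP i)).
(* Truncating the cofactors found at [f0] makes the combination [Q i f] homogeneous of degree N for
   every cubic f. *)
pose D i j := pihomog mdeg (N - dg j) (C i j).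
pose Q i f := \sum_j D i j * P j f.
have Q0 i j : (Q i f0)@_(mm j) = (i == j)%:R.
  have [R RE] := CE i; have : 'X_[mm i] = Q i f0 + pihomog mdeg (N - dE) R * E.
    rewrite -(@pihomog_dE _ _ mdeg N 'X_[mm i]) ?dhomogX; last by apply/eqP; case: (hms _ (mmP i)).
    rewrite RE raddfD raddf_sum /= (pihomogM _ hE dEN); congr (_ + _).
    by apply: eq_bigr => k _; rewrite /= (pihomogM _ (dP k f0 c0)).
  move/(congr1 (mcoeff (mm j))); rewrite mcoeffD E0 // addr0 mcoeffX (inj_eq mm_inj) => <-.
  by [].
have hQ i : polyfam e (Q i) by apply: polyfam_sum => j; apply: polyfamMl.
have dQ i f : cubic f -> Q i f \is N.-homog.
  move=> hf; apply: rpred_sum => j _; rewrite -(subnK (dN j)).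
  by apply: dhomogM; [exact: pihomogP|exact: dP].
pose A f : 'M[K]_n := \matrix_(i, j) (Q i f)@_(mm j).
exists (fun f => \det (A f)); split.
- exists (n * e)%N; apply: polyfun_det => i j.
  by apply: polyfun_ext (hQ i (mm j)) _ => f _; rewrite mxE.
- have -> : A f0 = 1%:M; last by rewrite det1 oner_neq0.
  by apply/matrixP => i j; rewrite !mxE Q0.
move=> f hf phi0 L hL LP Lrest m mN.
have [mms|mms] := boolP (m \in ms); last exact: Lrest.
pose v : 'cV[K]_n := \col_j L 'X_[mm j].
(* Row i says [L (Q i f) = 0]: monomials outside [ms] are killed by hypothesis, so only the unknowns
   indexed by [ms] remain. *)
have Av : A f *m v = 0.
  apply/colP => i; rewrite !mxE.
  have LQ : L (Q i f) = 0.
    have -> : Q i f = \sum_j 1 *: (D i j * P j f).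
      by apply: eq_bigr => j _; rewrite scale1r.
    by rewrite functional_sum // big1 // => j _; rewrite LP mulr0.
  transitivity (L (Q i f)) => //; rewrite [in RHS](mpolyE (Q i f)) functional_sum //.
  under eq_bigr => j _ do rewrite !mxE.
  rewrite -(big_mkord xpredT (fun j => (Q i f)@_(nth 0%MM ms j) * L 'X_[nth 0%MM ms j])).
  rewrite -(big_nth 0%MM xpredT (fun m => (Q i f)@_m * L 'X_[m])).
  rewrite (bigID (mem (msupp (Q i f)))) /= [X in _ + X]big1 ?addr0; last first.
    by move=> k; rewrite -mcoeff_eq0 => /eqP->; rewrite mul0r.
  rewrite [RHS](bigID (mem ms)) /= [X in _ = _ + X]big_seq_cond [X in _ = _ + X]big1 ?addr0; last first.
    move=> k /andP[kQ kms]; rewrite Lrest ?mulr0 //.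
    exact: (dhomog_mf (dQ i f hf)).
  rewrite -[LHS]big_filter -[RHS]big_filter; apply: perm_big.
  apply: uniq_perm; rewrite ?filter_uniq ?msupp_uniq // => k.
  by rewrite !mem_filter andbC.
have Au : A f \in unitmx by rewrite unitmxE unitfE.
have v0 : v = 0 by rewrite -(mulKmx Au v) Av mulmx0.
have lm : (index m ms < n)%N by rewrite index_mem.
have := congr1 (fun u : 'cV_n => u (Ordinal lm) 0) v0.
by rewrite !mxE /mm /= nth_index.
Qed.

End Elimination.

(** * Vectors with three coordinates and cross products *)

Definition i0 : 'I_3 := @Ordinal 3 0 isT.
Definition i1 : 'I_3 := @Ordinal 3 1 isT.
Definition i2 : 'I_3 := @Ordinal 3 2 isT.

Definition v3 (T : Type) (a b c : T) : 'I_3 -> T :=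
  fun i => match val i with 0%N => a | 1%N => b | _ => c end.

Lemma ord3P (P : 'I_3 -> Prop) : P i0 -> P i1 -> P i2 -> forall i, P i.
Proof.
move=> h0 h1 h2 [[|[|[|//]]] hi].
- by have -> : Ordinal hi = i0 by apply: val_inj.
- by have -> : Ordinal hi = i1 by apply: val_inj.
- by have -> : Ordinal hi = i2 by apply: val_inj.
Qed.

Lemma sum3 (V : nmodType) (F : 'I_3 -> V) : \sum_i F i = F i0 + F i1 + F i2.
Proof.
rewrite !big_ord_recl big_ord0 addr0 addrA.
by congr (F _ + F _ + F _); apply: val_inj.
Qed.

Definition dot (R : nzRingType) (a b : 'I_3 -> R) : R :=
  a i0 * b i0 + a i1 * b i1 + a i2 * b i2.

Definition cross (R : nzRingType) (a b : 'I_3 -> R) : 'I_3 -> R :=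
  v3 (a i1 * b i2 - a i2 * b i1) (a i2 * b i0 - a i0 * b i2)
     (a i0 * b i1 - a i1 * b i0).

(** Vectors perpendicular to [a] and [b] are parallel to their cross product. Stated without
    division, it also applies to vectors of polynomials. *)
Lemma cross_parallel (R : comNzRingType) (v a b : 'I_3 -> R) :
  dot v a = 0 -> dot v b = 0 ->
  forall i j, v i * cross a b j = v j * cross a b i.
Proof.
rewrite /dot => va vb.
have E01 : v i0 * cross a b i1 = v i1 * cross a b i0.
  apply/eqP; rewrite -subr_eq0; apply/eqP; rewrite /cross /v3 /=.
  transitivity (a i2 * (v i0 * b i0 + v i1 * b i1 + v i2 * b i2)
    - b i2 * (v i0 * a i0 + v i1 * a i1 + v i2 * a i2)); first by ring.
  by rewrite va vb !mulr0 subr0.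
have E02 : v i0 * cross a b i2 = v i2 * cross a b i0.
  apply/eqP; rewrite -subr_eq0; apply/eqP; rewrite /cross /v3 /=.
  transitivity (b i1 * (v i0 * a i0 + v i1 * a i1 + v i2 * a i2)
    - a i1 * (v i0 * b i0 + v i1 * b i1 + v i2 * b i2)); first by ring.
  by rewrite va vb !mulr0 subr0.
have E12 : v i1 * cross a b i2 = v i2 * cross a b i1.
  apply/eqP; rewrite -subr_eq0; apply/eqP; rewrite /cross /v3 /=.
  transitivity (a i0 * (v i0 * b i0 + v i1 * b i1 + v i2 * b i2)
    - b i0 * (v i0 * a i0 + v i1 * a i1 + v i2 * a i2)); first by ring.
  by rewrite va vb !mulr0 subr0.
by apply: ord3P; apply: ord3P => //; symmetry.
Qed.

(** * Rational plane cubics *)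

Section RationalCurves.
Variable K : numClosedFieldType.

(** Over an algebraically closed field, absence of a common root means that the gcd is constant. *)
Lemma bezout3 (v : 'I_3 -> {poly K}) : (forall x, exists i, (v i).[x] != 0) ->
  exists u : 'I_3 -> {poly K}, \sum_i u i * v i = 1.
Proof.
move=> hv; pose G := gcdp (v i0) (gcdp (v i1) (v i2)).
have Gv : forall i, G %| v i.
  apply: ord3P; rewrite /G ?dvdp_gcdl //.
    by apply: dvdp_trans (dvdp_gcdr _ _) (dvdp_gcdl _ _).
  by apply: dvdp_trans (dvdp_gcdr _ _) (dvdp_gcdr _ _).
have sG : size G == 1.
  apply/negPn/negP => /closed_rootP[x xG]; have [i /negP[]] := hv x.
  by apply: root_dvdp (Gv i) xG.
have [[a b] /= ab] := Bezoutp (v i1) (v i2).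
have [[c d] /= cd] := Bezoutp (v i0) (gcdp (v i1) (v i2)).
have [[k1 k2] /andP[/= k10 k20] kE] := eqpP _ _ ab.
have [[l1 l2] /andP[/= l10 l20] lE] := eqpP _ _ cd.
have [g g0 gE] := size_poly1P _ sG.
exists (v3 ((l1 / l2 / g) *: c) ((l1 / l2 / g) *: (d * ((k1 / k2) *: a)))
   ((l1 / l2 / g) *: (d * ((k1 / k2) *: b)))).
rewrite sum3 /v3 /=.
have E1 : gcdp (v i1) (v i2) = (k1 / k2) *: (a * v i1 + b * v i2).
  by rewrite mulrC -scalerA kE scalerA mulVf // scale1r.
have E2 : g%:P = (l1 / l2) *: (c * v i0 + d * gcdp (v i1) (v i2)).
  by rewrite mulrC -scalerA lE scalerA mulVf // scale1r -gE.
have : g^-1%:P * g%:P = 1 :> {poly K} by rewrite -polyCM mulVf.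
rewrite E2 E1 => <-; rewrite -!mul_polyC !polyCM; ring.
Qed.

Lemma deriv_eq0 (p : {poly K}) : p^`() = 0 -> p = (p`_0)%:P.
Proof.
move=> dp; apply/polyP => -[|i]; rewrite coefC //=.
have := congr1 (fun q : {poly K} => q`_i) dp; rewrite coef_deriv coef0 => /eqP.
by rewrite mulrn_eq0 /= => /eqP.
Qed.

(** The coefficient in degree [n] is recorded even when it is zero: it is the value at infinity of
    [p] seen as a form of degree [n]. *)
Definition has_top (n : nat) (p : {poly K}) (a : K) := (size p <= n.+1)%N /\ p`_n = a.

Lemma has_topM n m p q a b : has_top n p a -> has_top m q b ->
  has_top (n + m) (p * q) (a * b).
Proof.
move=> [sp <-] [sq <-]; split.
  apply: leq_trans (size_polyMleq _ _) _.
  by rewrite -subn1 leq_subLR add1n -addnS -addSn leq_add.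
have ln : (n < (n + m).+1)%N by rewrite ltnS leq_addr.
rewrite coefM (bigD1 (Ordinal ln)) //= addKn big1 ?addr0 // => i iN.
have [in_|ni|ni] := ltngtP i n.
- by rewrite (nth_default _ (leq_trans sq _)) ?mulr0 // ltn_subRL ltn_add2r.
- by rewrite nth_default ?mul0r // (leq_trans sp).
- by case/eqP: iN; apply: val_inj.
Qed.

Lemma has_topX n p a k : has_top n p a -> has_top (k * n) (p ^+ k) (a ^+ k).
Proof.
move=> h; elim: k => [|k IH]; last by rewrite !exprS mulSn; apply: has_topM.
by split; rewrite !expr0 ?mul0n ?size_polyC ?oner_neq0 // coefC.
Qed.

Lemma has_top_along n (g : 'I_3 -> {poly K}) e (P : {mpoly K[3]}) :
  (forall i, (size (g i) <= n.+1)%N) -> P \is e.-homog ->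
  has_top (e * n) (along g P) (P.@[fun i => (g i)`_n]).
Proof.
move=> sg /dhomogP hP.
have top (m : 'X_{1..3}) : mdeg m = e ->
    has_top (e * n) (mmap1 g m) (\prod_i (g i)`_n ^+ m i).
  move=> <-; rewrite mdegE /mmap1 !big_ord_recl !big_ord0 addn0 !mulr1 !mulnDl.
  by do 2?[apply: has_topM]; apply: has_topX; split.
split.
  rewrite /along /mmap big_seq; elim/big_ind: _ => [|p q sp sq|m /hP /top[sm _]].
  - by rewrite size_poly0.
  - by apply: leq_trans (size_polyD _ _) _; rewrite geq_max sp.
  by rewrite mul_polyC; apply: leq_trans (size_scale_leq _ _) sm.
rewrite /along /mmap coef_sum mevalE big_seq [RHS]big_seq; apply: eq_bigr => m /hP /top[_ cm].
by rewrite coefCM cm.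
Qed.

Lemma dhomog_deriv n d (P : {mpoly K[n]}) j : P \is d.+1.-homog -> P^`M(j) \is d.-homog.
Proof.
move=> /dhomogP hP; apply/dhomogP => m; rewrite mcoeff_msupp mcoeff_deriv mulrn_eq0 /= => mc.
have := hP (m + U_(j))%MM; rewrite mcoeff_msupp mc => /(_ isT).
by rewrite /= mdegD mdeg1 addn1 => -[].
Qed.

(* A smooth cubic would satisfy grad c (g) = k * (g x g') for a coprime parametrisation g, with
   the left side of degree 2 deg g and the right side of smaller degree. *)
Lemma rational_cubic_singular (c : {mpoly K[3]}) (g : 'I_3 -> {poly K}) :
  c \is 3.-homog -> along g c = 0 ->
  (forall (k : {poly K}) (p : 'I_3 -> K), ~ forall i, g i = k * (p i)%:P) ->
  exists2 p : 'I_3 -> K, exists i, p i != 0 & forall j, c^`M(j).@[p] = 0.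
Proof.
move=> hc gc npar.
pose G := gcdp (g i0) (gcdp (g i1) (g i2)).
have Gg : forall i, G %| g i.
  apply: ord3P; rewrite /G ?dvdp_gcdl //.
    by apply: dvdp_trans (dvdp_gcdr _ _) (dvdp_gcdl _ _).
  by apply: dvdp_trans (dvdp_gcdr _ _) (dvdp_gcdr _ _).
have G0 : G != 0.
  apply/eqP => G0; case: (npar 0 (fun=> 0)) => i; rewrite mul0r.
  by apply/eqP; rewrite -dvd0p -G0.
pose h i : {poly K} := g i %/ G.
have gE i : g i = h i * G by rewrite divpK.
have hcop x : exists i, (h i).[x] != 0.
  apply: boolp.contrapT => H.
  have {}H i : ('X - x%:P) %| h i.
    by rewrite dvdp_XsubCl /root; apply/negPn/negP => hx; apply: H; exists i.
  have : ('X - x%:P) * G %| G.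
    by rewrite {2}/G !dvdp_gcd !gE !dvdp_mul.
  move/(dvdp_leq G0); rewrite size_mul ?polyXsubC_eq0 // size_XsubC.
  by rewrite addSn /= add1n ltnn.
have hc0 : along h c = 0.
  have : G ^+ 3 * along h c = 0.
    rewrite -gc; apply: poly_eq_of_values => x.
    rewrite hornerM horner_exp !horner_along -(meval_scale _ _ hc).
    by apply: meval_eq => i; rewrite gE hornerM mulrC.
  by move/eqP; rewrite mulf_eq0 expf_eq0 (negPf G0) /= => /eqP.
apply: boolp.contrapT => smooth.
have {}smooth (p : 'I_3 -> K) i : p i != 0 -> exists j, c^`M(j).@[p] != 0.
  move=> pi; apply: boolp.contrapT => H; apply: smooth; exists p; first by exists i.
  by move=> j; apply/eqP/negPn/negP => Hj; apply: H; exists j.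
pose v j := along h c^`M(j).
have [u uE] : exists u : 'I_3 -> {poly K}, \sum_i u i * v i = 1.
  apply: bezout3 => x; have [i hi] := hcop x.
  have [j hj] := smooth (fun i => (h i).[x]) _ hi; exists j.
  by rewrite /v horner_along.
(* Euler's identity and the derivative of c(h) = 0 make the gradient [v] perpendicular to h and h',
   hence parallel to [w]; the Bezout relation for [v] turns this into w = k v. *)
have vh : dot v h = 0.
  apply: poly_eq_of_values => x; rewrite horner0.
  have := euler_homog (fun i => (h i).[x]) hc.
  rewrite -horner_along hc0 horner0 mulr0 sum3 => <-.
  by rewrite /dot !hornerD !hornerM /v !horner_along.
have vh' : dot v (fun i => (h i)^`()) = 0.
  by have := deriv_along h c; rewrite hc0 deriv0 sum3 => E; exact: (esym E).
pose w : 'I_3 -> {poly K} := cross h (fun i => (h i)^`()).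
have par i j : v i * w j = v j * w i by apply: cross_parallel.
pose k : {poly K} := \sum_i u i * w i.
have wE j : w j = k * v j.
  rewrite -[LHS]mul1r -uE !mulr_suml; apply: eq_bigr => i _.
  by rewrite -mulrA (par i j); ring.
pose D := (maxn (size (h i0)) (maxn (size (h i1)) (size (h i2)))).-1.
have sh : forall i, (size (h i) <= D.+1)%N.
  apply: ord3P; apply: leq_trans _ (leqSpred _); rewrite !leq_max leqnn ?orbT //.
have [i hiD] : exists i, (h i)`_D != 0.
  apply: boolp.contrapT => H.
  have lt i : (size (h i) <= D)%N.
    have := sh i; rewrite leq_eqVlt ltnS => /orP[/eqP E|//]; case: H; exists i.
    by rewrite -[D]/(D.+1.-1) -E -lead_coefE lead_coef_eq0 -size_poly_eq0 E.
  have [D0|D0] := posnP D.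
    have [i hi] := hcop 0; have := lt i; rewrite D0 leqn0 size_poly_eq0 => /eqP hi0.
    by rewrite hi0 horner0 eqxx in hi.
  have : (maxn (size (h i0)) (maxn (size (h i1)) (size (h i2))) <= D)%N.
    by rewrite !geq_max !lt.
  by move: D0; rewrite /D; case: (maxn _ (maxn _ _)) => [|n] //= _; rewrite ltnn.
have dc j : c^`M(j) \is 2.-homog by apply: dhomog_deriv.
(* The coefficients of degree D are the point of the curve at infinity. The gradient does not vanish
   there either, so some [v j] has degree 2 D. *)
have [j vj] := smooth (fun i => (h i)`_D) _ hiD.
have svj : (2 * D < size (v j))%N.
  have [_ top] := has_top_along sh (dc j); rewrite ltnNge; apply/negP => s.
  by move: vj; rewrite -top nth_default ?eqxx.
(* The size is the degree plus one: the degrees of the factors h and h' add up to at most 2 D -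
   1. *)
have sw : (size (w j) <= 2 * D)%N.
  have s2 a b : (size (h a * (h b)^`())%R <= 2 * D)%N.
    have [->|ha] := eqVneq (h b)^`() 0; first by rewrite mulr0 size_poly0.
    have hb : (h b) != 0 by apply: contraNneq ha => ->; rewrite deriv0.
    apply: leq_trans (size_polyMleq _ _) _; rewrite -subn1 leq_subLR add1n.
    have lt : (size (h b)^`() < D.+1)%N by apply: leq_trans (lt_size_deriv hb) (sh b).
    by rewrite mul2n -addnn -addSn; apply: leq_add.
  by case: j {vj svj} => -[|[|[|//]]] ?; rewrite /w /cross /v3 /=;
    apply: leq_trans (size_polyD _ _) _; rewrite size_polyN geq_max !s2.
have k0 : k = 0.
  apply/eqP/negPn/negP => k0; have : (size (w j) < size (v j))%N by apply: leq_ltn_trans svj.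
  rewrite wE size_mul //; last by rewrite -size_poly_gt0 (leq_trans _ svj).
  by rewrite -size_poly_gt0 in k0; case: (size k) k0 => // s _; rewrite addSn /= ltnNge leq_addl.
have w0 i' : w i' = 0 by rewrite wE k0 mul0r.
have [b bE] := bezout3 hcop.
(* With w = 0 the derivative is parallel to h, and the Bezout relation makes the factor [e] a
   polynomial; comparing degrees gives e = 0, so h is constant. *)
pose e := \sum_i b i * (h i)^`().
have h'E j' : (h j')^`() = e * h j'.
  rewrite -[LHS]mul1r -bE !mulr_suml; apply: eq_bigr => a _.
  rewrite -!mulrA; congr (_ * _); apply/eqP; rewrite -subr_eq0; apply/eqP.
  move: (w0 i0) (w0 i1) (w0 i2); rewrite /w /cross /v3 /= => e0 e1 e2.
  move: a j'; apply: ord3P; apply: ord3P; rewrite [_^`() * _]mulrC ?subrr //.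
  - by rewrite -oppr0 -e1; ring.
  - by rewrite -oppr0 -e2; ring.
  - by rewrite -oppr0 -e0; ring.
have hi0 : h i != 0 by apply: contraNneq hiD => ->; rewrite coef0.
have e0 : e = 0.
  apply/eqP/negPn/negP => e0; have := lt_size_deriv hi0.
  rewrite h'E size_mul //.
  by rewrite -size_poly_gt0 in e0; case: (size e) e0 => // s _; rewrite addSn /= ltnNge leq_addl.
apply: (npar G (fun j => (h j)`_0)) => j'.
by rewrite gE [LHS]mulrC {1}(@deriv_eq0 (h j')) // h'E e0 mul0r.
Qed.

End RationalCurves.

(** * The double point *)

Section DoublePoint.
Variable K : numClosedFieldType.
Implicit Types (f g : triple K).

Definition ev f (x : 'I_3 -> K) : 'I_3 -> K := fun i => (tnth f i).@[x].

(** As f (g y) is proportional to y, the cubic s f_i - f_j contains the image under g of the line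
    y_j = s y_i, so it is rational and therefore singular. The polynomial [P] excludes the values of
    s for which h vanishes at the starting point of the chosen parametrisation of that line. *)
Lemma pencil_singular f g h (i j k : 'I_3) : i != j -> k != i -> k != j -> cubic f ->
  h != 0 -> (forall y l, ev f (ev g y) l = h.@[y] * y l) ->
  exists2 P : {poly K}, P != 0 & forall s, P.[s] != 0 ->
    exists2 p : 'I_3 -> K, exists l, p l != 0 &
      forall l, s * (tnth f i)^`M(l).@[p] = (tnth f j)^`M(l).@[p].
Proof.
move=> ij ki kj hf h0 fg.
have [y] : exists y, (h * 'X_i).@[y] != 0.
  by apply: exists_nonzero; rewrite mulf_neq0 // -msize_poly_eq0 msizeX.
rewrite mevalM mevalXU mulf_eq0 negb_or => /andP[hy yi].
pose P := along (fun l => if l == j then y i *: 'X else (y l)%:P) h.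
have PE s : P.[s] = h.@[fun l => if l == j then s * y i else y l].
  rewrite horner_along; apply: meval_eq => l; case: eqP => _; last by rewrite hornerC.
  by rewrite hornerZ hornerX mulrC.
exists P.
  apply: contraNneq hy => P0; have := PE (y j / y i); rewrite P0 horner0 => /esym/eqP.
  move/eqP => <-; apply/eqP/meval_eq => l; case: eqP => // ->.
  by rewrite divfK.
move=> s Ps.
pose yc l : {poly K} := if l == j then (s * y i)%:P else if l == k then (y k)%:P + 'X else (y l)%:P.
pose yt t l := (yc l).[t].
pose c := s *: tnth f i - tnth f j.
have ycE t : [/\ yt t i = y i, yt t j = s * y i & yt t k = y k + t].
  rewrite /yt /yc (negPf ij) eqxx [i == k]eq_sym (negPf ki) (negPf kj) eqxx.
  by rewrite !hornerE.
have cE x : c.@[x] = s * ev f x i - ev f x j by rewrite mevalB mevalZ.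
have gam0 : h.@[yt 0] != 0.
  apply: contraNneq Ps => E; rewrite PE -E; apply/eqP/meval_eq => l.
  rewrite /yt /yc; case: eqP => _; first by rewrite hornerC.
  by case: eqP => [->|_]; rewrite !hornerE.
have [|||p p0 hp] := @rational_cubic_singular _ c (fun l => along yc (tnth g l)).
- by apply: rpredB; [apply: dhomogZ|]; exact: hf.
- apply: poly_eq_of_values => t; rewrite horner0 horner_along cE.
  have E l : ev f (fun l => (along yc (tnth g l)).[t]) l = h.@[yt t] * yt t l.
    by rewrite -fg; apply: meval_eq => l'; rewrite horner_along.
  by rewrite !E; case: (ycE t) => -> -> _; rewrite mulrCA subrr.
(* If the curve were a single point p, then f p would be proportional to points of the line with
   different ratios of the coordinates k and i. *)
- move=> kk p hp.
  have E t l : h.@[yt t] * yt t l = kk.[t] ^+ 3 * ev f p l.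
    rewrite -fg -(meval_scale _ _ (hf l)); apply: meval_eq => l'.
    by have := congr1 (horner^~ t) (hp l'); rewrite horner_along hornerM hornerC.
  have [t] : exists t, (along yc h * 'X).[t] != 0.
    apply: exists_nonroot; rewrite mulf_neq0 ?polyX_eq0 //.
    by apply: contraNneq gam0 => H; rewrite /yt -horner_along H horner0.
  rewrite hornerM hornerX mulf_eq0 negb_or horner_along -/(yt t) => /andP[ht t0].
  have X u : h.@[yt u] != 0 -> ev f p k * y i = ev f p i * (y k + u).
    move=> hu; have [E1 _ E2] := ycE u.
    have Ei := E u i; have Ek := E u k; rewrite E1 in Ei; rewrite E2 in Ek.
    by apply: (mulfI hu); rewrite mulrCA Ei [RHS]mulrCA Ek; ring.
  have /eqP := X t ht; rewrite (X 0 gam0) addr0 mulrDr -subr_eq0 opprD addNKr oppr_eq0.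
  rewrite mulf_eq0 (negPf t0) orbF => /eqP fi0.
  have [E1 _ _] := ycE 0; have /eqP := E 0 i.
  by rewrite fi0 mulr0 E1 mulf_eq0 (negPf gam0) (negPf yi).
exists p => // l; have := hp l; rewrite mderivB mderivZ mevalB mevalZ.
by move/eqP; rewrite subr_eq0 => /eqP.
Qed.

Lemma submonomial (m : 'X_{1..3}) N : (N <= mdeg m)%N ->
  exists m1 m2 : 'X_{1..3}, m = (m1 + m2)%MM /\ mdeg m2 = N.
Proof.
elim: N => [|N IH] hN.
  by exists m, 0%MM; rewrite addm0 mdeg0.
have [m1 [m2 [mE m2N]]] := IH (ltnW hN).
have : (0 < mdeg m1)%N by rewrite -(ltn_add2r (mdeg m2)) -mdegD -mE m2N.
rewrite mdegE lt0n sum_nat_eq0 negb_forall => H; case/existsP: H => i.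
rewrite /= -lt0n => m1i.
exists (m1 - U_(i))%MM, (m2 + U_(i))%MM; split.
  rewrite mE; apply/mnmP => l; rewrite !mnmDE mnmBE mnm1E.
  case: (i =P l) => [<-|_]; last by rewrite subn0 addn0.
  by rewrite [(m2 i + _)%N]addnC addnA subnK.
by rewrite mdegD mdeg1 m2N addn1.
Qed.

Lemma functional_eval (D : nat) (c : 'I_D -> K) (q : 'I_D -> 'I_3 -> K) :
  functional (fun P => \sum_k c k * P.@[q k]).
Proof.
move=> a P Q; rewrite mulr_sumr -big_split; apply: eq_bigr => k _ /=.
by rewrite mevalD mevalZ; ring.
Qed.

Section Finite.
Variables (J : finType) (P : J -> {mpoly K[3]}) (N : nat).
(** Dual form of the statement that, modulo x_2, the ideal of the [P j] contains all forms of degree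
    [N]; hence its zeros avoid the line x_2 = 0. *)
Hypothesis noinf : forall L : {mpoly K[3]} -> K, functional L ->
  (forall C j, L (C * P j) = 0) ->
  (forall m, mdeg m = N -> m i2 != 0%N -> L 'X_[m] = 0) ->
  forall m, mdeg m = N -> L 'X_[m] = 0.

Lemma zero_not_at_infinity (p : 'I_3 -> K) l : p l != 0 -> (forall j, (P j).@[p] = 0) ->
  p i2 != 0.
Proof.
move=> pl hp; apply: contraNneq pl => p2.
have H : forall m, mdeg m = N -> 'X_[m].@[p] = 0.
  apply: noinf => [a A B|C j|m _ m2]; first by rewrite mevalD mevalZ.
    by rewrite mevalM hp mulr0.
  rewrite mevalX (bigD1 i2) //= p2 expr0n (negPf m2) mul0r //.
have := H (U_(l) *+ N)%MM; rewrite mdegMn mdeg1 mul1n => /(_ erefl).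
by rewrite -mpolyXn rmorphXn /= mevalXU => /eqP; rewrite expf_eq0 => /andP[_].
Qed.

(** With more zeros than monomials of degree below [N], a nontrivial combination of evaluations
    kills all these monomials. Because x_2 = 1 at the zeros, [noinf] propagates this to every
    degree, whereas evaluations at distinct points are independent. *)
Lemma finitely_many_zeros (D : nat) (q : 'I_D -> 'I_3 -> K) :
  (forall k, q k i2 = 1) -> (forall k j, (P j).@[q k] = 0) ->
  (forall k l, k != l -> exists a, q k a != q l a) ->
  (D <= #|{: 'X_{1..3 < N}}|)%N.
Proof.
move=> q1 qP qd; rewrite leqNgt; apply/negP => MD.
pose M := #|{: 'X_{1..3 < N}}|.
pose A : 'M[K]_(D, M) := \matrix_(k, b) 'X_[(enum_val b : 'X_{1..3 < N})].@[q k].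
have : kermx A != 0.
  rewrite kermx_eq0 /row_free; apply/negP => /eqP rA.
  by have := rank_leq_col A; rewrite rA leqNgt MD.
case/rowV0Pn => c /sub_kermxP cA c0.
pose L (Q : {mpoly K[3]}) := \sum_k c 0 k * Q.@[q k].
have small m : (mdeg m < N)%N -> L 'X_[m] = 0.
  move=> hm; have := congr1 (fun u : 'rV_M => u 0 (enum_rank (BMultinom hm))) cA.
  rewrite !mxE => <-; apply: eq_bigr => k _.
  by rewrite mxE enum_rankK.
have shift m Q : L ('X_[(m + U_(i2))%MM] * Q) = L ('X_[m] * Q).
  apply: eq_bigr => k _; rewrite !mevalM mpolyXD mevalM mevalXU q1 mulr1 //.
have all_ n m : (mdeg m < n)%N -> L 'X_[m] = 0.
  elim: n m => // n IH m; rewrite ltnS => mn.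
  have [/small //|Nm] := ltnP (mdeg m) N.
  have [b [m' [mE m'N]]] := submonomial Nm.
  have bN : (mdeg b + N <= n)%N by rewrite -m'N -mdegD -mE.
  rewrite mE mpolyXD; move: m' m'N {mE}.
  apply: (@noinf (fun Q => L ('X_[b] * Q))) => [a Q S|C j|m' m'N m'2].
  - by rewrite mulrDr -scalerAr /L functional_eval.
  - by rewrite /L big1 // => k _; rewrite !mevalM qP !mulr0.
  have mE : m' = (m' - U_(i2) + U_(i2))%MM.
    apply/mnmP => l; rewrite mnmDE mnmBE mnm1E; case: (i2 =P l) => [<-|_].
      by rewrite subnK // lt0n.
    by rewrite subn0 addn0.
  have d : (mdeg (m' - U_(i2))%MM).+1 = N by rewrite -m'N {2}mE mdegD mdeg1 addn1.
  rewrite mE -mpolyXD addmA -['X_[_]]mulr1 shift mulr1; apply: IH.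
  by rewrite mdegD (leq_trans _ bN) // -d addnS.
have L0 Q : L Q = 0.
  rewrite (mpolyE Q) functional_sum; last exact: functional_eval.
  by rewrite big1 // => m _; rewrite (all_ (mdeg m).+1) ?mulr0.
have [k ck] : exists k, c 0 k != 0.
  apply: boolp.contrapT => H; case/eqP: c0; apply/rowP => k; rewrite mxE.
  by apply/eqP/negPn/negP => ck; apply: H; exists k.
have /fin_all_exists[a aP] : forall l, exists a, (k != l -> q k a != q l a).
  move=> l; have [->|kl] := eqVneq k l; first by exists i0.
  by have [a ha] := qd _ _ kl; exists a.
have := L0 (\prod_(l | l != k) ('X_(a l) - (q l (a l))%:MP)).
rewrite /L (bigD1 k) //= [X in _ + X]big1 ?addr0 => [|l lk].
  move/eqP; rewrite mulf_eq0 (negPf ck) /= rmorph_prod /= prodf_seq_eq0.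
  case/hasP => l _ /andP[lk]; rewrite mevalB mevalXU mevalC subr_eq0.
  by apply/negP; apply: aP; rewrite eq_sym.
by rewrite rmorph_prod /= (bigD1 l) //= mevalB mevalXU mevalC subrr mul0r mulr0.
Qed.

End Finite.

(** Its zeros are the points where the two gradients are dependent, among them the singular points
    of all members of the pencil. *)
Definition grad_pencil (i j : 'I_3) f : 'I_3 -> {mpoly K[3]} :=
  cross (fun l => (tnth f i)^`M(l)) (fun l => (tnth f j)^`M(l)).

(* For L a combination of evaluations this bounds the critical points of the members of the pencil
   spanned by f_i and f_j and keeps them off the line x_2 = 0. In this form, quantified over all
   functionals, the condition is open in f by elimination. *)
Definition finite_pencil N (i j : 'I_3) f := forall L : {mpoly K[3]} -> K, functional L ->
  (forall C l, L (C * grad_pencil i j f l) = 0) ->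
  (forall m, mdeg m = N -> m i2 != 0%N -> L 'X_[m] = 0) ->
  forall m, mdeg m = N -> L 'X_[m] = 0.

(* The gradient ideal of f_i has codimension at most one in degree N.+1. *)
Definition nodal N (i : 'I_3) f := forall L : {mpoly K[3]} -> K, functional L ->
  (forall C l, L (C * (tnth f i)^`M(l)) = 0) ->
  L ('X_i2 ^+ N.+1) = 0 ->
  forall m, mdeg m = N.+1 -> L 'X_[m] = 0.

Lemma meval_cross (a b : 'I_3 -> {mpoly K[3]}) p l :
  (cross a b l).@[p] = cross (fun i => (a i).@[p]) (fun i => (b i).@[p]) l.
Proof.
by move: l; apply: ord3P; rewrite /cross /v3 /= mevalB !mevalM.
Qed.

(** Pigeonhole: more values of s than possible critical points force two members to be singular at
    the same q. Then s_a grad f_i = grad f_j = s_b grad f_i at q with s_a and s_b distinct, and both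
    gradients vanish. *)
Lemma pencil_base_point N f g h (i j k : 'I_3) :
  i != j -> k != i -> k != j -> cubic f -> h != 0 ->
  (forall y l, ev f (ev g y) l = h.@[y] * y l) -> finite_pencil N i j f ->
  exists2 p : 'I_3 -> K, p i2 = 1 &
    forall l, (tnth f i)^`M(l).@[p] = 0 /\ (tnth f j)^`M(l).@[p] = 0.
Proof.
move=> ij ki kj hf h0 fg fin.
have [P P0 hP] := pencil_singular ij ki kj hf h0 fg.
pose D := #|{: 'X_{1..3 < N}}|.+1.
have [s [s_inj sP]] : exists s : 'I_D -> K, injective s /\ forall a, P.[s a] != 0.
  have [r [ur sr rP]] : exists r : seq K, [/\ uniq r, size r = D & all (fun x => P.[x] != 0) r].
    elim: D => [|n [r [ur sr rP]]]; first by exists [::].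
    have [x] : exists x, (P * \prod_(y <- r) ('X - y%:P)).[x] != 0.
      apply: exists_nonroot; rewrite mulf_neq0 // prodf_seq_neq0.
      by apply/allP => y _; rewrite polyXsubC_eq0.
    rewrite hornerM mulf_eq0 negb_or horner_prod prodf_seq_neq0 => /andP[Px /allP xr].
    exists (x :: r); rewrite /= ur sr Px rP andbT; split => //.
    by apply/negP => /xr /=; rewrite !hornerE subrr eqxx.
  exists (fun a => nth 0 r a); split.
    by move=> a b /eqP; rewrite nth_uniq ?sr // => /eqP/val_inj.
  by move=> a; apply: (allP rP); rewrite mem_nth ?sr.
have crossP (p : 'I_3 -> K) t : (forall l, t * (tnth f i)^`M(l).@[p] = (tnth f j)^`M(l).@[p]) ->
    forall l, (grad_pencil i j f l).@[p] = 0.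
  move=> hp l; rewrite meval_cross; move: l.
  by apply: ord3P; rewrite /cross /v3 /= -!hp; ring.
have /fin_all_exists[q qP] : forall a, exists q : 'I_3 -> K, q i2 = 1 /\
    forall l, s a * (tnth f i)^`M(l).@[q] = (tnth f j)^`M(l).@[q].
  move=> a; have [p [l pl] hp] := hP _ (sP a).
  have p2 := zero_not_at_infinity fin pl (crossP _ _ hp).
  exists (fun l => (p i2)^-1 * p l); split; first by rewrite mulVf.
  by move=> l'; rewrite !(meval_scale _ _ (dhomog_deriv _ (hf _))) mulrCA hp.
have [[a [b [ab qab]]]|H] := boolp.EM (exists a b, a != b /\ q a =1 q b).
  exists (q a); first by case: (qP a).
  move=> l; have [_ /(_ l) Ea] := qP a; have [_ /(_ l) Eb] := qP b.
  rewrite -!(meval_eq _ qab) -Ea in Eb.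
  suff E0 : (tnth f i)^`M(l).@[q a] = 0 by rewrite -Ea E0 mulr0.
  have sab : s a - s b != 0 by rewrite subr_eq0 (inj_eq s_inj).
  by apply: (mulfI sab); rewrite mulrBl Eb subrr mulr0.
have := finitely_many_zeros fin (fun a => proj1 (qP a))
  (fun a => crossP _ _ (proj2 (qP a))).
rewrite /D ltnn => /(_ _)/negP[] // a b ab; apply: boolp.contrapT => Hab.
apply: H; exists a, b; split => // l; apply/eqP/negPn/negP => hl.
by apply: Hab; exists l.
Qed.

(** The functional Q(p) - Q(q) kills the gradient ideal and the power of x_2; on x_l x_2^N it equals
    p_l - q_l. *)
Lemma nodal_unique N i f (p q : 'I_3 -> K) : nodal N i f -> p i2 = 1 -> q i2 = 1 ->
  (forall l, (tnth f i)^`M(l).@[p] = 0) -> (forall l, (tnth f i)^`M(l).@[q] = 0) ->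
  p =1 q.
Proof.
move=> nod p2 q2 hp hq l.
have := nod (fun Q => Q.@[p] - Q.@[q]) _ _ _ (U_(l) + U_(i2) *+ N)%MM.
rewrite mdegD mdeg1 mdegMn mdeg1 mul1n add1n mpolyXD -mpolyXn !mevalM !rmorphXn /=.
rewrite !mevalXU p2 q2 !expr1n !mulr1 => H; apply/eqP; rewrite -subr_eq0; apply/eqP/H => //.
- by move=> a A B; rewrite !mevalD !mevalZ; ring.
- by move=> C l'; rewrite !mevalM hp hq !mulr0 subrr.
- by rewrite subrr.
Qed.

Lemma double_point N N' N'' f g h : cubic f -> h != 0 ->
  (forall y l, ev f (ev g y) l = h.@[y] * y l) ->
  finite_pencil N i0 i1 f -> finite_pencil N' i0 i2 f -> nodal N'' i0 f ->
  exists2 p : 'I_3 -> K, p i2 = 1 & forall i l, (tnth f i)^`M(l).@[p] = 0.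
Proof.
move=> hf h0 fg f01 f02 nod.
have [p p2 hp] := pencil_base_point (i := i0) (j := i1) (k := i2) isT isT isT hf h0 fg f01.
have [q q2 hq] := pencil_base_point (i := i0) (j := i2) (k := i1) isT isT isT hf h0 fg f02.
have pq := nodal_unique nod p2 q2 (fun l => proj1 (hp l)) (fun l => proj1 (hq l)).
exists p => //; apply: ord3P => l; [by case: (hp l)|by case: (hp l)|].
by rewrite (meval_eq _ pq); case: (hq l).
Qed.

End DoublePoint.

(** * Binary forms *)

Section BinaryForms.
Variable K : numClosedFieldType.

(* The form of degree n with dehomogenisation p; its value at (t, 0) is read off the coefficient
   of degree n. *)
Definition hval (n : nat) (p : {poly K}) (t0 t1 : K) : K :=
  if t1 == 0 then p`_n * t0 ^+ n else t1 ^+ n * p.[t0 / t1].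

(** Forms are handled through their values on pairs, so that identities between them are left to
    [ring]. *)
Definition bform (n : nat) (phi : K -> K -> K) :=
  exists2 p : {poly K}, (size p <= n.+1)%N & forall t0 t1, phi t0 t1 = hval n p t0 t1.

Lemma bform_ext n phi psi : bform n psi -> (forall a b, phi a b = psi a b) -> bform n phi.
Proof. by case=> p sp pE E; exists p => // a b; rewrite E pE. Qed.

Lemma bform_const c : bform 0 (fun _ _ => c).
Proof.
exists c%:P => [|a b]; first by rewrite size_polyC leq_b1.
by rewrite /hval; case: eqP => _; rewrite expr0 ?mul1r ?mulr1 ?hornerC // coefC.
Qed.

Lemma bform_fst : bform 1 (fun a b => a).
Proof.
exists 'X => [|a b]; first by rewrite size_polyX.
rewrite /hval; case: eqP => [_|/eqP b0]; first by rewrite coefX mul1r expr1.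
by rewrite hornerX expr1 mulrC divfK.
Qed.

Lemma bform_snd : bform 1 (fun a b => b).
Proof.
exists 1 => [|a b]; first by rewrite size_poly1.
rewrite /hval; case: eqP => [->|/eqP b0]; first by rewrite coef1 mul0r.
by rewrite hornerC expr1 mulr1.
Qed.

Lemma bformD n phi psi : bform n phi -> bform n psi -> bform n (fun a b => phi a b + psi a b).
Proof.
move=> [p sp pE] [q sq qE]; exists (p + q) => [|a b].
  by apply: leq_trans (size_polyD _ _) _; rewrite geq_max sp.
by rewrite pE qE /hval; case: eqP => _; rewrite ?coefD ?mulrDl // hornerD mulrDr.
Qed.

Lemma bformM n m phi psi : bform n phi -> bform m psi ->
  bform (n + m) (fun a b => phi a b * psi a b).
Proof.
move=> [p sp pE] [q sq qE].
have [s c] := has_topM (conj sp erefl) (conj sq erefl).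
exists (p * q) => // a b; rewrite pE qE /hval; case: eqP => _.
  by rewrite c exprD; ring.
by rewrite hornerM exprD; ring.
Qed.

Lemma bformZ n c phi : bform n phi -> bform n (fun a b => c * phi a b).
Proof. by move=> h; rewrite -[n]add0n; apply: bformM => //; exact: bform_const. Qed.

Lemma bformN n phi : bform n phi -> bform n (fun a b => - phi a b).
Proof. by move=> h; apply: bform_ext (bformZ (-1) h) _ => a b; rewrite mulN1r. Qed.

Lemma bformB n phi psi : bform n phi -> bform n psi -> bform n (fun a b => phi a b - psi a b).
Proof. by move=> h h'; apply: bformD => //; exact: bformN. Qed.

Lemma bform_meval d n (P : {mpoly K[3]}) (phi : 'I_3 -> K -> K -> K) : P \is d.-homog ->
  (forall i, bform n (phi i)) -> bform (d * n) (fun a b => P.@[fun i => phi i a b]).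
Proof.
move=> hP /fin_all_exists2[p sp pE].
have [s c] := has_top_along sp hP.
exists (along p P) => // a b; rewrite (meval_eq _ (fun i => pE i a b)) /hval.
case: eqP => _.
  rewrite c; under meval_eq => i do rewrite mulrC.
  by rewrite (meval_scale _ _ hP) mulrC mulnC exprM.
by rewrite (meval_scale _ _ hP) horner_along mulnC exprM.
Qed.

Lemma bform_mul_eq0 n m phi psi : bform n phi -> bform m psi ->
  (forall a b, phi a b * psi a b = 0) ->
  (forall a b, phi a b = 0) \/ (forall a b, psi a b = 0).
Proof.
move=> [p sp pE] [q sq qE] H.
have : p * q = 0.
  apply: poly0_of_values => x; rewrite hornerM; have := H x 1.
  by rewrite pE qE /hval oner_eq0 !expr1n !mul1r divr1.
move/eqP; rewrite mulf_eq0 => /orP[/eqP E|/eqP E]; [left|right] => a b.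
  by rewrite pE E /hval coef0 horner0 mul0r mulr0 if_same.
by rewrite qE E /hval coef0 horner0 mul0r mulr0 if_same.
Qed.

Definition nonzero (a b : K) := (a != 0) || (b != 0).

Lemma bform_root n phi : bform n.+1 phi -> exists a b, nonzero a b /\ phi a b = 0.
Proof.
move=> [p sp pE]; have [p0|pn0] := eqVneq p`_n.+1 0.
  by exists 1, 0; rewrite /nonzero oner_neq0 pE /hval eqxx p0 mul0r.
have /closed_rootP[x px] : size p != 1%N.
  by apply: contraNneq pn0 => s1; rewrite nth_default // s1.
exists x, 1; rewrite /nonzero oner_neq0 orbT pE /hval oner_eq0 divr1.
by rewrite (eqP px) mulr0.
Qed.

Lemma bform_div n phi a b : bform n.+1 phi -> nonzero a b -> phi a b = 0 ->
  exists2 psi, bform n psi & forall t0 t1, phi t0 t1 = (b * t0 - a * t1) * psi t0 t1.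
Proof.
move=> [p sp pE] ab; rewrite pE /hval; case: eqP => [b0|/eqP b0].
  have a0 : a != 0 by move: ab; rewrite /nonzero b0 eqxx orbF.
  move/eqP; rewrite mulf_eq0 expf_eq0 (negPf a0) andbF orbF => /eqP p0.
  (* The root is (1 : 0): division lowers the formal degree and keeps the dehomogenisation up to a
     constant. *)
  exists (fun t0 t1 => (- a^-1) * hval n p t0 t1).
    apply: bformZ; exists p => //; move: sp; rewrite leq_eqVlt => /orP[/eqP s|//].
    have : lead_coef p = 0 by rewrite lead_coefE s.
    by move/eqP; rewrite lead_coef_eq0 => /eqP->; rewrite size_poly0.
  move=> t0 t1; rewrite pE.
  have -> : (b * t0 - a * t1) * (- a^-1 * hval n p t0 t1) = t1 * hval n p t0 t1.
    by rewrite b0; field.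
  rewrite /hval.
  case: eqP => [->|/eqP t10]; first by rewrite p0 !mul0r.
  by rewrite exprS mulrA.
move/eqP; rewrite mulf_eq0 expf_eq0 (negPf b0) andbF /= => /factor_theorem[q qE].
have sq : (size q <= n.+1)%N.
  have [->|q0] := eqVneq q 0; first by rewrite size_poly0.
  by move: sp; rewrite qE size_mul ?polyXsubC_eq0 // size_XsubC addn2.
exists (fun t0 t1 => b^-1 * hval n q t0 t1); first by apply: bformZ; exists q.
move=> t0 t1; rewrite pE /hval; case: eqP => [->|/eqP t10].
  rewrite qE mulrBr coefB coefMX coefMC /= [q`_n.+1]nth_default // mul0r subr0 mulr0 subr0.
  by rewrite exprS; field.
by rewrite qE hornerM hornerXsubC exprS; field; rewrite b0.
Qed.

Lemma bform_factor n phi : bform n phi -> (exists a b, phi a b != 0) ->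
  exists c (s : seq (K * K)), [/\ c != 0, size s = n, all (fun r => nonzero r.1 r.2) s &
    forall t0 t1, phi t0 t1 = c * \prod_(r <- s) (r.2 * t0 - r.1 * t1)].
Proof.
elim: n phi => [|n IH] phi h [a0 [b0 h0]].
  case: h => p sp pE; have pc := size1_polyC sp.
  exists p`_0, [::]; split=> // [|t0 t1].
    apply: contraNneq h0 => p0; rewrite pE pc p0 /hval.
    by rewrite coefC horner0 mul0r mulr0 if_same.
  by rewrite big_nil pE /hval; case: eqP => _; rewrite ?expr0 // mul1r {1}pc hornerC mulr1.
have [a [b [ab pab]]] := bform_root h.
have [psi hpsi E] := bform_div h ab pab.
have [|c [s [c0 ss hs sE]]] := IH psi hpsi.
  by exists a0, b0; apply: contraNneq h0 => p0; rewrite E p0 mulr0.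
exists c, ((a, b) :: s); split=> //=; rewrite ?ss ?hs ?andbT //.
by move=> t0 t1; rewrite E sE big_cons /=; ring.
Qed.

Lemma bform_prod (s : seq (K * K)) :
  bform (size s) (fun t0 t1 => \prod_(r <- s) (r.2 * t0 - r.1 * t1)).
Proof.
elim: s => [|r s IH].
  by apply: bform_ext (bform_const 1) _ => a b; rewrite big_nil.
apply: (@bform_ext (1 + size s)); last by move=> a b; rewrite big_cons; reflexivity.
apply: bformM => //; apply: bformB; apply: bformZ; [exact: bform_fst|exact: bform_snd].
Qed.

Lemma bform_distinct_roots n phi : bform n phi -> (exists a b, phi a b != 0) ->
  (forall a b psi, nonzero a b -> bform (n - 2) psi ->
     ~ forall t0 t1, phi t0 t1 = (b * t0 - a * t1) ^+ 2 * psi t0 t1) ->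
  exists r : 'I_n -> K * K, [/\ forall i, nonzero (r i).1 (r i).2,
    forall i j, (r i).1 * (r j).2 = (r i).2 * (r j).1 -> i = j &
    forall a b, nonzero a b ->
      (phi a b = 0 <-> exists i, a * (r i).2 = b * (r i).1)].
Proof.
move=> h /(bform_factor h)[c [s [c0 ss hs sE]]] nd.
have si (i : 'I_n) : (i < size s)%N by rewrite ss.
exists (fun i => nth (0, 0) s i); split.
- by move=> i; apply: (all_nthP (0, 0) hs).
- move=> i j E; apply/eqP/negPn/negP => ij.
  wlog lij : i j E ij / (i < j)%N.
    move=> H; have := ij; rewrite -val_eqE neq_ltn => /orP[]; first exact: H.
    by apply: H; rewrite 1?eq_sym // mulrC -E mulrC.
  set ri := nth _ s i in E; set rj := nth _ s j in E.
  (* Equal roots make the two linear factors proportional, which exhibits the square excluded by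
     [nd]. *)
  have [la laE] : exists l, forall t0 t1 : K, rj.2 * t0 - rj.1 * t1 = l * (ri.2 * t0 - ri.1 * t1).
    have := all_nthP (0, 0) hs _ (si i); rewrite -/ri /nonzero => /orP[r0|r0].
      exists (rj.1 / ri.1) => t0 t1; apply: (mulfI r0).
      rewrite mulrBr !mulrA E; field; done.
    exists (rj.2 / ri.2) => t0 t1; apply: (mulfI r0).
    by rewrite mulrBr !mulrA -E; field.
  have sEE : perm_eq s (ri :: rj :: (take i s ++ behead (drop i (take j s))) ++ drop j.+1 s).
    have E1 : s = take j s ++ rj :: drop j.+1 s by rewrite -drop_nth // cat_take_drop.
    have E2 : take j s = take i s ++ ri :: drop i.+1 (take j s).
      have -> : ri = nth (0, 0) (take j s) i by rewrite nth_take.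
      rewrite -drop_nth ?size_take ?si //.
      have -> : take i s = take i (take j s) by rewrite take_takel // ltnW.
      by rewrite cat_take_drop.
    have E3 : behead (drop i (take j s)) = drop i.+1 (take j s) by rewrite -drop1 drop_drop add1n.
    rewrite {1}E1 {1}E2 E3 -!catA !cat_cons -cat1s perm_catCA /= perm_cons.
    by rewrite catA -cat1s perm_catCA /= perm_cons catA.
  set w := _ ++ drop j.+1 s in sEE.
  have sw : size w = (n - 2)%N by have := perm_size sEE; rewrite ss => ->; rewrite /= subn2.
  apply: (nd ri.1 ri.2 (fun t0 t1 => (c * la) * \prod_(r <- w) (r.2 * t0 - r.1 * t1))).
  + exact: (all_nthP (0, 0) hs).
  + by rewrite -sw; apply: bformZ; exact: bform_prod.
  by move=> t0 t1; rewrite sE (perm_big _ sEE) /= !big_cons laE; ring.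
move=> a b ab; rewrite sE; split.
  move/eqP; rewrite mulf_eq0 (negPf c0) /= prodf_seq_eq0 => /hasP[r rs /=].
  rewrite subr_eq0 => /eqP E; have lt : (index r s < n)%N by rewrite -ss index_mem.
  by exists (Ordinal lt); rewrite /= nth_index // mulrC E mulrC.
case=> i E; apply/eqP; rewrite mulf_eq0 prodf_seq_eq0; apply/orP; right.
apply/hasP; exists (nth (0, 0) s i); first by rewrite mem_nth.
by rewrite /= subr_eq0 mulrC E mulrC.
Qed.

(** Common zeros are divided out one at a time; each division lowers the degree, until a vector
    without zeros is left. *)
Lemma bform_vector_primitive n (l : 'I_3 -> K -> K -> K) : (forall i, bform n (l i)) ->
  (exists i a b, l i a b != 0) ->
  exists k Q (m : 'I_3 -> K -> K -> K), [/\ bform (n - k) Q, (k <= n)%N, forall i, bform k (m i),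
    forall i a b, l i a b = Q a b * m i a b &
    forall a b, nonzero a b -> exists i, m i a b != 0].
Proof.
elim: n l => [|n IH] l hl [i [a [b h]]].
  exists 0%N, (fun _ _ => 1), l; split => //; first exact: bform_const.
    by move=> *; rewrite mul1r.
  move=> a' b' _; exists i; apply: contraNneq h.
  have [p sp pE] := hl i; rewrite !pE /hval {1 2 3 4}(size1_polyC sp) !hornerC !expr0.
  by rewrite !coefC /= !mul1r !mulr1 !if_same => ->.
have [[a' [b' [ab' z]]]|H] := boolp.EM (exists a b, nonzero a b /\ forall i, l i a b = 0).
  have /fin_all_exists2[l' hl' lE] : forall i, exists2 psi, bform n psi &
      forall t0 t1, l i t0 t1 = (b' * t0 - a' * t1) * psi t0 t1.
    by move=> j; apply: bform_div (hl j) ab' (z j).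
  have [|k [Q [m [hQ kn hm mE mP]]]] := IH l' hl'.
    by exists i, a, b; apply: contraNneq h => l0; rewrite lE l0 mulr0.
  exists k, (fun t0 t1 => (b' * t0 - a' * t1) * Q t0 t1), m; split => //.
  - rewrite subSn // -add1n; apply: bformM => //.
    by apply: bformB; apply: bformZ; [exact: bform_fst|exact: bform_snd].
  - exact: leqW.
  by move=> j t0 t1; rewrite lE mE mulrA.
exists n.+1, (fun _ _ => 1), l; rewrite subnn; split => //; first exact: bform_const.
  by move=> *; rewrite mul1r.
move=> t0 t1 nz; apply: boolp.contrapT => H'; apply: H; exists t0, t1; split => // j.
by apply/eqP/negPn/negP => lj; apply: H'; exists j.
Qed.

Lemma bform_line n phi a a' b b' : bform n phi ->
  exists q : {poly K}, forall e, phi (a + e * a') (b + e * b') = q.[e].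
Proof.
move=> [p sp pE].
have sumE t0 t1 : phi t0 t1 = \sum_(i < n.+1) p`_i * (t0 ^+ i * t1 ^+ (n - i)).
  rewrite pE /hval; case: eqP => [->|/eqP t10].
    rewrite big_ord_recr /= subnn expr0 mulr1 big1 ?add0r // => i _.
    by rewrite expr0n subn_eq0 leqNgt ltn_ord !mulr0.
  rewrite (horner_coef_wide _ sp) mulr_sumr; apply: eq_bigr => i _.
  have ni : (i <= n)%N by rewrite -ltnS.
  rewrite -{1}(subnK ni) exprD expr_div_n; field.
  by rewrite expf_neq0.
exists (\sum_(i < n.+1) p`_i *: ((a%:P + a' *: 'X) ^+ i * (b%:P + b' *: 'X) ^+ (n - i))).
move=> e; rewrite sumE horner_sum; apply: eq_bigr => i _.
by rewrite !hornerE ![e * _]mulrC.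
Qed.

End BinaryForms.

(** * Coordinates along the pencil of lines through the double point *)

Section NormalForm.
Variable K : numClosedFieldType.

(** The vector (t0, t1, 0) + z p with p = (al, be, 1): for fixed (t0 : t1) the points with varying
    [z] run along the line through p, with p itself at infinity. *)
Definition pt (al be t0 t1 z : K) : 'I_3 -> K := v3 (t0 + al * z) (t1 + be * z) z.

Lemma meval_monomial (m : 'X_{1..3}) (x : 'I_3 -> K) :
  'X_[m].@[x] = x i0 ^+ m i0 * x i1 ^+ m i1 * x i2 ^+ m i2.
Proof.
rewrite mevalX !big_ord_recl big_ord0 mulr1 mulrA.
by congr (x _ ^+ m _ * x _ ^+ m _ * x _ ^+ m _); apply: val_inj.
Qed.

Lemma meval_deriv_monomial (m : 'X_{1..3}) l (x : 'I_3 -> K) :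
  ('X_[m]^`M(l)).@[x] = (m l)%:R * (x i0 ^+ (m i0 - (l == i0)) * x i1 ^+ (m i1 - (l == i1))
     * x i2 ^+ (m i2 - (l == i2))).
Proof. by rewrite mderivX mevalZ meval_monomial !mnmBE !mnm1E. Qed.

Lemma cubic_values (P : {mpoly K[3]}) : P \is 3.-homog ->
  exists c : nat -> K, [/\
   forall x, P.@[x] = c 0%N * x i0 ^+ 3 + c 1%N * (x i0 ^+ 2 * x i1)
    + c 2%N * (x i0 ^+ 2 * x i2) + c 3%N * (x i0 * x i1 ^+ 2)
    + c 4%N * (x i0 * x i1 * x i2) + c 5%N * (x i0 * x i2 ^+ 2)
    + c 6%N * x i1 ^+ 3 + c 7%N * (x i1 ^+ 2 * x i2)
    + c 8%N * (x i1 * x i2 ^+ 2) + c 9%N * x i2 ^+ 3,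
   forall x, P^`M(i0).@[x] = 3%:R * c 0%N * x i0 ^+ 2 + 2%:R * c 1%N * (x i0 * x i1)
    + 2%:R * c 2%N * (x i0 * x i2) + c 3%N * x i1 ^+ 2 + c 4%N * (x i1 * x i2)
    + c 5%N * x i2 ^+ 2,
   forall x, P^`M(i1).@[x] = c 1%N * x i0 ^+ 2 + 2%:R * c 3%N * (x i0 * x i1)
    + c 4%N * (x i0 * x i2) + 3%:R * c 6%N * x i1 ^+ 2 + 2%:R * c 7%N * (x i1 * x i2)
    + c 8%N * x i2 ^+ 2 &
   forall x, P^`M(i2).@[x] = c 2%N * x i0 ^+ 2 + c 4%N * (x i0 * x i1)
    + 2%:R * c 5%N * (x i0 * x i2) + c 7%N * x i1 ^+ 2 + 2%:R * c 8%N * (x i1 * x i2)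
    + 3%:R * c 9%N * x i2 ^+ 2].
Proof.
move=> hP; exists (fun j => P@_(nth 0%MM cubic_monomials j)).
have cE : P = \sum_(m <- cubic_monomials) P@_m *: 'X_[m].
  by rewrite big_tuple -cubicE.
have vE x : P.@[x] = \sum_(m <- cubic_monomials) P@_m * 'X_[m].@[x].
  by rewrite {1}cE raddf_sum; apply: eq_bigr => m _; rewrite /= mevalZ.
have dE l x : P^`M(l).@[x] = \sum_(m <- cubic_monomials) P@_m * ('X_[m]^`M(l)).@[x].
  by rewrite {1}cE (raddf_sum (mderiv l)) (raddf_sum (meval x)); apply: eq_bigr => m _; rewrite /= mderivZ mevalZ.
split=> x; rewrite ?vE ?dE !big_cons big_nil ?meval_monomial ?meval_deriv_monomial;
  rewrite !(mnm_nth 0%N) /=;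
  do 10?[move: (P@_([multinom _])) => ?]; ring.
Qed.

(** Vanishing of the gradient at p removes the terms of degree two and three in z. *)
Lemma double_expand (P : {mpoly K[3]}) al be : P \is 3.-homog ->
  (forall l, P^`M(l).@[v3 al be 1] = 0) ->
  exists ab : (nat -> K) * (nat -> K), forall t0 t1 z,
    P.@[pt al be t0 t1 z] =
      z * (ab.1 0%N * t0 ^+ 2 + ab.1 1%N * (t0 * t1) + ab.1 2%N * t1 ^+ 2) +
      (ab.2 0%N * t0 ^+ 3 + ab.2 1%N * (t0 ^+ 2 * t1) + ab.2 2%N * (t0 * t1 ^+ 2)
       + ab.2 3%N * t1 ^+ 3).
Proof.
move=> hP hD; have [c [vE d0 d1 d2]] := cubic_values hP.
have D0 := hD i0; have D1 := hD i1; have D2 := hD i2.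
rewrite d0 /v3 /= in D0; rewrite d1 /v3 /= in D1; rewrite d2 /v3 /= in D2.
exists (fun n => nth 0 [:: 3%:R * al * c 0%N + be * c 1%N + c 2%N;
     2%:R * al * c 1%N + 2%:R * be * c 3%N + c 4%N; al * c 3%N + 3%:R * be * c 6%N + c 7%N] n,
   fun n => nth 0 [:: c 0%N; c 1%N; c 3%N; c 6%N] n) => t0 t1 z /=.
have three : 3%:R != 0 :> K by rewrite pnatr_eq0.
rewrite vE /pt /v3 /=; apply/eqP; rewrite -subr_eq0; apply/eqP.
move: (c 0%N) (c 1%N) (c 2%N) (c 3%N) (c 4%N) (c 5%N) (c 6%N) (c 7%N) (c 8%N) (c 9%N) D0 D1 D2.
move=> c0 c1 c2 c3 c4 c5 c6 c7 c8 c9 D0 D1 D2.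
pose E0 := 3%:R * c0 * al ^+ 2 + 2%:R * c1 * (al * be) + 2%:R * c2 * (al * 1) + c3 * be ^+ 2
   + c4 * (be * 1) + c5 * 1 ^+ 2.
pose E1 := c1 * al ^+ 2 + 2%:R * c3 * (al * be) + c4 * (al * 1) + 3%:R * c6 * be ^+ 2
   + 2%:R * c7 * (be * 1) + c8 * 1 ^+ 2.
pose E2 := c2 * al ^+ 2 + c4 * (al * be) + 2%:R * c5 * (al * 1) + c7 * be ^+ 2
   + 2%:R * c8 * (be * 1) + 3%:R * c9 * 1 ^+ 2.
(* By Euler's identity al E0 + be E1 + E2 is three times the value at p, whence the division by
   3. *)
transitivity (z ^+ 2 * t0 * E0 + z ^+ 2 * t1 * E1 + z ^+ 3 / 3%:R * (al * E0 + be * E1 + E2)).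
  by rewrite /E0 /E1 /E2; field.
have -> : E0 = 0 by []; have -> : E1 = 0 by []; have -> : E2 = 0 by []; ring.
Qed.

Lemma span_of_cross (a b y : 'I_3 -> K) j : dot y (cross a b) = 0 -> cross a b j != 0 ->
  exists la mu, forall i, y i = la * a i + mu * b i.
Proof.
rewrite /dot /cross /v3 /= => H; move: j; apply: ord3P => /= c0.
- exists ((y i1 * b i2 - y i2 * b i1) / (a i1 * b i2 - a i2 * b i1)),
    ((a i1 * y i2 - a i2 * y i1) / (a i1 * b i2 - a i2 * b i1)).
  apply: ord3P; apply: (mulIf c0).
  + apply/eqP; rewrite -subr_eq0 -H; apply/eqP; field; exact: c0.
  + by field.
  + by field.
- exists ((y i2 * b i0 - y i0 * b i2) / (a i2 * b i0 - a i0 * b i2)),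
    ((a i2 * y i0 - a i0 * y i2) / (a i2 * b i0 - a i0 * b i2)).
  apply: ord3P; apply: (mulIf c0).
  + by field.
  + apply/eqP; rewrite -subr_eq0 -H; apply/eqP; field; exact: c0.
  + by field.
- exists ((y i0 * b i1 - y i1 * b i0) / (a i0 * b i1 - a i1 * b i0)),
    ((a i0 * y i1 - a i1 * y i0) / (a i0 * b i1 - a i1 * b i0)).
  apply: ord3P; apply: (mulIf c0).
  + by field.
  + by field.
  + apply/eqP; rewrite -subr_eq0 -H; apply/eqP; field; exact: c0.
Qed.

Lemma perp_cross (n y : 'I_3 -> K) j : n j != 0 -> dot y n = 0 ->
  exists w, forall i, y i = cross n w i.
Proof.
move: j; apply: ord3P => nj; rewrite /dot => H.
- exists (v3 0 (y i2 / n i0) (- y i1 / n i0)); apply: ord3P; rewrite /cross /v3 /=.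
  + by apply: (mulIf nj); apply/eqP; rewrite -subr_eq0 -H; apply/eqP; field.
  + by field.
  + by field.
- exists (v3 (- y i2 / n i1) 0 (y i0 / n i1)); apply: ord3P; rewrite /cross /v3 /=.
  + by field.
  + by apply: (mulIf nj); apply/eqP; rewrite -subr_eq0 -H; apply/eqP; field.
  + by field.
- exists (v3 (y i1 / n i2) (- y i0 / n i2) 0); apply: ord3P; rewrite /cross /v3 /=.
  + by field.
  + by field.
  + by apply: (mulIf nj); apply/eqP; rewrite -subr_eq0 -H; apply/eqP; field.
Qed.

Lemma cross0_dependent (a b : 'I_3 -> K) : (forall i, cross a b i = 0) ->
  exists la mu, nonzero la mu /\ forall i, la * a i = mu * b i.
Proof.
move=> H; have [[j aj]|a0] := boolp.EM (exists j, a j != 0); last first.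
  exists 1, 0; rewrite /nonzero oner_neq0; split=> // i; rewrite mul0r mul1r.
  by apply/eqP/negPn/negP => ai; apply: a0; exists i.
exists (b j), (a j); rewrite /nonzero aj orbT; split=> //.
have := (H i0, H i1, H i2); rewrite /cross /v3 /= => -[[/subr0_eq h0 /subr0_eq h1] /subr0_eq h2].
move: j {aj}; apply: ord3P; apply: ord3P; rewrite ?[b _ * a _]mulrC //.
Qed.

Lemma cross_dependent0 (a b : 'I_3 -> K) la mu : nonzero la mu ->
  (forall i, la * a i = mu * b i) -> forall i, cross a b i = 0.
Proof.
have key (u u' w w' : K) : nonzero la mu -> la * u = mu * w -> la * u' = mu * w' ->
    u * w' - u' * w = 0.
  move=> /orP[l0|m0] E E'.
    apply: (mulfI l0); rewrite mulr0 mulrBr !mulrA E E'; ring.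
  apply: (mulfI m0); rewrite mulr0 mulrBr mulrCA -E' [mu * (u' * w)]mulrCA -E; ring.
by move=> nz H; apply: ord3P; rewrite /cross /v3 /=; apply: key.
Qed.

Lemma bform1P (phi : K -> K -> K) : bform 1 phi ->
  exists a b, forall t0 t1, phi t0 t1 = a * t0 + b * t1.
Proof.
move=> [p sp pE]; exists p`_1, p`_0 => t0 t1; rewrite pE /hval; case: eqP => [->|/eqP t10].
  by rewrite mulr0 addr0 expr1.
rewrite (horner_coef_wide _ sp) !big_ord_recl big_ord0 /= expr0 addr0 expr1; field; exact: t10.
Qed.

Lemma cubic_form0 (c0 c1 c2 c3 : K) :
  (forall t0 t1, c0 * t0 ^+ 3 + c1 * (t0 ^+ 2 * t1) + c2 * (t0 * t1 ^+ 2) + c3 * t1 ^+ 3 = 0) ->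
  [/\ c0 = 0, c1 = 0, c2 = 0 & c3 = 0].
Proof.
move=> H; pose p := Poly [:: c3; c2; c1; c0].
have p0 : p = 0.
  apply: poly0_of_values => x; rewrite horner_Poly /= -[RHS](H x 1); ring.
have E i : nth 0 [:: c3; c2; c1; c0] i = 0 by rewrite -coef_Poly -/p p0 coef0.
by split; [exact: (E 3)|exact: (E 2)|exact: (E 1%N)|exact: (E 0%N)].
Qed.

Lemma quartic_form0 (c0 c1 c2 c3 c4 : K) :
  (forall t0 t1, c0 * t0 ^+ 4 + c1 * (t0 ^+ 3 * t1) + c2 * (t0 ^+ 2 * t1 ^+ 2)
      + c3 * (t0 * t1 ^+ 3) + c4 * t1 ^+ 4 = 0) ->
  [/\ c0 = 0, c1 = 0, c2 = 0, c3 = 0 & c4 = 0].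
Proof.
move=> H; pose p := Poly [:: c4; c3; c2; c1; c0].
have p0 : p = 0.
  apply: poly0_of_values => x; rewrite horner_Poly /= -[RHS](H x 1); ring.
have E i : nth 0 [:: c4; c3; c2; c1; c0] i = 0 by rewrite -coef_Poly -/p p0 coef0.
by split; [exact: (E 4)|exact: (E 3)|exact: (E 2)|exact: (E 1%N)|exact: (E 0%N)].
Qed.

End NormalForm.

(** * The normal form *)

(* Up to a linear change of coordinates in the target, given by the rows nn0, nn1, nn2, the map
   is (t1 S, - t0 S, C) with S = z sg + sq a conic and C = z cc + dd a cubic, where t0, t1 are
   the coordinates of the pencil of lines through the double point (nal : nbe : 1). *)
Record nform (K : Type) := NForm {
  nal : K; nbe : K; nn0 : 'I_3 -> K; nn1 : 'I_3 -> K; nn2 : 'I_3 -> K;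
  g0 : K; g1 : K; q0 : K; q1 : K; q2 : K;
  c0 : K; c1 : K; c2 : K; d0 : K; d1 : K; d2 : K; d3 : K }.

Section DegreeOne.
Variable K : numClosedFieldType.

Definition sg (N : nform K) (t0 t1 : K) := g0 N * t0 + g1 N * t1.
Definition sq (N : nform K) (t0 t1 : K) :=
  q0 N * t0 ^+ 2 + q1 N * (t0 * t1) + q2 N * t1 ^+ 2.
Definition cc (N : nform K) (t0 t1 : K) :=
  c0 N * t0 ^+ 2 + c1 N * (t0 * t1) + c2 N * t1 ^+ 2.
Definition dd (N : nform K) (t0 t1 : K) :=
  d0 N * t0 ^+ 3 + d1 N * (t0 ^+ 2 * t1) + d2 N * (t0 * t1 ^+ 2) + d3 N * t1 ^+ 3.

Definition normal (N : nform K) (f : triple K) :=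
  dot (nn2 N) (cross (nn0 N) (nn1 N)) != 0 /\
  forall t0 t1 z, let y := ev f (pt (nal N) (nbe N) t0 t1 z) in
    [/\ dot (nn0 N) y = t1 * (z * sg N t0 t1 + sq N t0 t1),
        dot (nn1 N) y = - t0 * (z * sg N t0 t1 + sq N t0 t1) &
        dot (nn2 N) y = z * cc N t0 t1 + dd N t0 t1].

Section Fixed.
Variables (f g : triple K) (m : nat) (h : {mpoly K[3]}) (al be : K).
Variables A B : 'I_3 -> K -> K -> K.
Hypothesis hg : forall i, tnth g i \is m.-homog.
Hypothesis gf : forall x i, ev g (ev f x) i = h.@[x] * x i.
Hypothesis h0 : h != 0.
Hypothesis hA : forall i, bform 2 (A i).
Hypothesis hB : forall i, bform 3 (B i).
Hypothesis fAB : forall t0 t1 z i, ev f (pt al be t0 t1 z) i = z * A i t0 t1 + B i t0 t1.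

Let gu := tnth g i0 - al *: tnth g i2.
Let gv := tnth g i1 - be *: tnth g i2.

Let hgu : gu \is m.-homog. Proof. by rewrite rpredB ?dhomogZ ?hg. Qed.
Let hgv : gv \is m.-homog. Proof. by rewrite rpredB ?dhomogZ ?hg. Qed.

Let u (y : 'I_3 -> K) := gu.@[y].
Let v (y : 'I_3 -> K) := gv.@[y].

Let uE t0 t1 z : u (ev f (pt al be t0 t1 z)) = h.@[pt al be t0 t1 z] * t0.
Proof.
have := gf (pt al be t0 t1 z); rewrite /u /gu mevalB mevalZ /ev => H.
by rewrite !H /pt /v3 /=; ring.
Qed.

Let vE t0 t1 z : v (ev f (pt al be t0 t1 z)) = h.@[pt al be t0 t1 z] * t1.
Proof.
have := gf (pt al be t0 t1 z); rewrite /v /gv mevalB mevalZ /ev => H.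
by rewrite !H /pt /v3 /=; ring.
Qed.

(** Vanishes when (u y : v y), the direction from p of the image of y under g, is (t0 : t1). *)
Let wdg (y : 'I_3 -> K) t0 t1 := u y * t1 - v y * t0.

Let wdg0 t0 t1 z : wdg (ev f (pt al be t0 t1 z)) t0 t1 = 0.
Proof. by rewrite /wdg uE vE; ring. Qed.

(** For mu nonzero the vector is a multiple of a value of f; the case mu = 0 follows because the
    expression is polynomial in mu. *)
Let wdg_span t0 t1 la mu : wdg (fun i => la * A i t0 t1 + mu * B i t0 t1) t0 t1 = 0.
Proof.
have nz e : e != 0 -> wdg (fun i => la * A i t0 t1 + e * B i t0 t1) t0 t1 = 0.
  move=> e0; have := wdg0 t0 t1 (la / e); rewrite /wdg.
  have E : (fun i => la * A i t0 t1 + e * B i t0 t1) =1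
      (fun i => e * ev f (pt al be t0 t1 (la / e)) i).
    by move=> i; rewrite fAB; field.
  rewrite /u /v !(meval_eq _ E) !(meval_scale _ _ hgu) !(meval_scale _ _ hgv) => H.
  by rewrite -!mulrA -mulrBr H mulr0.
have [->|/nz //] := eqVneq mu 0.
pose q i : {poly K} := (la * A i t0 t1)%:P + (B i t0 t1) *: 'X.
pose p := along q gu * t1%:P - along q gv * t0%:P.
have pE e : p.[e] = wdg (fun i => la * A i t0 t1 + e * B i t0 t1) t0 t1.
  rewrite /p hornerD hornerN !hornerM !hornerC !horner_along /wdg /u /v.
  by congr (_ * _ - _ * _); apply: meval_eq => i; rewrite /q !hornerE [_ * e]mulrC.
rewrite -pE; suff -> : p = 0 by rewrite horner0.
have : p * 'X = 0.
  apply: poly0_of_values => e; rewrite hornerM hornerX.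
  have [->|/nz E] := eqVneq e 0; first by rewrite mulr0.
  by rewrite pE E mul0r.
by move/eqP; rewrite mulf_eq0 polyX_eq0 orbF => /eqP.
Qed.

(** Normal to the span of A and B, which contains the image of the line of direction (t0 : t1). *)
Let l i t0 t1 := cross (fun j => A j t0 t1) (fun j => B j t0 t1) i.

Let hl i : bform 5 (l i).
Proof.
move: i; apply: ord3P; rewrite /l /cross /v3 /=;
  by apply: bformB; apply: (@bformM _ 2 3).
Qed.

Let good_point (P : {mpoly K[3]}) : P != 0 -> exists t0 t1 z,
  [/\ P.@[pt al be t0 t1 z] != 0, h.@[pt al be t0 t1 z] != 0 & t0 != 0].
Proof.
move=> P0.
have X0 : 'X_i0 - al *: 'X_i2 != 0 :> {mpoly K[3]}.
  apply/eqP => /(congr1 (meval (v3 1 0 0))); rewrite mevalB mevalZ !mevalXU meval0 /v3 /=.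
  by rewrite mulr0 subr0 => /eqP; rewrite oner_eq0.
have [x] := exists_nonzero (mulf_neq0 P0 (mulf_neq0 h0 X0)).
rewrite !mevalM !mulf_eq0 !negb_or mevalB mevalZ !mevalXU => /and3P[Px hx tx].
exists (x i0 - al * x i2), (x i1 - be * x i2), (x i2).
have E : pt al be (x i0 - al * x i2) (x i1 - be * x i2) (x i2) =1 x.
  by apply: ord3P; rewrite /pt /v3 /= ?subrK.
by rewrite !(meval_eq _ E).
Qed.

(** Otherwise f would be constant on lines through p, whereas g recovers the points of such a line
    from their images. *)
Let l_nonzero : exists i a b, l i a b != 0.
Proof.
have [t0 [t1 [z [_ hz t00]]]] := good_point (oner_neq0 _).
apply: boolp.contrapT => H.
pose q : 'I_3 -> {poly K} := v3 (t0%:P + al *: 'X) (t1%:P + be *: 'X) 'X.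
have qE e : (fun i => (q i).[e]) =1 pt al be t0 t1 e.
  by apply: ord3P; rewrite /q /v3 /pt /v3 /= !hornerE // [_ * e]mulrC.
have [e] : exists e, (along q h * ('X - z%:P)).[e] != 0.
  apply: exists_nonroot; rewrite mulf_neq0 ?polyXsubC_eq0 //.
  by apply: contraNneq hz => p0; rewrite -(meval_eq _ (qE z)) -horner_along p0 horner0.
rewrite hornerM horner_along (meval_eq _ (qE e)) hornerXsubC mulf_eq0 negb_or subr_eq0.
case/andP=> he ez.
have [la [mu [nz E]]] : exists la mu, nonzero la mu /\
    forall i, la * ev f (pt al be t0 t1 z) i = mu * ev f (pt al be t0 t1 e) i.
  apply: cross0_dependent => i.
  have l0 : l i t0 t1 = 0 by apply/eqP/negPn/negP => hli; apply: H; exists i, t0, t1.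
  have -> : cross (ev f (pt al be t0 t1 z)) (ev f (pt al be t0 t1 e)) i = (z - e) * l i t0 t1.
    move: i {l0}; apply: ord3P; rewrite /l /cross /v3 /= !fAB; ring.
  by rewrite l0 mulr0.
have Eg i : la ^+ m * (h.@[pt al be t0 t1 z] * pt al be t0 t1 z i) =
    mu ^+ m * (h.@[pt al be t0 t1 e] * pt al be t0 t1 e i).
  by rewrite -!gf -!(meval_scale _ _ (hg i)); apply: meval_eq.
have E0 := Eg i0; have E2 := Eg i2; rewrite /pt /v3 /= in E0 E2.
have E3 : la ^+ m * h.@[pt al be t0 t1 z] = mu ^+ m * h.@[pt al be t0 t1 e].
  apply: (mulIf t00).
  transitivity (la ^+ m * (h.@[pt al be t0 t1 z] * (t0 + al * z)) -
     al * (la ^+ m * (h.@[pt al be t0 t1 z] * z))); first by rewrite /pt; ring.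
  by rewrite /pt /v3 E0 E2; ring.
have la0 : la ^+ m = 0.
  have : la ^+ m * h.@[pt al be t0 t1 z] * (z - e) = 0.
    rewrite mulrBr -mulrA E2 E3; ring.
  move/eqP; rewrite !mulf_eq0 (negPf hz) subr_eq0 [z == e]eq_sym (negPf ez) !orbF.
  by move/eqP.
have mu0 : mu ^+ m = 0.
  by move/esym/eqP: E3; rewrite la0 mul0r mulf_eq0 (negPf he) orbF => /eqP.
by move: nz la0 mu0 => /orP[] nz /eqP; rewrite expf_eq0 ?(negPf nz) ?andbF // => _ /eqP;
  rewrite expf_eq0 (negPf nz) andbF.
Qed.

(** Let n be the normal [l] freed of its common zeros, of degree k. If n(t) . y = 0 then y lies on
    the image line over t, so (u y : v y) = t. Hence n(t) . y is a constant times the k-th power of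
    v y t0 - u y t1. It is additive in y, but the sum of two k-th powers of independent linear forms
    has k distinct roots, so k = 1. The two coefficients of n are independent because n has no
    zero. *)
Lemma linear_syzygy : exists n0 n1 : 'I_3 -> K,
  (exists j, cross n0 n1 j != 0) /\
  forall t0 t1 z, t0 * dot n0 (ev f (pt al be t0 t1 z)) + t1 * dot n1 (ev f (pt al be t0 t1 z)) = 0.
Proof.
have [k [Q [n [hQ k5 hn lE nP]]]] := bform_vector_primitive hl l_nonzero.
have Qnz : ~ forall a b, Q a b = 0.
  by move=> Q0; have [i [a [b]]] := l_nonzero; rewrite lE Q0 mul0r eqxx.
have domain e phi : bform e phi -> (forall a b, Q a b * phi a b = 0) -> forall a b, phi a b = 0.
  by move=> hphi E; have [] := bform_mul_eq0 hQ hphi E.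
have bform_dot e X : (forall i, bform e (X i)) ->
    bform (e + k) (fun a b => dot (fun i => X i a b) (fun i => n i a b)).
  by move=> hX; do 2?[apply: bformD]; apply: bformM.
have An : forall a b, dot (fun i => A i a b) (fun i => n i a b) = 0.
  apply: domain (bform_dot _ _ hA) _ => a b.
  have E i : Q a b * n i a b = l i a b by rewrite lE.
  transitivity (dot (fun i => A i a b) (fun i => l i a b)); first by rewrite /dot -!E; ring.
  by rewrite /dot /l /cross /v3 /=; ring.
have Bn : forall a b, dot (fun i => B i a b) (fun i => n i a b) = 0.
  apply: domain (bform_dot _ _ hB) _ => a b.
  have E i : Q a b * n i a b = l i a b by rewrite lE.
  transitivity (dot (fun i => B i a b) (fun i => l i a b)); first by rewrite /dot -!E; ring.
  by rewrite /dot /l /cross /v3 /=; ring.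
have fn t0 t1 z : dot (ev f (pt al be t0 t1 z)) (fun i => n i t0 t1) = 0.
  transitivity (z * dot (fun i => A i t0 t1) (fun i => n i t0 t1) +
      dot (fun i => B i t0 t1) (fun i => n i t0 t1)).
    by rewrite /dot !fAB; ring.
  by rewrite An Bn mulr0 addr0.
(* Where Q is nonzero, the vectors perpendicular to n are combinations of A and B, and [wdg_span]
   applies; [domain] covers the zeros of Q. *)
have star w a b : wdg (cross (fun i => n i a b) w) a b = 0.
  move: a b; apply: domain.
    rewrite /wdg; apply: bformB; apply: (@bformM _ (m * k) 1);
      rewrite ?/u ?/v; try (exact: bform_fst || exact: bform_snd); apply: bform_meval => //;
      by apply: ord3P; rewrite /cross /v3 /=; apply: bformB;
        apply: bform_ext (bformZ _ (hn _)) _ => a b; rewrite mulrC.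
  move=> a b; have [->|Qab] := eqVneq (Q a b) 0; first by rewrite mul0r.
  have [nz|] := boolP (nonzero a b); last first.
    by rewrite /nonzero negb_or !negbK => /andP[/eqP-> /eqP->]; rewrite /wdg !mulr0 subr0 mulr0.
  have [j nj] := nP a b nz.
  have [||la [mu E]] := @span_of_cross _ (fun i => A i a b) (fun i => B i a b)
      (cross (fun i => n i a b) w) j.
  - have E i : cross (fun i => A i a b) (fun i => B i a b) i = Q a b * n i a b by rewrite -lE.
    by rewrite /dot !E /cross /v3 /=; ring.
  - by rewrite -/(l j a b) lE mulf_neq0.
  by have := wdg_span a b la mu; rewrite /wdg /u /v -!(meval_eq _ E) => ->; rewrite mulr0.
have perp y a b : nonzero a b -> dot y (fun i => n i a b) = 0 -> wdg y a b = 0.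
  move=> nz yn; have [j nj] := nP a b nz.
  have [w wE] := perp_cross nj yn.
  by have := star w a b; rewrite /wdg /u /v -!(meval_eq _ wE).
(* By [perp], every root of the form n(t) . y is (u y : v y). *)
have power y : nonzero (u y) (v y) -> exists2 c, c != 0 &
    forall a b, dot y (fun i => n i a b) = c * (v y * a - u y * b) ^+ k.
  move=> nz.
  have hphi : bform k (fun a b => dot y (fun i => n i a b)).
    by do 2?[apply: bformD]; apply: bformZ.
  have [|c [s [cn0 ss hs sE]]] := bform_factor hphi.
    apply: boolp.contrapT => H.
    have H0 a b : dot y (fun i => n i a b) = 0.
      by apply/eqP/negPn/negP => Hab; apply: H; exists a, b.
    have := perp y 1 0; rewrite /nonzero oner_neq0 /wdg mulr0 mulr1 sub0r => /(_ isT (H0 _ _))/eqP.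
    rewrite oppr_eq0 => /eqP v0.
    have := perp y 0 1; rewrite /nonzero oner_neq0 orbT /wdg mulr0 mulr1 subr0 => /(_ isT (H0 _ _)) u0.
    by move: nz; rewrite /nonzero u0 v0 eqxx.
  have hr r : r \in s -> exists2 la, la != 0 &
      forall a b, r.2 * a - r.1 * b = la * (v y * a - u y * b).
    move=> rs; have nr := allP hs r rs.
    have := perp y r.1 r.2 nr; rewrite sE => H.
    have {H} : wdg y r.1 r.2 = 0.
      apply: H; apply/eqP; rewrite mulf_eq0 prodf_seq_eq0; apply/orP; right.
      by apply/hasP; exists r => //=; rewrite subr_eq0 mulrC.
    rewrite /wdg => /subr0_eq E; move: nz; rewrite /nonzero => /orP[uy|vy].
      have r10 : r.1 != 0.
        move: nr; rewrite /nonzero => /orP[//|r2]; apply: contraNneq r2 => r1.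
        by apply/eqP/(mulfI uy); rewrite E r1 !mulr0.
      exists (r.1 / u y); first by rewrite mulf_neq0 ?invr_eq0.
      by move=> a b; apply: (mulfI uy); rewrite mulrBr !mulrA E; field.
    have r20 : r.2 != 0.
      move: nr; rewrite /nonzero => /orP[r1|//]; apply: contraNneq r1 => r2.
      by apply/eqP/(mulfI vy); rewrite -E r2 !mulr0.
    exists (r.2 / v y); first by rewrite mulf_neq0 ?invr_eq0.
    move=> a b; apply: (mulfI vy); rewrite mulrBr [v y * (r.1 * b)]mulrA -E; field.
    exact: vy.
  have [c' cn' E] : exists2 c', c' != 0 & forall a b,
      \prod_(r <- s) (r.2 * a - r.1 * b) = c' * (v y * a - u y * b) ^+ size s.
    elim: (s) hr => [|r s' IH] hr'.
      by exists 1; rewrite ?oner_neq0 // => a b; rewrite big_nil mul1r.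
    have [|c' cn' E'] := IH; first by move=> r' hr''; apply: hr'; rewrite inE hr'' orbT.
    have [la lan laE] := hr' r (mem_head _ _).
    exists (la * c'); first by rewrite mulf_neq0.
    by move=> a b; rewrite big_cons E' laE exprS; ring.
  exists (c * c'); first by rewrite mulf_neq0.
  by move=> a b; rewrite sE E ss mulrA.
have [t0 [t1 [z [_ hz t00]]]] := good_point (oner_neq0 _).
have k0 : k != 0%N.
  apply: contraTneq t00 => k0; rewrite negbK.
  have nconst i a b : n i a b = n i t0 t1.
    have := hn i; rewrite k0 => -[p sp pE]; have pc := size1_polyC sp.
    by rewrite !pE /hval pc !hornerC !expr0 !coefC /= !mulr1 !mul1r !if_same.
  have y0 : dot (ev f (pt al be t0 t1 z)) (fun i => n i 0 1) = 0.
    by rewrite -[RHS](fn t0 t1 z) /dot !(nconst _ 0 1).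
  have := perp _ 0 1 _ y0; rewrite /nonzero oner_neq0 orbT => /(_ isT).
  by rewrite /wdg mulr1 mulr0 subr0 uE => /eqP; rewrite mulf_eq0 (negPf hz).
pose y1 := ev f (pt al be t0 t1 z).
have [t0' [t1' [z' [hw hz' _]]]] : exists t0' t1' z', [/\ t0 * t1' - t1 * t0' != 0,
    h.@[pt al be t0' t1' z'] != 0 & t0' != 0].
  have [|a [b [e [H h' a0]]]] := @good_point (t0 *: ('X_i1 - be *: 'X_i2) - t1 *: ('X_i0 - al *: 'X_i2)).
    apply/eqP => /(congr1 (meval (v3 0 1 0))).
    rewrite mevalB !mevalZ !mevalB !mevalZ !mevalXU meval0 /v3 /= => /eqP.
    by rewrite !mulr0 !subr0 mulr1 mulr0 subr0 (negPf t00).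
  exists a, b, e; split=> //; apply: contraNneq H => E.
  rewrite mevalB !mevalZ !mevalB !mevalZ !mevalXU /pt /v3 /=.
  by rewrite !addrK E.
pose y2 := ev f (pt al be t0' t1' z').
have U1 : nonzero (u y1) (v y1) by rewrite /nonzero uE mulf_neq0.
have W12 : u y1 * v y2 - v y1 * u y2 != 0.
  rewrite !uE !vE; set H := h.@[_]; set H' := h.@[_].
  have -> : H * t0 * (H' * t1') - H * t1 * (H' * t0') = H * H' * (t0 * t1' - t1 * t0') by ring.
  by rewrite !mulf_neq0.
have U2 : nonzero (u y2) (v y2).
  apply: contraNT W12; rewrite /nonzero negb_or !negbK => /andP[/eqP-> /eqP->].
  by rewrite !mulr0 subrr.
have k1 : k = 1%N.
  apply/eqP; rewrite eqn_leq lt0n k0 andbT leqNgt; apply/negP => k2.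
  have [cA cA0 EA] := power _ U1; have [cB cB0 EB] := power _ U2.
  have [s [s0 Us]] : exists s, s != 0 /\
      nonzero (u (fun i => y1 i + s * y2 i)) (v (fun i => y1 i + s * y2 i)).
    pose q i : {poly K} := (y1 i)%:P + y2 i *: 'X.
    have qE e : (fun i => (q i).[e]) =1 (fun i => y1 i + e * y2 i).
      by move=> i; rewrite /q !hornerE [_ * e]mulrC.
    have qE0 : (fun i => (q i).[0]) =1 y1 by move=> i; rewrite qE mul0r addr0.
    have [P [P0 hP]] : exists P : {mpoly K[3]}, P.@[y1] != 0 /\
        forall y, P.@[y] != 0 -> nonzero (u y) (v y).
      move: U1; rewrite /nonzero => /orP[H|H]; [exists gu|exists gv];
        by split=> // y Hy; rewrite /nonzero /u /v Hy ?orbT.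
    have [s] : exists s, (along q P * 'X).[s] != 0.
      apply: exists_nonroot; rewrite mulf_neq0 ?polyX_eq0 //.
      by apply: contraNneq P0 => p0; rewrite -(meval_eq _ qE0) -horner_along p0 horner0.
    rewrite hornerM hornerX horner_along (meval_eq _ (qE s)) mulf_eq0 negb_or => /andP[Ps sn0].
    by exists s; split=> //; apply: hP.
  set ys := fun i => _ in Us.
  have root_uniq a b : nonzero a b -> cA * (v y1 * a - u y1 * b) ^+ k +
      s * (cB * (v y2 * a - u y2 * b) ^+ k) = 0 -> u ys * b = v ys * a.
    move=> nz E; apply: subr0_eq; apply: perp => //.
    by rewrite -E -EA -EB /dot /ys; ring.
  pose W := u y1 * v y2 - v y1 * u y2.
  (* The pair (a, b) is chosen so that the linear forms attached to y1 and y2 take the values - W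
     rho and - W. *)
  have sol rho : cA * rho ^+ k + s * cB = 0 ->
      u ys * (v y2 * rho - v y1) = v ys * (u y2 * rho - u y1).
    move=> E; have Wn0 : - W != 0 by rewrite oppr_eq0.
    apply: root_uniq.
      apply: contraNT Wn0; rewrite /nonzero negb_or !negbK => /andP[/eqP e1 /eqP e2].
      have -> : - W = v y2 * (u y2 * rho - u y1) - u y2 * (v y2 * rho - v y1) by rewrite /W; ring.
      by rewrite e1 e2 !mulr0 subrr.
    have -> : v y1 * (u y2 * rho - u y1) - u y1 * (v y2 * rho - v y1) = - W * rho.
      by rewrite /W; ring.
    have -> : v y2 * (u y2 * rho - u y1) - u y2 * (v y2 * rho - v y1) = - W.
      by rewrite /W; ring.
    by rewrite exprMn; transitivity ((- W) ^+ k * (cA * rho ^+ k + s * cB)); [ring|rewrite E mulr0].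
  (* For k at least 2, a k-th root of unity other than 1, found as a root of 1 + X + ... + X^(k-1),
     produces a second root of the sum of k-th powers, against the uniqueness of the root attached
     to [ys]. *)
  have [zt [zt1 ztk]] : exists zt : K, zt != 1 /\ zt ^+ k = 1.
    pose p : {poly K} := \sum_(i < k) 'X^i.
    have sp : size p = k.
      rewrite /p -(prednK (ltnW k2)).
      elim: k.-1 => [|j IH]; first by rewrite big_ord_recr big_ord0 /= add0r size_polyXn.
      by rewrite big_ord_recr /= addrC size_polyDl ?size_polyXn // IH.
    have /closed_rootP[x xp] : size p != 1%N by rewrite sp neq_ltn k2 orbT.
    exists x; split.
      apply: contraTneq xp => ->; rewrite /root /p horner_sum.
      under eq_bigr => i _ do rewrite hornerXn expr1n.
      by rewrite sumr_const card_ord pnatr_eq0 -lt0n ltnW.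
    apply/eqP; rewrite -subr_eq0 subrX1.
    have -> : \sum_(i < k) x ^+ i = p.[x].
      by rewrite /p horner_sum; apply: eq_bigr => i _; rewrite hornerXn.
    by rewrite (eqP xp) mulr0.
  have [rho rhoE] : exists rho : K, rho ^+ k = - (s * cB) / cA.
    have [r rE] := @solve_monicpoly K k (fun i => if i == 0%N then - (s * cB) / cA else 0) (ltnW k2).
    exists r; rewrite rE; rewrite (bigD1 (Ordinal (ltnW k2))) //= expr0 mulr1 big1 ?addr0 // => i i0'.
    by rewrite -[_ == _]/(val i == val (Ordinal (ltnW k2))) (inj_eq val_inj) (negPf i0') mul0r.
  have rho0 : rho != 0.
    apply: contraTneq isT => r0; move/eqP: rhoE; rewrite r0 expr0n (negPf k0) eq_sym.
    by rewrite !mulf_eq0 oppr_eq0 mulf_eq0 invr_eq0 (negPf cA0) (negPf s0) (negPf cB0).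
  have e1 : cA * rho ^+ k + s * cB = 0 by rewrite rhoE; field.
  have e2 : cA * (zt * rho) ^+ k + s * cB = 0 by rewrite exprMn ztk mul1r.
  have S1 := sol _ e1; have S2 := sol _ e2.
  have z1 : (zt - 1) * rho != 0 by rewrite mulf_neq0 ?subr_eq0.
  have S3 : u ys * v y2 = v ys * u y2.
    apply: (mulIf z1).
    transitivity (u ys * (v y2 * (zt * rho) - v y1) - u ys * (v y2 * rho - v y1)); first by ring.
    by rewrite S1 S2; ring.
  have S4 : u ys * v y1 = v ys * u y1.
    transitivity (u ys * v y2 * rho - u ys * (v y2 * rho - v y1)); first by ring.
    by rewrite S1 S3; ring.
  move: Us; rewrite /nonzero => /orP[Hu|Hv].
    case/negP: W12; apply/eqP/(mulfI Hu); rewrite mulr0 mulrBr !mulrA.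
    by rewrite [u ys * u y1 * v y2]mulrAC S3 S4; ring.
  case/negP: W12; apply/eqP/(mulfI Hv); rewrite mulr0 mulrBr !mulrA.
  by rewrite -S4 [v ys * v y1 * u y2]mulrAC -S3; ring.
have hn1 i : bform 1 (n i) by rewrite -{1}k1.
have /fin_all_exists2[n0 _ n01] : forall i, exists2 a : K, True & exists b, forall t0 t1, n i t0 t1 = a * t0 + b * t1.
  by move=> i; have [a [b E]] := bform1P (hn1 i); exists a => //; exists b.
have /fin_all_exists[n1 nE] := n01.
exists n0, n1; split.
  apply: boolp.contrapT => H.
  have H0 i : cross n0 n1 i = 0 by apply/eqP/negPn/negP => Hi; apply: H; exists i.
  have [la [mu [nz E]]] := cross0_dependent H0.
  have [|i] := nP la (- mu); first by rewrite /nonzero oppr_eq0.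
  by rewrite nE mulrC E mulrN [_ * mu]mulrC subrr eqxx.
move=> a b e; rewrite -(fn a b e) /dot !nE; ring.
Qed.

End Fixed.
End DegreeOne.

Section NormalFormTheory.
Variable K : numClosedFieldType.

(** Comparing coefficients of t0 and t1 in the syzygy t0 (n0 . f) + t1 (n1 . f) = 0 forces n0 . f =
    t1 S and n1 . f = - t0 S with the same S. *)
Lemma normal_form (f g : triple K) m (h : {mpoly K[3]}) al be : cubic f ->
  (forall i, tnth g i \is m.-homog) -> (forall x i, ev g (ev f x) i = h.@[x] * x i) ->
  h != 0 -> (forall i l, (tnth f i)^`M(l).@[v3 al be 1] = 0) ->
  exists N, [/\ nal N = al, nbe N = be & normal N f].
Proof.
move=> hf hg gf h0 hD.
have /fin_all_exists[ab abE] := fun i => double_expand (hf i) (hD i).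
pose A i (t0 t1 : K) := (ab i).1 0%N * t0 ^+ 2 + (ab i).1 1%N * (t0 * t1) + (ab i).1 2%N * t1 ^+ 2.
pose B i (t0 t1 : K) := (ab i).2 0%N * t0 ^+ 3 + (ab i).2 1%N * (t0 ^+ 2 * t1)
  + (ab i).2 2%N * (t0 * t1 ^+ 2) + (ab i).2 3%N * t1 ^+ 3.
have bX n : bform n (fun a b : K => a ^+ n).
  elim: n => [|n IH]; first by apply: bform_ext (bform_const 1) _ => a b; rewrite expr0.
  by apply: bform_ext (bformM (@bform_fst K) IH) _ => a b; rewrite exprS.
have bY n : bform n (fun a b : K => b ^+ n).
  elim: n => [|n IH]; first by apply: bform_ext (bform_const 1) _ => a b; rewrite expr0.
  by apply: bform_ext (bformM (@bform_snd K) IH) _ => a b; rewrite exprS.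
have hA i : bform 2 (A i).
  apply: bformD; last by apply: bformZ; exact: (bY 2).
  apply: bformD; first by apply: bformZ; exact: (bX 2).
  by apply: bformZ; apply: (@bformM _ 1 1); [exact: bform_fst|exact: bform_snd].
have hB i : bform 3 (B i).
  apply: bformD; last by apply: bformZ; exact: (bY 3).
  apply: bformD; last by apply: bformZ; apply: (@bformM _ 1 2); [exact: bform_fst|exact: (bY 2)].
  apply: bformD; first by apply: bformZ; exact: (bX 3).
  by apply: bformZ; apply: (@bformM _ 2 1); [exact: (bX 2)|exact: bform_snd].
have fAB t0 t1 z i : ev f (pt al be t0 t1 z) i = z * A i t0 t1 + B i t0 t1 by exact: abE.
have [n0 [n1 [[j nj] syz]]] := linear_syzygy hg gf h0 hA hB fAB.
pose a0 k := dot n0 (fun i => (ab i).1 k); pose b0 k := dot n0 (fun i => (ab i).2 k).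
pose a1 k := dot n1 (fun i => (ab i).1 k); pose b1 k := dot n1 (fun i => (ab i).2 k).
have [e0 e1 e2 e3] : [/\ a0 0%N = 0, a0 1%N + a1 0%N = 0, a0 2%N + a1 1%N = 0 & a1 2%N = 0].
  apply: cubic_form0 => t0 t1; have := syz t0 t1 1; have := syz t0 t1 0.
  rewrite /dot !fAB => E0 E1; rewrite -[RHS](subrr 0) -{1}E1 -E0 /a0 /a1 /dot /A /B; ring.
have [k0 k1 k2 k3 k4] : [/\ b0 0%N = 0, b0 1%N + b1 0%N = 0, b0 2%N + b1 1%N = 0,
    b0 3%N + b1 2%N = 0 & b1 3%N = 0].
  apply: quartic_form0 => t0 t1; have := syz t0 t1 0.
  rewrite /dot !fAB => E0; rewrite -[RHS]E0 /b0 /b1 /dot /A /B; ring.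
(* The third row is the basis vector of index [j], independent of n0 and n1 because that component
   of their cross product is nonzero. *)
exists (NForm al be n0 n1 (fun i => (i == j)%:R) (a0 1%N) (a0 2%N) (b0 1%N) (b0 2%N) (b0 3%N)
  ((ab j).1 0%N) ((ab j).1 1%N) ((ab j).1 2%N)
  ((ab j).2 0%N) ((ab j).2 1%N) ((ab j).2 2%N) ((ab j).2 3%N)).
have dj (y : 'I_3 -> K) : dot (fun i => (i == j)%:R) y = y j.
  by rewrite /dot; move: j {nj}; apply: ord3P; rewrite /= ?mul0r ?mul1r ?addr0 ?add0r.
split=> //; split=> [|t0 t1 z] /=; first by rewrite dj.
split; rewrite ?dj ?fAB /sg /sq /cc /dd /=.
- transitivity (z * (a0 0%N * t0 ^+ 2 + a0 1%N * (t0 * t1) + a0 2%N * t1 ^+ 2) +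
    (b0 0%N * t0 ^+ 3 + b0 1%N * (t0 ^+ 2 * t1) + b0 2%N * (t0 * t1 ^+ 2) + b0 3%N * t1 ^+ 3)).
    by rewrite /dot !fAB /A /B /a0 /b0 /dot; ring.
  by rewrite e0 k0; ring.
- transitivity (z * (a1 0%N * t0 ^+ 2 + a1 1%N * (t0 * t1) + a1 2%N * t1 ^+ 2) +
    (b1 0%N * t0 ^+ 3 + b1 1%N * (t0 ^+ 2 * t1) + b1 2%N * (t0 * t1 ^+ 2) + b1 3%N * t1 ^+ 3)).
    by rewrite /dot !fAB /A /B /a1 /b1 /dot; ring.
  move/eqP: e1; rewrite addrC addr_eq0 => /eqP ->; move/eqP: e2; rewrite addrC addr_eq0 => /eqP ->.
  move/eqP: k1; rewrite addrC addr_eq0 => /eqP ->; move/eqP: k2; rewrite addrC addr_eq0 => /eqP ->.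
  by move/eqP: k3; rewrite addrC addr_eq0 => /eqP ->; rewrite e3 k4; ring.
- by rewrite /A /B.
Qed.

Definition ndet (N : nform K) := dot (nn2 N) (cross (nn0 N) (nn1 N)).

(** Cramer's rule for the matrix with rows [nn0], [nn1], [nn2]. *)
Lemma recover N (y : 'I_3 -> K) i : ndet N * y i =
  cross (nn1 N) (nn2 N) i * dot (nn0 N) y + cross (nn2 N) (nn0 N) i * dot (nn1 N) y
  + cross (nn0 N) (nn1 N) i * dot (nn2 N) y.
Proof. by move: i; apply: ord3P; rewrite /ndet /dot /cross /v3 /=; ring. Qed.

Lemma recover_eq N (y y' : 'I_3 -> K) : ndet N != 0 -> dot (nn0 N) y = dot (nn0 N) y' ->
  dot (nn1 N) y = dot (nn1 N) y' -> dot (nn2 N) y = dot (nn2 N) y' -> y =1 y'.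
Proof. by move=> N0 e0 e1 e2 i; apply: (mulfI N0); rewrite !recover e0 e1 e2. Qed.

Lemma ncoord_surj N (a b c : K) : ndet N != 0 -> exists y,
  [/\ dot (nn0 N) y = a, dot (nn1 N) y = b & dot (nn2 N) y = c].
Proof.
move=> N0; exists (fun i => (cross (nn1 N) (nn2 N) i * a + cross (nn2 N) (nn0 N) i * b
  + cross (nn0 N) (nn1 N) i * c) / ndet N).
split; apply: (mulIf N0); rewrite /dot !mulrA; move: N0; rewrite /ndet /dot /cross /v3 /=;
  move=> N0; field; exact: N0.
Qed.

(** The resultant with respect to z of [SS] and [CC], both of degree one in z. *)
Definition qq (N : nform K) t0 t1 := sg N t0 t1 * dd N t0 t1 - cc N t0 t1 * sq N t0 t1.
Definition SS (N : nform K) t0 t1 z := z * sg N t0 t1 + sq N t0 t1.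
Definition CC (N : nform K) t0 t1 z := z * cc N t0 t1 + dd N t0 t1.

Lemma pt_coord al be (x : 'I_3 -> K) : x =1 pt al be (x i0 - al * x i2) (x i1 - be * x i2) (x i2).
Proof. by apply: ord3P; rewrite /pt /v3 /= ?subrK. Qed.

Lemma bform_lin (a b : K) : bform 1 (fun t0 t1 => a * t0 + b * t1).
Proof. by apply: bformD; apply: bformZ; [exact: bform_fst|exact: bform_snd]. Qed.

Lemma bform_pow (k l : nat) : bform (k + l) (fun a b : K => a ^+ k * b ^+ l).
Proof.
apply: bformM.
  elim: k => [|n IH]; first by apply: bform_ext (bform_const 1) _ => a b; rewrite expr0.
  by apply: bform_ext (bformM (@bform_fst K) IH) _ => a b; rewrite exprS.
elim: l => [|n IH]; first by apply: bform_ext (bform_const 1) _ => a b; rewrite expr0.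
by apply: bform_ext (bformM (@bform_snd K) IH) _ => a b; rewrite exprS.
Qed.

Lemma bform_sg (N : nform K) : bform 1 (sg N). Proof. exact: bform_lin. Qed.

Lemma bform_quadratic (a b c : K) :
  bform 2 (fun t0 t1 => a * t0 ^+ 2 + b * (t0 * t1) + c * t1 ^+ 2).
Proof.
do 2?[apply: bformD]; apply: bformZ.
- by apply: bform_ext (bform_pow 2 0) _ => t0 t1; rewrite expr0 mulr1.
- exact: (bform_pow 1 1).
- by apply: bform_ext (bform_pow 0 2) _ => t0 t1; rewrite expr0 mul1r.
Qed.

Lemma bform_cubic (a b c d : K) : bform 3 (fun t0 t1 =>
  a * t0 ^+ 3 + b * (t0 ^+ 2 * t1) + c * (t0 * t1 ^+ 2) + d * t1 ^+ 3).
Proof.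
do 3?[apply: bformD]; apply: bformZ.
- by apply: bform_ext (bform_pow 3 0) _ => t0 t1; rewrite expr0 mulr1.
- exact: (bform_pow 2 1).
- exact: (bform_pow 1 2).
- by apply: bform_ext (bform_pow 0 3) _ => t0 t1; rewrite expr0 mul1r.
Qed.

Lemma bform_sq (N : nform K) : bform 2 (sq N). Proof. exact: bform_quadratic. Qed.
Lemma bform_cc (N : nform K) : bform 2 (cc N). Proof. exact: bform_quadratic. Qed.
Lemma bform_dd (N : nform K) : bform 3 (dd N). Proof. exact: bform_cubic. Qed.

Lemma bform_qq (N : nform K) : bform 4 (qq N).
Proof.
apply: bformB; first exact: (bformM (bform_sg N) (bform_dd N)).
exact: (bformM (bform_cc N) (bform_sq N)).
Qed.

(** A double root is recognised by vanishing to order two along a line transverse to it, which is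
    how jets will detect it. *)
Lemma bform_simple_roots n (phi : K -> K -> K) : bform n phi ->
  (forall a b a' b' (q : {poly K}), nonzero a b -> a * b' - b * a' != 0 ->
     ~ forall e, phi (a + e * a') (b + e * b') = e ^+ 2 * q.[e]) ->
  exists r : 'I_n -> K * K, [/\ forall i, nonzero (r i).1 (r i).2,
    forall i j, (r i).1 * (r j).2 = (r i).2 * (r j).1 -> i = j &
    forall a b, nonzero a b ->
      (phi a b = 0 <-> exists i, a * (r i).2 = b * (r i).1)].
Proof.
move=> h nd; apply: bform_distinct_roots => //.
  apply: boolp.contrapT => H; apply: (nd 1 0 0 1 0).
  - by rewrite /nonzero oner_neq0.
  - by rewrite mulr1 mul0r subr0 oner_neq0.
  move=> e; rewrite horner0 [RHS]mulr0; apply/eqP/negPn/negP => He; apply: H.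
  by exists (1 + e * 0), (0 + e * 1).
move=> a b psi nz hpsi E.
have [a' [b' w]] : exists a' b', a * b' - b * a' != 0.
  move: nz; rewrite /nonzero => /orP[H|H]; [exists 0, 1|exists 1, 0].
    by rewrite mulr1 mulr0 subr0.
  by rewrite mulr1 mulr0 sub0r oppr_eq0.
have [q qE] := bform_line a a' b b' hpsi.
apply: (nd a b a' b' ((a * b' - b * a') ^+ 2 *: q) nz w) => e.
by rewrite E qE hornerZ; ring.
Qed.

Lemma bform_many_zeros n (phi : K -> K -> K) (r : seq (K * K)) : bform n phi -> size r = n.+1 ->
  all (fun t => nonzero t.1 t.2) r ->
  pairwise (fun s t => s.1 * t.2 != s.2 * t.1) r ->
  all (fun t => phi t.1 t.2 == 0) r -> forall a b, phi a b = 0.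
Proof.
elim: n phi r => [|n IH] phi [|[a b] r] //= h [sr] /andP[nz nr] /andP[pw pr] /andP[/eqP z zr].
  move=> a' b'; have [p sp pE] := h; move: z nz; rewrite /= !pE /hval (size1_polyC sp) !hornerC.
  by rewrite !expr0 !coefC /= !mulr1 !mul1r !if_same.
have [psi hpsi E] := bform_div h nz z.
move=> a' b'; rewrite E (IH psi r) ?mulr0 //.
apply/allP => t tr; have := allP zr t tr; rewrite E mulf_eq0 subr_eq0 => /orP[/eqP H|//].
by have := allP pw t tr; rewrite /= H eqxx.
Qed.

End NormalFormTheory.

(** * Degenerate singularities *)

Section Confinement.
Variable K : numClosedFieldType.
Implicit Types (f : triple K).

(* The ideal of the P_j has codimension at most three in degree N.+1; a double point uses up all
   three dimensions and leaves no room for any other zero. *)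
Definition confining (J : finType) N (P : J -> {mpoly K[3]}) :=
  forall L : {mpoly K[3]} -> K, functional L -> (forall C j, L (C * P j) = 0) ->
  (forall l, L ('X_l * 'X_i2 ^+ N) = 0) -> forall m, mdeg m = N.+1 -> L 'X_[m] = 0.

Lemma mderivXU (R : comNzRingType) n (i j : 'I_n) : ('X_i : {mpoly R[n]})^`M(j) = (i == j)%:R.
Proof.
rewrite mderivX mnm1E; case: eqP => [->|_]; last by rewrite scale0r.
by rewrite scale1r -{1}[U_(j)%MM]add0m addmK mpolyX0.
Qed.

Lemma mderiv_exp (R : comNzRingType) n (P : {mpoly R[n]}) k j :
  (P ^+ k.+1)^`M(j) = (P ^+ k * P^`M(j)) *+ k.+1.
Proof.
elim: k => [|k IH]; first by rewrite expr1 expr0 mul1r.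
by rewrite exprS mderivM IH mulrnAr mulrA -exprS [_^`M(j) * _]mulrC -mulrS.
Qed.

Definition twice0 (P : {mpoly K[3]}) (p : 'I_3 -> K) :=
  P.@[p] = 0 /\ forall l, P^`M(l).@[p] = 0.

Lemma twice0M (a b : {mpoly K[3]}) p : a.@[p] = 0 -> b.@[p] = 0 -> twice0 (a * b) p.
Proof.
move=> a0 b0; split=> [|l]; first by rewrite mevalM a0 mul0r.
by rewrite mderivM mevalD !mevalM a0 b0 !mulr0 mul0r addr0.
Qed.

Lemma twice0Ml (a b : {mpoly K[3]}) p : twice0 b p -> twice0 (a * b) p.
Proof.
move=> [b0 bD]; split=> [|l]; first by rewrite mevalM b0 mulr0.
by rewrite mderivM mevalD !mevalM bD b0 !mulr0 addr0.
Qed.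

Lemma twice0D (a b : {mpoly K[3]}) p : twice0 a p -> twice0 b p -> twice0 (a + b) p.
Proof.
move=> [a0 aD] [b0 bD]; split=> [|l]; first by rewrite mevalD a0 b0 addr0.
by rewrite mderivD mevalD aD bD addr0.
Qed.

Lemma twice0B (a b : {mpoly K[3]}) p : twice0 a p -> twice0 b p -> twice0 (a - b) p.
Proof.
by move=> ha hb; apply: twice0D => //; rewrite -mulN1r; apply: twice0Ml.
Qed.

(* The functionals Q(p), dQ/dx_0(p), dQ/dx_1(p) and L all kill the ideal, and its codimension
   is at most 3. *)
Lemma confine (J : finType) N (P : J -> {mpoly K[3]}) p : p i2 = 1 -> confining N P ->
  (forall j, twice0 (P j) p) -> forall L, functional L -> (forall C j, L (C * P j) = 0) ->
  forall Q, Q \is N.+1.-homog -> twice0 Q p -> L Q = 0.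
Proof.
move=> p2 conf hP L hL LP Q hQ [Q0 QD].
(* The three constants make the corrected functional [L'] vanish on the monomials x_l x_2^N left
   open by [confining]. *)
pose c0 := L ('X_i2 * 'X_i2 ^+ N).
pose c1 := L ('X_i0 * 'X_i2 ^+ N) - p i0 * c0.
pose c2 := L ('X_i1 * 'X_i2 ^+ N) - p i1 * c0.
pose L' S := L S - (c0 * S.@[p] + c1 * S^`M(i0).@[p] + c2 * S^`M(i1).@[p]).
have L'X m : mdeg m = N.+1 -> L' 'X_[m] = 0.
  apply: conf => [a S T|C j|].
  - by rewrite /L' hL !mderivD !mderivZ !mevalD !mevalZ; ring.
  - rewrite /L' LP; have [e0 eD] := twice0Ml C (hP j).
    by rewrite e0 !eD !mulr0 !addr0 subrr.
  have dX l k : k != i2 -> (('X_l * 'X_i2 ^+ N)^`M(k)).@[p] = (l == k)%:R.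
    move=> k2; rewrite mderivM mevalD !mevalM mderivXU rmorphXn /= mevalXU p2 expr1n mulr1.
    have -> : ('X_i2 ^+ N)^`M(k) = 0 :> {mpoly K[3]}.
      case: (N) => [|n]; first by rewrite expr0 -mpolyC1 mderivC.
      by rewrite mderiv_exp mderivXU eq_sym (negPf k2) mulr0 mul0rn.
    by rewrite meval0 mulr0 addr0; case: eqP => _; rewrite ?meval1 ?meval0.
  have X l : ('X_l * 'X_i2 ^+ N).@[p] = p l.
    by rewrite mevalM rmorphXn /= !mevalXU p2 expr1n mulr1.
  apply: ord3P; rewrite /L' X !dX //= -?/c0 ?p2 /c1 /c2; ring.
have LL : L' Q = 0.
  have hL' : functional L' by move=> a S T; rewrite /L' hL !mderivD !mderivZ !mevalD !mevalZ; ring.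
  rewrite (mpolyE Q) functional_sum // big_seq big1 // => m mQ.
  by rewrite L'X ?mulr0 //; exact: (dhomog_mf hQ).
by move: LL; rewrite /L' Q0 !QD !mulr0 !addr0 subr0.
Qed.

Lemma line_twice0 (p : 'I_3 -> K) a n (R : {mpoly K[3]}) : p i2 = 1 -> R \is n.-homog ->
  ('X_a - p a *: 'X_i2) ^+ 2 * R \is n.+2.-homog /\
  twice0 (('X_a - p a *: 'X_i2) ^+ 2 * R) p.
Proof.
move=> p2 hR; split.
  apply: (@dhomogM _ _ _ 2 _ n) => //; rewrite expr2; apply: (@dhomogM _ _ _ 1 _ 1);
    by rewrite rpredB ?dhomogZ // dhomogX /= mdeg1.
rewrite mulrC; apply: twice0Ml; rewrite expr2.
by apply: twice0M; rewrite mevalB mevalZ !mevalXU p2 mulr1 subrr.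
Qed.

(** Evaluation at q kills the ideal; it is applied to (x_a - p_a x_2)^(N+2), which is singular at
    p. *)
Lemma confine_point (J : finType) N (P : J -> {mpoly K[3]}) p : p i2 = 1 -> confining N.+1 P ->
  (forall j, twice0 (P j) p) -> forall q, (forall j, (P j).@[q] = 0) ->
  forall a, q a = p a * q i2.
Proof.
move=> p2 conf hP q hq a.
have hl : ('X_a - p a *: 'X_i2) ^+ N \is N.-homog.
  by rewrite -{2}[N]mul1n; apply: dhomogMn; rewrite rpredB ?dhomogZ // dhomogX /= mdeg1.
have [h1 h2] := line_twice0 a p2 hl.
have := confine p2 conf hP (L := fun Q => Q.@[q]) _ _ h1 h2.
rewrite -exprD rmorphXn /= mevalB mevalZ !mevalXU => /(_ _ _)/eqP.
rewrite expf_eq0 => H; apply/eqP; rewrite -subr_eq0; apply: (proj2 (andP (H _ _))).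
  by move=> c Q S; rewrite mevalD mevalZ.
by move=> C j; rewrite mevalM hq mulr0.
Qed.

Definition dir (p w : 'I_3 -> K) : 'I_3 -> {poly K} := fun i => (p i)%:P + w i *: 'X.

Lemma dir0 p w i : (dir p w i)`_0 = p i.
Proof. by rewrite coefD coefC coefZ coefX mulr0 addr0. Qed.

Lemma dir1 p w i : (dir p w i)`_1 = w i.
Proof. by rewrite coefD coefC coefZ coefX mulr1 add0r. Qed.

Lemma horner_dir p w e i : (dir p w i).[e] = p i + e * w i.
Proof. by rewrite hornerD hornerC hornerZ hornerX mulrC. Qed.

Lemma along_dir0 p w (P : {mpoly K[3]}) : (along (dir p w) P)`_0 = P.@[p].
Proof.
by rewrite -horner_coef0 horner_along; apply: meval_eq => i; rewrite horner_coef0 dir0.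
Qed.

Lemma along_dir1 p w (P : {mpoly K[3]}) :
  (along (dir p w) P)`_1 = \sum_i P^`M(i).@[p] * w i.
Proof.
rewrite coef1_along; apply: eq_bigr => i _; rewrite dir1; congr (_ * _).
by apply: meval_eq => j; rewrite dir0.
Qed.

Lemma coef2M (a b : {poly K}) : a`_0 = 0 -> b`_0 = 0 -> (a * b)`_2 = a`_1 * b`_1.
Proof. by move=> a0 b0; rewrite coefM !big_ord_recl big_ord0 /= a0 b0 mulr0 mul0r add0r !addr0. Qed.

Lemma coef2M_low (a b : {poly K}) : b`_0 = 0 -> b`_1 = 0 -> b`_2 = 0 -> (a * b)`_2 = 0.
Proof.
by move=> b0 b1 b2; rewrite coefM !big_ord_recl big_ord0 /= /bump /= b0 b1 b2 !mulr0 !addr0.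
Qed.

Lemma coef1M (a b : {poly K}) : (a * b)`_1 = a`_0 * b`_1 + a`_1 * b`_0.
Proof. by rewrite coefM !big_ord_recl big_ord0 /= addr0. Qed.

(** The coefficient of e^2 along p + e w kills the ideal; on (x_a - p_a x_2)^2 x_2^N it equals
    w_a^2. *)
Lemma confine_tangent (J : finType) N (P : J -> {mpoly K[3]}) p : p i2 = 1 ->
  confining N.+1 P -> (forall j, twice0 (P j) p) ->
  forall w, w i2 = 0 -> (forall j, (along (dir p w) (P j))`_2 = 0) -> forall a, w a = 0.
Proof.
move=> p2 conf hP w w2 hw a.
have hl : ('X_i2 ^+ N : {mpoly K[3]}) \is N.-homog.
  by rewrite -{2}[N]mul1n; apply: dhomogMn; rewrite dhomogX /= mdeg1.
have [h1 h2] := line_twice0 a p2 hl.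
have := confine p2 conf hP (L := fun Q => (along (dir p w) Q)`_2) _ _ h1 h2.
rewrite rmorphM !rmorphXn rmorphB /= alongZ !alongX.
have -> : dir p w a - p a *: dir p w i2 = w a *: 'X.
  by rewrite /dir p2 w2 scale0r addr0 alg_polyC addrC addKr.
have -> : dir p w i2 = 1 by rewrite /dir p2 w2 scale0r addr0.
rewrite expr1n mulr1 exprZn coefZ coefXn mulr1 => H.
have /eqP : w a ^+ 2 = 0; last by rewrite expf_eq0 => /eqP.
apply: H => [c Q S|C j]; first by rewrite rmorphD /= alongZ coefD coefZ.
have [P0 PD] := hP j.
rewrite rmorphM /=; apply: coef2M_low; rewrite ?along_dir0 ?along_dir1 ?hw //.
by rewrite big1 // => i _; rewrite PD mul0r.
Qed.

(** The foliation form as the cross product of x and f x: its zeros are the points where f x is a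
    multiple of x, possibly zero. *)
Definition om f : 'I_3 -> {mpoly K[3]} := cross (fun j => 'X_j) (fun j => tnth f j).

Lemma omE f i : om f i = tnth (foliation_form f) i.
Proof.
rewrite tnth_mktuple /om /cross /v3; move: i; apply: ord3P => /=;
by congr ('X_ _ * tnth f _ - 'X_ _ * tnth f _); apply: val_inj.
Qed.

(** The minors of order two of the Jacobian matrix of the form, which vanish where its rank is at
    most one. *)
Definition om_minors f (x : 'I_3 * 'I_3 * 'I_3) : {mpoly K[3]} :=
  cross (fun l => (om f x.1.1)^`M(l)) (fun l => (om f x.1.2)^`M(l)) x.2.

(* The row X adj(Df), which vanishes at the fixed points where Df is singular. *)
Definition adjx f : 'I_3 -> {mpoly K[3]} := fun l =>
  'X_i0 * cross (fun j => (tnth f i1)^`M(j)) (fun j => (tnth f i2)^`M(j)) l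
  + 'X_i1 * cross (fun j => (tnth f i2)^`M(j)) (fun j => (tnth f i0)^`M(j)) l
  + 'X_i2 * cross (fun j => (tnth f i0)^`M(j)) (fun j => (tnth f i1)^`M(j)) l.

Definition fam1 f (j : 'I_3 + 'I_3 * 'I_3 * 'I_3) :=
  match j with inl i => om f i | inr x => om_minors f x end.

Definition fam2 f (j : 'I_3 + 'I_3) :=
  match j with inl i => om f i | inr l => adjx f l end.

Lemma om_homog f i : cubic f -> om f i \is 4.-homog.
Proof.
move=> hf; rewrite /om /cross /v3; move: i; apply: ord3P => /=;
  by apply: rpredB; apply: (@dhomogM _ _ _ 1 _ 3); rewrite ?dhomogX /= ?mdeg1 //; exact: hf.
Qed.

Lemma meval_om f i x : (om f i).@[x] = cross x (ev f x) i.
Proof.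
rewrite /om meval_cross; move: i; apply: ord3P;
  by rewrite /cross /v3 /= !mevalXU.
Qed.

Section AtDoublePoint.
Variables (f : triple K) (p : 'I_3 -> K).
Hypotheses (hf : cubic f) (p2 : p i2 = 1).
Hypothesis hD : forall i l, (tnth f i)^`M(l).@[p] = 0.

Lemma twice0_f i : twice0 (tnth f i) p.
Proof.
split; last exact: hD.
have := euler_homog p (hf i); rewrite big1 => [|l _]; last by rewrite hD mul0r.
by move/esym/eqP; rewrite mulf_eq0 pnatr_eq0 => /eqP.
Qed.

Lemma twice0_om i : twice0 (om f i) p.
Proof.
by move: i; apply: ord3P; rewrite /om /cross /v3 /=; apply: twice0B; apply: twice0Ml;
  exact: twice0_f.
Qed.

Lemma twice0_fam1 j : twice0 (fam1 f j) p.
Proof.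
case: j => [i|[[j k] l]] /=; first exact: twice0_om.
have d i' l' : ((om f i')^`M(l')).@[p] = 0 by case: (twice0_om i').
by rewrite /om_minors /=; move: l; apply: ord3P; rewrite /cross /v3 /=; apply: twice0B;
  apply: twice0M.
Qed.

Lemma twice0_fam2 j : twice0 (fam2 f j) p.
Proof.
case: j => [i|l] /=; first exact: twice0_om.
have c a b l' : twice0 (cross (fun j => (tnth f a)^`M(j)) (fun j => (tnth f b)^`M(j)) l') p.
  by move: l'; apply: ord3P; rewrite /cross /v3 /=; apply: twice0B; apply: twice0M.
by rewrite /adjx; do 2?[apply: twice0D]; apply: twice0Ml.
Qed.

Lemma cross_perp0 (a b u v : 'I_3 -> K) l : cross u v l != 0 ->
  dot a u = 0 -> dot a v = 0 -> dot b u = 0 -> dot b v = 0 -> forall i, cross a b i = 0.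
Proof.
move=> uv au av bu bv.
have Ea i : a i = a l / cross u v l * cross u v i.
  by have := cross_parallel au av l i => E; apply: (mulIf uv); rewrite mulrAC divfK // E mulrC.
have Eb i : b i = b l / cross u v l * cross u v i.
  by have := cross_parallel bu bv l i => E; apply: (mulIf uv); rewrite mulrAC divfK // E mulrC.
move: (a l / _) (b l / _) Ea Eb => ca cb Ea Eb.
by apply: ord3P; rewrite {1}/cross /v3 /= !Ea !Eb; ring.
Qed.

(* At a degenerate zero q of the form, its differential kills the independent vectors q and v,
   hence has rank at most 1. *)
Lemma degenerate_zero N (q v : 'I_3 -> K) l : confining N.+1 (fam1 f) ->
  (forall i, (om f i).@[q] = 0) ->
  (forall i, \sum_j (om f i)^`M(j).@[q] * v j = 0) -> cross q v l != 0 ->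
  forall a, q a = p a * q i2.
Proof.
move=> conf q0 qv qvl; apply: (confine_point p2 conf twice0_fam1) => -[i|[[j k] i]] //=.
have dq i' : dot (fun l => (om f i')^`M(l).@[q]) q = 0.
  by have := euler_homog q (om_homog i' hf); rewrite q0 mulr0 sum3.
have dv i' : dot (fun l => (om f i')^`M(l).@[q]) v = 0.
  by have := qv i'; rewrite sum3.
by rewrite /om_minors meval_cross; apply: (cross_perp0 qvl).
Qed.

Lemma fam2_zero N (q : 'I_3 -> K) : confining N.+1 (fam2 f) ->
  (forall i, (om f i).@[q] = 0) -> (forall i, (adjx f i).@[q] = 0) ->
  forall a, q a = p a * q i2.
Proof. by move=> conf q0 qa; apply: (confine_point p2 conf twice0_fam2) => -[i|i] /=. Qed.

(** If the form vanishes to order three at p along w, the linear terms of its Jacobian rows along p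
    + e w kill p by Euler's identity and w by differentiation. These rows are then parallel, so the
    minors have no term in e^2 and [confine_tangent] applies. *)
Lemma tangent_zero N (w : 'I_3 -> K) : confining N.+1 (fam1 f) -> w i2 = 0 ->
  (forall i, (along (dir p w) (om f i))`_2 = 0) -> forall a, w a = 0.
Proof.
move=> conf w2 hw a; apply/eqP/negPn/negP => wa; move: (wa) => /negP[]; apply/eqP.
apply: (confine_tangent p2 conf twice0_fam1 w2) => -[i|[[j k] i]] //=.
have d0 i' l' : (along (dir p w) (om f i')^`M(l'))`_0 = 0.
  by rewrite along_dir0; case: (twice0_om i').
have dp i' : dot (fun l => (along (dir p w) (om f i')^`M(l))`_1) p = 0.
  have E : \sum_l along (dir p w) (om f i')^`M(l) * dir p w l = 4%:R *: along (dir p w) (om f i').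
    apply: poly_eq_of_values => x; rewrite hornerZ horner_along horner_sum.
    rewrite -(euler_homog _ (om_homog i' hf)); apply: eq_bigr => l _.
    by rewrite hornerM horner_along.
  have := congr1 (fun P : {poly K} => P`_1) E.
  rewrite coef_sum coefZ along_dir1 [X in _ * X]big1 => [|l _]; last first.
    by case: (twice0_om i') => _ ->; rewrite mul0r.
  by rewrite mulr0 sum3 !coef1M !d0 !mul0r !add0r !dir0.
have dw i' : dot (fun l => (along (dir p w) (om f i')^`M(l))`_1) w = 0.
  have := congr1 (fun P : {poly K} => P`_1) (deriv_along (dir p w) (om f i')).
  rewrite coef_deriv hw mul0rn coef_sum sum3 => /esym.
  have dE l : (dir p w l)^`() = (w l)%:P.
    by rewrite derivD derivC derivZ derivX add0r alg_polyC.
  by rewrite !dE !coefMC.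
have [l pw] : exists l, cross p w l != 0.
  move: a wa; apply: ord3P => wa.
  - by exists i1; rewrite /cross /v3 /= p2 w2 mul1r mulr0 subr0.
  - by exists i0; rewrite /cross /v3 /= p2 w2 mul1r mulr0 sub0r oppr_eq0.
  - by rewrite w2 eqxx in wa.
have crossE : (along (dir p w) (om_minors f (j, k, i)))`_2 =
    cross (fun l => (along (dir p w) (om f j)^`M(l))`_1)
          (fun l => (along (dir p w) (om f k)^`M(l))`_1) i.
  by rewrite /om_minors /=; move: i; apply: ord3P; rewrite /cross /v3 /= rmorphB !rmorphM /=
    coefB !coef2M.
by rewrite crossE; apply: (cross_perp0 pw).
Qed.

End AtDoublePoint.
End Confinement.

(** * First-order expansions *)

Section Jets.
Variable K : numClosedFieldType.

(** An expansion to first order with polynomial remainder. It is a property of functions, so that it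
    applies directly to values of [ev], [cross] and [pt]. *)
Definition jet (phi : K -> K) (a0 a1 : K) :=
  exists q : {poly K}, forall e, phi e = a0 + e * a1 + e ^+ 2 * q.[e].

Lemma jet_ext phi psi a0 a1 : jet psi a0 a1 -> (forall e, phi e = psi e) -> jet phi a0 a1.
Proof. by case=> q qE E; exists q => e; rewrite E qE. Qed.

Lemma jetC c : jet (fun=> c) c 0.
Proof. by exists 0 => e; rewrite horner0 !mulr0 !addr0. Qed.

Lemma jetL a0 a1 : jet (fun e => a0 + e * a1) a0 a1.
Proof. by exists 0 => e; rewrite horner0 mulr0 addr0. Qed.

Lemma jetD phi psi a0 a1 b0 b1 : jet phi a0 a1 -> jet psi b0 b1 ->
  jet (fun e => phi e + psi e) (a0 + b0) (a1 + b1).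
Proof. by move=> [p pE] [q qE]; exists (p + q) => e; rewrite pE qE hornerD; ring. Qed.

Lemma jetM phi psi a0 a1 b0 b1 : jet phi a0 a1 -> jet psi b0 b1 ->
  jet (fun e => phi e * psi e) (a0 * b0) (a0 * b1 + a1 * b0).
Proof.
move=> [p pE] [q qE].
exists ((a1 * b1)%:P + (a0%:P + a1 *: 'X) * q + (b0%:P + b1 *: 'X) * p + 'X ^+ 2 * p * q) => e.
by rewrite pE qE !hornerE; ring.
Qed.

Lemma jetZ c phi a0 a1 : jet phi a0 a1 -> jet (fun e => c * phi e) (c * a0) (c * a1).
Proof. by move=> h; have := jetM (jetC c) h; rewrite mul0r addr0. Qed.

Lemma jetN phi a0 a1 : jet phi a0 a1 -> jet (fun e => - phi e) (- a0) (- a1).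
Proof.
by move=> h; have := jetZ (-1) h; rewrite !mulN1r => h'; apply: jet_ext h' _ => e; rewrite mulN1r.
Qed.

Lemma jetB phi psi a0 a1 b0 b1 : jet phi a0 a1 -> jet psi b0 b1 ->
  jet (fun e => phi e - psi e) (a0 - b0) (a1 - b1).
Proof. by move=> h h'; apply: jetD => //; exact: jetN. Qed.

Lemma jetX2 phi a0 a1 : jet phi a0 a1 -> jet (fun e => phi e ^+ 2) (a0 ^+ 2) (2%:R * (a0 * a1)).
Proof.
move=> h; have := jetM h h; have -> : a0 * a1 + a1 * a0 = 2%:R * (a0 * a1) by ring.
by rewrite -expr2 => h'; apply: jet_ext h' _ => e; rewrite expr2.
Qed.

Lemma jetX3 phi a0 a1 : jet phi a0 a1 ->
  jet (fun e => phi e ^+ 3) (a0 ^+ 3) (3%:R * (a0 ^+ 2 * a1)).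
Proof.
move=> h; have := jetM h (jetX2 h).
have -> : a0 * (2%:R * (a0 * a1)) + a1 * a0 ^+ 2 = 3%:R * (a0 ^+ 2 * a1) by ring.
by rewrite -exprS => h'; apply: jet_ext h' _ => e; rewrite exprS.
Qed.

Lemma jet_unique phi a0 a1 b0 b1 : jet phi a0 a1 -> jet phi b0 b1 -> a0 = b0 /\ a1 = b1.
Proof.
move=> [p pE] [q qE].
have E : a0%:P + a1 *: 'X + 'X^2 * p = b0%:P + b1 *: 'X + 'X^2 * q.
  apply: poly_eq_of_values => e; have := pE e; rewrite qE !hornerE => H.
  by rewrite [a1 * e]mulrC [b1 * e]mulrC H.
have c (r : {poly K}) x y : (x%:P + y *: 'X + 'X^2 * r)`_0 = x /\ (x%:P + y *: 'X + 'X^2 * r)`_1 = y.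
  by rewrite !coefD !coefC !coefZ !coefX ![('X^2 * r)`__]coefXnM /= !addr0 mulr0 mulr1 add0r addr0.
have [c1 c2] := c p a0 a1; have [c3 c4] := c q b0 b1.
have := congr1 (fun r : {poly K} => r`_0) E; have := congr1 (fun r : {poly K} => r`_1) E.
by rewrite /= c1 c2 c3 c4 => -> ->.
Qed.

Lemma jet_meval n (P : {mpoly K[n]}) (g : 'I_n -> K -> K) x v :
  (forall i, jet (g i) (x i) (v i)) ->
  jet (fun e => P.@[fun i => g i e]) P.@[x] (\sum_j P^`M(j).@[x] * v j).
Proof.
move=> hg; elim/mpoly_gen_ind: P => [c|i|p q hp hq|p q hp hq].
- apply: jet_ext; last by move=> e; rewrite mevalC; reflexivity.
  rewrite mevalC big1; first exact: jetC.
  by move=> j _; rewrite mderivC meval0 mul0r.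
- apply: jet_ext; last by move=> e; rewrite mevalXU; reflexivity.
  rewrite mevalXU (bigD1 i) //= big1 => [|j ji].
    by rewrite mderivXU eqxx meval1 mul1r addr0.
  by rewrite mderivXU eq_sym (negPf ji) meval0 mul0r.
- apply: jet_ext; last by move=> e; rewrite mevalD; reflexivity.
  rewrite mevalD; have -> : \sum_j (p + q)^`M(j).@[x] * v j =
      \sum_j p^`M(j).@[x] * v j + \sum_j q^`M(j).@[x] * v j.
    by rewrite -big_split; apply: eq_bigr => j _; rewrite mderivD mevalD mulrDl.
  exact: jetD.
apply: jet_ext; last by move=> e; rewrite mevalM; reflexivity.
rewrite mevalM; have -> : \sum_j (p * q)^`M(j).@[x] * v j =
    p.@[x] * (\sum_j q^`M(j).@[x] * v j) + (\sum_j p^`M(j).@[x] * v j) * q.@[x].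
  rewrite mulr_sumr mulr_suml -big_split; apply: eq_bigr => j _ /=.
  by rewrite mderivM mevalD !mevalM; ring.
exact: jetM.
Qed.

(** [sq1], [cc1] and [dd1] are the derivatives of [sq], [cc] and [dd] at (t0, t1) in the direction
    (a, b); that of the linear form [sg] is [sg] at (a, b). *)
Definition sq1 (N : nform K) t0 t1 a b :=
  q0 N * (2%:R * (t0 * a)) + q1 N * (t0 * b + a * t1) + q2 N * (2%:R * (t1 * b)).
Definition cc1 (N : nform K) t0 t1 a b :=
  c0 N * (2%:R * (t0 * a)) + c1 N * (t0 * b + a * t1) + c2 N * (2%:R * (t1 * b)).
Definition dd1 (N : nform K) t0 t1 a b :=
  d0 N * (3%:R * (t0 ^+ 2 * a)) + d1 N * (t0 ^+ 2 * b + 2%:R * (t0 * a) * t1)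
  + d2 N * (t0 * (2%:R * (t1 * b)) + a * t1 ^+ 2) + d3 N * (3%:R * (t1 ^+ 2 * b)).

Section Binary.
Variables (N : nform K) (T0 T1 : K -> K) (t0 t1 a b : K).
Hypotheses (h0 : jet T0 t0 a) (h1 : jet T1 t1 b).

Lemma jet_sg : jet (fun e => sg N (T0 e) (T1 e)) (sg N t0 t1) (sg N a b).
Proof. by apply: jetD; apply: jetZ. Qed.

Lemma jet_sq : jet (fun e => sq N (T0 e) (T1 e)) (sq N t0 t1) (sq1 N t0 t1 a b).
Proof. by do 2?[apply: jetD]; apply: jetZ; [exact: jetX2|exact: jetM|exact: jetX2]. Qed.

Lemma jet_cc : jet (fun e => cc N (T0 e) (T1 e)) (cc N t0 t1) (cc1 N t0 t1 a b).
Proof. by do 2?[apply: jetD]; apply: jetZ; [exact: jetX2|exact: jetM|exact: jetX2]. Qed.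

Lemma jet_dd : jet (fun e => dd N (T0 e) (T1 e)) (dd N t0 t1) (dd1 N t0 t1 a b).
Proof.
do 3?[apply: jetD]; apply: jetZ; [exact: jetX3| | |exact: jetX3].
  by apply: jetM => //; exact: jetX2.
by apply: jetM => //; exact: jetX2.
Qed.

Definition SS1 z ze := z * sg N a b + ze * sg N t0 t1 + sq1 N t0 t1 a b.
Definition CC1 z ze := z * cc1 N t0 t1 a b + ze * cc N t0 t1 + dd1 N t0 t1 a b.

Lemma jet_SS Z z ze : jet Z z ze -> jet (fun e => SS N (T0 e) (T1 e) (Z e)) (SS N t0 t1 z) (SS1 z ze).
Proof. by move=> hZ; apply: jetD (jetM hZ jet_sg) jet_sq. Qed.

Lemma jet_CC Z z ze : jet Z z ze -> jet (fun e => CC N (T0 e) (T1 e) (Z e)) (CC N t0 t1 z) (CC1 z ze).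
Proof. by move=> hZ; apply: jetD (jetM hZ jet_cc) jet_dd. Qed.

End Binary.
End Jets.

(** * Base points and the conic of fixed points *)

Section Geometry.
Variable K : numClosedFieldType.

(* The target coordinates in which f has its normal form. *)
Definition nc (N : nform K) (x : 'I_3 -> K) : 'I_3 -> K :=
  v3 (dot (nn0 N) x) (dot (nn1 N) x) (dot (nn2 N) x).

Lemma cross_ext (a a' b b' : 'I_3 -> K) : a =1 a' -> b =1 b' -> cross a b =1 cross a' b'.
Proof. by move=> ha hb; apply: ord3P; rewrite /cross /v3 /= !ha !hb. Qed.

(** Cross products transform by the cofactor matrix, so proportionality can be tested in the target
    coordinates. *)
Lemma cross_nc N x y i : ndet N * cross x y i =
  nn0 N i * cross (nc N x) (nc N y) i0 + nn1 N i * cross (nc N x) (nc N y) i1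
  + nn2 N i * cross (nc N x) (nc N y) i2.
Proof. by move: i; apply: ord3P; rewrite /ndet /nc /dot /cross /v3 /=; ring. Qed.

Lemma nc_cross N x y : (forall i, cross x y i = 0) -> forall i, cross (nc N x) (nc N y) i = 0.
Proof.
move=> H; have e0 := H i0; have e1 := H i1; have e2 := H i2.
have E u v : dot u x * dot v y - dot v x * dot u y = dot (cross u v) (cross x y).
  by rewrite /dot /cross /v3 /=; ring.
have Z u : dot u (cross x y) = 0 by rewrite /dot e0 e1 e2 !mulr0 !addr0.
by apply: ord3P; rewrite {1}/cross /nc /v3 /= E Z.
Qed.

Lemma nc_cross_inv N x y : ndet N != 0 -> (forall i, cross (nc N x) (nc N y) i = 0) ->
  forall i, cross x y i = 0.
Proof. by move=> N0 H i; apply: (mulfI N0); rewrite cross_nc !H !mulr0 !addr0. Qed.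

Lemma pt_wedge (al be t0 t1 z a b ze : K) :
  (forall l, cross (pt al be t0 t1 z) (pt al be a b ze) l = 0) -> t0 * b - t1 * a = 0.
Proof.
move=> H; have := H i0; have := H i1; have := H i2; rewrite /cross /pt /v3 /= => e2 e1 e0.
transitivity (((t0 + al * z) * (b + be * ze) - (t1 + be * z) * (a + al * ze))
  + be * (z * (a + al * ze) - (t0 + al * z) * ze) + al * ((t1 + be * z) * ze - z * (b + be * ze))).
  by ring.
by rewrite e0 e1 e2 !mulr0 !addr0.
Qed.

Lemma kernel2 (u v : 'I_3 -> K) : exists w, [/\ exists i, w i != 0, dot u w = 0 & dot v w = 0].
Proof.
pose A : 'M[K]_(3, 1 + 1) := row_mx (\col_i u i) (\col_i v i).
have : kermx A != 0.
  rewrite kermx_eq0 /row_free; apply/negP => /eqP rA.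
  by have := rank_leq_col A; rewrite rA.
case/rowV0Pn => w /sub_kermxP; rewrite mul_mx_row => E w0.
have : row_mx (w *m \col_i u i) (w *m \col_i v i) = row_mx 0 0 by rewrite E row_mx0.
case/eq_row_mx => Eu Ev; exists (fun i => w 0 i); split.
- apply: boolp.contrapT => H; case/eqP: w0; apply/rowP => i; rewrite mxE.
  by apply/eqP/negPn/negP => wi; apply: H; exists i.
- have := congr1 (fun M : 'M_1 => M 0 0) Eu; rewrite !mxE sum3 !mxE => <-.
  by rewrite /dot ![u _ * _]mulrC.
- have := congr1 (fun M : 'M_1 => M 0 0) Ev; rewrite !mxE sum3 !mxE => <-.
  by rewrite /dot ![v _ * _]mulrC.
Qed.

(* No line l . x = 0 is mapped to itself. *)
Definition noline (f : triple K) := forall l : 'I_3 -> K,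
  (forall v, dot l (ev f (cross l v)) = 0) -> forall i, l i = 0.

Section Fixed.
Variables (f : triple K) (N : nform K).
Hypotheses (hf : cubic f) (nf : normal N f).
Let p : 'I_3 -> K := v3 (nal N) (nbe N) 1.
Hypothesis hD : forall i l, (tnth f i)^`M(l).@[p] = 0.
Hypothesis conf1 : confining 6 (fam1 f).
Hypothesis conf2 : confining 6 (fam2 f).
Hypothesis hline : noline f.

Let N0 : ndet N != 0. Proof. by case: nf. Qed.
Let p2 : p i2 = 1. Proof. by []. Qed.
Let ptN := pt (nal N) (nbe N).

(** First-order term of f along a jet of direction (a, b), with S' and C' the first-order terms of
    [SS] and [CC]; the normal form is solved by Cramer's rule. *)
Definition fvec t0 t1 (S a b S' C' : K) i :=
  (cross (nn1 N) (nn2 N) i * (b * S + t1 * S') - cross (nn2 N) (nn0 N) i * (a * S + t0 * S')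
   + cross (nn0 N) (nn1 N) i * C') / ndet N.

Lemma nc_f t0 t1 z : nc N (ev f (ptN t0 t1 z)) =1
  v3 (t1 * SS N t0 t1 z) (- t0 * SS N t0 t1 z) (CC N t0 t1 z).
Proof.
by have [_ /(_ t0 t1 z)[e0 e1 e2]] := nf; apply: ord3P; rewrite /nc /v3 /= /ptN ?e0 ?e1 ?e2.
Qed.

Lemma ev_f t0 t1 z i : ev f (ptN t0 t1 z) i =
  (cross (nn1 N) (nn2 N) i * (t1 * SS N t0 t1 z) - cross (nn2 N) (nn0 N) i * (t0 * SS N t0 t1 z)
   + cross (nn0 N) (nn1 N) i * CC N t0 t1 z) / ndet N.
Proof.
have [_ /(_ t0 t1 z)[e0 e1 e2]] := nf.
apply: (mulfI N0); rewrite recover /ptN e0 e1 e2 [RHS]mulrC divfK // /SS /CC; ring.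
Qed.

Lemma f_zero t0 t1 z : (forall i, ev f (ptN t0 t1 z) i = 0) <->
  [/\ t1 * SS N t0 t1 z = 0, t0 * SS N t0 t1 z = 0 & CC N t0 t1 z = 0].
Proof.
split=> [H|[e0 e1 e2] i]; last by rewrite ev_f e0 e1 e2 !mulr0 subrr addr0 mul0r.
have d0 n : dot n (ev f (ptN t0 t1 z)) = 0 by rewrite /dot !H !mulr0 !addr0.
have := nc_f t0 t1 z => E; split.
- by rewrite -[LHS](E i0) /nc /v3 /= d0.
- by apply/eqP; rewrite -oppr_eq0 -mulNr -[X in X == _](E i1) /nc /v3 /= d0.
- by rewrite -[LHS](E i2) /nc /v3 /= d0.
Qed.

Lemma jet_f T0 T1 Z t0 t1 z a b ze i : jet T0 t0 a -> jet T1 t1 b -> jet Z z ze ->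
  jet (fun e => ev f (ptN (T0 e) (T1 e) (Z e)) i) (ev f (ptN t0 t1 z) i)
    (fvec t0 t1 (SS N t0 t1 z) a b (SS1 N t0 t1 a b z ze) (CC1 N t0 t1 a b z ze) i).
Proof.
move=> h0 h1 hZ; apply: jet_ext; last by move=> e; rewrite ev_f mulrC; reflexivity.
have hS := jet_SS N h0 h1 hZ; have hC := jet_CC N h0 h1 hZ.
have := jetZ (ndet N)^-1 (jetD (jetB (jetZ (cross (nn1 N) (nn2 N) i) (jetM h1 hS))
   (jetZ (cross (nn2 N) (nn0 N) i) (jetM h0 hS))) (jetZ (cross (nn0 N) (nn1 N) i) hC)).
rewrite [X in jet _ X]mulrC -ev_f.
set u := _ * _; set w := fvec _ _ _ _ _ _ _ _; suff -> : u = w by [].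
by rewrite /u /w /fvec mulrC; congr (_ / _); congr (_ * _ - _ * _ + _); ring.
Qed.

Lemma jet_pt T0 T1 Z t0 t1 z a b ze i : jet T0 t0 a -> jet T1 t1 b -> jet Z z ze ->
  jet (fun e => ptN (T0 e) (T1 e) (Z e) i) (ptN t0 t1 z i) (ptN a b ze i).
Proof.
by move=> h0 h1 hZ; move: i; apply: ord3P; rewrite /ptN /pt /v3 //=; apply: jetD => //; apply: jetZ.
Qed.

Lemma pt_parallel t0 t1 z : (forall a, ptN t0 t1 z a = p a * ptN t0 t1 z i2) -> ~~ nonzero t0 t1.
Proof.
move=> H; have := H i0; have := H i1; rewrite /ptN /pt /p /v3 /= => e1 e0.
rewrite /nonzero negb_or !negbK; apply/andP; split; apply/eqP.
  by apply: (addIr (nal N * z)); rewrite e0 add0r.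
by apply: (addIr (nbe N * z)); rewrite e1 add0r.
Qed.

(** A velocity independent of the point would make it a degenerate zero of the form, and by
    [degenerate_zero] such a zero is p, excluded by the direction (t0, t1) being nonzero. *)
Lemma simple_zero t0 t1 z a b ze (T0 T1 Z : K -> K) : nonzero t0 t1 ->
  jet T0 t0 a -> jet T1 t1 b -> jet Z z ze ->
  (forall i, jet (fun e => cross (ptN (T0 e) (T1 e) (Z e)) (ev f (ptN (T0 e) (T1 e) (Z e))) i) 0 0) ->
  forall l, cross (ptN t0 t1 z) (ptN a b ze) l = 0.
Proof.
move=> nz h0 h1 hZ hj l; apply/eqP/negPn/negP => cl.
have H i : (om f i).@[ptN t0 t1 z] = 0 /\ \sum_j (om f i)^`M(j).@[ptN t0 t1 z] * ptN a b ze j = 0.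
  have j1 := jet_meval (om f i) (fun j => jet_pt j h0 h1 hZ).
  apply: jet_unique j1 _; apply: jet_ext (hj i) _ => e.
  by rewrite -meval_om.
have := @degenerate_zero _ f p hf p2 hD 5 (ptN t0 t1 z) (ptN a b ze) l conf1
  (fun i => proj1 (H i)) (fun i => proj2 (H i)) cl.
by move/pt_parallel; rewrite nz.
Qed.

(** The second vector gives the target coordinates of the leading term of f at p in the direction
    (t0, t1). Were it parallel to p, the form would vanish to order three at p in that direction. *)
Lemma pencil_not_contracted t0 t1 : nonzero t0 t1 ->
  ~ forall i, cross (nc N p) (v3 (t1 * sg N t0 t1) (- t0 * sg N t0 t1) (cc N t0 t1)) i = 0.
Proof.
move=> nz H.
(* With w = (t0, t1, 0), the expansion at p is f (p + e w) = e^2 (A + e B). *)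
pose A i := (cross (nn1 N) (nn2 N) i * (t1 * sg N t0 t1) - cross (nn2 N) (nn0 N) i * (t0 * sg N t0 t1)
   + cross (nn0 N) (nn1 N) i * cc N t0 t1) / ndet N.
pose B i := (cross (nn1 N) (nn2 N) i * (t1 * sq N t0 t1) - cross (nn2 N) (nn0 N) i * (t0 * sq N t0 t1)
   + cross (nn0 N) (nn1 N) i * dd N t0 t1) / ndet N.
have nA : nc N A =1 v3 (t1 * sg N t0 t1) (- t0 * sg N t0 t1) (cc N t0 t1).
  apply: ord3P; apply: (mulfI N0); rewrite /nc /A /dot /v3 /=; move: N0;
    rewrite /ndet /dot /cross /v3 /= => N0'; field; exact: N0'.
have pA i : cross p A i = 0.
  apply: (nc_cross_inv N0) => j; rewrite -[RHS](H j).
  by apply: cross_ext.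
pose w : 'I_3 -> K := v3 t0 t1 0.
have fE e i : ev f (fun j => p j + e * w j) i = e ^+ 2 * (A i + e * B i).
  have -> : ev f (fun j => p j + e * w j) i = ev f (ptN (e * t0) (e * t1) 1) i.
    by apply: meval_eq; apply: ord3P; rewrite /p /w /ptN /pt /v3 /= ?mulr1 ?mulr0 ?addr0 // addrC.
  by rewrite ev_f /A /B /SS /CC /sg /sq /cc /dd; field.
have W := @tangent_zero _ f p hf p2 hD 5 w conf1 erefl _.
have {W} W : forall a, w a = 0.
  apply: W => i.
  pose BB : 'I_3 -> {poly K} := fun i => (A i)%:P + B i *: 'X.
  have -> : along (dir p w) (om f i) = 'X^3 * (cross p B i + cross w A i)%:P + 'X^4 * (cross w B i)%:P.
    apply: poly_eq_of_values => e; rewrite horner_along (meval_eq _ (horner_dir p w e)).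
    rewrite meval_om !hornerE /=.
    transitivity (e ^+ 2 * cross p A i + e ^+ 3 * (cross p B i + cross w A i) + e ^+ 4 * cross w B i).
      rewrite (cross_ext (frefl _) (fE e)).
      by move: i {pA H}; apply: ord3P; rewrite /cross /v3 /=; ring.
    by rewrite pA mulr0 add0r.
  by rewrite coefD !coefXnM /= addr0.
by move: nz; rewrite /nonzero => /orP[] /negP[]; apply/eqP; [exact: (W i0)|exact: (W i1)].
Qed.

Lemma sg_cc t0 t1 : nonzero t0 t1 -> nonzero (sg N t0 t1) (cc N t0 t1).
Proof.
move=> nz; apply: contraT; rewrite /nonzero negb_or !negbK => /andP[/eqP s0 /eqP c0].
case: (pencil_not_contracted nz); rewrite s0 c0 !mulr0.
by apply: ord3P; rewrite /cross /v3 /= !mulr0 subrr.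
Qed.

(** Compatibility of two equations of degree one in z whose leading coefficients do not both
    vanish. *)
Lemma base_point t0 t1 : nonzero t0 t1 -> qq N t0 t1 = 0 ->
  exists z, SS N t0 t1 z = 0 /\ CC N t0 t1 z = 0.
Proof.
move=> nz; rewrite /qq => Q0; have := sg_cc nz; rewrite /nonzero /SS /CC.
have [s0|s0] /= := eqVneq (sg N t0 t1) 0 => [c0|_].
  move: Q0; rewrite s0 mul0r sub0r => /eqP; rewrite oppr_eq0 mulf_eq0 (negPf c0) /= => /eqP sq0.
  by exists (- dd N t0 t1 / cc N t0 t1); rewrite mulr0 sq0 addr0 divfK // addNr.
exists (- sq N t0 t1 / sg N t0 t1); split; first by rewrite divfK // addNr.
apply: (mulfI s0); rewrite mulr0 -[RHS]Q0; field; exact: s0.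
Qed.

Lemma base_point_unique t0 t1 z z' : nonzero t0 t1 -> SS N t0 t1 z = 0 -> CC N t0 t1 z = 0 ->
  SS N t0 t1 z' = 0 -> CC N t0 t1 z' = 0 -> z = z'.
Proof.
rewrite /SS /CC => nz e1 e2 e3 e4; apply: subr0_eq.
have := sg_cc nz; rewrite /nonzero => /orP[H|H]; apply: (mulIf H); rewrite mul0r.
  by transitivity ((z * sg N t0 t1 + sq N t0 t1) - (z' * sg N t0 t1 + sq N t0 t1));
    [ring|rewrite e1 e3 subrr].
by transitivity ((z * cc N t0 t1 + dd N t0 t1) - (z' * cc N t0 t1 + dd N t0 t1));
    [ring|rewrite e2 e4 subrr].
Qed.

Lemma base_qq t0 t1 z : SS N t0 t1 z = 0 -> CC N t0 t1 z = 0 -> qq N t0 t1 = 0.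
Proof.
move=> s0 c0; transitivity (sg N t0 t1 * CC N t0 t1 z - cc N t0 t1 * SS N t0 t1 z).
  by rewrite /qq /SS /CC; ring.
by rewrite s0 c0 !mulr0 subrr.
Qed.

(** At a double root of [qq] there is a transverse direction along which S and C both vanish to
    second order. Then f does too, and so does the form, which [simple_zero] forbids. *)
Lemma qq_roots : exists r : 'I_4 -> K * K, [/\ forall i, nonzero (r i).1 (r i).2,
    forall i j, (r i).1 * (r j).2 = (r i).2 * (r j).1 -> i = j &
    forall a b, nonzero a b ->
      (qq N a b = 0 <-> exists i, a * (r i).2 = b * (r i).1)].
Proof.
apply: bform_simple_roots (bform_qq N) _ => t0 t1 a b q nz w E.
have T0 := jetL t0 a; have T1 := jetL t1 b.
have [Q0 Q1] : qq N t0 t1 = 0 /\ sg N t0 t1 * dd1 N t0 t1 a b + sg N a b * dd N t0 t1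
    - (cc N t0 t1 * sq1 N t0 t1 a b + cc1 N t0 t1 a b * sq N t0 t1) = 0.
  apply: (@jet_unique _ (fun e => qq N (t0 + e * a) (t1 + e * b))).
    by apply: jetB; apply: jetM; [exact: jet_sg|exact: jet_dd|exact: jet_cc|exact: jet_sq].
  by exists q => e; rewrite E mulr0 addr0 add0r.
have [z [S0 C0]] := base_point nz Q0.
(* Vanishing of the derivative of the resultant is the compatibility condition for the two equations
   in [ze]. *)
have [ze [S1 C1]] : exists ze, SS1 N t0 t1 a b z ze = 0 /\ CC1 N t0 t1 a b z ze = 0.
  have K1 : sg N t0 t1 * (z * cc1 N t0 t1 a b + dd1 N t0 t1 a b) =
      cc N t0 t1 * (z * sg N a b + sq1 N t0 t1 a b).
    apply: subr0_eq; rewrite -[RHS]Q1.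
    transitivity ((z * sg N t0 t1) * cc1 N t0 t1 a b + sg N t0 t1 * dd1 N t0 t1 a b -
      (z * cc N t0 t1) * sg N a b - cc N t0 t1 * sq1 N t0 t1 a b); first by ring.
    move/eqP: S0; rewrite /SS addr_eq0 => /eqP ->; move/eqP: C0; rewrite /CC addr_eq0 => /eqP ->.
    by ring.
  have := sg_cc nz; rewrite /nonzero /SS1 /CC1 => /orP[s0|c0].
    exists (- (z * sg N a b + sq1 N t0 t1 a b) / sg N t0 t1); split; first by field.
    apply: (mulfI s0); rewrite mulr0.
    transitivity (sg N t0 t1 * (z * cc1 N t0 t1 a b + dd1 N t0 t1 a b) -
      cc N t0 t1 * (z * sg N a b + sq1 N t0 t1 a b)); first by field.
    by rewrite K1 subrr.
  exists (- (z * cc1 N t0 t1 a b + dd1 N t0 t1 a b) / cc N t0 t1); split; last by field.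
  apply: (mulfI c0); rewrite mulr0.
  transitivity (cc N t0 t1 * (z * sg N a b + sq1 N t0 t1 a b) -
    sg N t0 t1 * (z * cc1 N t0 t1 a b + dd1 N t0 t1 a b)); first by field.
  by rewrite K1 subrr.
case/negP: w; apply/eqP; apply: (@pt_wedge (nal N) (nbe N) t0 t1 z a b ze).
apply: (simple_zero nz T0 T1 (jetL z ze)) => i.
have F j : jet (fun e => ev f (ptN (t0 + e * a) (t1 + e * b) (z + e * ze)) j) 0 0.
  have := jet_f j T0 T1 (jetL z ze).
  have -> : ev f (ptN t0 t1 z) j = 0 by apply: (proj2 (f_zero t0 t1 z)); rewrite S0 C0 !mulr0.
  by rewrite /fvec S0 S1 C1 !mulr0 !addr0 !mulr0 subrr mul0r.
have X j := jet_pt j T0 T1 (jetL z ze).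
have M j k := jetM (X j) (F k).
have M0 j k : jet (fun e => ptN (t0 + e * a) (t1 + e * b) (z + e * ze) j *
    ev f (ptN (t0 + e * a) (t1 + e * b) (z + e * ze)) k) 0 0.
  by have := M j k; rewrite !mulr0 addr0.
by have B j k j' k' := jetB (M0 j k) (M0 j' k'); move: i; apply: ord3P;
  rewrite -[X in jet _ X _](subrr 0) -[X in jet _ _ X](subrr 0); apply: B.
Qed.

(* For a row n, the linear form n . x is tev n + z pk n in the coordinates (t0, t1, z). *)
Definition tev (n : 'I_3 -> K) t0 t1 := t0 * n i0 + t1 * n i1.
Definition pk (n : 'I_3 -> K) := nal N * n i0 + nbe N * n i1 + n i2.
(** At x = [ptN t0 t1 z] the linear form t0 nn0 + t1 nn1, which the syzygy makes vanish at f x,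
    takes the value z nu + mu. Over t a fixed point therefore has z nu = - mu. *)
Definition nu t0 t1 := t0 * pk (nn0 N) + t1 * pk (nn1 N).
Definition mu t0 t1 := t0 * tev (nn0 N) t0 t1 + t1 * tev (nn1 N) t0 t1.

Lemma dot_pt n t0 t1 z : dot n (ptN t0 t1 z) = tev n t0 t1 + z * pk n.
Proof. by rewrite /dot /ptN /pt /v3 /tev /pk /=; ring. Qed.

Lemma ndet_wedge t0 t1 : nonzero t0 t1 -> exists i, t0 * nn0 N i + t1 * nn1 N i != 0.
Proof.
move=> nz; apply: boolp.contrapT => H; move: N0 => /negP[]; apply/eqP.
have c0 := @cross_dependent0 _ (nn0 N) (nn1 N) t0 (- t1).
have {}c0 i : cross (nn0 N) (nn1 N) i = 0.
  apply: c0; first by rewrite /nonzero oppr_eq0.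
  move=> j; rewrite mulNr; apply/eqP; rewrite -addr_eq0; apply/negPn/negP => Hj.
  by apply: H; exists j.
by rewrite /ndet /dot !c0 !mulr0 !addr0.
Qed.

(* Otherwise the line through the double point in the direction (t0, t1) is invariant. *)
Lemma nu_mu t0 t1 : nonzero t0 t1 -> nu t0 t1 = 0 -> mu t0 t1 != 0.
Proof.
move=> nz nu0; apply/eqP => mu0; pose l i := t0 * nn0 N i + t1 * nn1 N i.
have [j lj] := ndet_wedge nz; case/negP: (lj); apply/eqP; apply: (hline (l := l)) => v.
set x := cross l v; have lx : dot l x = 0 by rewrite /x /dot /cross /v3 /=; ring.
pose a := x i0 - nal N * x i2; pose b := x i1 - nbe N * x i2.
have xE : x =1 ptN a b (x i2) by exact: pt_coord.
have E1 : a * l i0 + b * l i1 = 0.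
  rewrite -[RHS]lx -[in RHS](subr0 (dot l x)) -{1}(mulr0 (x i2)) -nu0 /a /b /dot /nu /l /pk; ring.
have E2 : t0 * l i0 + t1 * l i1 = 0 by rewrite -[RHS]mu0 /mu /l /tev; ring.
have l01 : nonzero (l i0) (l i1).
  apply: contraNT lj; rewrite /nonzero negb_or !negbK => /andP[/eqP l0 /eqP l1].
  have l2 : l i2 = 0.
    transitivity (nu t0 t1 - nal N * l i0 - nbe N * l i1); first by rewrite /l /nu /pk; ring.
    by rewrite nu0 l0 l1 !mulr0 !subr0.
  by apply/eqP; move: j; apply: ord3P.
have W : t0 * b - t1 * a = 0.
  move: l01; rewrite /nonzero => /orP[H|H]; apply: (mulIf H); rewrite mul0r.
    transitivity (b * (t0 * l i0 + t1 * l i1) - t1 * (a * l i0 + b * l i1)); first by ring.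
    by rewrite E1 E2 !mulr0 subrr.
  transitivity (t0 * (a * l i0 + b * l i1) - a * (t0 * l i0 + t1 * l i1)); first by ring.
  by rewrite E1 E2 !mulr0 subrr.
have [_ /(_ a b (x i2))[e0 e1 _]] := nf.
transitivity (t0 * dot (nn0 N) (ev f (ptN a b (x i2))) + t1 * dot (nn1 N) (ev f (ptN a b (x i2)))).
  have xf i : ev f x i = ev f (ptN a b (x i2)) i by apply: meval_eq.
  by rewrite /dot /l !xf; ring.
rewrite /ptN e0 e1; transitivity ((t0 * b - t1 * a) * SS N a b (x i2)); last by rewrite W mul0r.
by rewrite /SS; ring.
Qed.

(** In target coordinates [xt] is (t1 th, - t0 th, ka) and its image is nu^2 (t1 Sphi, - t0 Sphi,
    Cphi). The two are proportional when the determinant [R5] vanishes. *)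
Definition th t0 t1 := pk (nn1 N) * tev (nn0 N) t0 t1 - pk (nn0 N) * tev (nn1 N) t0 t1.
Definition ka t0 t1 := nu t0 t1 * tev (nn2 N) t0 t1 - mu t0 t1 * pk (nn2 N).
Definition Sphi t0 t1 := nu t0 t1 * sq N t0 t1 - mu t0 t1 * sg N t0 t1.
Definition Cphi t0 t1 := nu t0 t1 * dd N t0 t1 - mu t0 t1 * cc N t0 t1.
Definition R5 t0 t1 := th t0 t1 * Cphi t0 t1 - ka t0 t1 * Sphi t0 t1.

(* The fixed points lie on the conic n(x) . x = 0, parametrised by xt. *)
Definition xt t0 t1 := ptN (nu t0 t1 * t0) (nu t0 t1 * t1) (- mu t0 t1).

Lemma nc_xt t0 t1 : nc N (xt t0 t1) =1 v3 (t1 * th t0 t1) (- t0 * th t0 t1) (ka t0 t1).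
Proof.
by apply: ord3P; rewrite /nc /v3 /= /xt dot_pt /th /ka /nu /mu /tev; ring.
Qed.

Lemma SS_xt t0 t1 : SS N (nu t0 t1 * t0) (nu t0 t1 * t1) (- mu t0 t1) = nu t0 t1 * Sphi t0 t1.
Proof. by rewrite /SS /Sphi /sg /sq; ring. Qed.

Lemma CC_xt t0 t1 : CC N (nu t0 t1 * t0) (nu t0 t1 * t1) (- mu t0 t1) = nu t0 t1 ^+ 2 * Cphi t0 t1.
Proof. by rewrite /CC /Cphi /cc /dd; ring. Qed.

Lemma nc_fxt t0 t1 : nc N (ev f (xt t0 t1)) =1 v3 (nu t0 t1 ^+ 2 * (t1 * Sphi t0 t1))
  (- (nu t0 t1 ^+ 2 * (t0 * Sphi t0 t1))) (nu t0 t1 ^+ 2 * Cphi t0 t1).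
Proof.
move=> i; rewrite /xt nc_f SS_xt CC_xt; move: i; apply: ord3P; rewrite /v3 /=; ring.
Qed.

Lemma cross_xt t0 t1 : cross (nc N (xt t0 t1)) (nc N (ev f (xt t0 t1))) =1
  v3 (- (nu t0 t1 ^+ 2 * (t0 * R5 t0 t1))) (- (nu t0 t1 ^+ 2 * (t1 * R5 t0 t1))) 0.
Proof.
move=> i; rewrite (cross_ext (@nc_xt t0 t1) (@nc_fxt t0 t1)); move: i; apply: ord3P;
  by rewrite /cross /v3 /= /R5; ring.
Qed.

Lemma bform_nu : bform 1 nu.
Proof. by apply: bform_ext (bform_lin (pk (nn0 N)) (pk (nn1 N))) _ => a b; rewrite /nu; ring. Qed.

Lemma bform_tev n : bform 1 (tev n).
Proof. by apply: bform_ext (bform_lin (n i0) (n i1)) _ => a b; rewrite /tev; ring. Qed.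

Lemma bform_mu : bform 2 mu.
Proof.
apply: bformD; apply: (@bformM _ 1 1); try exact: bform_tev; [exact: bform_fst|exact: bform_snd].
Qed.

Lemma bform_R5 : bform 5 R5.
Proof.
have h1 : bform 1 th by apply: bformB; apply: bformZ; exact: bform_tev.
have h2 : bform 2 ka.
  apply: bformB; first exact: (bformM bform_nu (bform_tev (nn2 N))).
  apply: bform_ext (bformZ (pk (nn2 N)) bform_mu) _ => a b; exact: mulrC.
have h3 : bform 3 Sphi.
  apply: bformB; first exact: (bformM bform_nu (bform_sq N)).
  exact: (bformM bform_mu (bform_sg N)).
have h4 : bform 4 Cphi.
  apply: bformB; first exact: (bformM bform_nu (bform_dd N)).
  exact: (bformM bform_mu (bform_cc N)).
by apply: bformB; [exact: (bformM h1 h4)|exact: (bformM h2 h3)].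
Qed.

(** The syzygy kills f x, hence also its multiple x, which gives z nu + mu = 0; nu = 0 would entail
    mu = 0, against [nu_mu]. *)
Lemma fixed_on_conic t0 t1 z : nonzero t0 t1 ->
  (forall i, cross (ptN t0 t1 z) (ev f (ptN t0 t1 z)) i = 0) ->
  (exists i, ev f (ptN t0 t1 z) i != 0) ->
  [/\ nu t0 t1 != 0, z * nu t0 t1 = - mu t0 t1 & R5 t0 t1 = 0].
Proof.
move=> nz c0 [j fj].
have [la [m [nlm E]]] := cross0_dependent c0.
have la0 : la != 0.
  apply: contraTneq nlm => l0; rewrite /nonzero l0 eqxx /=.
  have := E j; rewrite l0 mul0r => /esym/eqP; rewrite mulf_eq0 (negPf fj) orbF => ->.
  by [].
have [_ /(_ t0 t1 z)[e0 e1 _]] := nf.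
have Z : z * nu t0 t1 = - mu t0 t1.
  apply/eqP; rewrite -addr_eq0; apply/eqP; apply: (mulfI la0); rewrite mulr0.
  transitivity (t0 * dot (nn0 N) (fun i => la * ptN t0 t1 z i) +
     t1 * dot (nn1 N) (fun i => la * ptN t0 t1 z i)).
    by rewrite /dot /ptN /pt /v3 /nu /mu /pk /tev /=; ring.
  rewrite /dot !E; transitivity (m * (t0 * dot (nn0 N) (ev f (ptN t0 t1 z)) +
     t1 * dot (nn1 N) (ev f (ptN t0 t1 z)))); first by rewrite /dot; ring.
  by rewrite /ptN e0 e1; ring.
have nu0 : nu t0 t1 != 0.
  apply/negP => /eqP n0; have := nu_mu nz n0; move: Z; rewrite n0 mulr0 => /esym/eqP.
  by rewrite oppr_eq0 => ->.
split=> //.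
have xE : xt t0 t1 =1 (fun i => nu t0 t1 * ptN t0 t1 z i).
  by apply: ord3P; rewrite /xt -Z /ptN /pt /v3 /=; ring.
have fE : ev f (xt t0 t1) =1 (fun i => nu t0 t1 ^+ 3 * ev f (ptN t0 t1 z) i).
  by move=> i; rewrite /ev (meval_eq _ xE) (meval_scale _ _ (hf i)).
have cx : forall i, cross (xt t0 t1) (ev f (xt t0 t1)) i = 0.
  move=> i; rewrite (cross_ext xE fE) -[RHS](mulr0 (nu t0 t1 ^+ 4)) -(c0 i).
  by move: i; apply: ord3P; rewrite /cross {1 2}/v3 /=; ring.
have n4 : nu t0 t1 ^+ 2 != 0 by rewrite expf_neq0.
have c1 := nc_cross N cx; have := c1 i0; have := c1 i1; rewrite !cross_xt /v3 /=.
move/eqP; rewrite oppr_eq0 mulf_eq0 (negPf n4) /= mulf_eq0 => /orP[t10|/eqP //].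
move/eqP; rewrite oppr_eq0 mulf_eq0 (negPf n4) /= mulf_eq0 => /orP[t00|/eqP //].
by move: nz; rewrite /nonzero t10 t00.
Qed.

(** At a zero of nu the target coordinates of p are (r t1, - r t0, pk nn2), and [R5] reduces to mu^2
    (r cc - pk nn2 sg). Its vanishing would make the leading term of f at p parallel to p. *)
Lemma R5_nu t0 t1 : nonzero t0 t1 -> R5 t0 t1 = 0 -> nu t0 t1 != 0.
Proof.
move=> nz R0; apply/eqP => nu0; have mu0 := nu_mu nz nu0.
have [r [r0 r1]] : exists r, pk (nn0 N) = r * t1 /\ pk (nn1 N) = - r * t0.
  move: (nu0) nz; rewrite /nu /nonzero => E /orP[t00|t10].
    exists (- pk (nn1 N) / t0); split; last by field.
    apply: (mulfI t00); transitivity (t0 * pk (nn0 N) + t1 * pk (nn1 N) - t1 * pk (nn1 N)).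
      by ring.
    by rewrite E sub0r; field.
  exists (pk (nn0 N) / t1); split; first by field.
  apply: (mulfI t10); transitivity (t0 * pk (nn0 N) + t1 * pk (nn1 N) - t0 * pk (nn0 N)).
    by ring.
  by rewrite E sub0r; field.
have K1 : r * cc N t0 t1 = pk (nn2 N) * sg N t0 t1.
  apply: subr0_eq; apply: (mulfI (mulf_neq0 mu0 mu0)); rewrite mulr0 -[RHS]R0.
  rewrite /R5 /Cphi /Sphi /ka nu0 /th r0 r1 /mu; ring.
apply: (pencil_not_contracted nz).
have pE : nc N p =1 v3 (r * t1) (- r * t0) (pk (nn2 N)).
  by apply: ord3P; rewrite /nc /v3 /= -?r0 -?r1 /dot /pk /p /v3 /=; ring.
move=> i; rewrite (cross_ext pE (frefl _)); move: i; apply: ord3P; rewrite /cross /v3 /=.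
- transitivity (- t0 * (r * cc N t0 t1 - pk (nn2 N) * sg N t0 t1)); first by ring.
  by rewrite K1 subrr mulr0.
- transitivity (- t1 * (r * cc N t0 t1 - pk (nn2 N) * sg N t0 t1)); first by ring.
  by rewrite K1 subrr mulr0.
- by ring.
Qed.

Lemma R5_fixed t0 t1 : R5 t0 t1 = 0 -> forall i, cross (xt t0 t1) (ev f (xt t0 t1)) i = 0.
Proof.
move=> R0; apply: (nc_cross_inv N0) => i; rewrite cross_xt R0 !mulr0 oppr0.
by move: i; apply: ord3P.
Qed.

End Fixed.
End Geometry.

(** * Simplicity of the fixed points *)

Section FixedPoints.
Variable K : numClosedFieldType.

Lemma jet_cross (X Y : 'I_3 -> K -> K) x y x' y' i : (forall j, jet (X j) (x j) (x' j)) ->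
  (forall j, jet (Y j) (y j) (y' j)) ->
  jet (fun e => cross (fun j => X j e) (fun j => Y j e) i) (cross x y i)
    (cross x y' i + cross x' y i).
Proof.
move=> hX hY; have M j k := jetM (hX j) (hY k).
have B j k j' k' : jet (fun e => X j e * Y k e - X j' e * Y k' e) (x j * y k - x j' * y k')
    ((x j * y' k - x j' * y' k') + (x' j * y k - x' j' * y k')).
  have := jetB (M j k) (M j' k').
  by have -> : x j * y' k + x' j * y k - (x j' * y' k' + x' j' * y k') =
    (x j * y' k - x j' * y' k') + (x' j * y k - x' j' * y k') by ring.
by move: i; apply: ord3P; rewrite /cross /v3 /=; apply: B.
Qed.

Lemma meval_adjx (f : triple K) l x : (adjx f l).@[x] =
  x i0 * cross (fun j => (tnth f i1)^`M(j).@[x]) (fun j => (tnth f i2)^`M(j).@[x]) l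
  + x i1 * cross (fun j => (tnth f i2)^`M(j).@[x]) (fun j => (tnth f i0)^`M(j).@[x]) l
  + x i2 * cross (fun j => (tnth f i0)^`M(j).@[x]) (fun j => (tnth f i1)^`M(j).@[x]) l.
Proof.
have E (A B C : {mpoly K[3]}) : ('X_i0 * A + 'X_i1 * B + 'X_i2 * C).@[x] =
    x i0 * A.@[x] + x i1 * B.@[x] + x i2 * C.@[x] by rewrite !mevalD !mevalM !mevalXU.
by rewrite E !meval_cross.
Qed.

Variables (f : triple K) (N : nform K).
Hypotheses (hf : cubic f) (nf : normal N f).
Let p : 'I_3 -> K := v3 (nal N) (nbe N) 1.
Hypothesis hD : forall i l, (tnth f i)^`M(l).@[p] = 0.
Hypothesis conf1 : confining 6 (fam1 f).
Hypothesis conf2 : confining 6 (fam2 f).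
Hypothesis hline : noline f.

Let N0 : ndet N != 0. Proof. by case: nf. Qed.
Let p2 : p i2 = 1. Proof. by []. Qed.
Let ptN := pt (nal N) (nbe N).

Lemma nc_fvec t0 t1 S a b S' C' :
  nc N (fvec N t0 t1 S a b S' C') =1 v3 (b * S + t1 * S') (- (a * S + t0 * S')) C'.
Proof.
apply: ord3P; apply: (mulfI N0); rewrite /nc /fvec /dot /v3 /=; move: N0;
  rewrite /ndet /dot /cross /v3 /= => N0'; field; exact: N0'.
Qed.

Lemma cross_pt_p t0 t1 z : (forall l, cross (ptN t0 t1 z) p l = 0) -> ~~ nonzero t0 t1.
Proof.
move=> H; have := H i0; have := H i1; rewrite /cross /ptN /pt /p /v3 /= => e1 e0.
rewrite /nonzero negb_or !negbK; apply/andP; split; apply/eqP.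
  by rewrite -[RHS]oppr0 -e1; ring.
by rewrite -e0; ring.
Qed.

Lemma exists_transverse (t0 t1 : K) : nonzero t0 t1 -> exists a b, t0 * b - t1 * a != 0.
Proof.
rewrite /nonzero => /orP[H|H]; [exists 0, 1|exists 1, 0].
  by rewrite mulr1 mulr0 subr0.
by rewrite mulr1 mulr0 sub0r oppr_eq0.
Qed.

(** If f vanished at [xt], the first-order part of the form along (a, b, ze) would vanish under the
    single linear condition psi = 0. Three unknowns leave a solution independent of the point:
    either (0, 0, 1), which is the direction of p, or a transverse (a, b) with [ze] solved for. *)
Lemma R5_not_base t0 t1 : nonzero t0 t1 -> R5 N t0 t1 = 0 -> exists i, ev f (xt N t0 t1) i != 0.
Proof.
move=> nz R0; have nu0 := R5_nu hf nf hD conf1 hline nz R0.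
apply: boolp.contrapT => H.
have {}H i : ev f (xt N t0 t1) i = 0 by apply/eqP/negPn/negP => Hi; apply: H; exists i.
pose T0 := nu N t0 t1 * t0; pose T1 := nu N t0 t1 * t1; pose Z := - mu N t0 t1.
have nzT : nonzero T0 T1 by move: nz; rewrite /nonzero /T0 /T1 !mulf_eq0 (negPf nu0).
have [e1 e0 C0] := proj1 (f_zero nf T0 T1 Z) H.
have S0 : SS N T0 T1 Z = 0.
  by move: nzT; rewrite /nonzero => /orP[h|h]; apply: (mulfI h); rewrite mulr0.
pose psi a b ze := ka N t0 t1 * nu N t0 t1 * SS1 N T0 T1 a b Z ze - th N t0 t1 * CC1 N T0 T1 a b Z ze.
have key a b ze : psi a b ze = 0 -> forall l, cross (ptN T0 T1 Z) (ptN a b ze) l = 0.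
  move=> psi0; apply: (simple_zero hf hD conf1 nzT (jetL T0 a) (jetL T1 b) (jetL Z ze)) => i.
  have := jet_cross i (fun j => jet_pt N j (jetL T0 a) (jetL T1 b) (jetL Z ze))
     (fun j => jet_f nf j (jetL T0 a) (jetL T1 b) (jetL Z ze)).
  have -> : cross (pt (nal N) (nbe N) T0 T1 Z) (ev f (pt (nal N) (nbe N) T0 T1 Z)) i = 0.
    by rewrite -/ptN -[ptN T0 T1 Z]/(xt N t0 t1) (cross_ext (frefl _) H);
      move: (i); apply: ord3P; rewrite /cross /v3 /= !mulr0 subrr.
  have -> : cross (pt (nal N) (nbe N) a b ze) (ev f (pt (nal N) (nbe N) T0 T1 Z)) i = 0.
    by rewrite -[pt (nal N) (nbe N) T0 T1 Z]/(xt N t0 t1) (cross_ext (frefl _) H);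
      move: (i); apply: ord3P; rewrite /cross /v3 /= !mulr0 subrr.
  rewrite addr0 S0; set F := fvec _ _ _ _ _ _ _ _.
  have -> // : cross (pt (nal N) (nbe N) T0 T1 Z) F i = 0.
  apply: (nc_cross_inv N0) => j; rewrite -[pt _ _ T0 T1 Z]/(xt N t0 t1).
  rewrite (cross_ext (@nc_xt _ N t0 t1) (nc_fvec _ _ _ _ _ _ _)) !mulr0 !add0r.
  move: j; apply: ord3P; rewrite /cross /v3 /= /T0 /T1.
  - by rewrite -[RHS](mulr0 t0) -psi0 /psi; ring.
  - by rewrite -[RHS](mulr0 t1) -psi0 /psi; ring.
  - by ring.
have [E|E] := eqVneq (psi 0 0 1) 0.
  have W : ~~ nonzero T0 T1.
    apply: (@cross_pt_p T0 T1 Z) => l; rewrite -[RHS](key _ _ _ E l); apply: cross_ext => //.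
    by apply: ord3P; rewrite /p /ptN /pt /v3 /= ?add0r ?mulr1.
  by rewrite nzT in W.
have [a [b w]] := exists_transverse nzT.
have lin : psi a b (- psi a b 0 / psi 0 0 1) = 0.
  transitivity (psi a b 0 + (- psi a b 0 / psi 0 0 1) * psi 0 0 1); last by field.
  by rewrite /psi /SS1 /CC1 /sq1 /cc1 /dd1 /sg; ring.
by have := pt_wedge (key _ _ _ lin) => /eqP; rewrite (negPf w).
Qed.

(** Along the conic [xt] the form is a multiple of [R5], so at a double root it would vanish to
    second order along a curve whose velocity is independent of the point. *)
Lemma R5_roots : exists r : 'I_5 -> K * K, [/\ forall i, nonzero (r i).1 (r i).2,
    forall i j, (r i).1 * (r j).2 = (r i).2 * (r j).1 -> i = j &
    forall a b, nonzero a b ->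
      (R5 N a b = 0 <-> exists i, a * (r i).2 = b * (r i).1)].
Proof.
apply: bform_simple_roots (bform_R5 N) _ => t0 t1 a b q nz w E.
have R0 : R5 N t0 t1 = 0.
  by have := E 0; rewrite !mul0r !addr0 expr2 !mul0r.
have nu0 := R5_nu hf nf hD conf1 hline nz R0.
have jR : jet (fun e => R5 N (t0 + e * a) (t1 + e * b)) 0 0.
  by exists q => e; rewrite E mulr0 addr0 add0r.
have jnu : jet (fun e => nu N (t0 + e * a) (t1 + e * b)) (nu N t0 t1) (nu N a b).
  by apply: jet_ext (jetL (nu N t0 t1) (nu N a b)) _ => e; rewrite /nu; ring.
have jtev n : jet (fun e => tev n (t0 + e * a) (t1 + e * b)) (tev n t0 t1) (tev n a b).
  by apply: jet_ext (jetL (tev n t0 t1) (tev n a b)) _ => e; rewrite /tev; ring.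
have [m1 jmu] : exists m1, jet (fun e => mu N (t0 + e * a) (t1 + e * b)) (mu N t0 t1) m1.
  by eexists; apply: jetD; apply: jetM (jetL _ _) (jtev _).
have jT0 := jetM jnu (jetL t0 a); have jT1 := jetM jnu (jetL t1 b); have jZ := jetN jmu.
have W := simple_zero hf hD conf1 _ jT0 jT1 jZ.
suff /W H : forall i, jet (fun e => cross (xt N (t0 + e * a) (t1 + e * b))
    (ev f (xt N (t0 + e * a) (t1 + e * b))) i) 0 0.
  have nzT : nonzero (nu N t0 t1 * t0) (nu N t0 t1 * t1).
    by move: nz; rewrite /nonzero !mulf_eq0 (negPf nu0).
  have /eqP := pt_wedge (H nzT).
  have -> : nu N t0 t1 * t0 * (nu N t0 t1 * b + nu N a b * t1) -
      nu N t0 t1 * t1 * (nu N t0 t1 * a + nu N a b * t0) = nu N t0 t1 ^+ 2 * (t0 * b - t1 * a) by ring.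
  by rewrite mulf_eq0 expf_eq0 (negPf nu0) (negPf w).
move=> i.
have jL : jet (fun e => nn0 N i * (t0 + e * a) + nn1 N i * (t1 + e * b)) _ _ :=
  jetD (jetZ (nn0 N i) (jetL t0 a)) (jetZ (nn1 N i) (jetL t1 b)).
have := jetZ (- (ndet N)^-1) (jetM jR (jetM (jetX2 jnu) jL)).
rewrite !mul0r addr0 mulr0 => J; apply: jet_ext J _ => e.
apply: (mulfI N0); rewrite cross_nc !(cross_xt nf) /v3 /=; field; exact: N0.
Qed.

(** The conic S = 0 and the lines over the roots of [qq] are contracted by f, so Df is singular
    there. At a fixed point where Df is singular, the row [adjx] vanishes together with the form,
    which [fam2_zero] forbids. *)
Lemma fixed_noncritical t0 t1 z : nonzero t0 t1 ->
  (forall i, cross (ptN t0 t1 z) (ev f (ptN t0 t1 z)) i = 0) ->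
  (exists i, ev f (ptN t0 t1 z) i != 0) -> SS N t0 t1 z != 0 /\ qq N t0 t1 != 0.
Proof.
move=> nz cx [j fj].
have [la [m [nlm E]]] := cross0_dependent cx.
have la0 : la != 0.
  apply: contraTneq nlm => l0; rewrite /nonzero l0 eqxx /=.
  by have := E j; rewrite l0 mul0r => /esym/eqP; rewrite mulf_eq0 (negPf fj) orbF => ->.
have m0 : m != 0.
  apply: contraTneq nz => m0.
  have x0 i : ptN t0 t1 z i = 0 by apply: (mulfI la0); rewrite E m0 mul0r mulr0.
  have z0 : z = 0 by exact: (x0 i2).
  have := x0 i0; have := x0 i1; rewrite /ptN /pt /v3 /= z0 !mulr0 !addr0 => -> ->.
  by rewrite /nonzero eqxx.
pose r i l := (tnth f i)^`M(l).@[ptN t0 t1 z].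
(* A normal form serving as a container for the three rows of Df, so that [recover] supplies
   Cramer's rule for them. *)
pose R := NForm (nal N) (nbe N) (r i0) (r i1) (r i2) 0 0 0 0 0 0 0 0 0 0 0 (0 : K).
have nocrit a b ze : (exists i, ptN a b ze i != 0) -> b * SS N t0 t1 z + t1 * SS1 N t0 t1 a b z ze = 0 ->
    a * SS N t0 t1 z + t0 * SS1 N t0 t1 a b z ze = 0 -> CC1 N t0 t1 a b z ze = 0 -> False.
  move=> [k wk] h1 h0 h2.
  have F0 i : fvec N t0 t1 (SS N t0 t1 z) a b (SS1 N t0 t1 a b z ze) (CC1 N t0 t1 a b z ze) i = 0.
    by rewrite /fvec h0 h1 h2 !mulr0 subrr addr0 mul0r.
  have rw i : dot (r i) (ptN a b ze) = 0.
    have j1 := jet_meval (tnth f i) (fun l => jet_pt N l (jetL t0 a) (jetL t1 b) (jetL z ze)).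
    have j2 := jet_f nf i (jetL t0 a) (jetL t1 b) (jetL z ze).
    have [_] := jet_unique j1 j2; rewrite F0 sum3; exact.
  have det0 : ndet R = 0.
    by apply: (mulIf wk); rewrite recover /= !rw !mulr0 !addr0 mul0r.
  have rp i : dot (r i) (ptN t0 t1 z) = 3%:R * ev f (ptN t0 t1 z) i.
    by have := euler_homog (ptN t0 t1 z) (hf i); rewrite sum3.
  have adj0 l : (adjx f l).@[ptN t0 t1 z] = 0.
    have := recover R (ptN t0 t1 z) l; rewrite det0 mul0r /= !rp => H.
    have three : 3%:R * la != 0 :> K by rewrite mulf_neq0 // pnatr_eq0.
    apply: (mulfI three); rewrite mulr0 -[RHS](mulr0 m) [in RHS]H.
    have -> : (adjx f l).@[ptN t0 t1 z] = ptN t0 t1 z i0 * cross (r i1) (r i2) l +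
        ptN t0 t1 z i1 * cross (r i2) (r i0) l + ptN t0 t1 z i2 * cross (r i0) (r i1) l.
      exact: meval_adjx.
    transitivity (3%:R * ((la * ptN t0 t1 z i0) * cross (r i1) (r i2) l +
      (la * ptN t0 t1 z i1) * cross (r i2) (r i0) l + (la * ptN t0 t1 z i2) * cross (r i0) (r i1) l)).
      by ring.
    by rewrite !E; ring.
  have om0 i : (om f i).@[ptN t0 t1 z] = 0 by rewrite meval_om.
  by have := fam2_zero hf p2 hD conf2 om0 adj0 => /pt_parallel; rewrite nz.
split; apply/negP => /eqP Z0.
  (* [u] and [v] are the gradients of S and C in the coordinates (t0, t1, z). When S = 0, a vector
     killed by both is a kernel vector of Df. *)
  pose u : 'I_3 -> K := v3 (z * g0 N + 2%:R * q0 N * t0 + q1 N * t1)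
    (z * g1 N + q1 N * t0 + 2%:R * q2 N * t1) (sg N t0 t1).
  pose v : 'I_3 -> K := v3 (z * (2%:R * c0 N * t0 + c1 N * t1) + 3%:R * d0 N * t0 ^+ 2 +
      2%:R * d1 N * t0 * t1 + d2 N * t1 ^+ 2)
    (z * (c1 N * t0 + 2%:R * c2 N * t1) + d1 N * t0 ^+ 2 + 2%:R * d2 N * t0 * t1 + 3%:R * d3 N * t1 ^+ 2)
    (cc N t0 t1).
  have [w [[k wk] uw vw]] := kernel2 u v.
  have S1 : SS1 N t0 t1 (w i0) (w i1) z (w i2) = 0.
    by rewrite -[RHS]uw /SS1 /sq1 /dot /u /v3 /= /sg; ring.
  apply: (@nocrit (w i0) (w i1) (w i2)); rewrite ?Z0 ?S1 ?mulr0 ?addr0 //.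
    apply: boolp.contrapT => H; have {}H i : ptN (w i0) (w i1) (w i2) i = 0.
      by apply/eqP/negPn/negP => hi; apply: H; exists i.
    have w2 : w i2 = 0 by exact: (H i2).
    have := H i0; have := H i1; rewrite /ptN /pt /v3 /= w2 !mulr0 !addr0 => w1 w0.
    by case/negP: wk; apply/eqP; move: k; apply: ord3P.
  by rewrite -[RHS]vw /CC1 /cc1 /dd1 /dot /v /v3 /= /cc; ring.
(* The two equations say that the derivative of f along (ka t0, ka t1, ze) vanishes; their
   determinant is 3 qq. *)
have [ka [ze [k0 h1 h2]]] : exists ka ze, [/\ ka != 0,
    ze * sg N t0 t1 + ka * (2%:R * z * sg N t0 t1 + 3%:R * sq N t0 t1) = 0 &
    ze * cc N t0 t1 + ka * (2%:R * z * cc N t0 t1 + 3%:R * dd N t0 t1) = 0].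
  have := sg_cc hf nf hD conf1 nz; rewrite /nonzero => /orP[s0|c0].
    exists (sg N t0 t1), (- (2%:R * z * sg N t0 t1 + 3%:R * sq N t0 t1)); split=> //; first by ring.
    by transitivity (3%:R * qq N t0 t1); [rewrite /qq; ring|rewrite Z0 mulr0].
  exists (cc N t0 t1), (- (2%:R * z * cc N t0 t1 + 3%:R * dd N t0 t1)); split=> //; last by ring.
  by transitivity (- 3%:R * qq N t0 t1); [rewrite /qq; ring|rewrite Z0 mulr0].
have S1 : ka * SS N t0 t1 z + SS1 N t0 t1 (ka * t0) (ka * t1) z ze = 0.
  by rewrite -[RHS]h1 /SS /SS1 /sq1 /sg /sq; ring.
apply: (@nocrit (ka * t0) (ka * t1) ze).
- apply: boolp.contrapT => H; have {}H i : ptN (ka * t0) (ka * t1) ze i = 0.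
    by apply/eqP/negPn/negP => hi; apply: H; exists i.
  have ze0 : ze = 0 by exact: (H i2).
  have := H i0; have := H i1; rewrite /ptN /pt /v3 /= ze0 !mulr0 !addr0 => /eqP w1 /eqP w0.
  by move: nz w0 w1; rewrite /nonzero !mulf_eq0 (negPf k0) /= => /orP[/negPf->|/negPf->].
- by rewrite -[RHS](mulr0 t1) -S1; ring.
- by rewrite -[RHS](mulr0 t0) -S1; ring.
- by rewrite -[RHS]h2 /CC1 /cc1 /dd1 /cc /dd; ring.
Qed.

End FixedPoints.

(** * The inverse map *)

Section Coprimality.
Variable K : numClosedFieldType.

Lemma rootless_const (p : {poly K}) : (forall x, p.[x] != 0) -> forall x y, p.[x] = p.[y].
Proof.
move=> h; have [/closed_rootP[x /rootP px]|] := boolP (size p != 1%N).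
  by have := h x; rewrite px eqxx.
by rewrite negbK => /size_poly1P[c c0 ->] x y; rewrite !hornerC.
Qed.

(* A common factor has no zero on the plane spanned by q and r outside the origin, hence it is
   constant there, and then on every line through the origin. *)
Lemma plane_no_common_factor m (G : triple K) (q r : 'I_3 -> K) :
  (forall i, tnth G i \is m.-homog) ->
  (forall a b, nonzero a b -> exists i, ev G (fun j => a * q j + b * r j) i != 0) ->
  no_common_factor G.
Proof.
move=> hG pl d dG.
have dn0 x i : ev G x i != 0 -> d.@[x] != 0.
  by have [e E] := dG i; rewrite /ev E mevalM mulf_eq0 negb_or => /andP[].
pose D a b := d.@[fun j => a * q j + b * r j].
have D0 a b : nonzero a b -> D a b != 0.
  by move=> nz; have [i Gi] := pl a b nz; apply: dn0 Gi.
have Da a : a != 0 -> forall b b', D a b = D a b'.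
  move=> a0 b b'.
  pose p := along (fun j => (a * q j)%:P + r j *: 'X) d.
  have pE e : p.[e] = D a e.
    by rewrite horner_along; apply: meval_eq => j; rewrite !hornerE [r j * e]mulrC.
  by rewrite -!pE; apply: rootless_const => e; rewrite pE D0 // /nonzero a0.
have Db b : b != 0 -> forall a a', D a b = D a' b.
  move=> b0 a a'.
  pose p := along (fun j => (b * r j)%:P + q j *: 'X) d.
  have pE e : p.[e] = D e b.
    by rewrite horner_along; apply: meval_eq => j; rewrite !hornerE addrC [q j * e]mulrC.
  by rewrite -!pE; apply: rootless_const => e; rewrite pE D0 // /nonzero b0 orbT.
have Dc b : b != 0 -> D 0 b = D 1 0 by move=> b0; rewrite (Db b b0 0 1); apply: Da; rewrite oner_eq0.
have d00 : d.@[fun=> 0] != 0.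
  pose p := along (fun j => r j *: 'X) d - (D 1 0)%:P.
  have pE e : p.[e] = D 0 e - D 1 0.
    rewrite hornerD hornerN hornerC horner_along; congr (_ - _); apply: meval_eq => j.
    by rewrite hornerZ hornerX mul0r add0r mulrC.
  have : p * 'X = 0.
    apply: poly0_of_values => e; rewrite hornerM hornerX pE.
    by have [->|e0] := eqVneq e 0; rewrite ?mulr0 // Dc // subrr mul0r.
  move/eqP; rewrite mulf_eq0 polyX_eq0 orbF => /eqP p0.
  have := pE 0; rewrite p0 horner0 => /esym/subr0_eq H.
  have := D0 1 0; rewrite /nonzero oner_eq0 -H => /(_ isT).
  by have -> // : D 0 0 = d.@[fun=> 0] by apply: meval_eq => j; rewrite !mul0r addr0.
have [i [x Gx]] : exists i x, ev G x i != 0.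
  by have := pl 1 0; rewrite /nonzero oner_eq0 => /(_ isT)[i Gi]; exists i; eexists; exact: Gi.
have Gi0 : tnth G i != 0 by apply: contraNneq Gx => E; rewrite /ev E meval0.
suff E : d = (d.@[fun=> 0])%:MP.
  by rewrite E; apply/unitrP; exists (d.@[fun=> 0])^-1%:MP; rewrite -!mpolyCM mulVf ?mulfV.
apply: (mulIf Gi0); apply: mpoly_eq_of_values => y; rewrite !mevalM mevalC.
have [->|Gy] := eqVneq (tnth G i).@[y] 0; first by rewrite !mulr0.
congr (_ * _); pose p := along (fun j => y j *: 'X) d.
have pE e : p.[e] = d.@[fun j => e * y j].
  by rewrite horner_along; apply: meval_eq => j; rewrite hornerZ hornerX mulrC.
have -> : d.@[y] = p.[1] by rewrite pE; apply: meval_eq => j; rewrite mul1r.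
have -> : d.@[fun=> 0] = p.[0] by rewrite pE; apply: meval_eq => j; rewrite mul0r.
apply: rootless_const => e; rewrite pE; have [->|e0] := eqVneq e 0.
  by have -> : d.@[fun j => 0 * y j] = d.@[fun=> 0] by apply: meval_eq => j; rewrite mul0r.
by apply: (dn0 _ i); rewrite /ev (meval_scale _ _ (hG i)) mulf_neq0 ?expf_neq0.
Qed.

(** Forms known by their values: the components of the inverse are built and checked as
    functions. *)
Definition homfun d (phi : ('I_3 -> K) -> K) :=
  exists2 P : {mpoly K[3]}, P \is d.-homog & forall x, P.@[x] = phi x.

Lemma homfunD d phi psi : homfun d phi -> homfun d psi -> homfun d (fun x => phi x + psi x).
Proof. by move=> [P hP PE] [Q hQ QE]; exists (P + Q) => [|x]; rewrite ?rpredD // mevalD PE QE. Qed.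

Lemma homfunM d e phi psi : homfun d phi -> homfun e psi -> homfun (d + e) (fun x => phi x * psi x).
Proof. by move=> [P hP PE] [Q hQ QE]; exists (P * Q) => [|x]; rewrite ?dhomogM // mevalM PE QE. Qed.

Lemma homfunZ d c phi : homfun d phi -> homfun d (fun x => c * phi x).
Proof. by move=> [P hP PE]; exists (c *: P) => [|x]; rewrite ?dhomogZ // mevalZ PE. Qed.

Lemma homfunN d phi : homfun d phi -> homfun d (fun x => - phi x).
Proof. by move=> [P hP PE]; exists (- P) => [|x]; rewrite ?rpredN // mevalN PE. Qed.

Lemma homfunB d phi psi : homfun d phi -> homfun d psi -> homfun d (fun x => phi x - psi x).
Proof. by move=> h h'; apply: homfunD => //; exact: homfunN. Qed.

Lemma homfunX d k phi : homfun d phi -> homfun (d * k) (fun x => phi x ^+ k).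
Proof.
by move=> [P hP PE]; exists (P ^+ k) => [|x]; rewrite ?dhomogMn // rmorphXn /= PE.
Qed.

Lemma homfun_coord i : homfun 1 (fun x => x i).
Proof. by exists 'X_i => [|x]; [rewrite dhomogX /= mdeg1|rewrite mevalXU]. Qed.

Lemma wedge_scale (a b c d : K) : nonzero a b -> nonzero c d -> a * d = b * c ->
  exists2 la, la != 0 & a = la * c /\ b = la * d.
Proof.
move=> nab ncd E; have := ncd; rewrite /nonzero => /orP[c0|d0].
  have eb : b = a / c * d by apply: (mulIf c0); transitivity (a * d); [rewrite E|field].
  exists (a / c); last by split=> //; field.
  by apply: contraTneq nab => l0; rewrite eb -[a](divfK c0) l0 !mul0r /nonzero eqxx.
have ea : a = b / d * c by apply: (mulIf d0); transitivity (b * c); [rewrite E|field].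
exists (b / d); last by split=> //; field.
by apply: contraTneq nab => l0; rewrite ea -[b](divfK d0) l0 !mul0r /nonzero eqxx.
Qed.

Lemma homfun_dot n : homfun 1 (dot n).
Proof. by do 2?[apply: homfunD]; apply: homfunZ; exact: homfun_coord. Qed.

Section Forms.
Variables (N : nform K) (T0 T1 : ('I_3 -> K) -> K).
Hypotheses (h0 : homfun 1 T0) (h1 : homfun 1 T1).

Lemma homfun_sg : homfun 1 (fun x => sg N (T0 x) (T1 x)).
Proof. by apply: homfunD; apply: homfunZ. Qed.

Lemma homfun_sq : homfun 2 (fun x => sq N (T0 x) (T1 x)).
Proof.
by do 2?[apply: homfunD]; apply: homfunZ;
  [exact: (homfunX 2 h0)|exact: (homfunM h0 h1)|exact: (homfunX 2 h1)].
Qed.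

Lemma homfun_cc : homfun 2 (fun x => cc N (T0 x) (T1 x)).
Proof.
by do 2?[apply: homfunD]; apply: homfunZ;
  [exact: (homfunX 2 h0)|exact: (homfunM h0 h1)|exact: (homfunX 2 h1)].
Qed.

Lemma homfun_dd : homfun 3 (fun x => dd N (T0 x) (T1 x)).
Proof.
by do 3?[apply: homfunD]; apply: homfunZ; [exact: (homfunX 3 h0)|
  exact: (homfunM (homfunX 2 h0) h1)|exact: (homfunM h0 (homfunX 2 h1))|exact: (homfunX 3 h1)].
Qed.

Lemma homfun_qq : homfun 4 (fun x => qq N (T0 x) (T1 x)).
Proof.
by apply: homfunB; [exact: (homfunM homfun_sg homfun_dd)|exact: (homfunM homfun_cc homfun_sq)].
Qed.

End Forms.
End Coprimality.

Section Inverse.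
Variable K : numClosedFieldType.
Variables (f : triple K) (N : nform K).
Hypotheses (hf : cubic f) (nf : normal N f).
Let p : 'I_3 -> K := v3 (nal N) (nbe N) 1.
Hypothesis hD : forall i l, (tnth f i)^`M(l).@[p] = 0.
Hypothesis conf1 : confining 6 (fam1 f).
Hypothesis conf2 : confining 6 (fam2 f).
Hypothesis hline : noline f.

Let N0 : ndet N != 0. Proof. by case: nf. Qed.
Let ptN := pt (nal N) (nbe N).

Let T0 y := - dot (nn1 N) y.
Let T1 y := dot (nn0 N) y.
Let Y2 y := dot (nn2 N) y.
(** In target coordinates y is (T1, - T0, Y2), and f (pt T0 T1 z) is proportional to it when CC = Y2
    SS. This is the equation z U = Z, whence the inverse (U T0, U T1, Z) in the coordinates of
    [pt]. *)
Let U y := cc N (T0 y) (T1 y) - Y2 y * sg N (T0 y) (T1 y).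
Let Z y := Y2 y * sq N (T0 y) (T1 y) - dd N (T0 y) (T1 y).

Lemma R5_fixed_point a b : nonzero a b -> R5 N a b = 0 ->
  [/\ nonzero (nu N a b * a) (nu N a b * b), SS N (nu N a b * a) (nu N a b * b) (- mu N a b) != 0,
      qq N (nu N a b * a) (nu N a b * b) != 0 &
      exists2 c, c != 0 & forall i, ev f (xt N a b) i = c * xt N a b i].
Proof.
move=> nab R0.
have nu0 := R5_nu hf nf hD conf1 hline nab R0.
have [j fj] := R5_not_base hf nf hD conf1 hline nab R0.
have cx := R5_fixed nf R0; set t0 := nu N a b * a; set t1 := nu N a b * b.
have nzt : nonzero t0 t1 by move: nab; rewrite /nonzero /t0 /t1 !mulf_eq0 (negPf nu0).
have [S0 Q0] := fixed_noncritical hf nf hD conf1 conf2 nzt cx (ex_intro _ j fj).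
have [la [m [nlm E]]] := cross0_dependent cx.
have m0 : m != 0.
  apply: contraTneq nlm => m0; rewrite /nonzero m0 eqxx orbF negbK; apply/eqP.
  have [i xi] : exists i, xt N a b i != 0.
    apply: boolp.contrapT => H; have x0 i : xt N a b i = 0.
      by apply/eqP/negPn/negP => hi; apply: H; exists i.
    case/negP: fj; have -> : ev f (xt N a b) j = ev f (fun i => 0 * xt N a b i) j.
      by apply: meval_eq => i; rewrite mul0r x0.
    by rewrite /ev (meval_scale _ _ (hf j)) expr0n mul0r.
  by apply: (mulIf xi); rewrite mul0r E m0 mul0r.
have la0 : la != 0.
  apply: contraNneq fj => l0; have := E j; rewrite l0 mul0r => /esym/eqP.
  by rewrite mulf_eq0 (negPf m0).
split=> //; exists (la / m); first by rewrite mulf_neq0 ?invr_neq0.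
by move=> i; apply: (mulfI m0); rewrite -E; field.
Qed.

(** Supplies a point showing that the factors of f after g and of g after f, which involve S, U and
    [qq], are not identically zero. *)
Lemma exists_fixed : exists t0 t1 z c, [/\ nonzero t0 t1, SS N t0 t1 z != 0, qq N t0 t1 != 0, c != 0 &
  forall i, ev f (ptN t0 t1 z) i = c * ptN t0 t1 z i].
Proof.
have [r [nz _ rR]] := R5_roots hf nf hD conf1 hline.
have R0 : R5 N (r ord0).1 (r ord0).2 = 0 by apply/rR => //; exists ord0; exact: mulrC.
by have [n S0 Q0 [c c0 cE]] := R5_fixed_point (nz ord0) R0; do 4 eexists; split; eassumption.
Qed.

Lemma inverse_formula : exists g : triple K, exists h h' : {mpoly K[3]}, [/\
  forall i, tnth g i \is 3.-homog,
  forall y, ev g y =1 ptN (U y * T0 y) (U y * T1 y) (Z y),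
  forall y, h.@[y] = - U y ^+ 2 * qq N (T0 y) (T1 y) /\ (forall i, ev f (ev g y) i = h.@[y] * y i) &
  forall t0 t1 z, h'.@[ptN t0 t1 z] = - SS N t0 t1 z ^+ 2 * qq N t0 t1 /\
    (forall i, ev g (ev f (ptN t0 t1 z)) i = h'.@[ptN t0 t1 z] * ptN t0 t1 z i)].
Proof.
have hT0 : homfun 1 T0 by apply: homfunN; exact: homfun_dot.
have hT1 : homfun 1 T1 by exact: homfun_dot.
have hY : homfun 1 Y2 by exact: homfun_dot.
have hU : homfun 2 U.
  by apply: homfunB; [exact: homfun_cc|exact: (homfunM hY (homfun_sg N hT0 hT1))].
have hZ : homfun 3 Z.
  by apply: homfunB; [exact: (homfunM hY (homfun_sq N hT0 hT1))|exact: homfun_dd].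
have /fin_all_exists2[G hG GE] i : homfun 3 (fun y => ptN (U y * T0 y) (U y * T1 y) (Z y) i).
  by move: i; apply: ord3P; rewrite /ptN /pt /v3 //=; apply: homfunD (homfunZ _ hZ);
    apply: (@homfunM _ 2 1).
have [h _ hE] := homfunM (homfunN (homfunX 2 hU)) (homfun_qq N hT0 hT1).
pose t0 (x : 'I_3 -> K) := x i0 - nal N * x i2; pose t1 (x : 'I_3 -> K) := x i1 - nbe N * x i2.
have ht0 : homfun 1 t0 by apply: homfunB (homfunZ _ _); exact: homfun_coord.
have ht1 : homfun 1 t1 by apply: homfunB (homfunZ _ _); exact: homfun_coord.
have hS : homfun 2 (fun x => SS N (t0 x) (t1 x) (x i2)).
  by apply: homfunD (homfun_sq N ht0 ht1); apply: (@homfunM _ 1 1); [exact: homfun_coord|exact: homfun_sg].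
have [h' _ h'E] := homfunM (homfunN (homfunX 2 hS)) (homfun_qq N ht0 ht1).
have gE y : ev [tuple G i | i < 3] y =1 ptN (U y * T0 y) (U y * T1 y) (Z y).
  by move=> i; rewrite /ev tnth_mktuple GE.
exists [tuple G i | i < 3], h, h'; split.
- by move=> i; rewrite tnth_mktuple.
- exact: gE.
- move=> y; split=> [|i]; first exact: hE.
  have -> : ev f (ev [tuple G i | i < 3] y) i =
      ev f (ptN (U y * T0 y) (U y * T1 y) (Z y)) i by apply: meval_eq.
  have hom k : dot (fun i => h.@[y] * k i) y = h.@[y] * dot k y by rewrite /dot; ring.
  have homr k : dot k (fun i => h.@[y] * y i) = h.@[y] * dot k y by rewrite /dot; ring.
  move: i; apply: (recover_eq N0); rewrite homr hE; have [_ /(_ (U y * T0 y) (U y * T1 y) (Z y))] := nf;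
    case=> e0 e1 e2; rewrite /ptN ?e0 ?e1 ?e2.
  + rewrite -/(T1 y) /qq /sg /sq; rewrite /Z /U /sg /sq; ring.
  + have -> : dot (nn1 N) y = - T0 y by rewrite /T0 opprK.
    by rewrite /qq /Z /U /sg /sq; ring.
  + by rewrite -/(Y2 y) /qq /Z /U /sg /sq /cc /dd; ring.
move=> a b z; have tE : t0 (ptN a b z) = a /\ t1 (ptN a b z) = b.
  by rewrite /t0 /t1 /ptN /pt /v3 /=; split; ring.
have E : h'.@[ptN a b z] = - SS N a b z ^+ 2 * qq N a b by rewrite h'E; case: tE => -> ->.
split=> // i; rewrite gE E.
have n := nc_f nf a b z.
have Y0E : T1 (ev f (ptN a b z)) = b * SS N a b z by rewrite -[RHS](n i0).
have Y1E : T0 (ev f (ptN a b z)) = a * SS N a b z.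
  by have e : dot (nn1 N) (ev f (ptN a b z)) = - a * SS N a b z := n i1; rewrite /T0 e mulNr opprK.
have Y2E : Y2 (ev f (ptN a b z)) = CC N a b z by rewrite -[RHS](n i2).
have UE : U (ev f (ptN a b z)) = - SS N a b z * qq N a b.
  by rewrite /U Y0E Y1E Y2E /qq /CC /SS /sg /sq /cc /dd; ring.
have ZE : Z (ev f (ptN a b z)) = - SS N a b z ^+ 2 * z * qq N a b.
  rewrite /Z Y0E Y1E Y2E.
  transitivity (SS N a b z ^+ 2 * (CC N a b z * sq N a b - SS N a b z * dd N a b)).
    by rewrite /sq /dd; ring.
  by rewrite /CC /SS /qq; ring.
rewrite UE ZE Y0E Y1E.
by move: i; apply: ord3P; rewrite /ptN /pt /v3 /=; ring.
Qed.

Lemma inverse_exists : exists g, inverse_map f g /\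
  forall t0 t1 z, SS N t0 t1 z != 0 -> qq N t0 t1 != 0 ->
    nonzero t0 t1 -> exists i, ev g (ev f (ptN t0 t1 z)) i != 0.
Proof.
have [g [h [h' [hg gE hE h'E]]]] := inverse_formula.
exists g; split; last first.
  move=> t0 t1 z S0 Q0 nz; have [E1 E2] := h'E t0 t1 z.
  have [j wj] : exists j, ptN t0 t1 z j != 0.
    apply: boolp.contrapT => H; have x0 i : ptN t0 t1 z i = 0.
      by apply/eqP/negPn/negP => hi; apply: H; exists i.
    have z0 : z = 0 by exact: (x0 i2).
    have := x0 i0; have := x0 i1; rewrite /ptN /pt /v3 /= z0 !mulr0 !addr0 => E3 E4.
    by move: nz; rewrite /nonzero E3 E4 eqxx.
  by exists j; rewrite E2 E1 mulf_neq0 // mulf_neq0 // oppr_eq0 expf_neq0.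
have [t0 [t1 [z [c [nz S0 Q0 c0 fE]]]]] := exists_fixed.
split.
- exists 3%N; split=> //.
  have [r [nzr _ rq]] := qq_roots hf nf hD conf1.
  (* Coprimality of g is tested on the plane Y2 = e T0 + e^2 T1. A common zero there lies over a
     root of [qq], and U is nonzero at the four roots for this e. *)
  have [e he] : exists e, forall i, ((r i).1 * e + (r i).2 * e ^+ 2) * sg N (r i).1 (r i).2 != cc N (r i).1 (r i).2.
    pose P i := sg N (r i).1 (r i).2 *: ((r i).1 *: 'X + (r i).2 *: 'X^2) - (cc N (r i).1 (r i).2)%:P.
    have [e] : exists e, (\prod_i P i).[e] != 0.
      apply: exists_nonroot; apply/prodf_neq0 => i _; apply/eqP => Pi0.
      have := congr1 (fun u : {poly K} => u`_0) Pi0; have := congr1 (fun u : {poly K} => u`_1) Pi0.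
      have := congr1 (fun u : {poly K} => u`_2) Pi0; have := sg_cc hf nf hD conf1 (nzr i).
      rewrite !coefB !coefZ !coefD !coefZ !coefX !coefXn !coefC /= !mulr0 !mulr1 !subr0 ?addr0 ?add0r ?mulr0 sub0r.
      move=> H /eqP u2 /eqP u1 /eqP; rewrite oppr_eq0 => /eqP u0.
      move: H u1 u2; rewrite /nonzero u0 eqxx orbF !mulf_eq0 => /negPf -> /=.
      by move: (nzr i); rewrite /nonzero => /orP[] /negPf ->.
    rewrite horner_prod => /prodf_neq0 H; exists e => i; have := H i isT.
    rewrite -[_ == cc _ _ _]subr_eq0; congr (_ != 0); rewrite /P !hornerE; ring.
  have [q [qa qb qc]] := ncoord_surj 0 (-1) e N0.
  have [s [sa sb sc]] := ncoord_surj 1 0 (e ^+ 2) N0.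
  apply: (@plane_no_common_factor _ 3 g q s hg) => a b nab.
  apply: boolp.contrapT => H; pose y j := a * q j + b * s j.
  have {}H i : ev g y i = 0 by apply/eqP/negPn/negP => hi; apply: H; exists i.
  have dl k : dot k y = a * dot k q + b * dot k s by rewrite /dot /y; ring.
  have yT0 : T0 y = a by rewrite /T0 dl qb sb; ring.
  have yT1 : T1 y = b by rewrite /T1 dl qa sa; ring.
  have yY : Y2 y = a * e + b * e ^+ 2 by rewrite /Y2 dl qc sc.
  have Z0 : Z y = 0 by rewrite -[LHS](gE y i2) H.
  have U0 : U y = 0.
    have := gE y i0; have := gE y i1; rewrite !H /ptN /pt /v3 /= Z0 !mulr0 !addr0 yT0 yT1.
    move=> /esym/eqP; rewrite mulf_eq0 => /orP[/eqP //|b0] /esym/eqP; rewrite mulf_eq0 => /orP[/eqP //|a0].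
    by move: nab; rewrite /nonzero a0 b0.
  have Q : qq N a b = 0.
    transitivity (- (Z y * sg N a b + U y * sq N a b)); last by rewrite Z0 U0 !mul0r addr0 oppr0.
    by rewrite /Z /U yT0 yT1 /qq; ring.
  have [i ri] := proj1 (rq a b nab) Q.
  have [la la0 [la1 la2]] := wedge_scale nab (nzr i) ri.
  case/negP: (he i); rewrite eq_sym -subr_eq0; apply/eqP; apply: (mulfI (expf_neq0 2 la0)).
  rewrite mulr0 -[RHS]U0 /U yT0 yT1 yY la1 la2 /cc /sg; ring.
- exists h.
    have X1 := hE (ev f (ptN t0 t1 z)).
    have [E1 E2] := h'E t0 t1 z.
    apply/eqP => h0; have [_ H] := X1; have h'0 : h'.@[ptN t0 t1 z] != 0.
      by rewrite E1 mulf_neq0 // oppr_eq0 expf_neq0.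
    have [j fj] : exists j, ev f (ptN t0 t1 z) j != 0.
      apply: boolp.contrapT => F; have F0 i : ev f (ptN t0 t1 z) i = 0.
        by apply/eqP/negPn/negP => hi; apply: F; exists i.
      have [/eqP + /eqP + _] := proj1 (f_zero nf t0 t1 z) F0.
      by rewrite !mulf_eq0 (negPf S0) !orbF => b0 a0; move: nz; rewrite /nonzero a0 b0.
    have := H j; rewrite h0 meval0 mul0r.
    have -> : ev f (ev g (ev f (ptN t0 t1 z))) j = ev f (fun i => h'.@[ptN t0 t1 z] * ptN t0 t1 z i) j.
      exact: meval_eq.
    rewrite /ev (meval_scale _ _ (hf j)) => /eqP; rewrite mulf_eq0 expf_eq0 (negPf h'0) andbF /=.
    by rewrite -/(ev f _ j) (negPf fj).
  move=> i; apply: mpoly_eq_of_values => y; rewrite tnth_mktuple comp_mpoly_meval mevalM mevalXU.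
  by have [_ <-] := hE y.
exists h'.
  apply/eqP => h0; have [/eqP] := h'E t0 t1 z.
  by rewrite h0 meval0 eq_sym mulf_eq0 oppr_eq0 expf_eq0 (negPf S0) (negPf Q0).
move=> i; apply: mpoly_eq_of_values => x; rewrite tnth_mktuple comp_mpoly_meval mevalM mevalXU.
have E : x =1 ptN (x i0 - nal N * x i2) (x i1 - nbe N * x i2) (x i2) by exact: pt_coord.
have [_ H] := h'E (x i0 - nal N * x i2) (x i1 - nbe N * x i2) (x i2).
rewrite (meval_eq h' E) [x i]E -H; apply: meval_eq => j; exact: meval_eq.
Qed.

End Inverse.

(** * Local multiplicities *)

Lemma clear_denominators (F : fieldType) (h h' g g' a b : F) : h != 0 -> h' != 0 ->
  h * h' * (g / h * a + g' / h' * b) = g * h' * a + g' * h * b.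
Proof. by move=> h0 h'0; field; rewrite ?h0 ?h'0. Qed.

Lemma dot_delta (R : comNzRingType) (n : 'I_3 -> R) c j : dot (fun i => c * (i == j)%:R) n = c * n j.
Proof. by move: j; apply: ord3P; rewrite /dot /=; ring. Qed.

Section LocalMultiplicity.
Variable K : numClosedFieldType.
Local Notation "p %:F" := (tofrac p).
Local Notation F := {fraction {mpoly K[2]}}.
Let j0 : 'I_2 := ord0.
Let j1 : 'I_2 := ord_max.

Lemma ord2P (P : 'I_2 -> Prop) : P j0 -> P j1 -> forall i, P i.
Proof.
by move=> h0 h1 [[|[|//]] hi]; [move: h0|move: h1]; congr P; apply: val_inj.
Qed.

Lemma sum2 (V : nmodType) (G : 'I_2 -> V) : \sum_i G i = G j0 + G j1.
Proof.
rewrite big_ord_recl big_ord1; congr (_ + G _); exact: val_inj.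
Qed.

Section Point.
Variable x : 'I_2 -> K.
Let u : {mpoly K[2]} := 'X_j0 - (x j0)%:MP.
Let v : {mpoly K[2]} := 'X_j1 - (x j1)%:MP.
Let O := local_ring x.

Lemma hadamard (P : {mpoly K[2]}) : exists A B, P = (P.@[x])%:MP + u * A + v * B.
Proof.
elim/mpoly_gen_ind: P => [c|i|P Q [A [B EP]] [C [D EQ]]|P Q [A [B EP]] [C [D EQ]]].
- by exists 0, 0; rewrite mevalC !mulr0 !addr0.
- rewrite mevalXU; move: i; apply: ord2P; [exists 1, 0|exists 0, 1];
  rewrite mulr1 mulr0 ?addr0 /u /v; ring.
- exists (A + C), (B + D); rewrite mevalD mpolyCD {1}EP {1}EQ; ring.
exists (A * Q + P.@[x]%:MP * C), (B * Q + P.@[x]%:MP * D).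
rewrite mevalM mpolyCM; move: (P.@[x]) (Q.@[x]) EP EQ => p q EP EQ.
transitivity (p%:MP * Q + u * (A * Q) + v * (B * Q)); first by rewrite EP; ring.
by rewrite {1}EQ; ring.
Qed.

Lemma hadamard_deriv (P A B : {mpoly K[2]}) : P = (P.@[x])%:MP + u * A + v * B ->
  P^`M(j0).@[x] = A.@[x] /\ P^`M(j1).@[x] = B.@[x].
Proof.
move=> E; have uv : u.@[x] = 0 /\ v.@[x] = 0 by rewrite !mevalB !mevalXU !mevalC !subrr.
have d j : P^`M(j).@[x] = (j0 == j)%:R * A.@[x] + (j1 == j)%:R * B.@[x].
  rewrite E !mderivD !mderivM mderivC !mderivB !mderivXU !mderivC !mevalD !mevalM !mevalB meval0.
  move: uv; rewrite !mevalB => -[-> ->].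
  by rewrite !mul0r !addr0 !subr0 add0r; case: eqP; case: eqP;
    rewrite ?meval1 ?meval0.
by rewrite !d /= !mul1r !mul0r addr0 add0r.
Qed.

Lemma local_poly P : O P%:F.
Proof. by exists P, 1; rewrite meval1 oner_eq0 tofrac1 divr1. Qed.

Lemma frac_neq0 (h : {mpoly K[2]}) : h.@[x] != 0 -> h%:F != 0.
Proof. by rewrite tofrac_eq0; apply: contraNneq => ->; rewrite meval0. Qed.

Lemma localM r s : O r -> O s -> O (r * s).
Proof.
move=> [g [h [h0 ->]]] [g' [h' [h'0 ->]]]; exists (g * g'), (h * h').
by rewrite mevalM mulf_neq0 // !tofracM mulf_div.
Qed.

Lemma localD r s : O r -> O s -> O (r + s).
Proof.
move=> [g [h [h0 ->]]] [g' [h' [h'0 ->]]]; exists (g * h' + g' * h), (h * h').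
by rewrite mevalM mulf_neq0 // tofracD !tofracM addf_div ?frac_neq0.
Qed.

Lemma local_inv h : h.@[x] != 0 -> O (h%:F)^-1.
Proof. by exists 1, h; rewrite tofrac1 div1r. Qed.

Lemma local_hadamard r : O r -> exists c A B, [/\ O A, O B & r = (c%:MP)%:F + u%:F * A + v%:F * B].
Proof.
move=> [g [h [h0 ->]]]; pose c := g.@[x] / h.@[x].
have [A [B E]] := hadamard (g - c%:MP * h).
exists c, (A%:F / h%:F), (B%:F / h%:F); split; try exact: localM (local_poly _) (local_inv h0).
have {}E : g%:F = (c%:MP)%:F * h%:F + u%:F * A%:F + v%:F * B%:F.
  rewrite -!tofracM -!tofracD; congr (_%:F).
  have e0 : (g - c%:MP * h).@[x] = 0 by rewrite mevalB mevalM mevalC divfK // subrr.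
  by move: E; rewrite e0 mpolyC0 add0r => /eqP; rewrite subr_eq => /eqP ->; ring.
by rewrite E !mulrDl mulfK ?frac_neq0 // !mulrA.
Qed.

Section Ideal.
Variables a b : {mpoly K[2]}.
Let I := local_ideal x a b.

Lemma ideal_comb s t : O s -> O t -> I (s * a%:F + t * b%:F).
Proof. by exists s, t. Qed.

Lemma idealD r s : I r -> I s -> I (r + s).
Proof.
move=> [s1 [t1 [h1 h2 ->]]] [s2 [t2 [h3 h4 ->]]]; exists (s1 + s2), (t1 + t2).
by split; [exact: localD|exact: localD|ring].
Qed.

Lemma idealM r s : O r -> I s -> I (r * s).
Proof.
move=> hr [s1 [t1 [h1 h2 ->]]]; exists (r * s1), (r * t1).
by split; [exact: localM|exact: localM|ring].
Qed.

Lemma idealN r : I r -> I (- r).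
Proof.
move=> h; rewrite -mulN1r; apply: idealM => //; rewrite -tofrac1 -tofracN; exact: local_poly.
Qed.

Lemma ideal_poly L : I L%:F -> exists H G G', H.@[x] != 0 /\ H * L = G * a + G' * b.
Proof.
move=> [s [t [[g [h [h0 ->]]] [g' [h' [h'0 ->]]] E]]].
exists (h * h'), (g * h'), (g' * h); split; first by rewrite mevalM mulf_neq0.
apply/eqP; rewrite -tofrac_eq !tofracD !tofracM E; apply/eqP.
exact: clear_denominators (frac_neq0 h0) (frac_neq0 h'0).
Qed.

Lemma local_dim_unique n : local_dim x a b 1 -> (1 < n)%N -> ~ local_dim x a b n.
Proof.
move=> [e [_ gen _]] n1 [e' [he' _ free]].
pose k0 := Ordinal (ltnW n1); pose k1 := Ordinal n1.
have [c0 E0] := gen _ (he' k0); have [c1 E1] := gen _ (he' k1).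
have I01 : I ((c1 ord0)%:MP%:F * e' k0 - (c0 ord0)%:MP%:F * e' k1).
  have := idealD (idealM (local_poly (c1 ord0)%:MP) E0) (idealN (idealM (local_poly (c0 ord0)%:MP) E1)).
  by rewrite /lin_comb !big_ord1; congr I; ring.
have lc (s t : K) : lin_comb (fun i => if i == k0 then s else if i == k1 then t else 0) e' =
    s%:MP%:F * e' k0 + t%:MP%:F * e' k1.
  rewrite /lin_comb (bigD1 k0) //= (bigD1 k1) //= big1 => [|i /andP[/negPf i0 /negPf i1]].
    by rewrite addr0.
  by rewrite i0 i1 mpolyC0 tofrac0 mul0r.
have z : c0 ord0 = 0.
  have := free (fun i => if i == k0 then c1 ord0 else if i == k1 then - c0 ord0 else 0).
  rewrite lc mpolyCN tofracN mulNr => /(_ I01 k1) /= /eqP; rewrite oppr_eq0.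
  by move/eqP.
have := free (fun i => if i == k0 then 1 else if i == k1 then 0 else 0); rewrite lc.
rewrite mpolyC0 tofrac0 mul0r addr0 tofrac1 mul1r.
move: E0; rewrite /lin_comb big_ord1 z mpolyC0 tofrac0 mul0r subr0 => E0 /(_ E0 k0) /=.
by move/eqP; rewrite oner_eq0.
Qed.

Lemma ideal_unit H r : H.@[x] != 0 -> I (H%:F * r) -> I r.
Proof.
move=> H0 h; have := idealM (local_inv H0) h; by rewrite mulKf // frac_neq0.
Qed.

Lemma ideal_left c : O c -> I (c * a%:F).
Proof.
move=> hc; have := @ideal_comb c 0 hc; rewrite mul0r addr0; apply.
by rewrite -tofrac0; exact: local_poly.
Qed.

Lemma ideal_right c : O c -> I (c * b%:F).
Proof.
move=> hc; have := @ideal_comb 0 c; rewrite mul0r add0r; apply => //.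
by rewrite -tofrac0; exact: local_poly.
Qed.

(** By Cramer's rule the Jacobian determinant, a unit at x, times u or v lies in the ideal; so the
    ideal contains u and v. *)
Lemma local_dim1 : a.@[x] = 0 -> b.@[x] = 0 ->
  (forall w : 'I_2 -> K, \sum_j a^`M(j).@[x] * w j = 0 ->
     \sum_j b^`M(j).@[x] * w j = 0 -> forall j, w j = 0) ->
  local_dim x a b 1.
Proof.
move=> ax bx nd.
have [a0 [a1 Ea]] := hadamard a; have [b0 [b1 Eb]] := hadamard b.
have [a0E a1E] := hadamard_deriv Ea; have [b0E b1E] := hadamard_deriv Eb.
rewrite ax mpolyC0 add0r in Ea; rewrite bx mpolyC0 add0r in Eb.
pose D := a0 * b1 - a1 * b0.
have D0 : D.@[x] != 0.
  apply/eqP; rewrite /D mevalB !mevalM => DE.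
  have det w0 w1 : a0.@[x] * w0 + a1.@[x] * w1 = 0 -> b0.@[x] * w0 + b1.@[x] * w1 = 0 ->
      w0 = 0 /\ w1 = 0.
    move=> Ha Hb; have := nd (fun j => if j == j0 then w0 else w1).
    by rewrite !sum2 /= a0E a1E b0E b1E => /(_ Ha Hb) W; split; [exact: (W j0)|exact: (W j1)].
  have [||a10 /eqP] := det a1.@[x] (- a0.@[x]); first by ring.
    by rewrite -[RHS]oppr0 -DE; ring.
  rewrite oppr_eq0 => /eqP a00; have [||b10 /eqP] := det b1.@[x] (- b0.@[x]).
  - by rewrite -[RHS]DE; ring.
  - by ring.
  rewrite oppr_eq0 => /eqP b00; have [||/eqP] := det 1 0.
  - by rewrite a00 mulr0 mul0r addr0.
  - by rewrite b00 mulr0 mul0r addr0.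
  by rewrite oner_eq0.
have Iu : I u%:F.
  apply: (ideal_unit D0); rewrite -tofracM.
  have -> : D * u = b1 * a + (- a1) * b by rewrite /D {1}Ea {1}Eb; ring.
  by rewrite tofracD !tofracM; apply: ideal_comb; exact: local_poly.
have Iv : I v%:F.
  apply: (ideal_unit D0); rewrite -tofracM.
  have -> : D * v = (- b0) * a + a0 * b by rewrite /D {1}Ea {1}Eb; ring.
  by rewrite tofracD !tofracM; apply: ideal_comb; exact: local_poly.
exists (fun=> 1); split.
- by move=> _; rewrite -tofrac1; exact: local_poly.
- move=> r /local_hadamard[c [A [B [hA hB ->]]]]; exists (fun=> c).
  rewrite /lin_comb big_ord1 mulr1.
  have := idealD (idealM hA Iu) (idealM hB Iv); congr I; ring.
move=> c; rewrite /lin_comb big_ord1 mulr1 => /ideal_poly[H [G [G' [H0 E]]]] i.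
have := congr1 (meval x) E; rewrite mevalD !mevalM ax bx !mulr0 addr0 mevalC => /eqP.
by rewrite mulf_eq0 (negPf H0) (ord1 i) => /eqP.
Qed.

End Ideal.

Definition line (w : 'I_2 -> K) : 'I_2 -> {poly K} := fun j => (x j)%:P + w j *: 'X.

Definition quad (R : comNzRingType) (k : 'I_3 -> R) s t := k i0 * s ^+ 2 + k i1 * (s * t) + k i2 * t ^+ 2.

(** Vanishing to order two with leading form [q], expressed on the lines through x. *)
Definition tangent_cone (a : {mpoly K[2]}) (q : 'I_3 -> K) := forall w : 'I_2 -> K,
  exists2 p : {poly K}, p.[0] = quad q (w j0) (w j1) & along (line w) a = 'X ^+ 2 * p.

Lemma along_u w : along (line w) u = w j0 *: 'X.
Proof. by rewrite /u rmorphB /= alongX alongC /line addrC addKr. Qed.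

Lemma along_v w : along (line w) v = w j1 *: 'X.
Proof. by rewrite /v rmorphB /= alongX alongC /line addrC addKr. Qed.

Lemma along_line0 w (P : {mpoly K[2]}) : (along (line w) P).[0] = P.@[x].
Proof. by rewrite horner_along; apply: meval_eq => j; rewrite hornerD hornerC hornerZ hornerX mulr0 addr0. Qed.

Lemma quad_inj (k k' : 'I_3 -> K) : (forall s t, quad k s t = quad k' s t) -> k =1 k'.
Proof.
move=> H; have := H 1 0; have := H 0 1; have := H 1 1.
rewrite /quad !expr1n !expr0n /= !mulr1 !mulr0 !addr0 !add0r => e11 e01 e10.
apply: ord3P => //; move: e11; rewrite e10 e01 => /eqP; rewrite -!addrA (inj_eq (addrI _)).
by rewrite (inj_eq (addIr _)) => /eqP.
Qed.

(** Hadamard's expansion is applied twice; restriction to lines removes the terms of degree below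
    two and identifies the leading coefficients. *)
Lemma tangent_cone_decomp a q : tangent_cone a q ->
  exists2 A : 'I_3 -> {mpoly K[2]}, a = quad A u v & forall i, (A i).@[x] = q i.
Proof.
move=> H; have [A [B Ea]] := hadamard a.
have [A0 [A1 EA]] := hadamard A; have [B0 [B1 EB]] := hadamard B.
have [k E] : exists k, a = (a.@[x])%:MP + (A.@[x])%:MP * u + (B.@[x])%:MP * v + quad k u v.
  by exists (v3 A0 (A1 + B0) B1); rewrite {1}Ea {1}EA {1}EB /quad /v3 /=; ring.
have al w : along (line w) a = (a.@[x])%:P + (A.@[x] * w j0 + B.@[x] * w j1) *: 'X +
    'X ^+ 2 * (quad (fun i => along (line w) (k i)) (w j0)%:P (w j1)%:P).
  rewrite {1}E /quad !rmorphD /= !rmorphM /= ?rmorphXn /= ?rmorphM /= !alongC !along_u !along_v.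
  by rewrite -!mul_polyC !polyCD !polyCM; ring.
have ax : a.@[x] = 0.
  have [p _ E'] := H (fun=> 0); have := congr1 (horner^~ 0) E'.
  by rewrite along_line0 hornerM hornerXn expr0n mul0r.
have d w : A.@[x] * w j0 + B.@[x] * w j1 = 0 /\ quad (fun i => (k i).@[x]) (w j0) (w j1) = quad q (w j0) (w j1).
  have [p p0 E'] := H w; move: E'; rewrite al ax polyC0 add0r => E'.
  have X0 : 'X != 0 :> {poly K} by rewrite polyX_eq0.
  have {}E' : (A.@[x] * w j0 + B.@[x] * w j1)%:P =
      'X * (p - quad (fun i => along (line w) (k i)) (w j0)%:P (w j1)%:P).
    apply: (mulfI X0); apply/eqP; rewrite -subr_eq0; apply/eqP; rewrite -[RHS](subrr ('X ^+ 2 * p)).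
    by rewrite -{1}E' -mul_polyC; ring.
  have e0 : A.@[x] * w j0 + B.@[x] * w j1 = 0.
    by have := congr1 (horner^~ 0) E'; rewrite hornerC hornerM hornerX mul0r.
  split=> //; move: E'; rewrite e0 polyC0 => /esym/eqP; rewrite mulf_eq0 (negPf X0) /= subr_eq0.
  move=> /eqP pE; rewrite -p0 pE /quad !hornerE /= !along_line0.
  by rewrite ?expr2.
have A0x : A.@[x] = 0.
  by have [+ _] := d (fun j => (j == j0)%:R); rewrite /= mulr1 mulr0 addr0.
have B0x : B.@[x] = 0.
  by have [+ _] := d (fun j => (j == j1)%:R); rewrite /= mulr1 mulr0 add0r.
exists k; first by rewrite {1}E ax A0x B0x mpolyC0 !mul0r !add0r.
apply: quad_inj => s t; have [_ ] := d (fun j => if j == j0 then s else t); exact.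
Qed.

(* If the resultant vanishes then the cross product of the coefficient vectors is proportional to
   (s ^ 2, s t, t ^ 2) for a common root (s : t). *)
Lemma resultant_root (q r : 'I_3 -> K) : cross q r i1 ^+ 2 = cross q r i0 * cross q r i2 ->
  exists s t, [/\ nonzero s t, quad q s t = 0 & quad r s t = 0].
Proof.
move=> R0; set n := cross q r in R0.
have perp1 : q i0 * n i0 + q i1 * n i1 + q i2 * n i2 = 0 by rewrite /n /cross /v3 /=; ring.
have perp2 : r i0 * n i0 + r i1 * n i1 + r i2 * n i2 = 0 by rewrite /n /cross /v3 /=; ring.
have [n0|n0] := eqVneq (n i0) 0; last first.
  exists (n i0), (n i1); split; first by rewrite /nonzero n0.
    by rewrite -[RHS](mulr0 (n i0)) -perp1 /quad R0; ring.
  by rewrite -[RHS](mulr0 (n i0)) -perp2 /quad R0; ring.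
have n1 : n i1 = 0 by move: R0; rewrite n0 mul0r => /eqP; rewrite expf_eq0 => /eqP.
have [n2|n2] := eqVneq (n i2) 0; last first.
  exists 0, 1; split; first by rewrite /nonzero oner_eq0 orbT.
    apply: (mulIf n2); rewrite mul0r -[RHS]perp1 n0 n1 /quad; ring.
  apply: (mulIf n2); rewrite mul0r -[RHS]perp2 n0 n1 /quad; ring.
have root (k : 'I_3 -> K) : exists s t, nonzero s t /\ quad k s t = 0 by apply: bform_root; exact: bform_quadratic.
have [la [m [nlm E]]] : exists la m, nonzero la m /\ forall i, la * q i = m * r i.
  by apply: cross0_dependent; apply: ord3P.
have [m0|m0] := eqVneq m 0.
  have [s [t [st rr]]] := root r; exists s, t; split=> //.
  have la0 : la != 0 by move: nlm; rewrite /nonzero m0 eqxx orbF.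
  have q0 i : q i = 0 by apply: (mulfI la0); rewrite E m0 mul0r mulr0.
  by rewrite /quad !q0 !mul0r !addr0.
have [s [t [st rr]]] := root q; exists s, t; split=> //.
apply: (mulfI m0); rewrite mulr0 -[RHS](mulr0 la) -rr /quad !mulrDr !mulrA !E; ring.
Qed.

Section Node.
Variables a b : {mpoly K[2]}.
Let I := local_ideal x a b.
Variables q r : 'I_3 -> K.
Hypotheses (ha : tangent_cone a q) (hb : tangent_cone b r).
Hypothesis cop : forall s t, quad q s t = 0 -> quad r s t = 0 -> ~~ nonzero s t.

(** The products of a and b by u and v are combinations of the four cubic monomials through a
    Sylvester matrix. Its determinant is, up to sign, n_1^2 - n_0 n_2, a unit at x by coprimality of
    the cones; the combinations displayed come from its cofactors. *)
Let cubes : [/\ I (u%:F ^+ 3), I (u%:F ^+ 2 * v%:F), I (u%:F * v%:F ^+ 2) & I (v%:F ^+ 3)].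
Proof.
have [A Ea EA] := tangent_cone_decomp ha; have [B Eb EB] := tangent_cone_decomp hb.
pose n := cross A B.
have nx i : (n i).@[x] = cross q r i by move: i; apply: ord3P; rewrite /n /cross /v3 /= mevalB !mevalM !EA !EB.
have R0 : (n i1 ^+ 2 - n i0 * n i2).@[x] != 0.
  rewrite mevalB rmorphXn mevalM /= !nx subr_eq0; apply/eqP => /resultant_root[s [t [st e1 e2]]].
  by have := cop e1 e2; rewrite st.
have comb P G G' : P = G * a + G' * b -> I P%:F.
  by move=> ->; rewrite tofracD !tofracM; apply: ideal_comb; exact: local_poly.
have c21 : I (u%:F ^+ 2 * v%:F).
  apply: (ideal_unit R0); rewrite -tofracXn -!tofracM.
  apply: (comb _ (n i0 * u * B i0 - n i1 * v * B i2) (n i1 * v * A i2 - n i0 * u * A i0)).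
  by rewrite Ea Eb /n /quad /cross /v3 /=; ring.
have c12 : I (u%:F * v%:F ^+ 2).
  apply: (ideal_unit R0); rewrite -tofracXn -!tofracM.
  apply: (comb _ (n i1 * u * B i0 - n i2 * v * B i2) (n i2 * v * A i2 - n i1 * u * A i0)).
  by rewrite Ea Eb /n /quad /cross /v3 /=; ring.
split=> //.
  apply: (ideal_unit R0); rewrite -tofracXn -!tofracM.
  have -> : (n i1 ^+ 2 - n i0 * n i2) * u ^+ 3 =
    (- n i1 * u * B i2 - n i0 * u * B i1) * a + (n i1 * u * A i2 + n i0 * u * A i1) * b
    + n i1 * n i0 * (u ^+ 2 * v) - n i0 * n i0 * (u * v ^+ 2).
    by rewrite Ea Eb /n /quad /cross /v3 /=; ring.
  rewrite tofracB tofracD; apply: idealD (idealN _); first apply: idealD.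
  - exact: comb.
  - by rewrite tofracM [_ (u ^+ 2 * v)]tofracM tofracXn; apply: idealM => //; exact: local_poly.
  - by rewrite tofracM [_ (u * v ^+ 2)]tofracM tofracXn; apply: idealM => //; exact: local_poly.
apply: (ideal_unit R0); rewrite -tofracXn -!tofracM.
have -> : (n i1 ^+ 2 - n i0 * n i2) * v ^+ 3 =
  (n i1 * v * B i0 + n i2 * v * B i1) * a + (- n i1 * v * A i0 - n i2 * v * A i1) * b
  + n i1 * n i2 * (u * v ^+ 2) - n i2 * n i2 * (u ^+ 2 * v).
  by rewrite Ea Eb /n /quad /cross /v3 /=; ring.
rewrite tofracB tofracD; apply: idealD (idealN _); first apply: idealD.
- exact: comb.
- by rewrite tofracM [_ (u * v ^+ 2)]tofracM tofracXn; apply: idealM => //; exact: local_poly.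
- by rewrite tofracM [_ (u ^+ 2 * v)]tofracM tofracXn; apply: idealM => //; exact: local_poly.
Qed.

Local Notation cst c := ((c%:MP)%:F : F).

(** Replacing coefficients by their values at x changes a quadratic expression by cubic terms, which
    lie in the ideal. *)
Let ideal_quad (B : 'I_3 -> F) (k : 'I_3 -> K) : (forall i, exists A A', [/\ O A, O A' &
    B i = cst (k i) + u%:F * A + v%:F * A']) ->
  I (quad B u%:F v%:F - quad (fun i => cst (k i)) u%:F v%:F).
Proof.
move=> h; have [A0 [A0' [h0 h0' E0]]] := h i0; have [A1 [A1' [h1 h1' E1]]] := h i1.
have [A2 [A2' [h2 h2' E2]]] := h i2; have [I30 I21 I12 I03] := cubes.
have := idealD (idealD (idealM h0 I30) (idealM (localD h0' h1) I21))
  (idealD (idealM (localD h1' h2) I12) (idealM h2' I03)).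
by congr I; rewrite /quad E0 E1 E2; ring.
Qed.

Let mon : 'I_3 -> {mpoly K[2]} := v3 (u ^+ 2) (u * v) (v ^+ 2).

Let cstD c d : cst (c + d) = cst c + cst d. Proof. by rewrite mpolyCD tofracD. Qed.
Let cstM c d : cst (c * d) = cst c * cst d. Proof. by rewrite mpolyCM tofracM. Qed.

Let cst_mon j c : quad (fun i => cst (c * (i == j)%:R)) u%:F v%:F = cst c * (mon j)%:F.
Proof.
by move: j; apply: ord3P; rewrite /quad /mon /v3 /= ?mulr1 ?mulr0 mpolyC0 tofrac0 ?mul0r ?addr0 ?add0r
  ?tofracM ?tofracXn.
Qed.

Let along_mon w j : along (line w) (mon j) = 'X ^+ 2 * (quad (fun i => (i == j)%:R) (w j0) (w j1))%:P.
Proof.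
move: j; apply: ord3P; rewrite /quad /mon /v3 /= ?rmorphM ?rmorphXn /= ?along_u ?along_v;
  rewrite ?mul1r ?mul0r ?addr0 ?add0r -?mul_polyC ?polyCM ?rmorphXn /= ?polyCM; ring.
Qed.

Let quad_frac (A : 'I_3 -> {mpoly K[2]}) s t : (quad A s t)%:F = quad (fun i => (A i)%:F) s%:F t%:F.
Proof. by rewrite /quad !tofracD !tofracM; ring. Qed.

(** Modulo cubic terms, q and r leave one of the three quadratic monomials, so the dimension is 1 +
    2 + 1. The cross product of q and r is the linear form on quadratic forms vanishing on both; any
    monomial on which it is nonzero can be kept. *)
Lemma local_dim4 : local_dim x a b 4.
Proof.
have Iq (c : {mpoly K[2]}) (k : 'I_3 -> K) : tangent_cone c k -> I c%:F -> I (quad (fun i => cst (k i)) u%:F v%:F).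
  move=> /tangent_cone_decomp[A Ec EA] Ic.
  have I1 : I (quad (fun i => (A i)%:F) u%:F v%:F - quad (fun i => cst (k i)) u%:F v%:F).
    apply: ideal_quad => i; have [A0 [A1 E]] := hadamard (A i); exists A0%:F, A1%:F.
    split; [exact: local_poly|exact: local_poly|].
    by rewrite [in LHS]E 2!tofracD 2!tofracM EA.
  have := idealD Ic (idealN I1); congr I; rewrite {1}Ec quad_frac; ring.
have Ia : I a%:F by rewrite -[a%:F]mul1r -tofrac1; apply: ideal_left; exact: local_poly.
have Ib : I b%:F by rewrite -[b%:F]mul1r -tofrac1; apply: ideal_right; exact: local_poly.
have {Ia}Iqa := Iq _ _ ha Ia; have {Ib}Iqb := Iq _ _ hb Ib; have {Iq} := 0.
pose n := cross q r.
have [j nj] : exists j, n j != 0.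
  apply: boolp.contrapT => H; have n0 i : n i = 0.
    by apply/eqP/negPn/negP => hi; apply: H; exists i.
  have [|s [t [st e1 e2]]] := @resultant_root q r; first by rewrite -/n !n0 expr0n mul0r.
  by have := cop e1 e2; rewrite st.
pose e (i : 'I_4) : F := nth 0 [:: 1; u%:F; v%:F; (mon j)%:F] i.
pose o1 : 'I_4 := @Ordinal 4 1 isT; pose o2 : 'I_4 := @Ordinal 4 2 isT; pose o3 : 'I_4 := @Ordinal 4 3 isT.
have lc c : lin_comb c e = cst (c ord0) + cst (c o1) * u%:F + cst (c o2) * v%:F + cst (c o3) * (mon j)%:F.
  rewrite /lin_comb 4!big_ord_recl big_ord0.
  have -> : lift ord0 (ord0 : 'I_3) = o1 by exact: val_inj.
  have -> : lift ord0 (lift ord0 (ord0 : 'I_2)) = o2 by exact: val_inj.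
  have -> : lift ord0 (lift ord0 (lift ord0 (ord0 : 'I_1))) = o3 by exact: val_inj.
  by rewrite /e /= mulr1 addr0 !addrA.
exists e; split.
- move=> [[|[|[|[|//]]]] hi]; rewrite /e /= -?tofrac1; exact: local_poly.
- move=> z /local_hadamard[c [A [B [/local_hadamard[c1 [A1 [B1 [hA1 hB1 ->]]]]
    /local_hadamard[c2 [A2 [B2 [hA2 hB2 ->]]]] ->]]]].
  have [k0 [X0 [Y0 [hX0 hY0 E0]]]] := local_hadamard hA1.
  have [k1 [X1 [Y1 [hX1 hY1 E1]]]] := local_hadamard (localD hB1 hA2).
  have [k2 [X2 [Y2 [hX2 hY2 E2]]]] := local_hadamard hB2.
  pose k : 'I_3 -> K := v3 k0 k1 k2; pose BB : 'I_3 -> F := v3 A1 (B1 + A2) B2.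
  have Ik : I (quad BB u%:F v%:F - quad (fun i => cst (k i)) u%:F v%:F).
    by apply: ideal_quad; apply: ord3P; [exists X0, Y0|exists X1, Y1|exists X2, Y2].
  (* Subtracting g times the kept monomial makes the form perpendicular to the cross product, hence
     a combination of q and r. *)
  pose g := dot k n / n j.
  have [|al [be kE]] := @span_of_cross _ q r (fun i => k i - g * (i == j)%:R) j _ nj.
    rewrite -/n; transitivity (dot k n - g * n j); last by rewrite /g divfK // subrr.
    by rewrite -dot_delta /dot; ring.
  exists (fun i : 'I_4 => nth 0 [:: c; c1; c2; g] i); rewrite lc /=.
  have hc d : O (cst d) by exact: local_poly.
  have := idealD Ik (idealD (idealM (hc al) Iqa) (idealM (hc be) Iqb)); congr I.
  have {}kE i : cst (k i) = cst al * cst (q i) + cst be * cst (r i) + cst (g * (i == j)%:R).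
    by rewrite -!cstM -!cstD; congr (cst _); rewrite -kE subrK.
  have Q : quad (fun i => cst (k i)) u%:F v%:F = cst al * quad (fun i => cst (q i)) u%:F v%:F +
      cst be * quad (fun i => cst (r i)) u%:F v%:F + cst g * (mon j)%:F.
    by rewrite -cst_mon /quad !kE; ring.
  by rewrite Q /quad /BB /v3 /=; ring.
move=> c; rewrite lc => H.
have {H} : I (((c ord0)%:MP + (c o1)%:MP * u + (c o2)%:MP * v + (c o3)%:MP * mon j)%:F).
  by rewrite !tofracD !tofracM.
case/ideal_poly => H [G [G' [H0 E]]].
have X0 : 'X != 0 :> {poly K} by rewrite polyX_eq0.
pose l w := c o1 * w j0 + c o2 * w j1; pose m w := c o3 * quad (fun i => (i == j)%:R) (w j0) (w j1).
(* Restricted to the lines through x, the relation can be read order by order: orders zero and one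
   kill the first three coefficients, order two the last. *)
have EX w : exists2 p, p.[0] = G.@[x] * quad q (w j0) (w j1) + G'.@[x] * quad r (w j0) (w j1) &
    along (line w) H * ((c ord0)%:P + (l w)%:P * 'X + (m w)%:P * 'X ^+ 2) = 'X ^+ 2 * p.
  have [pa pa0 Ea] := ha w; have [pb pb0 Eb] := hb w.
  exists (along (line w) G * pa + along (line w) G' * pb).
    by rewrite hornerD !hornerM !along_line0 pa0 pb0.
  have Lw : along (line w) ((c ord0)%:MP + (c o1)%:MP * u + (c o2)%:MP * v + (c o3)%:MP * mon j) =
      (c ord0)%:P + (l w)%:P * 'X + (m w)%:P * 'X ^+ 2.
    rewrite 3!rmorphD /= 3!rmorphM /= !alongC along_u along_v along_mon /l /m -!mul_polyC.
    by move: (quad _ _ _) => Q; rewrite polyCD !polyCM; ring.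
  have := congr1 (along (line w)) E; rewrite rmorphM /= Lw => ->.
  by rewrite rmorphD /= !rmorphM /= Ea Eb; ring.
have ev1 (s t : K) : (s%:P + t%:P * 'X).[0] = s by rewrite hornerD hornerM hornerX !hornerC mulr0 addr0.
have ev2 (s t t' : K) : (s%:P + t%:P * 'X + t'%:P * 'X^2).[0] = s.
  by rewrite hornerD ev1 hornerM hornerXn expr0n mulr0 addr0.
have z0 : c ord0 = 0.
  have [p _ E'] := EX (fun=> 0); have := congr1 (horner^~ 0) E'.
  rewrite [in RHS]hornerM hornerXn expr0n mul0r hornerM along_line0.
  by rewrite ev2 => /eqP; rewrite mulf_eq0 (negPf H0) => /eqP.
have z12 w : l w = 0 /\ H.@[x] * m w = G.@[x] * quad q (w j0) (w j1) + G'.@[x] * quad r (w j0) (w j1).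
  have [p p0 E'] := EX w; rewrite z0 polyC0 add0r in E'.
  have {}E' : along (line w) H * ((l w)%:P + (m w)%:P * 'X) = 'X * p.
    by apply: (mulfI X0); transitivity ('X ^+ 2 * p); [rewrite -E'|]; ring.
  have l0 : l w = 0.
    have := congr1 (horner^~ 0) E'; rewrite [in RHS]hornerM hornerX mul0r hornerM along_line0.
    by rewrite ev1 => /eqP; rewrite mulf_eq0 (negPf H0) => /eqP.
  split=> //; rewrite -p0; suff <- : along (line w) H * (m w)%:P = p.
    by rewrite hornerM hornerC along_line0.
  by apply: (mulfI X0); rewrite -E' l0 polyC0 add0r; ring.
have z1 : c o1 = 0.
  by have [+ _] := z12 (fun j => (j == j0)%:R); rewrite /l /= mulr1 mulr0 addr0.
have z2 : c o2 = 0.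
  by have [+ _] := z12 (fun j => (j == j1)%:R); rewrite /l /= mulr1 mulr0 add0r.
have K3 i : H.@[x] * c o3 * (i == j)%:R = G.@[x] * q i + G'.@[x] * r i.
  apply: (@quad_inj (fun i => H.@[x] * c o3 * (i == j)%:R) (fun i => G.@[x] * q i + G'.@[x] * r i)) => s t.
  have [_] := z12 (fun j => if j == j0 then s else t); rewrite /m /quad /= => K3.
  by transitivity (H.@[x] * (c o3 * ((i0 == j)%:R * s ^+ 2 + (i1 == j)%:R * (s * t) + (i2 == j)%:R * t ^+ 2)));
    [ring|rewrite K3; ring].
have z3 : c o3 = 0.
  apply: (mulfI H0); apply: (mulIf nj); rewrite mulr0 mul0r.
  transitivity (dot (fun i => H.@[x] * c o3 * (i == j)%:R) n).
    by rewrite dot_delta.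
  by rewrite /dot !K3 /n /cross /v3 /=; ring.
move=> [[|[|[|[|//]]]] hi]; [rewrite -[RHS]z0|rewrite -[RHS]z1|rewrite -[RHS]z2|rewrite -[RHS]z3];
  by congr c; apply: val_inj.
Qed.

End Node.
End Point.
End LocalMultiplicity.

(** * Multiplicities in affine charts *)

Section Charts.
Variable K : numClosedFieldType.

(** The value c = 1 gives a point of the chart x_k = 1, the value c = 0 a tangent vector to it. *)
Definition chart (k : 'I_3) (c : K) (y : 'I_2 -> K) : 'I_3 -> K :=
  fun i => if unlift k i is Some j then y j else c.

Lemma meval_dehomog k (P : {mpoly K[3]}) y : (dehomog k P).@[y] = P.@[chart k 1 y].
Proof.
rewrite /dehomog comp_mpoly_meval; apply: meval_eq => i; rewrite tnth_mktuple /chart.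
by case: (unlift k i) => [j|]; rewrite ?mevalXU ?meval1.
Qed.

Lemma chart_affine (q : 'rV[K]_3) k i : q 0 k != 0 -> chart k 1 (affine_point k q) i = (q 0 k)^-1 * q 0 i.
Proof.
by move=> qk; rewrite /chart; case: unliftP => [j|] ->; rewrite ?mulVf // /affine_point mulrC.
Qed.

Lemma chart_jet k y w i : jet (fun e => chart k 1 (fun j => y j + e * w j) i) (chart k 1 y i) (chart k 0 w i).
Proof. by rewrite /chart; case: (unlift k i) => [j|]; [exact: jetL|exact: jetC]. Qed.

Lemma deriv_dehomog k (P : {mpoly K[3]}) y w :
  \sum_j (dehomog k P)^`M(j).@[y] * w j = \sum_i P^`M(i).@[chart k 1 y] * chart k 0 w i.
Proof.
have j1 := jet_meval P (chart_jet k y w).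
have j2 := jet_meval (dehomog k P) (fun j => jetL (y j) (w j)).
have [_ ->] // : _ /\ _ := jet_unique (jet_ext j2 (fun e => esym (meval_dehomog k P _))) j1.
Qed.

Lemma cross0_swap (a b : 'I_3 -> K) : (forall l, cross a b l = 0) -> forall i j, a i * b j = a j * b i.
Proof.
move=> H; have e0 := subr0_eq (H i0); have e1 := subr0_eq (H i1); have e2 := subr0_eq (H i2).
by apply: ord3P; apply: ord3P => //; symmetry.
Qed.

Section Multiplicities.
Variables (f : triple K) (N : nform K).
Hypotheses (hf : cubic f) (nf : normal N f).
Let p : 'I_3 -> K := v3 (nal N) (nbe N) 1.
Hypothesis hD : forall i l, (tnth f i)^`M(l).@[p] = 0.
Hypothesis conf1 : confining 6 (fam1 f).

Let p2 : p i2 = 1. Proof. by []. Qed.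
Let N0 : ndet N != 0. Proof. by case: nf. Qed.

(** A common kernel vector W of the two differentials in the chart kills the third one as well, so
    by [degenerate_zero] it is parallel to the point. Its coordinate k is zero while that of the
    point is 1, whence W = 0. *)
Lemma simple_multiplicity (q : 'rV[K]_3) k : q 0 k != 0 -> (forall i, (om f i).@[q 0] = 0) ->
  ~ (forall a, q 0 a = p a * q 0 i2) ->
  local_dim (affine_point k q) (dehomog k (tnth (foliation_form f) (lift k ord0)))
    (dehomog k (tnth (foliation_form f) (lift k ord_max))) 1.
Proof.
move=> qk q0 qp; rewrite -!omE; set x := affine_point k q.
have xE : chart k 1 x =1 (fun i => (q 0 k)^-1 * q 0 i) by move=> i; exact: chart_affine.
have om0 i : (om f i).@[chart k 1 x] = 0.
  by rewrite (meval_eq _ xE) (meval_scale _ _ (om_homog i hf)) q0 mulr0.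
have z i : (dehomog k (om f i)).@[x] = 0 by rewrite meval_dehomog om0.
apply: (local_dim1 (z _) (z _)) => w e0 e1.
have d0 := etrans (esym (deriv_dehomog k (om f (lift k ord0)) x w)) e0.
have d1 := etrans (esym (deriv_dehomog k (om f (lift k ord_max)) x w)) e1.
set W := chart k 0 w in d0 d1.
have Wk : W k = 0 by rewrite /W /chart unlift_none.
have xk : chart k 1 x k = 1 by rewrite /chart unlift_none.
(* Differentiating the identity x . om = 0 recovers the component left out in the chart. *)
have dk : \sum_j (om f k)^`M(j).@[chart k 1 x] * W j = 0.
  have J i := jetM (chart_jet k x w i) (jet_meval (om f i) (chart_jet k x w)).
  have Z (y : 'I_3 -> K) : y i0 * (om f i0).@[y] + y i1 * (om f i1).@[y] + y i2 * (om f i2).@[y] = 0.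
    by rewrite !meval_om /cross /v3 /=; ring.
  have [_] := jet_unique (jetD (jetD (J i0) (J i1)) (J i2)) (jet_ext (jetC 0) (fun e => Z _)).
  rewrite !om0 !mulr0 !addr0 -/W => S.
  have {S} : \sum_i chart k 1 x i * (\sum_j (om f i)^`M(j).@[chart k 1 x] * W j) = 0 by rewrite sum3.
  rewrite (bigD1 k) //= xk mul1r [X in _ + X]big1 ?addr0 // => i ik.
  have [j ->] : exists j, i = lift k j.
    by case: (unliftP k i) ik => [j|] ->; [exists j|rewrite eqxx].
  by move: j; apply: ord2P; rewrite ?d0 ?d1 mulr0.
have dW i : \sum_j (om f i)^`M(j).@[chart k 1 x] * W j = 0.
  by case: (unliftP k i) => [j|] -> //; move: j; apply: ord2P.
suff W0 i : W i = 0 by move=> j; rewrite -[RHS](W0 (lift k j)) /W /chart liftK.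
have cW l : cross (chart k 1 x) W l = 0.
  apply/eqP/negPn/negP => cl; apply: qp => a.
  have H := degenerate_zero hf p2 hD conf1 om0 dW cl; have := H a; rewrite !xE.
  by rewrite mulrCA => /(mulfI (invr_neq0 qk)).
by have := cross0_swap cW k i; rewrite xk mul1r Wk mulr0.
Qed.

(** The tangent cones are two components of the cross product of p with the quadratic leading term
    of f. As this vector is perpendicular to p and p_2 = 1, a common root of the cones kills the
    third component too, against [pencil_not_contracted]. *)
Lemma double_point_multiplicity : multiplicity f (\row_i p i) 4.
Proof.
exists i2; first by rewrite mxE oner_eq0.
set x := affine_point _ _; rewrite -!omE.
have xE (w : 'I_2 -> K) e : chart i2 1 (fun j => x j + e * w j) =1
    pt (nal N) (nbe N) (e * w ord0) (e * w ord_max) 1.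
  apply: ord3P; rewrite /chart /pt /v3 /= ?mulr1.
  - have -> : i0 = lift i2 ord0 by exact: val_inj.
    by rewrite liftK /x /affine_point !mxE /= divr1 addrC.
  - have -> : i1 = lift i2 ord_max by exact: val_inj.
    by rewrite liftK /x /affine_point !mxE /= divr1 addrC.
  - by rewrite unlift_none.
pose c12 := cross (nn1 N) (nn2 N); pose c20 := cross (nn2 N) (nn0 N); pose c01 := cross (nn0 N) (nn1 N).
pose A (k : 'I_3) i := v3 (c01 i * c0 N - c20 i * g0 N) (c12 i * g0 N - c20 i * g1 N + c01 i * c1 N)
  (c12 i * g1 N + c01 i * c2 N) k / ndet N.
pose B t0 t1 i := (c12 i * (t1 * sq N t0 t1) - c20 i * (t0 * sq N t0 t1) + c01 i * dd N t0 t1) / ndet N.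
pose AA t0 t1 i := quad (fun k => A k i) t0 t1.
have fE t0 t1 e i : ev f (pt (nal N) (nbe N) (e * t0) (e * t1) 1) i = e ^+ 2 * (AA t0 t1 i + e * B t0 t1 i).
  by rewrite (ev_f nf) /AA /A /B /quad /SS /CC /sg /sq /cc /dd /v3 /= -/c12 -/c20 -/c01; field.
have pA t0 t1 : (forall i, cross p (AA t0 t1) i = 0) -> ~~ nonzero t0 t1.
  move=> H; apply/negP => nz; apply: (pencil_not_contracted hf nf hD conf1 nz) => j.
  have := nc_cross N H j; suff E : nc N (AA t0 t1) =1 v3 (t1 * sg N t0 t1) (- t0 * sg N t0 t1) (cc N t0 t1).
    by rewrite (cross_ext (frefl _) E).
  apply: ord3P; apply: (mulfI N0); rewrite /nc /AA /A /quad /dot /v3 /c12 /c20 /c01 /=; move: N0;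
    rewrite /ndet /dot /cross /v3 /sg /cc /= => N0'; field; exact: N0'.
have cone i : tangent_cone x (dehomog i2 (om f i)) (fun k => cross p (A k) i).
  move=> w; pose a := AA (w ord0) (w ord_max); pose b := B (w ord0) (w ord_max).
  pose W : 'I_3 -> K := v3 (w ord0) (w ord_max) 0.
  exists ((cross p a i)%:P + (cross p b i + cross W a i)%:P * 'X + (cross W b i)%:P * 'X ^+ 2).
    rewrite hornerD hornerM hornerXn expr0n mulr0 addr0 hornerD hornerM hornerX mulr0 addr0 hornerC.
    rewrite /a /AA /quad.
    by move: i; apply: ord3P; rewrite /cross /v3 /=; ring.
  apply: poly_eq_of_values => e; rewrite horner_along meval_dehomog.
  have -> : (om f i).@[chart i2 1 (fun j => (line x w j).[e])] =
      (om f i).@[pt (nal N) (nbe N) (e * w ord0) (e * w ord_max) 1].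
    apply: meval_eq => l; rewrite -xE /chart; case: (unlift i2 l) => // j.
    by rewrite hornerD hornerC hornerZ hornerX [w j * e]mulrC.
  rewrite meval_om (cross_ext (frefl _) (fE _ _ e)) -/a -/b !hornerE.
  by move: i; apply: ord3P; rewrite /cross /pt /W /p /v3 /=; ring.
have -> : lift i2 ord0 = i0 by exact: val_inj.
have -> : lift i2 ord_max = i1 by exact: val_inj.
apply: local_dim4 (cone i0) (cone i1) _ => s t z0 z1; apply: pA.
have E i : quad (fun k => cross p (A k) i) s t = cross p (AA s t) i.
  by move: i; apply: ord3P; rewrite /AA /quad /cross /v3 /=; ring.
rewrite !E in z0 z1; apply: ord3P => //.
transitivity (dot p (cross p (AA s t))); last by rewrite /dot /cross /v3 /=; ring.
by rewrite /dot z0 z1 p2 !mulr0 !add0r mul1r.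
Qed.

End Multiplicities.
End Charts.

(** * The singularities of a generic map *)

Section Singularities.
Variable K : numClosedFieldType.

Lemma proj_eqE (u v : 'rV[K]_3) : proj_eq u v <-> exists2 c, c != 0 & forall i, v 0 i = c * u 0 i.
Proof.
split=> [[c c0 ->]|[c c0 E]]; exists c => //.
  by move=> i; rewrite mxE.
by apply/rowP => i; rewrite mxE.
Qed.

Lemma row_neq0 (q : 'rV[K]_3) : q != 0 <-> exists i, q 0 i != 0.
Proof.
split=> [q0|[i qi]]; last by apply: contraNneq qi => ->; rewrite mxE.
apply: boolp.contrapT => H; case/eqP: q0; apply/rowP => i; rewrite mxE.
by apply/eqP/negPn/negP => qi; apply: H; exists i.
Qed.

Lemma cross_proportional (a b : 'I_3 -> K) c : (forall i, b i = c * a i) -> forall l, cross a b l = 0.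
Proof. by move=> E; apply: ord3P; rewrite /cross /v3 /= !E; ring. Qed.

Lemma indeterminacyE (f : triple K) q : indeterminacy f q <-> q != 0 /\ forall i, ev f (q 0) i = 0.
Proof.
split=> -[q0 H]; split=> //.
  by move=> i; have /rowP/(_ i) := H; rewrite !mxE.
by apply/rowP => i; rewrite !mxE; exact: H.
Qed.

Lemma inverse_ev (f g : triple K) : inverse_map f g -> (exists m, forall i, tnth g i \is m.-homog) /\
  exists h h', [/\ h != 0, h' != 0, forall y i, ev f (ev g y) i = h.@[y] * y i &
    forall x i, ev g (ev f x) i = h'.@[x] * x i].
Proof.
case=> -[m [hg _]] [h h0 hE] [h' h'0 h'E]; split; first by exists m.
exists h, h'; split=> // x i.
  have := congr1 (meval x) (hE i); rewrite tnth_mktuple comp_mpoly_meval mevalM mevalXU; exact.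
have := congr1 (meval x) (h'E i); rewrite tnth_mktuple comp_mpoly_meval mevalM mevalXU; exact.
Qed.

Lemma ev_scale (f : triple K) d c x y : (forall i, tnth f i \is d.-homog) -> (forall i, y i = c * x i) ->
  forall i, ev f y i = c ^+ d * ev f x i.
Proof. by move=> hf E i; rewrite /ev (meval_eq _ E) (meval_scale _ _ (hf i)). Qed.

Lemma indeterminacy_scale (f : triple K) d c (x y : 'rV[K]_3) : (forall i, tnth f i \is d.-homog) ->
  c != 0 -> (forall i, y 0 i = c * x 0 i) -> indeterminacy f x -> indeterminacy f y.
Proof.
move=> hf c0 E /indeterminacyE[/row_neq0[j xj] H]; apply/indeterminacyE; split.
  by apply/row_neq0; exists j; rewrite E mulf_neq0.
by move=> i; rewrite (ev_scale hf E) H mulr0.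
Qed.

Variables (f : triple K) (N : nform K).
Hypotheses (hf : cubic f) (nf : normal N f).
Let p : 'I_3 -> K := v3 (nal N) (nbe N) 1.
Hypothesis hD : forall i l, (tnth f i)^`M(l).@[p] = 0.
Hypothesis conf1 : confining 6 (fam1 f).
Hypothesis conf2 : confining 6 (fam2 f).
Hypothesis hline : noline f.

Let ptN := pt (nal N) (nbe N).

Lemma f_double_point i : ev f p i = 0.
Proof.
have -> : ev f p i = ev f (ptN 0 0 1) i.
  by apply: meval_eq; apply: ord3P; rewrite /p /ptN /pt /v3 /= ?add0r ?mulr1.
move: i; apply: (proj2 (f_zero nf 0 0 1)).
by rewrite /CC /cc /dd; split; ring.
Qed.

Lemma pt_nonparallel t0 t1 z : nonzero t0 t1 -> ~ forall a, ptN t0 t1 z a = p a * ptN t0 t1 z i2.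
Proof. by move=> nz /pt_parallel; rewrite nz. Qed.

Lemma pt_off (t0 t1 z c : K) : nonzero t0 t1 -> ~ forall i, p i = c * ptN t0 t1 z i.
Proof.
move=> nz H; have c2 : 1 = c * z := H i2.
have c0 : c != 0 by apply: contraTneq (oner_neq0 K) => c0; rewrite c2 c0 mul0r eqxx.
apply: (@pt_nonparallel t0 t1 z nz) => a; apply: (mulfI c0).
by rewrite -[LHS]H mulrCA -[ptN t0 t1 z i2]/z -c2 mulr1.
Qed.

Lemma indeterminacyP q : indeterminacy f q <-> q != 0 /\ ((forall i, q 0 i = q 0 i2 * p i) \/
  exists t0 t1 z, [/\ nonzero t0 t1, SS N t0 t1 z = 0, CC N t0 t1 z = 0 & q 0 =1 ptN t0 t1 z]).
Proof.
split=> [/indeterminacyE[q0 H]|[q0 H]].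
  split=> //; have qE := @pt_coord _ (nal N) (nbe N) (q 0).
  set t0 := q 0 i0 - _ in qE; set t1 := q 0 i1 - _ in qE.
  have {}H i : ev f (ptN t0 t1 (q 0 i2)) i = 0 by rewrite -[RHS](H i); apply: esym (meval_eq _ _).
  have [e1 e0 C0] := proj1 (f_zero nf _ _ _) H.
  have [nz|] := boolP (nonzero t0 t1).
    right; exists t0, t1, (q 0 i2); split=> //.
    by move: nz; rewrite /nonzero => /orP[h|h]; apply: (mulfI h); rewrite mulr0.
  rewrite /nonzero negb_or !negbK => /andP[/eqP z0 /eqP z1]; left => i; rewrite {1}qE z0 z1.
  by move: i; apply: ord3P; rewrite /p /pt /v3 /= ?add0r ?mulr1 // mulrC.
apply/indeterminacyE; split=> // i; case: H => [H|[t0 [t1 [z [nz S0 C0 qE]]]]].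
  by rewrite (ev_scale hf H) f_double_point mulr0.
rewrite /ev (meval_eq _ qE); move: i; apply: (proj2 (f_zero nf _ _ _)).
by rewrite S0 C0 !mulr0.
Qed.

Lemma xt_coord t0 t1 z : z * nu N t0 t1 = - mu N t0 t1 ->
  forall i, xt N t0 t1 i = nu N t0 t1 * ptN t0 t1 z i.
Proof. by move=> E; apply: ord3P; rewrite /xt -E /ptN /pt /v3 /=; ring. Qed.

Lemma xt_scale la t0 t1 i : xt N (la * t0) (la * t1) i = la ^+ 2 * xt N t0 t1 i.
Proof. by move: i; apply: ord3P; rewrite /xt /pt /v3 /nu /mu /tev /=; ring. Qed.

Lemma fixed_pointP q : fixed_point f q <-> exists t0 t1 c, [/\ nonzero t0 t1, R5 N t0 t1 = 0, c != 0 &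
  forall i, q 0 i = c * xt N t0 t1 i].
Proof.
split=> [[q0 nI _ /proj_eqE[c c0 cE]]|[t0 [t1 [c [nz R0 c0 qE]]]]].
  have qE := @pt_coord _ (nal N) (nbe N) (q 0).
  set t0 := q 0 i0 - _ in qE; set t1 := q 0 i1 - _ in qE; set z := q 0 i2 in qE.
  have fE i : ev f (ptN t0 t1 z) i = c * q 0 i by rewrite -cE mxE; apply: esym (meval_eq _ _).
  have [j qj] := proj1 (row_neq0 q) q0.
  have nz : nonzero t0 t1.
    apply/negPn/negP; rewrite /nonzero negb_or !negbK => /andP[/eqP z0 /eqP z1]; apply: nI.
    apply/indeterminacyP; split=> //; left => i; rewrite {1}qE z0 z1.
    by move: i; apply: ord3P; rewrite /p /pt /v3 /= ?add0r ?mulr1 // mulrC.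
  have cx i : cross (ptN t0 t1 z) (ev f (ptN t0 t1 z)) i = 0.
    rewrite (cross_ext (fun a => esym (qE a)) fE); move: (i); apply: ord3P;
    by rewrite /cross /v3 /=; ring.
  have [|n0 nE R0] := fixed_on_conic hf nf hline nz cx.
    by exists j; rewrite fE mulf_neq0.
  exists t0, t1, (nu N t0 t1)^-1; split; rewrite ?invr_neq0 // => i.
  by rewrite (xt_coord nE) mulKf // qE.
have [nzt S0 Q0 [d d0 dE]] := R5_fixed_point hf nf hD conf1 conf2 hline nz R0.
have fq i : ev f (q 0) i = c ^+ 3 * (d * xt N t0 t1 i) by rewrite (ev_scale hf qE) dE.
have [j fj] := R5_not_base hf nf hD conf1 hline nz R0.
have xj : xt N t0 t1 j != 0 by apply: contraNneq fj => x0; rewrite dE x0 mulr0.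
have q0 : q != 0 by apply/row_neq0; exists j; rewrite qE mulf_neq0.
have [g [fg gne]] := inverse_exists hf nf hD conf1 conf2 hline.
split=> //.
- case/indeterminacyE => _ /(_ j)/eqP; rewrite fq; apply/negP.
  by rewrite !mulf_neq0 ?expf_neq0.
(* Being fixed, q is a multiple of the image of [xt], where g is nonzero because S and [qq] are. *)
- exists g => //; case/indeterminacyE => _ H.
  have [[m hg] _] := inverse_ev fg.
  have [i gi] := gne _ _ _ S0 Q0 nzt; case/negP: gi; apply/eqP.
  have E a : ev f (xt N t0 t1) a = (d / c) * q 0 a by rewrite dE qE; field.
  by rewrite (ev_scale hg E) H mulr0.
apply/proj_eqE; exists (c ^+ 2 * d); first by rewrite mulf_neq0 ?expf_neq0.
by move=> i; rewrite mxE -/(ev f (q 0) i) fq qE; ring.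
Qed.

Lemma om_zero_multiplicity (q : 'rV[K]_3) t0 t1 z : q != 0 -> nonzero t0 t1 -> q 0 =1 ptN t0 t1 z ->
  (forall i, cross (q 0) (ev f (q 0)) i = 0) -> forall k, q 0 k != 0 ->
  local_dim (affine_point k q) (dehomog k (tnth (foliation_form f) (lift k ord0)))
    (dehomog k (tnth (foliation_form f) (lift k ord_max))) 1.
Proof.
move=> q0 nz qE cx k qk; apply: (simple_multiplicity hf hD conf1 qk) => [i|H].
  by rewrite meval_om.
by apply: (@pt_nonparallel t0 t1 z nz) => a; rewrite -!qE.
Qed.

Lemma base_multiplicity (q : 'rV[K]_3) t0 t1 z : nonzero t0 t1 -> q 0 =1 ptN t0 t1 z ->
  indeterminacy f q -> forall k, q 0 k != 0 ->
  local_dim (affine_point k q) (dehomog k (tnth (foliation_form f) (lift k ord0)))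
    (dehomog k (tnth (foliation_form f) (lift k ord_max))) 1.
Proof.
move=> nz qE /indeterminacyE[q0 H]; apply: (om_zero_multiplicity q0 nz qE) => i.
rewrite (cross_ext (frefl _) H); move: i; apply: ord3P; by rewrite /cross /v3 /= !mulr0 subrr.
Qed.

Lemma fixed_multiplicity (q : 'rV[K]_3) : fixed_point f q -> forall k, q 0 k != 0 ->
  local_dim (affine_point k q) (dehomog k (tnth (foliation_form f) (lift k ord0)))
    (dehomog k (tnth (foliation_form f) (lift k ord_max))) 1.
Proof.
move=> fq; have [q0 _ _ /proj_eqE[c c0 cE]] := fq.
move/fixed_pointP: fq => [t0 [t1 [d [nz R0 d0 qE]]]].
have nu0 := R5_nu hf nf hD conf1 hline nz R0.
apply: (@om_zero_multiplicity q (d * (nu N t0 t1 * t0)) (d * (nu N t0 t1 * t1)) (d * (- mu N t0 t1))) => //.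
- by move: nz; rewrite /nonzero !mulf_eq0 (negPf d0) (negPf nu0).
- by move=> i; rewrite qE; move: i; apply: ord3P; rewrite /xt /ptN /pt /v3 /=; ring.
have fE i : ev f (q 0) i = c * q 0 i by rewrite -cE mxE.
exact: cross_proportional fE.
Qed.

(** Every singularity other than p is nondegenerate and has multiplicity 1, so the multiplicities
    single out p. *)
Lemma multiplicity4 q : fixed_point f q \/ indeterminacy f q -> multiplicity f q 4 ->
  forall i, q 0 i = q 0 i2 * p i.
Proof.
move=> H [k qk M4]; apply: boolp.contrapT => nq.
suff M1 : local_dim (affine_point k q) (dehomog k (tnth (foliation_form f) (lift k ord0)))
    (dehomog k (tnth (foliation_form f) (lift k ord_max))) 1.
  exact: (local_dim_unique M1 _ M4).
case: H => [fq|Iq]; first exact: fixed_multiplicity.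
have /indeterminacyP[q0 [//|[t0 [t1 [z [nz S0 C0 qE]]]]]] := Iq.
exact: (base_multiplicity nz qE Iq).
Qed.

Lemma double_point_indeterminate : indeterminacy f (\row_i p i).
Proof.
apply/indeterminacyP; split; first by apply/row_neq0; exists i2; rewrite mxE oner_eq0.
by left => i; rewrite !mxE mul1r.
Qed.

Lemma generic_singularities : has_generic_singularities f.
Proof.
split.
  have [r [nz rd rR]] := R5_roots hf nf hD conf1 hline.
  have R0 i : R5 N (r i).1 (r i).2 = 0 by apply/rR => //; exists i; exact: mulrC.
  have F i : fixed_point f (\row_k xt N (r i).1 (r i).2 k).
    apply/fixed_pointP; exists (r i).1, (r i).2, 1; split; rewrite ?oner_eq0 // => k.
    by rewrite mxE mul1r.
  exists (fun i => \row_k xt N (r i).1 (r i).2 k); last first.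
    move=> i; have [/row_neq0[k qk] _ _ _] := F i.
    by exists k => //; apply: fixed_multiplicity.
  split=> [i|i j /proj_eqE[c c0 E]|q q0].
  - by case: (F i).
  - apply: rd; set a := (r i).1 in E *; set b := (r i).2 in E *.
    set a' := (r j).1 in E *; set b' := (r j).2 in E *.
    have nu0 : nu N a b != 0 := R5_nu hf nf hD conf1 hline (nz i) (R0 i).
    have nu1 : nu N a' b' != 0 := R5_nu hf nf hD conf1 hline (nz j) (R0 j).
    have := @pt_wedge _ (nal N) (nbe N) (nu N a b * a) (nu N a b * b) (- mu N a b)
      (nu N a' b' * a') (nu N a' b' * b') (- mu N a' b').
    have {}E l : xt N a' b' l = c * xt N a b l by have := E l; rewrite !mxE.
    move=> W; have : nu N a b * a * (nu N a' b' * b') - nu N a b * b * (nu N a' b' * a') = 0.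
      apply: W => l; rewrite -[pt _ _ _ _ _]/(xt N a b) -[pt _ _ (_ * a') _ _]/(xt N a' b').
      exact: cross_proportional E l.
    move=> H; apply: subr0_eq; apply: (mulfI (mulf_neq0 nu0 nu1)); rewrite mulr0 -[RHS]H; ring.
  - rewrite fixed_pointP; split=> [[t0 [t1 [c [nt Rt c0 qE]]]]|[i /proj_eqE[c c0 qE]]].
      have [i ri] := proj1 (rR _ _ nt) Rt; exists i.
      have [la la0 [E0 E1]] := wedge_scale nt (nz i) ri.
      apply/proj_eqE; exists (c * la ^+ 2); first by rewrite mulf_neq0 ?expf_neq0.
      by move=> k; rewrite qE E0 E1 xt_scale mxE mulrA.
    by exists (r i).1, (r i).2, c; split=> // k; rewrite qE mxE.
have [r [nz rd rq]] := qq_roots hf nf hD conf1.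
have Q0 i : qq N (r i).1 (r i).2 = 0 by apply/rq => //; exists i; exact: mulrC.
have /fin_all_exists[z zE] := fun i => base_point hf nf hD conf1 (nz i) (Q0 i).
pose b i : 'rV[K]_3 := \row_k ptN (r i).1 (r i).2 (z i) k.
have bI i : indeterminacy f (b i).
  apply/indeterminacyP; split.
    apply/row_neq0; apply: boolp.contrapT => H; have {}H k : ptN (r i).1 (r i).2 (z i) k = 0.
      by apply/eqP/negPn/negP => hk; apply: H; exists k; rewrite mxE.
    by apply: (@pt_nonparallel _ _ (z i) (nz i)) => a; rewrite !H mulr0.
  right; exists (r i).1, (r i).2, (z i); have [S0 C0] := zE i.
  by split=> // k; rewrite mxE.
exists (fun i => if unlift ord0 i is Some j then b j else \row_k p k); last first.
  split=> [|i]; first by rewrite unlift_none; exact: double_point_multiplicity hf nf hD conf1.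
  case: unliftP => [j ->|->] _ //; have /indeterminacyE[/row_neq0[k qk] _] := bI j.
  exists k => //; apply: (@base_multiplicity (b j) (r j).1 (r j).2 (z j)) => // l.
  by rewrite mxE.
split.
- move=> i; case: (unlift ord0 i) => [j|]; first by case: (bI j).
  by case: double_point_indeterminate.
- move=> i j; case: (unliftP ord0 i) => [i' ->|->]; case: (unliftP ord0 j) => [j' ->|->] //=.
  + move=> /proj_eqE[c c0 E]; congr (lift _ _); apply: rd; apply: subr0_eq.
    apply: (@pt_wedge _ (nal N) (nbe N) _ _ (z i') _ _ (z j')) => l.
    have {}E a : ptN (r j').1 (r j').2 (z j') a = c * ptN (r i').1 (r i').2 (z i') a.
      by have := E a; rewrite !mxE.
    exact: cross_proportional E l.
  + move=> /proj_eqE[c c0 E]; exfalso.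
    by apply: (pt_off (nz i') (z := z i') (c := c)) => a; have := E a; rewrite !mxE.
  + move=> /proj_eqE[c c0 E]; exfalso.
    apply: (pt_off (nz j') (z := z j') (c := c^-1)) => a; have := E a; rewrite !mxE => ->.
    by rewrite mulKf.
move=> q q0; split=> [/indeterminacyP[_ [H|[t0 [t1 [z' [nt S0 C0 qE]]]]]]|].
- exists ord0; rewrite unlift_none; apply/proj_eqE; exists (q 0 i2) => [|i]; last by rewrite mxE.
  by apply: contraTneq q0 => q2; apply/negPn/eqP/rowP => i; rewrite H q2 mul0r mxE.
- have [i ri] := proj1 (rq _ _ nt) (base_qq S0 C0); exists (lift ord0 i); rewrite liftK.
  have [la la0 [E0 E1]] := wedge_scale nt (nz i) ri.
  (* S and C are homogeneous in (t0, t1, z), so rescaling the direction rescales z, which is unique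
     over each root. *)
  have zz : z' / la = z i.
    have [S1 C1] := zE i; apply: (base_point_unique hf nf hD conf1 (nz i)) => //.
      by apply: (mulfI (expf_neq0 2 la0)); rewrite mulr0 -[RHS]S0 E0 E1 /SS /sg /sq; field.
    by apply: (mulfI (expf_neq0 3 la0)); rewrite mulr0 -[RHS]C0 E0 E1 /CC /cc /dd; field.
  apply/proj_eqE; exists la => // k; rewrite qE mxE -zz E0 E1.
  by move: k; apply: ord3P; rewrite /ptN /pt /v3 /=; field.
case=> i; case: (unlift ord0 i) => [j|] /proj_eqE[c c0 E].
  exact: indeterminacy_scale hf c0 E (bI j).
exact: indeterminacy_scale hf c0 E double_point_indeterminate.
Qed.

End Singularities.

(** * Determination by the singularities *)

Section Determination.
Variable K : numClosedFieldType.

Definition det3 (a b c : 'I_3 -> K) := dot a (cross b c).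

(** In the basis of the first three eigenvectors all coordinates of [e3] are nonzero. Applying m to
    e3 and comparing coordinates equates each [la k] with mu. *)
Lemma four_eigenvectors (m e : 'I_3 -> 'I_3 -> K) (e3 : 'I_3 -> K) (la : 'I_3 -> K) mu :
  det3 (e i0) (e i1) (e i2) != 0 -> det3 e3 (e i1) (e i2) != 0 -> det3 (e i0) e3 (e i2) != 0 ->
  det3 (e i0) (e i1) e3 != 0 -> (forall k j, dot (m j) (e k) = la k * e k j) ->
  (forall j, dot (m j) e3 = mu * e3 j) -> forall v j, dot (m j) v = mu * v j.
Proof.
move=> D D0 D1 D2 hm h3.
have cramer (v : 'I_3 -> K) j : det3 (e i0) (e i1) (e i2) * v j = det3 v (e i1) (e i2) * e i0 j
    + det3 (e i0) v (e i2) * e i1 j + det3 (e i0) (e i1) v * e i2 j.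
  by move: j; apply: ord3P; rewrite /det3 /dot /cross /v3 /=; ring.
have dcramer (k v : 'I_3 -> K) : det3 (e i0) (e i1) (e i2) * dot k v = det3 v (e i1) (e i2) * dot k (e i0)
    + det3 (e i0) v (e i2) * dot k (e i1) + det3 (e i0) (e i1) v * dot k (e i2).
  by rewrite /det3 /dot /cross /v3 /=; ring.
pose w j := det3 e3 (e i1) (e i2) * (la i0 - mu) * e i0 j + det3 (e i0) e3 (e i2) * (la i1 - mu) * e i1 j
  + det3 (e i0) (e i1) e3 * (la i2 - mu) * e i2 j.
have w0 j : w j = 0.
  transitivity (det3 (e i0) (e i1) (e i2) * dot (m j) e3 - mu * (det3 (e i0) (e i1) (e i2) * e3 j)).
    by rewrite dcramer !hm cramer /w; ring.
  by rewrite h3; ring.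
have lin c0 c1 c2 (c := fun j => c0 * e i0 j + c1 * e i1 j + c2 * e i2 j) :
    [/\ det3 c (e i1) (e i2) = det3 (e i0) (e i1) (e i2) * c0,
        det3 (e i0) c (e i2) = det3 (e i0) (e i1) (e i2) * c1 &
        det3 (e i0) (e i1) c = det3 (e i0) (e i1) (e i2) * c2].
  by rewrite /det3 /c /dot /cross /v3 /=; split; ring.
have [l0 l1 l2] := lin (det3 e3 (e i1) (e i2) * (la i0 - mu)) (det3 (e i0) e3 (e i2) * (la i1 - mu))
  (det3 (e i0) (e i1) e3 * (la i2 - mu)).
have laE k : la k = mu.
  apply: subr0_eq; move: k; apply: ord3P.
  - apply: (mulfI (mulf_neq0 D D0)); rewrite mulr0; transitivity (det3 w (e i1) (e i2)).
      by rewrite -mulrA -l0.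
    by rewrite /det3 /dot !w0 !mul0r !addr0.
  - apply: (mulfI (mulf_neq0 D D1)); rewrite mulr0; transitivity (det3 (e i0) w (e i2)).
      by rewrite -mulrA -l1.
    by rewrite /det3 /dot /cross /v3 /= !w0 !(mul0r, mulr0, subr0, addr0, oppr0).
  - apply: (mulfI (mulf_neq0 D D2)); rewrite mulr0; transitivity (det3 (e i0) (e i1) w).
      by rewrite -mulrA -l2.
    by rewrite /det3 /dot /cross /v3 /= !w0 !(mul0r, mulr0, subr0, addr0, oppr0).
by move=> v j; apply: (mulfI D); rewrite dcramer !hm !laE [RHS]mulrCA cramer; ring.
Qed.

Section Conic.
Variables (f : triple K) (N : nform K).
Hypotheses (hf : cubic f) (nf : normal N f).
Let p : 'I_3 -> K := v3 (nal N) (nbe N) 1.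
Hypothesis hD : forall i l, (tnth f i)^`M(l).@[p] = 0.
Hypothesis conf1 : confining 6 (fam1 f).
Hypothesis conf2 : confining 6 (fam2 f).
Hypothesis hline : noline f.
Let ptN := pt (nal N) (nbe N).

(** A Vandermonde factorisation for points of a parametrised conic. The constant is the value of mu
    at the root of nu. *)
Lemma det3_xt (s t r : K * K) : det3 (xt N s.1 s.2) (xt N t.1 t.2) (xt N r.1 r.2) =
  - mu N (pk N (nn1 N)) (- pk N (nn0 N)) * (s.1 * t.2 - s.2 * t.1) * (t.1 * r.2 - t.2 * r.1)
  * (s.1 * r.2 - s.2 * r.1).
Proof.
rewrite /det3 /xt /nu /mu /tev; move: (pk N (nn0 N)) (pk N (nn1 N)) => p0 p1.
move: (nn0 N i0) (nn0 N i1) (nn1 N i0) (nn1 N i1) => m0 m1 m2 m3.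
by case: s t r => [s0 s1] [t0 t1] [r0 r1]; rewrite /dot /cross /pt /v3 /=; ring.
Qed.

(** By [nu_mu], applied at the root of nu, which is not identically zero since it is nonzero at the
    roots of [R5]. *)
Lemma conic_smooth : mu N (pk N (nn1 N)) (- pk N (nn0 N)) != 0.
Proof.
have [r [nz _ rR]] := R5_roots hf nf hD conf1 hline.
have R0 : R5 N (r ord0).1 (r ord0).2 = 0 by apply/rR => //; exists ord0; exact: mulrC.
have nu0 := R5_nu hf nf hD conf1 hline (nz ord0) R0.
apply: (nu_mu nf hline); last by rewrite /nu; ring.
apply: contraNT nu0; rewrite /nonzero negb_or !negbK oppr_eq0 => /andP[/eqP e1 /eqP e0].
by rewrite /nu e0 e1 !mulr0 addr0.
Qed.

(** Write P as z A + B. A suitable multiple of cc makes A vanish at the root of sg, so A is a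
    combination of sg, with linear coefficient, and cc. The same combination of sq and dd differs
    from B by a binary cubic that vanishes over the four simple base points, hence is zero. *)
Lemma base_linear_combination (P : {mpoly K[3]}) : P \is 3.-homog ->
  (forall l, P^`M(l).@[p] = 0) ->
  (forall t0 t1 z, nonzero t0 t1 -> SS N t0 t1 z = 0 -> CC N t0 t1 z = 0 -> P.@[ptN t0 t1 z] = 0) ->
  exists m : 'I_3 -> K, forall x, P.@[x] = dot m (ev f x).
Proof.
move=> hP dP bP; have [ab PE] := double_expand hP dP.
pose A (t0 t1 : K) := ab.1 0%N * t0 ^+ 2 + ab.1 1%N * (t0 * t1) + ab.1 2%N * t1 ^+ 2.
pose B (t0 t1 : K) := ab.2 0%N * t0 ^+ 3 + ab.2 1%N * (t0 ^+ 2 * t1) + ab.2 2%N * (t0 * t1 ^+ 2)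
  + ab.2 3%N * t1 ^+ 3.
have {}PE t0 t1 z : P.@[ptN t0 t1 z] = z * A t0 t1 + B t0 t1 by exact: PE.
(* If sg were identically zero it would vanish together with cc at a root of cc. *)
have g01 : nonzero (g1 N) (- g0 N).
  apply: contraT; rewrite /nonzero negb_or !negbK oppr_eq0 => /andP[/eqP e1 /eqP e0].
  have [a [b [nab cab]]] := bform_root (bform_cc N).
  have := sg_cc hf nf hD conf1 nab; rewrite /nonzero cab eqxx orbF /sg e0 e1 !mul0r addr0.
  by rewrite eqxx.
have s0 : sg N (g1 N) (- g0 N) = 0 by rewrite /sg; ring.
have c0 : cc N (g1 N) (- g0 N) != 0.
  by have := sg_cc hf nf hD conf1 g01; rewrite /nonzero s0 eqxx.
pose ga := A (g1 N) (- g0 N) / cc N (g1 N) (- g0 N).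
have hpsi : bform 2 (fun t0 t1 => A t0 t1 - ga * cc N t0 t1).
  by apply: bformB; [exact: bform_quadratic|apply: bformZ; exact: bform_cc].
have [|psi /bform1P[a [b psiE]] AE] := bform_div hpsi g01.
  by rewrite /ga divfK // subrr.
have {}AE t0 t1 : A t0 t1 = - (a * t0 + b * t1) * sg N t0 t1 + ga * cc N t0 t1.
  by have := AE t0 t1; rewrite psiE => /eqP; rewrite subr_eq => /eqP ->; rewrite /sg; ring.
pose D t0 t1 := B t0 t1 + (a * t0 + b * t1) * sq N t0 t1 - ga * dd N t0 t1.
have hDf : bform 3 D.
  apply: bformB; last by apply: bformZ; exact: bform_dd.
  by apply: bformD; [exact: bform_cubic|exact: bformM (bform_lin a b) (bform_sq N)].
have [r [nz rd rq]] := qq_roots hf nf hD conf1.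
have D0 t0 t1 : D t0 t1 = 0.
  apply: (@bform_many_zeros _ 3 D [seq r i | i <- enum 'I_4]) => //.
  - by rewrite size_map size_enum_ord.
  - by apply/allP => _ /mapP[i _ ->]; exact: nz.
  - rewrite pairwise_map; apply: sub_pairwise (_ : pairwise (fun i j => i != j) (enum 'I_4)) => [i j|].
      by apply: contraNN => /eqP/rd/eqP.
    by rewrite -uniq_pairwise enum_uniq.
  apply/allP => _ /mapP[i _ ->]; apply/eqP.
  have Q0 : qq N (r i).1 (r i).2 = 0 by apply/rq => //; exists i; exact: mulrC.
  have [z [S0 C0]] := base_point hf nf hD conf1 (nz i) Q0.
  have := bP _ _ _ (nz i) S0 C0; rewrite PE AE /D => E; rewrite -[RHS]E.
  move: S0 C0; rewrite /SS /CC => /eqP; rewrite addrC addr_eq0 => /eqP -> /eqP.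
  by rewrite addrC addr_eq0 => /eqP ->; ring.
exists (fun i => - b * nn0 N i + a * nn1 N i + ga * nn2 N i) => x.
have xE := @pt_coord _ (nal N) (nbe N) x; set t0 := x i0 - _ in xE; set t1 := x i1 - _ in xE.
have fE : ev f x =1 ev f (ptN t0 t1 (x i2)) by move=> i; apply: meval_eq.
rewrite (meval_eq P xE) PE AE.
have [_ /(_ t0 t1 (x i2))[e0 e1 e2]] := nf.
transitivity (- b * dot (nn0 N) (ev f (ptN t0 t1 (x i2))) + a * dot (nn1 N) (ev f (ptN t0 t1 (x i2)))
  + ga * dot (nn2 N) (ev f (ptN t0 t1 (x i2)))); last by rewrite /dot !fE; ring.
rewrite /ptN e0 e1 e2; have := D0 t0 t1; rewrite /D => /eqP; rewrite subr_eq add0r => /eqP E.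
have -> : B t0 t1 = ga * dd N t0 t1 - (a * t0 + b * t1) * sq N t0 t1 by rewrite -E addrK.
ring.
Qed.

End Conic.

Lemma same_singularities_eq (f g : triple K) (N N' : nform K) :
  cubic f -> normal N f -> (forall i l, (tnth f i)^`M(l).@[v3 (nal N) (nbe N) 1] = 0) ->
  confining 6 (fam1 f) -> confining 6 (fam2 f) -> noline f ->
  cubic g -> normal N' g -> (forall i l, (tnth g i)^`M(l).@[v3 (nal N') (nbe N') 1] = 0) ->
  confining 6 (fam1 g) -> confining 6 (fam2 g) -> noline g ->
  same_singularities f g -> triple_eq f g.
Proof.
move=> hf nf hD conf1 conf2 hline hg ng gD gconf1 gconf2 gline [sF sI sM].
have pI := double_point_indeterminate hf nf.
have p4 := double_point_multiplicity hf nf hD conf1.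
have pE i : v3 (nal N) (nbe N) 1 i = v3 (nal N') (nbe N') 1 i.
  have := multiplicity4 hg ng gD gconf1 gconf2 gline (or_intror (proj1 (sI _) pI))
    (proj1 (sM _ (or_intror pI) 4%N) p4) i.
  by rewrite !mxE mul1r.
have {}gD i l : (tnth g i)^`M(l).@[v3 (nal N) (nbe N) 1] = 0.
  by rewrite (meval_eq _ pE); exact: gD.
have bP j t0 t1 z : nonzero t0 t1 -> SS N t0 t1 z = 0 -> CC N t0 t1 z = 0 ->
    (tnth g j).@[pt (nal N) (nbe N) t0 t1 z] = 0.
  move=> nz S0 C0; set x := pt _ _ _ _ _.
  have : indeterminacy f (\row_i x i).
    apply/(indeterminacyP hf nf); split; last first.
      by right; exists t0, t1, z; split=> // i; rewrite mxE.
    apply/row_neq0; apply: boolp.contrapT => H; have {}H i : x i = 0.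
      by apply/eqP/negPn/negP => xi; apply: H; exists i; rewrite mxE.
    by apply: (@pt_nonparallel _ N t0 t1 z nz) => a; rewrite -/x !H mulr0.
  case/sI/indeterminacyE => _ /(_ j) <-; apply: meval_eq => i; by rewrite mxE.
have /fin_all_exists[m mE] := fun j => base_linear_combination hf nf hD conf1 (hg j) (gD j) (bP j).
have [r [nz rd rR]] := R5_roots hf nf hD conf1 hline.
pose x i := xt N (r i).1 (r i).2.
have R0 i : R5 N (r i).1 (r i).2 = 0 by apply/rR => //; exists i; exact: mulrC.
(* At a common fixed point f x = c x and g x = d x, so the matrix M has eigenvalue d / c there. *)
have eig i : exists2 la, la != 0 & forall j, dot (m j) (x i) = la * x i j.
  have [_ _ _ [c c0 cE]] := R5_fixed_point hf nf hD conf1 conf2 hline (nz i) (R0 i).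
  have : fixed_point f (\row_k x i k).
    apply/(fixed_pointP hf nf hD conf1 conf2 hline).
    by exists (r i).1, (r i).2, 1; split; rewrite ?oner_eq0 // => k; rewrite mxE mul1r.
  case/sF => _ _ _ /proj_eqE[d d0 dE]; exists (d / c) => [|j]; first by rewrite mulf_neq0 ?invr_neq0.
  have gE : ev g (x i) j = d * x i j.
    have := dE j; rewrite !mxE => <-; apply: meval_eq => k; by rewrite mxE.
  apply: (mulfI c0); transitivity (dot (m j) (ev f (x i))).
    by rewrite /dot !cE -/(x i); ring.
  by rewrite -mE -/(ev g (x i) j) gE; field.
have /fin_all_exists2[la la0 laE] := eig.
have D i j k : i != j -> j != k -> i != k -> det3 (x i) (x j) (x k) != 0.
  have w i' j' : i' != j' -> (r i').1 * (r j').2 - (r i').2 * (r j').1 != 0.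
    by apply: contraNneq => /subr0_eq/rd ->.
  move=> ij jk ik; rewrite /x det3_xt !mulf_neq0 ?w // oppr_eq0.
  exact: conic_smooth hf nf hD conf1 hline.
pose o (k : nat) : 'I_5 := inord k.
have oN a b : (a < 5)%N -> (b < 5)%N -> a != b -> o a != o b.
  by move=> a5 b5; apply: contraNneq => /(congr1 val); rewrite /= !inordK // => ->.
have sc := @four_eigenvectors m (fun k => x (o k)) (x (o 3%N)) (fun k => la (o k)) (la (o 3%N)).
exists (la (o 3%N)); first exact: la0.
move=> j; apply: mpoly_eq_of_values => y; rewrite mE mevalZ.
by apply: sc => *; rewrite ?laE //; apply: D; apply: oN.
Qed.

End Determination.

(** * Certificates of ideal membership *)

Delimit Scope Z_scope with BZ.

Section Reflection.
Variable K : numClosedFieldType.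

(* Forms with integer coefficients, as lists of terms; the exponents are those of X_0, X_1, X_2. *)
Definition expo := (nat * nat * nat)%type.
Definition spoly := seq (Z * expo).

Definition emnm (m : expo) : 'X_{1..3} := [multinom [tuple m.1.1; m.1.2; m.2]].
Definition zval (z : Z) : K := (int_of_Z z)%:~R.
Definition interp (s : spoly) : {mpoly K[3]} := \sum_(t <- s) zval t.1 *: 'X_[emnm t.2].

Definition eadd (m m' : expo) : expo := (m.1.1 + m'.1.1, m.1.2 + m'.1.2, m.2 + m'.2)%N.
Definition sopp (s : spoly) : spoly := [seq (Z.opp t.1, t.2) | t <- s].
Definition smul (s t : spoly) : spoly := [seq (Z.mul u.1 v.1, eadd u.2 v.2) | u <- s, v <- t].
Definition eget (m : expo) : 'I_3 -> nat := v3 m.1.1 m.1.2 m.2.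
Definition edec (i : 'I_3) (m : expo) : expo :=
  v3 (m.1.1.-1, m.1.2, m.2) (m.1.1, m.1.2.-1, m.2) (m.1.1, m.1.2, m.2.-1) i.
Definition sder (s : spoly) (i : 'I_3) : spoly := 
  [seq (Z.mul t.1 (Z.of_nat (eget t.2 i)), edec i t.2) | t <- s & eget t.2 i != 0%N].
Definition scross (a b : 'I_3 -> spoly) : 'I_3 -> spoly :=
  v3 (smul (a i1) (b i2) ++ sopp (smul (a i2) (b i1))) (smul (a i2) (b i0) ++ sopp (smul (a i0) (b i2)))
     (smul (a i0) (b i1) ++ sopp (smul (a i1) (b i0))).
Definition sX : 'I_3 -> spoly := v3 [:: (1%BZ, (1, 0, 0)%N)] [:: (1%BZ, (0, 1, 0)%N)] [:: (1%BZ, (0, 0, 1)%N)].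
Definition sexp (s : spoly) n : spoly := iter n (smul s) [:: (1%BZ, (0, 0, 0)%N)].
Definition scomp (s : spoly) (l : 'I_3 -> spoly) : spoly :=
  flatten [seq smul [:: (t.1, (0, 0, 0)%N)] (smul (sexp (l i0) t.2.1.1)
    (smul (sexp (l i1) t.2.1.2) (sexp (l i2) t.2.2))) | t <- s].

Lemma zvalD a b : zval (Z.add a b) = zval a + zval b.
Proof. by rewrite /zval -intrD -(rmorphD int_of_Z). Qed.

Lemma zvalM a b : zval (Z.mul a b) = zval a * zval b.
Proof. by rewrite /zval -intrM -(rmorphM int_of_Z). Qed.

Lemma zvalN a : zval (Z.opp a) = - zval a.
Proof. by rewrite /zval -mulrNz -(rmorphN int_of_Z). Qed.

Lemma zval_nat n : zval (Z.of_nat n) = n%:R.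
Proof. by rewrite /zval; have -> : int_of_Z (Z.of_nat n) = n by exact: Z_of_intK n. Qed.

Lemma zval0 : zval 0%BZ = 0. Proof. by []. Qed.
Lemma zval1 : zval 1%BZ = 1. Proof. by []. Qed.

Lemma zval_eq0 z : (zval z == 0) = (z == 0%BZ).
Proof. by rewrite /zval intr_eq0 -(can_eq int_of_ZK). Qed.

Lemma emnmE m i : emnm m i = eget m i.
Proof. by rewrite multinomE (tnth_nth 0%N); move: i; apply: ord3P. Qed.

Lemma emnmD m m' : emnm (eadd m m') = (emnm m + emnm m')%MM.
Proof. by apply/mnmP => i; rewrite mnmDE !emnmE; move: i; apply: ord3P. Qed.

Lemma emnm_inj : injective emnm.
Proof.
move=> [[a b] c] [[a' b'] c'] /mnmP E; have := E i0; have := E i1; have := E i2.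
by rewrite !emnmE /eget /v3 /= => -> -> ->.
Qed.

Lemma interp_nil : interp [::] = 0. Proof. by rewrite /interp big_nil. Qed.

Lemma interp_cons t s : interp (t :: s) = zval t.1 *: 'X_[emnm t.2] + interp s.
Proof. by rewrite /interp big_cons. Qed.

Lemma interp_cat s t : interp (s ++ t) = interp s + interp t.
Proof. by rewrite /interp big_cat. Qed.

Lemma interp_opp s : interp (sopp s) = - interp s.
Proof.
rewrite /interp big_map -sumrN; apply: eq_bigr => t _; by rewrite zvalN scaleNr.
Qed.

Lemma interp_mul s t : interp (smul s t) = interp s * interp t.
Proof.
rewrite /interp /smul big_allpairs_dep mulr_suml; apply: eq_bigr => u _.
rewrite mulr_sumr; apply: eq_bigr => v _.
by rewrite zvalM emnmD mpolyXD -scalerAl -scalerAr scalerA.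
Qed.

Lemma interp_der s i : interp (sder s i) = (interp s)^`M(i).
Proof.
rewrite /interp /sder big_map big_filter raddf_sum [RHS](bigID (fun t : Z * expo => eget t.2 i != 0%N)) /=.
rewrite [X in _ + X]big1 ?addr0 => [|t]; last first.
  by rewrite negbK mderivZ mderivX emnmE => /eqP ->; rewrite scale0r scaler0.
apply: eq_bigr => t _; rewrite mderivZ mderivX zvalM zval_nat -scalerA; congr (_ *: _).
case: t => _ [[a b] c] /=; rewrite emnmE.
congr (_ *: 'X_[_]); apply/mnmP => j; rewrite mnmBE mnm1E !emnmE.
by move: i; apply: ord3P; move: j; apply: ord3P; rewrite /= ?subn0 ?subn1.
Qed.

Lemma interp_X i : interp (sX i) = 'X_i.
Proof.
move: i; apply: ord3P; rewrite /sX /v3 /= interp_cons interp_nil addr0 zval1 scale1r /=; congr 'X_[_];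
  by apply/mnmP; apply: ord3P; rewrite emnmE mnm1E.
Qed.

Lemma interp_cross a b i : interp (scross a b i) = cross (fun j => interp (a j)) (fun j => interp (b j)) i.
Proof.
by move: i; apply: ord3P; rewrite /scross /cross /v3 /= interp_cat interp_opp !interp_mul.
Qed.

Lemma interp_const z : interp [:: (z, (0, 0, 0)%N)] = (zval z)%:MP.
Proof.
rewrite interp_cons interp_nil addr0 -[_%:MP]mulr1 mul_mpolyC -mpolyX0; congr (_ *: 'X_[_]).
by apply/mnmP; apply: ord3P; rewrite emnmE mnm0E.
Qed.

Lemma interp_exp s n : interp (sexp s n) = interp s ^+ n.
Proof.
elim: n => [|n IH]; first by rewrite /sexp /= interp_const zval1 expr0.
by rewrite exprS -IH -interp_mul.
Qed.

Lemma interp_comp s l (q : 3.-tuple {mpoly K[3]}) : (forall i, tnth q i = interp (l i)) ->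
  interp (scomp s l) = interp s \mPo q.
Proof.
move=> qE; elim: s => [|t s IH]; first by rewrite /scomp /= !interp_nil comp_mpoly0.
rewrite /scomp /= interp_cat -/(scomp s l) IH interp_cons comp_mpolyD comp_mpolyZ; congr (_ + _).
rewrite !interp_mul interp_const !interp_exp mul_mpolyC; congr (_ *: _).
rewrite comp_mpolyX; transitivity (\prod_i interp (l i) ^+ emnm t.2 i).
  rewrite 2!big_ord_recl big_ord1 !emnmE /=.
  have -> : lift ord0 (lift ord0 (ord0 : 'I_1)) = i2 by exact: val_inj.
  have -> : lift ord0 (ord0 : 'I_2) = i1 by exact: val_inj.
  by have -> : ord0 = i0 by exact: val_inj.
by apply: eq_bigr => i _; rewrite qE.
Qed.

Fixpoint coefZ (s : spoly) (m : expo) : Z :=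
  if s is t :: s' then (if t.2 == m then Z.add t.1 (coefZ s' m) else coefZ s' m) else 0%BZ.

Lemma interpE (L : seq expo) s : uniq L -> all (fun t => t.2 \in L) s ->
  interp s = \sum_(m <- L) zval (coefZ s m) *: 'X_[emnm m].
Proof.
move=> uL; elim: s => [|t s IH] /=.
  by rewrite interp_nil big1 // => m _; rewrite zval0 scale0r.
move=> /andP[tL /IH E]; rewrite interp_cons E (bigD1_seq _ tL uL) [in RHS](bigD1_seq _ tL uL) /= eqxx.
rewrite zvalD scalerDl -!addrA; congr (_ + (_ + _)); apply: eq_bigr => m mt.
by rewrite eq_sym (negPf mt).
Qed.

Fixpoint axpy (c : Z) (v w : seq Z) : seq Z :=
  match v, w with a :: v', b :: w' => Z.add (Z.mul c a) b :: axpy c v' w' | _, _ => [::] end.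

Definition dense (L : seq expo) (s : spoly) : seq Z := [seq coefZ s m | m <- L].
Definition interp_dense (L : seq expo) (v : seq Z) : {mpoly K[3]} :=
  \sum_(p <- zip v L) zval p.1 *: 'X_[emnm p.2].

Definition column (gens : seq spoly) (k : nat * expo) : spoly := smul [:: (1%BZ, k.2)] (nth [::] gens k.1).
Definition unit_row (L : seq expo) (D : Z) (m : expo) : seq Z := [seq (if m' == m then D else 0%BZ) | m' <- L].
Definition combination (cols : seq (seq Z)) (cs : seq Z) (z : seq Z) : seq Z :=
  foldr (fun p acc => axpy p.1 p.2 acc) z (zip cs cols).

(* Each row (D, m, cs) asserts that D X^m is the combination, with coefficients cs, of the columns,
   which are multiples of the generators by monomials. *)
Definition certified (L : seq expo) (gens : seq spoly) (idx : seq (nat * expo))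
    (rows : seq (Z * expo * seq Z)) :=
  let cols := [seq column gens k | k <- idx] in
  let dcols := [seq dense L c | c <- cols] in
  let z := nseq (size L) 0%BZ in
  [&& uniq L, all (fun c : spoly => all (fun t => t.2 \in L) c) cols &
      all (fun r => [&& r.1.1 != 0%BZ, r.1.2 \in L &
        combination dcols r.2 z == unit_row L r.1.1 r.1.2]) rows].

Lemma interp_dense_axpy L c v w : size v = size L -> size w = size L ->
  interp_dense L (axpy c v w) = zval c *: interp_dense L v + interp_dense L w /\ size (axpy c v w) = size L.
Proof.
rewrite /interp_dense; elim: L v w => [|m L IH] [|a v] [|b w] //=.
  by rewrite !big_nil scaler0 addr0.
case=> sv [sw]; have [E ->] := IH v w sv sw; split=> //.
by rewrite !big_cons E /= zvalD zvalM !scalerDr !scalerDl !scalerA !addrA; congr (_ + _); rewrite addrAC.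
Qed.

(** Rational cofactors are stored without denominators; the integer D is invertible in K because the
    characteristic is zero. *)
Lemma certified_sound (I : {mpoly K[3]} -> Prop) L gens idx rows :
  (forall p q, I p -> I q -> I (p + q)) -> (forall p q, I q -> I (p * q)) -> I 0 ->
  (forall g, g \in gens -> I (interp g)) -> certified L gens idx rows ->
  forall r, r \in rows -> I 'X_[emnm r.1.2].
Proof.
move=> ID IM I0 Ig /and3P[uL aL aR] r rR.
have IZ c p : I p -> I (c *: p) by rewrite -mul_mpolyC; exact: IM.
have /and3P[D0 mL /eqP E] := allP aR r rR.
have denseE s : all (fun t => t.2 \in L) s -> interp_dense L (dense L s) = interp s.
  move=> sL; rewrite (interpE uL sL) /interp_dense /dense.
  by elim: (L) => [|m l IH] /=; rewrite ?big_nil ?big_cons ?IH.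
have key cols cs : all (fun c : spoly => all (fun t => t.2 \in L) c) cols ->
    (forall c, c \in cols -> I (interp c)) ->
    I (interp_dense L (combination [seq dense L c | c <- cols] cs (nseq (size L) 0%BZ))) /\
    size (combination [seq dense L c | c <- cols] cs (nseq (size L) 0%BZ)) = size L.
  rewrite /combination; elim: cols cs => [|c cols IH] [|a cs] //=; try (move=> _ _; split; last exact: size_nseq).
  1-3: by rewrite /interp_dense; elim: (L) => [|m l IHl] /=; rewrite ?big_nil ?big_cons ?zval0 ?scale0r ?add0r.
  move=> /andP[cL aC] Ic; have [IH1 IH2] := IH cs aC (fun c' h => Ic c' (mem_behead (s := c :: cols) h)).
  have [-> ->] := interp_dense_axpy a (size_map _ _ : size (dense L c) = size L) IH2; split=> //.
  by apply: ID => //; apply: IZ; rewrite denseE //; apply: Ic; rewrite mem_head.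
have colI c : c \in [seq column gens k | k <- idx] -> I (interp c).
  case/mapP => k _ ->; rewrite /column interp_mul; apply: IM.
  have [kg|kg] := ltnP k.1 (size gens); first by apply: Ig; exact: mem_nth.
  by rewrite nth_default // interp_nil.
have [] := key _ r.2 aL colI; rewrite E => H _.
suff UE : interp_dense L (unit_row L r.1.1 r.1.2) = zval r.1.1 *: 'X_[emnm r.1.2].
  by rewrite UE in H; have := IZ (zval r.1.1)^-1 _ H; rewrite scalerA mulVf ?scale1r // zval_eq0.
rewrite /interp_dense /unit_row.
transitivity (\sum_(m <- L) (if m == r.1.2 then zval r.1.1 else 0) *: 'X_[emnm m] : {mpoly K[3]}).
  elim: (L) => [|m l IH] /=; rewrite ?big_nil ?big_cons ?IH //=; by case: eqP.
rewrite (bigD1_seq _ mL uL) /= eqxx big1 ?addr0 // => m /negPf ->; exact: scale0r.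
Qed.

Definition expos (N : nat) : seq expo :=
  [seq (a, b, (N - a - b)%N) | a <- iota 0 N.+1, b <- iota 0 (N.+1 - a)].

Lemma expos_deg N m : m \in expos N -> mdeg (emnm m) = N.
Proof.
case/allpairsPdep => a [b []]; rewrite !mem_iota !add0n ltn_subRL !ltnS => _ /andP[_ ab] ->.
have -> : mdeg (emnm (a, b, N - a - b)%N) = (a + b + (N - a - b))%N by rewrite mdegE sum3 !emnmE.
by rewrite -subnDA subnKC.
Qed.

Lemma exposP N (m : 'X_{1..3}) : mdeg m = N -> exists2 e, e \in expos N & m = emnm e.
Proof.
move=> mN; have E : (m i0 + m i1 + m i2 = N)%N by rewrite -mN mdegE sum3.
exists (m i0, m i1, m i2); last by apply/mnmP; apply: ord3P; rewrite emnmE.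
apply/allpairsPdep; exists (m i0), (m i1); rewrite !mem_iota !add0n ltn_subRL !ltnS -subnDA -E addKn.
by rewrite -addnA leq_addr addnA leq_addr.
Qed.

End Reflection.

(** * The explicit map and its certificates *)

Section Certificates.
Variable K : numClosedFieldType.

(** The last generator [sE] does not vary with f: the certificate may use its multiples, none of
    which involves a monomial of [rows]. *)
Lemma reflected_elimination (J : finType) e (P : J -> triple K -> {mpoly K[3]}) (dg : J -> nat) N
    (f0 : triple K) (g : J -> spoly) (js : seq J) (sE : spoly) dE idx rows :
  (forall j, polyfam e (P j)) -> (forall j f, cubic f -> P j f \is (dg j).-homog) ->
  (forall j, dg j <= N)%N -> cubic f0 -> (forall j, P j f0 = interp K (g j)) ->
  interp K sE \is dE.-homog -> (dE <= N)%N ->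
  (forall Q m, m \in [seq r.1.2 | r <- rows] -> (Q * interp K sE)@_(emnm m) = 0) ->
  certified (expos N) (rcons [seq g j | j <- js] sE) idx rows -> uniq [seq r.1.2 | r <- rows] ->
  exists phi : triple K -> K, [/\ exists d, polyfun d phi, phi f0 != 0 &
    forall f, cubic f -> phi f != 0 -> forall L, functional L ->
      (forall C j, L (C * P j f) = 0) ->
      (forall m, m \in expos N -> m \notin [seq r.1.2 | r <- rows] -> L 'X_[emnm m] = 0) ->
      forall m, mdeg m = N -> L 'X_[m] = 0].
Proof.
move=> hP dP dN c0 Pg hE dEN E0 cert ur.
have [|||phi [d p0 H]] := @elimination K J e P dg N [seq emnm r.1.2 | r <- rows] f0 (interp K sE) dE hP dP dN c0 _ hE dEN.
- by rewrite (map_comp emnm (fun r : Z * expo * seq Z => r.1.2)) (map_inj_uniq emnm_inj).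
- by move=> Q _ /mapP[r rr ->]; apply: E0; apply/mapP; exists r.
- move=> _ /mapP[r rr ->].
  have /and3P[_ _ /allP/(_ r rr)/and3P[_ rL _]] := cert; split; first exact: expos_deg.
  pose I q := exists (C : J -> {mpoly K[3]}) Q, q = \sum_j C j * P j f0 + Q * interp K sE.
  apply: (@certified_sound K I _ _ _ _ _ _ _ _ cert r rr).
  + move=> _ _ [C [Q ->]] [C' [Q' ->]]; exists (fun j => C j + C' j), (Q + Q').
    by rewrite mulrDl addrACA -big_split; congr (_ + _); apply: eq_bigr => j _; rewrite mulrDl.
  + move=> q _ [C [Q ->]]; exists (fun j => q * C j), (q * Q).
    by rewrite mulrDr mulr_sumr mulrA; congr (_ + _); apply: eq_bigr => j _; rewrite mulrA.
  + by exists (fun=> 0), 0; rewrite mul0r addr0 big1 // => j _; rewrite mul0r.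
  move=> s; rewrite mem_rcons inE => /orP[/eqP ->|/mapP[j _ ->]].
    by exists (fun=> 0), 1; rewrite mul1r big1 ?add0r // => j _; rewrite mul0r.
  exists (fun i => (i == j)%:R), 0; rewrite mul0r addr0 (bigD1 j) //= eqxx mul1r Pg big1 ?addr0 //.
  by move=> i /negPf ->; rewrite mul0r.
exists phi; split=> // f hf pf L hL LP Lr m mN; apply: (H f hf pf L hL LP) => // {}m {}mN.
have [e' eN ->] := exposP mN; rewrite (map_comp emnm (fun r : Z * expo * seq Z => r.1.2)).
by rewrite (mem_map emnm_inj); exact: Lr.
Qed.

Definition sf0 : 'I_3 -> spoly :=
  v3 [:: (-1, (0, 2, 1)%N); (-1, (2, 1, 0)%N); (-1, (2, 0, 1)%N)]%BZ
     [:: (1, (1, 1, 1)%N); (1, (3, 0, 0)%N); (1, (1, 2, 0)%N)]%BZ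
     [:: (-1, (2, 0, 1)%N); (1, (0, 3, 0)%N)]%BZ.

(* In the normal form, S = - y z - x ^ 2 - y ^ 2 and C = - x ^ 2 z + y ^ 3, and the components are
   y S + C, - x S and C. *)
Definition f0 : triple K := [tuple interp K (sf0 i) | i < 3].

Lemma f0E i : tnth f0 i = interp K (sf0 i). Proof. by rewrite tnth_mktuple. Qed.

Lemma interp_homog d s : all (fun t : Z * expo => eget t.2 i0 + eget t.2 i1 + eget t.2 i2 == d)%N s ->
  interp K s \is d.-homog.
Proof.
move=> /allP h; rewrite /interp big_seq; apply: rpred_sum => t ts; apply: dhomogZ.
by rewrite dhomogX /= mdegE sum3 !emnmE; exact: h.
Qed.

Lemma cubic_f0 : cubic f0.
Proof. by move=> i; rewrite f0E; apply: interp_homog; move: i; apply: ord3P. Qed.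

Lemma deriv_f0 i l : (tnth f0 i)^`M(l) = interp K (sder (sf0 i) l).
Proof. by rewrite f0E interp_der. Qed.

Lemma cross_interp (a b : 'I_3 -> {mpoly K[3]}) sa sb i : (forall j, a j = interp K (sa j)) ->
  (forall j, b j = interp K (sb j)) -> cross a b i = interp K (scross sa sb i).
Proof.
by move=> ha hb; rewrite interp_cross; move: i; apply: ord3P; rewrite /cross /v3 /= !ha !hb.
Qed.

Lemma polyfam_cross d e (a b : 'I_3 -> triple K -> {mpoly K[3]}) i :
  (forall j, polyfam d (a j)) -> (forall j, polyfam e (b j)) ->
  polyfam (d + e) (fun f => cross (fun j => a j f) (fun j => b j f) i).
Proof.
by move=> ha hb; move: i; apply: ord3P; rewrite /cross /v3 /=; apply: polyfamB; apply: polyfamM.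
Qed.

Lemma cross_homog d e (a b : 'I_3 -> {mpoly K[3]}) i : (forall j, a j \is d.-homog) ->
  (forall j, b j \is e.-homog) -> cross a b i \is (d + e).-homog.
Proof.
by move=> ha hb; move: i; apply: ord3P; rewrite /cross /v3 /=; apply: rpredB; apply: dhomogM.
Qed.

(* Equal to 1 at f0; multiplying by it makes the degrees in the coefficients of f uniform. *)
Definition leading (f : triple K) : {mpoly K[3]} := ((tnth f i1)@_(emnm (1, 1, 1)%N))%:MP.

Lemma polyfam_leading : polyfam 1 leading.
Proof. exact/polyfam_coef/polyfam_coord. Qed.

Lemma leading_f0 : leading f0 = 1.
Proof.
rewrite /leading f0E /interp /sf0 /v3 /= !big_cons big_nil !mcoeffD !mcoeffZ !mcoeffX mcoeff0.
by rewrite !(inj_eq emnm_inj) /= !mulr0 !addr0 mulr1.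
Qed.

Lemma leadingM_homog f d P : P \is d.-homog -> leading f * P \is d.-homog.
Proof. by move=> hP; rewrite mul_mpolyC; exact: dhomogZ. Qed.

Lemma polyfam_om i : polyfam 1 (fun f : triple K => om f i).
Proof.
apply: (@polyfam_cross 0 1 (fun j _ => 'X_j) (fun j f => tnth f j)) => j.
  exact: polyfam_const.
exact: polyfam_coord.
Qed.

Definition som := scross sX sf0.

Lemma om_f0 i : om f0 i = interp K (som i).
Proof. by apply: cross_interp => j; rewrite ?interp_X ?f0E. Qed.

Definition som_minors (x : 'I_3 * 'I_3 * 'I_3) := scross (sder (som x.1.1)) (sder (som x.1.2)) x.2.

Lemma om_minors_f0 x : om_minors f0 x = interp K (som_minors x).
Proof. by apply: cross_interp => j; rewrite om_f0 interp_der. Qed.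

Definition sgrad_pencil i j := scross (sder (sf0 i)) (sder (sf0 j)).

Lemma grad_pencil_f0 i j l : grad_pencil i j f0 l = interp K (sgrad_pencil i j l).
Proof. by apply: cross_interp => k; rewrite deriv_f0. Qed.

Lemma grad_homog i l (f : triple K) : cubic f -> (tnth f i)^`M(l) \is 2.-homog.
Proof. by move=> hf; apply: dhomog_deriv; exact: hf. Qed.

Lemma polyfam_grad i l : polyfam 1 (fun f : triple K => (tnth f i)^`M(l)).
Proof. exact/polyfam_deriv/polyfam_coord. Qed.

Definition sadj l := smul (sX i0) (sgrad_pencil i1 i2 l) ++ smul (sX i1) (sgrad_pencil i2 i0 l) ++
  smul (sX i2) (sgrad_pencil i0 i1 l).

Lemma adjx_f0 l : adjx f0 l = interp K (sadj l).
Proof.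
by rewrite /sadj interp_cat interp_cat 3!interp_mul !interp_X -!grad_pencil_f0 addrA.
Qed.

(** Generators 0 to 2 are the components of [grad_pencil] at [f0], generator 3 is x_2. *)
Definition pencil01_columns : seq (nat * expo) := [::
  (0, (0, 0, 1)); (0, (0, 1, 0)); (0, (1, 0, 0)); (1, (0, 0, 1)); (1, (0, 1, 0)); (1, (1, 0, 0)); (2, (0, 1, 0)); (2,
  (1, 0, 0)); (3, (0, 4, 0)); (3, (1, 3, 0)); (3, (2, 2, 0)); (3, (3, 1, 0)); (3, (4, 0, 0))]%N.

Definition pencil01_rows : seq (Z * expo * seq Z) := [::
  (9, (5, 0, 0)%N, [:: 2; -1; 0; 0; 0; -2; 0; 1; 0; -9; 0; 0; 0]);
  (9, (4, 1, 0)%N, [:: 0; 0; 3; 4; 0; 0; 2; 0; 0; 0; 9; 0; 9]);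
  (9, (3, 2, 0)%N, [:: -4; -1; 0; 0; 0; -2; 0; -2; 0; 9; 0; 9; 0]);
  (9, (2, 3, 0)%N, [:: 0; 0; 3; -2; 0; 0; -1; 0; 0; 0; 0; 0; -9]);
  (9, (1, 4, 0)%N, [:: 2; 5; 0; 0; 0; 1; 0; 1; 0; 0; 0; -9; 0]);
  (9, (0, 5, 0)%N, [:: 0; 0; -15; -8; -9; 0; -4; 0; -9; 0; -18; 0; -9])]%BZ.

Definition pencil02_columns : seq (nat * expo) := [::
  (0, (0, 1, 0)); (0, (1, 0, 0)); (1, (0, 0, 1)); (1, (0, 1, 0)); (1, (1, 0, 0)); (2, (0, 1, 0)); (2, (1, 0, 0)); (3,
  (1, 2, 1)); (3, (1, 3, 0)); (3, (2, 1, 1)); (3, (2, 2, 0)); (3, (4, 0, 0))]%N.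

Definition pencil02_rows : seq (Z * expo * seq Z) := [::
  (2, (5, 0, 0)%N, [:: 0; 2; 1; 3; 0; 1; 0; 2; 0; 0; 0; 0]);
  (2, (4, 1, 0)%N, [:: 0; 0; 0; 0; -1; 0; 0; 0; 0; 0; 2; 0]);
  (2, (3, 2, 0)%N, [:: 0; 0; 0; -1; 0; 0; 0; 0; 2; 0; 0; 0]);
  (6, (2, 3, 0)%N, [:: 0; 0; 0; 0; 0; 0; -1; 0; 0; -4; -6; -2]);
  (6, (1, 4, 0)%N, [:: 0; 0; 1; 0; 0; -1; 0; -6; -6; 0; 0; 0]);
  (6, (0, 5, 0)%N, [:: 2; 0; 0; 0; 1; 0; 1; 0; 0; 4; 0; 2])]%BZ.

Definition nodal_columns : seq (nat * expo) := [::
  (0, (0, 0, 1)); (0, (0, 1, 0)); (0, (1, 0, 0)); (1, (0, 0, 1)); (1, (0, 1, 0)); (1, (1, 0, 0)); (2, (0, 0, 1)); (2,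
  (0, 1, 0)); (2, (1, 0, 0))]%N.

Definition nodal_rows : seq (Z * expo * seq Z) := [::
  (3, (3, 0, 0)%N, [:: 0; 1; 0; 0; 0; -1; 0; 0; -2]);
  (3, (2, 1, 0)%N, [:: 0; 0; -1; 0; -1; 0; 2; 0; 0]);
  (6, (2, 0, 1)%N, [:: 0; 0; -1; 0; 2; 0; -4; 0; 0]);
  (3, (1, 2, 0)%N, [:: 0; -1; 0; 0; 0; 1; 0; 0; -1]);
  (6, (1, 1, 1)%N, [:: 0; -1; 0; 0; 0; -2; 0; 0; 2]);
  (6, (1, 0, 2)%N, [:: -3; 1; 0; 0; 0; 2; 0; 0; -2]);
  (3, (0, 3, 0)%N, [:: 0; 0; 1; 0; 1; 0; -2; -3; 0]);
  (6, (0, 2, 1)%N, [:: 0; 0; 1; 0; -2; 0; -2; 0; 0]);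
  (12, (0, 1, 2)%N, [:: 0; 0; 1; -6; -2; 0; 4; 0; 0])]%BZ.

Definition noline_columns : seq (nat * expo) := [::
  (0, (0, 2, 0)); (0, (1, 0, 1)); (0, (1, 1, 0)); (1, (0, 0, 2)); (1, (0, 1, 1)); (1, (0, 2, 0)); (1, (1, 0, 1)); (1,
  (1, 1, 0)); (2, (0, 0, 2)); (2, (0, 1, 1)); (2, (0, 2, 0)); (2, (1, 0, 1)); (2, (1, 1, 0)); (2, (2, 0, 0)); (3, (0,
  0, 2)); (3, (0, 1, 1)); (3, (0, 2, 0)); (3, (1, 0, 1)); (3, (2, 0, 0)); (4, (0, 0, 2)); (4, (0, 1, 1)); (4, (0, 2,
  0)); (4, (1, 0, 1)); (4, (1, 1, 0)); (4, (2, 0, 0)); (5, (0, 2, 0)); (5, (1, 0, 1)); (5, (2, 0, 0))]%N.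

Definition noline_rows : seq (Z * expo * seq Z) := [::
  (12, (6, 0, 0)%N, [:: 219; -141; -109; 8; -313; 181; -323; -63; 204; 0; 4; 4; -4; -4; 111; -8; 73; -34; 10; -119;
    -12; 0; 0; 4; 0; -4; 16; -12]);
  (6, (5, 1, 0)%N, [:: -38; 15; 1; -9; -6; -1; 18; 15; -25; -2; -4; 4; -8; -6; 1; 1; -13; 2; -5; 8; 2; 4; 4; 0; 6; 0;
    0; 0]);
  (6, (5, 0, 1)%N, [:: -63; 37; 19; -6; 43; -31; 61; 19; -44; -4; 0; -2; 0; 0; -17; 4; -21; 8; -4; 23; 4; 0; 0; 0; 0;
    0; -6; 0]);
  (12, (4, 2, 0)%N, [:: 9; 5; 25; 20; 205; -73; 135; 11; -40; -20; 4; -12; 8; 8; -67; -12; -5; 6; -10; 47; 8; 0; 0;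
    -8; 0; -4; -8; 0]);
  (6, (4, 1, 1)%N, [:: 17; 5; 47; 18; 247; -111; 177; 9; -48; -12; 4; -10; 4; 0; -79; -10; 1; 0; -2; 61; 0; 0; 6; -4;
    0; -4; 0; 0]);
  (2, (4, 0, 2)%N, [:: 13; -8; -2; 3; 1; 2; -7; -2; 7; 0; 0; 0; 0; 0; 0; -1; 4; -2; 1; -3; 0; 0; 0; 0; 0; 0; 0; 0]);
  (6, (3, 3, 0)%N, [:: 21; -4; 18; 9; 115; -58; 75; -18; -7; -8; 6; -6; 8; 0; -36; -3; 6; 2; -1; 27; -4; -2; 4; -4; 0;
    -4; 0; 0]);
  (12, (3, 2, 1)%N, [:: 21; -13; -1; 6; 5; -11; -13; -19; 14; 4; 0; 8; 0; 0; -1; 2; 9; -2; 4; -5; -4; 0; 0; 0; 0; 0;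
    0; 0]);
  (4, (3, 1, 2)%N, [:: 23; -11; -3; 6; 23; -9; 5; -5; 6; 0; 0; 0; 0; 0; -7; -2; 7; -2; 0; 1; 0; 0; 0; 0; 0; 0; 0; 0]);
  (1, (3, 0, 3)%N, [:: 6; -5; -5; 0; -15; 8; -14; -2; 7; 0; 0; 0; 0; 0; 5; 0; 2; -1; 0; -5; 0; 0; 0; 0; 0; 0; 0; 0]);
  (3, (2, 4, 0)%N, [:: -36; 16; -3; -13; -81; 21; -37; 4; -2; 8; -2; 5; -4; -1; 25; 8; -8; 1; 3; -12; -2; 0; 0; 4; 0;
    2; 1; 0]);
  (12, (2, 3, 1)%N, [:: 7; -5; -5; 0; -25; -3; -15; 9; 0; 12; -4; 4; -4; 0; 7; 4; 5; -6; 2; -7; 0; 0; 0; 4; 0; 4; 0;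
    0]);
  (2, (2, 2, 2)%N, [:: 9; -7; -7; 0; -21; 11; -19; -1; 10; 0; 0; 0; 0; 0; 7; 0; 3; -2; 0; -7; 0; 0; 0; 0; 0; 0; 0; 0]);
  (4, (2, 1, 3)%N, [:: -17; 9; -3; -6; -29; 11; -11; 3; -2; 0; 0; 0; 0; 0; 9; 2; -5; 2; 0; -3; 0; 0; 0; 0; 0; 0; 0;
    0]);
  (2, (2, 0, 4)%N, [:: -3; 1; 3; 0; 9; -5; 9; 1; -4; 0; 0; 0; 0; 0; -3; 0; -1; 0; 0; 3; 0; 0; 0; 0; 0; 0; 0; 0]);
  (6, (1, 5, 0)%N, [:: -25; 13; 11; 0; 17; 5; 27; 45; -34; 4; -8; 2; -6; 0; -7; -4; -11; -4; 0; 7; 8; 4; -2; 4; 0; 4;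
    0; 0]);
  (6, (1, 4, 1)%N, [:: 18; -11; -5; 3; -2; 17; -8; 13; 7; -4; 0; -2; 0; 0; 1; -5; 3; -4; -1; -4; 4; 0; 0; 0; 0; 0; 0;
    0]);
  (2, (1, 3, 2)%N, [:: -3; 1; -3; -2; -15; 9; -9; 1; 2; 0; 0; 0; 0; 0; 5; 0; -1; 0; 0; -3; 0; 0; 0; 0; 0; 0; 0; 0]);
  (2, (1, 2, 3)%N, [:: -3; 1; 1; 0; 3; -1; 3; 1; -2; 0; 0; 0; 0; 0; -1; 0; -1; 0; 0; 1; 0; 0; 0; 0; 0; 0; 0; 0]);
  (2, (1, 1, 4)%N, [:: -9; 7; 7; 0; 21; -11; 19; 3; -10; 0; 0; 0; 0; 0; -7; 0; -3; 2; 0; 7; 0; 0; 0; 0; 0; 0; 0; 0]);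
  (4, (1, 0, 5)%N, [:: 17; -9; 3; 6; 29; -11; 15; -3; 2; 0; 0; 0; 0; 0; -9; -2; 5; -2; 0; 3; 0; 0; 0; 0; 0; 0; 0; 0]);
  (12, (0, 6, 0)%N, [:: 309; -141; 23; 110; 653; -179; 283; -51; 30; -60; 28; -32; 32; 8; -201; -62; 73; -10; -20; 91;
    12; 0; 0; -32; 0; -16; -8; 0]);
  (12, (0, 5, 1)%N, [:: 55; -23; 1; 18; 119; -21; 45; -33; 18; -12; 8; -8; 8; 0; -35; -14; 11; 6; -4; 17; 0; 0; 0; -8;
    0; -8; 0; 0]);
  (1, (0, 4, 2)%N, [:: -3; 2; 2; 0; 6; -3; 5; -1; -2; 0; 0; 0; 0; 0; -2; 0; -1; 1; 0; 2; 0; 0; 0; 0; 0; 0; 0; 0]);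
  (1, (0, 3, 3)%N, [:: -4; 3; 3; 0; 9; -5; 8; 0; -4; 0; 0; 0; 0; 0; -3; 0; -1; 1; 0; 3; 0; 0; 0; 0; 0; 0; 0; 0]);
  (2, (0, 2, 4)%N, [:: 3; -1; 3; 2; 15; -7; 9; -1; -2; 0; 0; 0; 0; 0; -5; 0; 1; 0; 0; 3; 0; 0; 0; 0; 0; 0; 0; 0]);
  (2, (0, 1, 5)%N, [:: 3; -1; -1; 0; -1; 1; -3; -1; 2; 0; 0; 0; 0; 0; 1; 0; 1; 0; 0; -1; 0; 0; 0; 0; 0; 0; 0; 0]);
  (2, (0, 0, 6)%N, [:: 9; -7; -7; 2; -21; 11; -19; -3; 10; 0; 0; 0; 0; 0; 7; 0; 3; -2; 0; -7; 0; 0; 0; 0; 0; 0; 0; 0])]%BZ.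

(** Generators 0 to 2 are the components of [om], generators 3 to 11 the minors in the order of
    [fam1_indices]. *)
Definition fam1_columns : seq (nat * expo) := [::
  (0, (0, 0, 3)); (0, (0, 1, 2)); (0, (0, 2, 1)); (0, (0, 3, 0)); (0, (1, 0, 2)); (0, (1, 1, 1)); (0, (1, 2, 0)); (0,
  (2, 0, 1)); (0, (2, 1, 0)); (0, (3, 0, 0)); (1, (0, 0, 3)); (1, (1, 0, 2)); (1, (2, 0, 1)); (2, (0, 0, 3)); (2, (0,
  1, 2)); (2, (0, 2, 1)); (2, (0, 3, 0)); (2, (1, 0, 2)); (2, (1, 1, 1)); (2, (1, 2, 0)); (2, (2, 0, 1)); (2, (2, 1,
  0)); (2, (3, 0, 0)); (5, (0, 0, 1)); (6, (0, 0, 1)); (6, (0, 1, 0)); (6, (1, 0, 0)); (7, (0, 0, 1)); (7, (0, 1, 0));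
  (8, (0, 0, 1)); (9, (0, 0, 1)); (9, (1, 0, 0)); (11, (0, 0, 1))]%N.

Definition fam1_rows : seq (Z * expo * seq Z) := [::
  (51174, (7, 0, 0)%N, [:: 0; -10704; 60765; -65808; 154048; 249972; 123148; -11998; 139344; 157436; 0; 7136; -96512;
    57768; 35980; 26481; -159620; 44260; 140556; 9388; 109434; 60200; 51174; 0; 24981; 16452; -30787; -20060; -1069;
    19256; 10462; -14668; -1784]);
  (51174, (6, 1, 0)%N, [:: 0; 115536; 6360; -37332; 5720; -57198; -58672; 56452; -64284; -111932; 0; -77024; -39241;
    2145; 50981; -78876; -40888; 41009; -48834; -26980; -85740; -98954; 0; 0; 9333; 9333; 14668; 23912; -2804; 715;
    -18187; -20060; 19256]);
  (51174, (6, 0, 1)%N, [:: 0; -57588; 45318; -1416; 45800; 86202; 77024; -15116; 155133; 11056; 0; 38392; 25049;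
    17175; -45085; 51834; -79870; -3139; 120309; 68828; 13932; 75964; 0; 0; 8883; 354; -19256; -22060; -980; 5725;
    21080; 715; -9598]);
  (51174, (5, 2, 0)%N, [:: 0; 4290; -41034; 132624; -176480; -240531; -80240; 99230; 41376; -78148; 0; -2860; 164206;
    -66180; -81065; -17292; 165040; -4754; 5340; 42382; -44328; 49880; 0; 0; -33156; -33156; 20060; 6529; 8618;
    -22060; 2089; 23912; 715]);
  (51174, (5, 1, 1)%N, [:: 0; 34350; -1773; -99456; 68944; 39915; 2860; -65404; -170184; -55540; 0; -22900; -67856;
    25854; 36931; -19707; -58196; -8840; -100506; -29840; -66618; -106864; 0; 0; 16335; 24864; -715; 7903; -5371;
    8618; -4745; -22060; 5725]);
  (51174, (5, 0, 2)%N, [:: 0; -5880; -717; 30552; 25264; 57228; 22900; -1810; 133074; 11444; 0; 3920; 13150; 9474;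
    -16646; 7299; -9584; 9856; 80118; 45928; -4254; 84320; 0; 0; 891; -7638; -5725; -11096; 6737; 3158; 9304; 8618;
    -980]);
  (51174, (4, 3, 0)%N, [:: 0; -132360; 34512; -28008; 63224; 156816; 95648; -155972; 90267; 124624; 0; 88240; -45673;
    23709; -5521; 101814; -85540; -83965; 42147; -2860; 87354; 77380; 0; 0; 15531; 7002; -23912; -24538; -11096; 7903;
    13442; 6529; -22060]);
  (51174, (4, 2, 1)%N, [:: 0; 51708; -54564; 66084; -88768; -148380; -88240; 98596; -56175; -67844; 0; -34472; 81920;
    -33288; -31264; -53064; 138518; 38582; -23133; 11216; -52302; 8356; 0; 0; -25050; -16521; 22060; 10964; 16246;
    -11096; -3247; 7903; 8618]);
  (51174, (4, 1, 2)%N, [:: 0; 18948; 23076; -65868; 61736; 63240; 34472; -35768; -51912; 20284; 0; -12632; -87283;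
    23151; 55103; -6306; -78148; -325; -50730; -30196; 45840; -53096; 0; 0; 16467; 16467; -8618; 7628; -10796; 7717;
    -9895; -11096; 3158]);
  (51174, (4, 0, 3)%N, [:: 0; -10752; -13008; 57816; -18136; 17406; 12632; 1564; 107115; -23912; 0; 7168; 44759;
    -6801; -76495; 12372; 29750; -4153; 101907; 67412; -57978; 71332; 0; 0; -5925; -14454; -3158; -13954; 6958; -2267;
    20912; 7717; -1792]);
  (51174, (3, 4, 0)%N, [:: 0; 47418; 12057; -100656; 87712; 40977; 26116; -17692; -123138; -40870; 0; -31612; -48170;
    32892; 15685; -27243; -77696; 26278; -54060; 20008; -59148; -75640; 0; 0; 16635; 25164; -6529; 4435; -901; 10964;
    3193; -24538; 7903]);
  (51174, (3, 3, 1)%N, [:: 0; -66576; 24849; -528; 61024; 151260; 31612; -55654; 118272; 109940; 0; 44384; -96188;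
    22884; 52288; 47517; -54068; -17072; 49776; -34472; 112458; 53768; 0; 0; 8661; 132; -7903; -8804; -5425; 7628;
    -5150; 10964; -11096]);
  (51174, (3, 2, 2)%N, [:: 0; 46302; -37878; 95496; -111632; -167757; -44384; 105722; -372; -69472; 0; -30868; 125428;
    -41862; -59849; -37572; 124624; 28636; 47376; 55600; -53724; 21128; 0; 0; -23874; -23874; 11096; 5671; 8750;
    -13954; 3079; 7628; 7717]);
  (51174, (3, 1, 3)%N, [:: 0; -13602; 49263; -99000; 70000; 87615; 30868; -61018; -84690; 36116; 0; 9068; -84548;
    26250; 43981; 17955; -101960; 11590; -65958; -61064; 27774; -73696; 0; 0; 16221; 24750; -7717; 1033; -12187; 8750;
    -4691; -13954; -2267]);
  (51174, (3, 0, 4)%N, [:: 0; 92922; -40113; 62832; -29264; -37866; -9068; 106670; 100830; -50548; 0; -79006; 51628;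
    -10974; -64334; -76557; 54400; 52840; 64014; 76480; -77262; 83648; 0; 0; -7179; -15708; 2267; -9920; 14429; -3658;
    15820; 8750; 6958]);
  (51174, (2, 5, 0)%N, [:: 0; 65784; -69366; 61596; -70432; -124962; -98152; 83260; -57285; -82916; 0; -43856; 43304;
    -26412; -1894; -62826; 150878; 41306; -26487; 2504; -60186; -23612; 0; 0; -23928; -15399; 24538; 15734; 14200;
    -8804; -10063; 4435; 10964]);
  (51174, (2, 4, 1)%N, [:: 0; 45768; 33744; -38820; 45368; 40326; 43856; 58300; -3900; -1628; 0; -30512; -33253;
    17013; 22589; -18624; -65068; 49757; 10806; 10268; 15636; -21344; 0; 0; 9705; 9705; -10964; 3236; -7496; 5671;
    -2203; -8804; 7628]);
  (51174, (2, 3, 2)%N, [:: 0; -83724; 17658; 984; 8264; 84078; 30512; -110540; 61041; 84064; 0; 55816; -14323; 3099;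
    -2593; 66906; -40870; -73375; 27417; -30868; 50166; 13516; 0; 0; 8283; -246; -7628; -15124; -9920; 1033; 5204;
    5671; -13954]);
  (51174, (2, 2, 3)%N, [:: 0; 52500; -35634; 39132; -79360; -174678; -55816; 88048; -40401; -94868; 0; -35000; 100688;
    -29760; -47542; -46284; 92882; 31406; -20835; 43184; -104574; 12316; 0; 0; -18312; -9783; 13954; 4034; 16000;
    -9920; 3437; 1033; 8750]);
  (51174, (2, 1, 4)%N, [:: 0; -21948; 27210; -88428; 8594; 62736; 35000; -63326; -47640; 57268; 0; 14632; -51523;
    22413; 58247; 15774; -103588; -53131; -57738; -61948; 83928; -52880; 0; 0; 22107; 22107; -8750; 7250; -12050;
    7471; -10771; -9920; -3658]);
  (102348, (2, 0, 5)%N, [:: 0; 45213; -83097; 72852; 71599; -180639; -29264; 64787; 133593; -424648; -51174; -123961;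
    201970; 30048; -440462; -59688; 123406; 106735; 204135; 352804; -527706; 194792; 0; -25587; -1155; -18213; 7316;
    -16784; 66659; -7042; 109030; -10645; 11800]);
  (51174, (1, 6, 0)%N, [:: 0; -52824; 21687; 27720; 25888; 127284; 68914; -9298; 119238; 124532; 0; 35216; -61844;
    9708; 41020; 42735; -21488; -2108; 64866; -43856; 125958; 54296; 0; 0; 1599; -6930; -4435; -9728; -6595; 3236;
    -5396; 15734; -8804]);
  (51174, (1, 5, 1)%N, [:: 0; 34026; -32778; 69744; -120992; -143943; -35216; 47462; -31644; -59992; 0; -22684;
    124510; -45372; -54881; -23256; 98488; -13658; 3228; 37720; -62292; -6136; 0; 0; -17436; -17436; 8804; 2209; 4034;
    -15124; 1825; 3236; 5671]);
  (51174, (1, 4, 2)%N, [:: 0; 6198; 27831; -90480; 32272; -6921; 22684; -34732; -65616; -25396; 0; -4132; 9376; 12102;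
    -21809; -183; -82916; -14288; -42624; -12416; -50850; -42928; 0; 0; 14091; 22620; -5671; -1637; -1279; 4034; 8887;
    -15124; 1033]);
  (51174, (1, 3, 3)%N, [:: 0; -59520; -22053; -23544; 58000; 103056; 4132; -87598; 37050; 55268; 0; 39680; -94910;
    21750; 48382; 31935; -35744; -39134; -42954; -35000; 56154; 20816; 0; 0; 14415; 5886; -1033; -2312; 137; 7250;
    -6080; 4034; -9920]);
  (51174, (1, 2, 4)%N, [:: 0; -6348; -39816; 93000; -67136; -116421; -39680; 66452; 29934; -93544; 0; -29884; 92002;
    -25176; -53549; 4068; 118180; 4792; 76434; 82864; -58656; 47864; 0; 0; -23250; -23250; 9920; 10057; 14636; -8392;
    4579; 7250; 7471]);
  (51174, (1, 1, 5)%N, [:: -51174; -21126; 65595; -81768; 168262; 209511; 29884; -29044; -72492; 88148; 0; 65258;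
    -177554; 43908; 155977; 21777; -94868; 79762; -45144; -91832; 114966; -77200; 0; 0; 11913; 20442; -7471; 7165;
    -18379; 14636; -17015; -8392; -3521]);
  (51174, (0, 7, 0)%N, [:: 0; 19416; 53646; -8910; 17672; 40722; 62936; 15376; 17112; 22924; 0; -12944; 4445; 6627;
    -1813; 5454; -103564; 4739; 21186; 1100; 14952; -16640; 0; 0; 15021; 15021; -15734; -4996; -10166; 2209; 3359;
    -9728; 3236]);
  (51174, (0, 6, 1)%N, [:: 0; -90744; 36732; -17544; -13096; 12456; 12944; -127148; 32103; 44464; 0; 60496; 25571;
    -4911; -35869; 61086; -34906; -98161; -10785; -22684; 1746; 12532; 0; 0; 12915; 4386; -3236; -13402; -2312; -1637;
    11090; 2209; -15124]);
  (51174, (0, 5, 2)%N, [:: 0; 24204; -48240; 9588; -18496; -100428; -60496; 5884; -58107; -97028; 0; -16136; 13232;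
    -6936; -8728; 7674; 73358; 8654; -53313; 29984; -79302; 7300; 0; 0; -10926; -2397; 15124; 12812; 18586; -2312;
    -2755; -1637; 4034]);
  (51174, (0, 4, 3)%N, [:: 0; 43500; 12876; -14364; 80456; 117960; 16136; 80752; 10632; 1324; 0; -29000; -85447;
    30171; 96341; -34938; -25876; 84263; 37566; 5564; 62976; 1432; 0; 0; 3591; 3591; -4034; 14552; -1364; 10057;
    -7387; -2312; 7250]);
  (51174, (0, 3, 4)%N, [:: 0; -50352; 29856; 40776; 159668; 206478; 29000; -51008; 68967; 99112; 0; 33568; -143089;
    72669; 55085; 48648; -8338; 47603; 55239; -29884; 99270; 9796; 0; 0; -1665; -10194; -7250; -8614; -14858; 7165;
    -6244; 10057; -8392]);
  (102348, (0, 2, 5)%N, [:: 0; 303567; -7443; 276756; -263315; -226677; -67136; 450401; 89247; 98480; -51174; -142675;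
    194152; -140322; 98536; -188844; 264058; 183475; 125277; -5948; 93018; 36632; 0; 25587; -86247; -69189; 16784;
    -12932; -13975; -29716; -43688; 39917; 29272])]%BZ.

Definition fam2_columns : seq (nat * expo) := [::
  (0, (0, 0, 3)); (0, (0, 1, 2)); (0, (0, 2, 1)); (0, (0, 3, 0)); (0, (1, 0, 2)); (0, (1, 1, 1)); (0, (1, 2, 0)); (0,
  (2, 0, 1)); (0, (2, 1, 0)); (0, (3, 0, 0)); (1, (0, 0, 3)); (1, (1, 0, 2)); (1, (2, 0, 1)); (2, (0, 0, 3)); (2, (0,
  1, 2)); (2, (0, 2, 1)); (2, (0, 3, 0)); (2, (1, 0, 2)); (2, (1, 1, 1)); (2, (1, 2, 0)); (2, (2, 0, 1)); (2, (2, 1,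
  0)); (2, (3, 0, 0)); (3, (0, 0, 2)); (3, (0, 1, 1)); (3, (0, 2, 0)); (3, (1, 0, 1)); (3, (1, 1, 0)); (3, (2, 0, 0));
  (4, (0, 0, 2)); (4, (0, 1, 1)); (4, (0, 2, 0)); (5, (0, 0, 2))]%N.

Definition fam2_rows : seq (Z * expo * seq Z) := [::
  (6, (7, 0, 0)%N, [:: 0; 12; -2; -6; -12; 0; 45; 23; 12; 27; 0; -6; 30; -4; 8; -17; -6; 11; 32; 30; 31; 12; 6; -6;
    -3; -2; 10; 15; 4; -4; 12; 1; 0]);
  (6, (6, 1, 0)%N, [:: 0; -8; 14; -27; -15; -20; 12; -23; -12; 6; 0; 4; 22; -5; -7; 20; -39; -21; 7; 6; -6; -30; 0; 4;
    -9; -9; -3; 4; -12; -5; -2; 2; 0]);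
  (6, (6, 0, 1)%N, [:: 0; 4; -5; 12; 3; 6; 12; 11; 15; -6; 0; -2; 3; 1; 7; -6; 12; 8; 14; 18; 5; 15; 0; -2; 3; 4; 8;
    4; 5; 1; 6; -2; 0]);
  (6, (5, 2, 0)%N, [:: 0; -10; -4; 24; 18; 9; -36; -14; 6; -24; 0; 5; -33; 6; -1; 14; 24; -4; -20; -18; -22; 6; 0; 5;
    8; 8; -3; -12; 2; 6; -7; -4; 0]);
  (6, (5, 1, 1)%N, [:: 0; 2; 6; -24; -12; -11; 15; -3; -18; 9; 0; -1; 19; -4; -3; -1; -24; -5; 2; 6; 3; -18; 0; -1;
    -7; -8; -1; 5; -6; -4; 1; 3; 0]);
  (6, (5, 0, 2)%N, [:: 0; -4; -8; 18; 6; 2; -3; -13; 12; -15; 0; 2; -4; 2; 4; 7; 18; -7; 4; 12; -11; 12; 0; 2; 5; 6;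
    6; -1; 4; 2; 2; -5; 0]);
  (6, (4, 3, 0)%N, [:: 0; 12; -7; 6; 3; 12; 6; 25; 9; 6; 0; -6; -3; 1; 5; -24; 12; 20; 4; 0; 13; 21; 0; -6; 1; 2; 2;
    2; 7; 1; 4; 2; 0]);
  (6, (4, 2, 1)%N, [:: 0; -8; -1; 9; 6; -2; -18; -14; -3; -12; 0; 4; -11; 2; -2; 12; 9; -9; -11; -6; -13; -3; 0; 4; 4;
    3; -1; -6; -1; 2; -4; -4; 0]);
  (6, (4, 1, 2)%N, [:: 0; 4; 4; -15; -9; -6; 12; 5; -6; 12; 0; -2; 12; -3; -3; -6; -15; 1; 3; 0; 10; -6; 0; -2; -5;
    -5; -3; 4; -2; -3; 0; 4; 0]);
  (6, (4, 0, 3)%N, [:: 0; -8; -9; 24; 9; 8; -6; -21; 9; -18; 0; 4; -13; 3; 5; 16; 24; -12; 4; 12; -15; 9; 0; 4; 7; 8;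
    8; -2; 3; 3; 2; -6; 0]);
  (6, (3, 4, 0)%N, [:: 0; 2; 4; -18; -12; -13; 21; -1; -12; 9; 0; -1; 23; -4; -1; -1; -18; -5; 8; 18; 5; -12; 0; -1;
    -5; -6; 3; 7; -4; -4; 3; 1; 0]);
  (6, (3, 3, 1)%N, [:: 0; 4; -2; 6; 0; 4; -3; 11; 12; 3; 0; -2; -2; 0; 0; -9; 6; 7; 4; -6; 7; 12; 0; -2; 1; 2; -2; -1;
    4; 0; 0; 1; 0]);
  (6, (3, 2, 2)%N, [:: 0; -6; -2; 12; 6; 3; -6; -10; 0; -6; 0; 3; -9; 2; 1; 12; 12; -6; -2; 0; -6; 0; 0; 3; 4; 4; 1;
    -2; 0; 2; -1; -2; 0]);
  (6, (3, 1, 3)%N, [:: 0; 6; 8; -18; -6; 1; 9; 13; -6; 15; 0; -3; 7; -2; -1; -9; -18; 11; 2; -6; 13; -6; 0; -3; -5;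
    -6; -3; 3; -2; -2; 1; 5; 0]);
  (6, (3, 0, 4)%N, [:: 0; -6; -12; 24; 12; 2; -9; -27; 6; -27; 0; 0; -16; 4; 6; 17; 24; -15; -2; 18; -25; 6; 0; 6; 7;
    8; 10; -3; 2; 4; 2; -9; 0]);
  (6, (2, 5, 0)%N, [:: 0; -8; 1; 3; 0; -6; -12; -16; -3; -6; 0; 4; -3; 0; -4; 14; 3; -13; -7; -6; -9; -9; 0; 4; 2; 1;
    -3; -4; -3; 0; -4; -2; 0]);
  (6, (2, 4, 1)%N, [:: 0; 0; 2; -3; -3; 0; 12; 1; 0; 6; 0; 0; 6; -1; 1; 4; -3; -1; 7; 6; 6; 0; 0; 0; -1; -1; 1; 4; 0;
    -1; 2; 2; 0]);
  (6, (2, 3, 2)%N, [:: 0; 4; -1; 0; 3; 10; 0; 7; 3; 6; 0; -2; -5; 1; 3; -6; 0; 8; 2; -6; 7; 3; 0; -2; -1; 0; 0; 0; 1;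
    1; 2; 2; 0]);
  (6, (2, 2, 3)%N, [:: 0; -4; -1; 3; 6; -4; -6; -8; -3; -12; 0; 2; -7; 2; 2; 6; 3; -3; -7; 6; -13; -3; 0; 2; 2; 1; 3;
    -2; -1; 2; 0; -4; 0]);
  (6, (2, 1, 4)%N, [:: 0; 8; 4; -21; -15; -8; 6; 17; -6; 12; 0; -4; 16; -3; -5; -18; -21; 7; 1; -6; 10; -6; 0; -4; -7;
    -7; -5; 2; -2; -3; -2; 4; 0]);
  (12, (2, 0, 5)%N, [:: 0; -32; -33; 63; 33; 0; -24; -84; 9; -81; -6; 4; -30; 12; 6; 53; 63; -45; 7; 57; -78; 9; 0;
    16; 19; 21; 30; -8; 3; 6; 0; -27; -3]);
  (6, (1, 6, 0)%N, [:: 0; 0; -2; 12; 6; 12; -3; 5; 12; 3; 0; 0; -12; 2; 2; 1; 12; 5; 2; -12; 7; 12; 0; 0; 3; 4; -2;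
    -3; 4; 2; 0; 1; 0]);
  (6, (1, 5, 1)%N, [:: 0; -2; 0; 0; 6; 9; 0; -6; -6; 0; 0; 1; -9; 2; 3; 6; 0; 0; -4; 0; -2; -6; 0; 1; 0; 0; 1; 0; -2;
    2; 1; 0; 0]);
  (6, (1, 4, 2)%N, [:: 0; 2; 2; -12; 0; -3; 3; 1; -6; -3; 0; -1; 3; 0; 1; -5; -12; 3; 0; 6; -5; -6; 0; -1; -3; -4; 3;
    1; -2; 0; 1; -1; 0]);
  (6, (1, 3, 3)%N, [:: 0; 4; -4; -6; -6; -10; -3; 7; 0; -3; 0; -2; 8; -2; -4; -13; -6; 3; -4; 0; -3; 0; 0; -2; -3; -2;
    -2; -1; 0; -2; -2; -1; 0]);
  (6, (1, 2, 4)%N, [:: 0; -12; -4; 18; 0; -5; -6; -14; 6; -12; 0; 3; 1; 0; -3; 14; 18; -16; 2; 6; -10; 6; 0; 3; 6; 6;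
    1; -2; 2; 0; -3; -4; 0]);
  (6, (1, 1, 5)%N, [:: -6; 6; 12; -12; -6; 5; 9; 21; 0; 27; 0; 3; 11; -4; 1; -7; -12; 13; 6; -18; 27; 0; 0; -3; -3;
    -4; -9; 3; 0; -4; -1; 9; 0]);
  (6, (0, 7, 0)%N, [:: 0; 4; 2; -3; 3; 10; 12; 7; 0; 6; 0; -2; -2; 1; 5; -4; -9; 9; 7; 6; 6; 0; 0; -2; -3; -3; 3; 4;
    0; 1; 4; 2; 0]);
  (6, (0, 6, 1)%N, [:: 0; 4; 1; -6; 3; 0; -6; 5; -3; -6; 0; -2; -3; 1; 1; -12; -6; 8; -4; 0; -7; -3; 0; -2; -3; -2; 2;
    -2; -1; 1; 0; -2; 0]);
  (6, (0, 5, 2)%N, [:: 0; 0; -1; -3; -6; -18; -6; -2; -3; -12; 0; 0; 9; -2; -6; -2; -3; -5; -7; 6; -13; -3; 0; 0; 0;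
    -1; -1; -2; -1; -2; -4; -4; 0]);
  (6, (0, 4, 3)%N, [:: 0; -4; 0; 9; -9; -6; 0; -3; 6; 0; 0; 2; 12; -3; -1; 6; 9; -11; 7; 0; 2; 6; 0; 2; 3; 3; -3; 0;
    2; -3; -4; 0; 0]);
  (6, (0, 3, 4)%N, [:: 0; 0; 3; 12; 9; 16; 6; 3; 9; 18; 0; 0; -5; 5; 1; 8; 12; 4; 8; -12; 21; 9; 0; 0; 3; 4; -4; 2; 3;
    -1; 2; 6; 0]);
  (12, (0, 2, 5)%N, [:: 0; -4; 9; 39; 33; 40; 0; -18; 15; 9; -6; 8; -50; 6; 24; 43; 39; -5; -5; -9; 14; 15; 0; 8; 15;
    13; 4; 0; 5; 12; 12; 3; 3])]%BZ.

(** Elimination modulo x_2: the certified monomials are those free of x_2, and they do not occur in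
    multiples of x_2. *)
Lemma generic_pencil (i j : 'I_3) idx (rows : seq (Z * expo * seq Z)) :
  certified (expos 5) (rcons [seq sgrad_pencil i j l | l <- [:: i0; i1; i2]] (sX i2)) idx rows ->
  uniq [seq r.1.2 | r <- rows] -> all (fun m => (m.2 == 0%N) == (m \in [seq r.1.2 | r <- rows])) (expos 5) ->
  all (fun r => r.1.2.2 == 0%N) rows ->
  exists phi : triple K -> K, [/\ exists d, polyfun d phi, phi f0 != 0 &
    forall f, cubic f -> phi f != 0 -> finite_pencil 5 i j f].
Proof.
move=> cert ur full flat.
have [|||||||phi [d p0 H]] := @reflected_elimination 'I_3 2 (fun l f => grad_pencil i j f l) (fun=> 4%N) 5 f0
  (sgrad_pencil i j) [:: i0; i1; i2] (sX i2) 1 idx rows _ _ _ cubic_f0 _ _ _ _ cert ur => //.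
- by move=> l; apply: (@polyfam_cross 1 1 (fun l (f : triple K) => (tnth f i)^`M(l))
    (fun l (f : triple K) => (tnth f j)^`M(l))) => k; exact: polyfam_grad.
- by move=> l f hf; apply: (@cross_homog 2 2) => k; exact: grad_homog.
- exact: grad_pencil_f0.
- by rewrite interp_X dhomogX /= mdeg1.
- move=> Q _ /mapP[r rr ->]; have /eqP m0 := allP flat r rr.
  rewrite interp_X; apply/eqP; rewrite mcoeff_eq0; apply/negP => /msuppM_le/allpairsP[[u v] /= [_]].
  rewrite msuppX inE => /eqP -> /(congr1 (fun m : 'X_{1..3} => m i2)).
  by rewrite emnmE /eget /v3 /= m0 mnmDE mnm1E addn1.
exists phi; split=> // f hf pf L hL LP Lz; apply: (H f hf pf L hL) => [C l|m mE mr]; first exact: LP.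
apply: Lz; first exact: expos_deg.
by rewrite emnmE /eget /v3 /=; apply: contraNneq mr => m0; rewrite -(eqP (allP full m mE)) m0.
Qed.

Lemma generic_pencil01 : exists phi : triple K -> K, [/\ exists d, polyfun d phi, phi f0 != 0 &
  forall f, cubic f -> phi f != 0 -> finite_pencil 5 i0 i1 f].
Proof. by apply: (@generic_pencil i0 i1 pencil01_columns pencil01_rows); vm_compute. Qed.

Lemma generic_pencil02 : exists phi : triple K -> K, [/\ exists d, polyfun d phi, phi f0 != 0 &
  forall f, cubic f -> phi f != 0 -> finite_pencil 5 i0 i2 f].
Proof. by apply: (@generic_pencil i0 i2 pencil02_columns pencil02_rows); vm_compute. Qed.

Lemma nodal_certified :
  certified (expos 3) (rcons [seq sder (sf0 i0) l | l <- [:: i0; i1; i2]] [::]) nodal_columns nodal_rows.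
Proof. by vm_compute. Qed.

Lemma generic_nodal : exists phi : triple K -> K, [/\ exists d, polyfun d phi, phi f0 != 0 &
  forall f, cubic f -> phi f != 0 -> nodal 2 i0 f].
Proof.
have [||||||||phi [d p0 H]] := @reflected_elimination 'I_3 1 (fun l f => (tnth f i0)^`M(l)) (fun=> 2%N) 3 f0
  (sder (sf0 i0)) [:: i0; i1; i2] [::] 0 nodal_columns nodal_rows _ _ _ cubic_f0 _ _ _ _ nodal_certified _ => //.
- exact: polyfam_grad.
- by move=> l f hf; exact: grad_homog.
- exact: deriv_f0.
- by rewrite interp_nil dhomog0.
- by move=> Q m _; rewrite interp_nil mulr0 mcoeff0.
exists phi; split=> // f hf pf L hL LP Lz; apply: (H f hf pf L hL) => [C l|m mE mr]; first exact: LP.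
have E : all (fun m => (m \in [seq r.1.2 | r <- nodal_rows]) || (m == (0, 0, 3)%N)) (expos 3) by vm_compute.
have := allP E m mE; rewrite (negPf mr) => /eqP ->; rewrite -[RHS]Lz; congr L; rewrite mpolyXn; congr 'X_[_].
by apply/mnmP; apply: ord3P; rewrite emnmE mulmnE mnm1E.
Qed.

(** For each of these vectors v, l . f (l x v) is a quartic in l. At [f0] the six quartics generate
    all forms of degree 6, so that they vanish together only at l = 0. *)
Definition line_vectors : seq (Z * Z * Z) := [:: (0, 1, 0); (1, 0, 0); (0, 0, 1); (1, -1, 0); (1, 0, 1); (0, 1, 1)]%BZ.
Definition sline (k : 'I_6) : 'I_3 -> spoly :=
  let v := nth (0, 0, 0)%BZ line_vectors k in
  scross sX (v3 [:: (v.1.1, (0, 0, 0)%N)] [:: (v.1.2, (0, 0, 0)%N)] [:: (v.2, (0, 0, 0)%N)]).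
Definition sline_form k : spoly :=
  smul (sX i0) (scomp (sf0 i0) (sline k)) ++ smul (sX i1) (scomp (sf0 i1) (sline k)) ++
  smul (sX i2) (scomp (sf0 i2) (sline k)).

Definition line_indices : seq 'I_6 := [:: @Ordinal 6 0 isT; @Ordinal 6 1 isT; @Ordinal 6 2 isT;
  @Ordinal 6 3 isT; @Ordinal 6 4 isT; @Ordinal 6 5 isT].

Lemma noline_certified :
  certified (expos 6) (rcons [seq sline_form k | k <- line_indices] [::]) noline_columns noline_rows.
Proof. by vm_compute. Qed.

Lemma comp_linear_homog d (P : {mpoly K[3]}) (q : 3.-tuple {mpoly K[3]}) : P \is d.-homog ->
  (forall i, tnth q i \is 1.-homog) -> P \mPo q \is d.-homog.
Proof.
move=> hP hq; rewrite comp_mpolyEX big_seq; apply: rpred_sum => m /(dhomog_mf hP) md.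
apply: dhomogZ; rewrite comp_mpolyX; have {md} <- : mdeg m = d by [].
have hX i : tnth q i ^+ m i \is (m i).-homog by rewrite -[X in X.-homog]mul1n; exact: dhomogMn.
rewrite mdegE !big_ord_recl !big_ord0; do 3?[apply: dhomogM => //]; exact: dhomog1.
Qed.

Lemma generic_noline : exists phi : triple K -> K, [/\ exists d, polyfun d phi, phi f0 != 0 &
  forall f, cubic f -> phi f != 0 -> noline f].
Proof.
pose q k : 3.-tuple {mpoly K[3]} := [tuple interp K (sline k i) | i < 3].
pose P k (f : triple K) := 'X_i0 * (tnth f i0 \mPo q k) + 'X_i1 * (tnth f i1 \mPo q k) + 'X_i2 * (tnth f i2 \mPo q k).
have qE k i : tnth (q k) i = interp K (sline k i) by rewrite tnth_mktuple.
pose w k : 'I_3 -> K := let v := nth (0, 0, 0)%BZ line_vectors k in v3 (zval K v.1.1) (zval K v.1.2) (zval K v.2).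
have slineE k x i : (interp K (sline k i)).@[x] = cross x (w k) i.
  rewrite interp_cross meval_cross; apply: cross_ext; apply: ord3P => /=; rewrite ?interp_const ?mevalC //.
  - by rewrite (interp_X K i0) mevalXU.
  - by rewrite (interp_X K i1) mevalXU.
  - by rewrite (interp_X K i2) mevalXU.
have PE k f x : (P k f).@[x] = dot x (ev f (cross x (w k))).
  rewrite /P !mevalD !mevalM !mevalXU !comp_mpoly_meval /dot /ev.
  by congr (_ * _ + _ * _ + _ * _); apply: meval_eq => i; rewrite qE slineE.
have qh k i : tnth (q k) i \is 1.-homog.
  by rewrite qE; apply: interp_homog; move: k i => [[|[|[|[|[|[|//]]]]]] hk]; apply: ord3P.
have [||||||||phi [d p0 H]] := @reflected_elimination 'I_6 1 P (fun=> 4%N) 6 f0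
  sline_form line_indices [::] 0 noline_columns noline_rows _ _ _ cubic_f0 _ _ _ _ noline_certified _ => //.
- by move=> k; do 2?[apply: polyfamD]; apply: polyfamMl; exact: polyfam_comp.
- move=> k f hf; have h i := comp_linear_homog (hf i) (qh k).
  by do 2?[apply: rpredD]; apply: (@dhomogM _ _ _ 1 _ 3); rewrite ?dhomogX /= ?mdeg1.
- move=> k; rewrite /P /sline_form interp_cat interp_cat 3!interp_mul !interp_X !f0E addrA.
  by rewrite !(interp_comp _ (qE k)).
- by rewrite interp_nil dhomog0.
- by move=> Q m _; rewrite interp_nil mulr0 mcoeff0.
exists phi; split=> // f hf pf l ll i.
have hL : functional (fun Q : {mpoly K[3]} => Q.@[l]) by move=> a A B; rewrite mevalD mevalZ.
(* Evaluation at l kills the six quartics, hence every monomial of degree 6, in particular the sixth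
   powers of the coordinates. *)
have /eqP : ('X_[(U_(i) *+ 6)%MM] : {mpoly K[3]}).@[l] = 0.
  apply: (H f hf pf _ hL) => [C k|m mE mr|]; last by rewrite mdegMn mdeg1 mul1n.
    by rewrite mevalM PE ll mulr0.
  have E : all (fun m => m \in [seq r.1.2 | r <- noline_rows]) (expos 6) by vm_compute.
  by rewrite (allP E m mE) in mr.
by rewrite -mpolyXn rmorphXn /= mevalXU expf_eq0 => /eqP.
Qed.

(** The three monomials without a certificate in degree 7 are those tested by [confining 6]. The
    family [Q] is [P] up to factors that make the degrees in the coefficients of f uniform. *)
Lemma confining_of_monomials (J : finType) (P : J -> triple K -> {mpoly K[3]}) (Q : J -> triple K -> {mpoly K[3]}) 
    (rows : seq (Z * expo * seq Z)) (phi : triple K -> K) :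
  (forall j f, exists c, Q j f = c * P j f) ->
  all (fun m => (m \in [seq r.1.2 | r <- rows]) || (m \in [:: (0, 0, 7); (1, 0, 6); (0, 1, 6)]%N)) (expos 7) ->
  (forall f, cubic f -> phi f != 0 -> forall L, functional L -> (forall C j, L (C * Q j f) = 0) ->
      (forall m, m \in expos 7 -> m \notin [seq r.1.2 | r <- rows] -> L 'X_[emnm m] = 0) ->
      forall m, mdeg m = 7%N -> L 'X_[m] = 0) ->
  forall f, cubic f -> phi f != 0 -> confining 6 (fun j => P j f).
Proof.
move=> QP full H f hf pf L hL LP Lz; apply: (H f hf pf L hL) => [C j|m mE mr].
  by have [c ->] := QP j f; rewrite mulrA.
have E l k : ('X_l * 'X_i2 ^+ 6 : {mpoly K[3]}) = 'X_[emnm k] -> L 'X_[emnm k] = 0 by move=> <-.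
have := allP full m mE; rewrite /= (negPf mr) /= !inE => /or3P[] /eqP ->; [apply: (E i2)|apply: (E i0)|apply: (E i1)];
  rewrite mpolyXn -mpolyXD; congr 'X_[_]; by apply/mnmP; apply: ord3P; rewrite mnmDE mulmnE !mnm1E emnmE.
Qed.

Definition sfam1 (j : 'I_3 + 'I_3 * 'I_3 * 'I_3) := match j with inl i => som i | inr x => som_minors x end.
Definition fam1_indices : seq ('I_3 + 'I_3 * 'I_3 * 'I_3) :=
  [:: inl i0; inl i1; inl i2; inr (i0, i1, i0); inr (i0, i1, i1); inr (i0, i1, i2); inr (i0, i2, i0);
      inr (i0, i2, i1); inr (i0, i2, i2); inr (i1, i2, i0); inr (i1, i2, i1); inr (i1, i2, i2)].

Lemma fam1_certified :
  certified (expos 7) (rcons [seq sfam1 j | j <- fam1_indices] [::]) fam1_columns fam1_rows.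
Proof. by vm_compute. Qed.

Definition sfam2 (j : 'I_3 + 'I_3) := match j with inl i => som i | inr x => sadj x end.
Definition fam2_indices : seq ('I_3 + 'I_3) := [:: inl i0; inl i1; inl i2; inr i0; inr i1; inr i2].

Lemma fam2_certified :
  certified (expos 7) (rcons [seq sfam2 j | j <- fam2_indices] [::]) fam2_columns fam2_rows.
Proof. by vm_compute. Qed.

Lemma generic_fam1 : exists phi : triple K -> K, [/\ exists d, polyfun d phi, phi f0 != 0 &
  forall f, cubic f -> phi f != 0 -> confining 6 (fam1 f)].
Proof.
pose Q (j : 'I_3 + 'I_3 * 'I_3 * 'I_3) (f : triple K) :=
  match j with inl i => leading f * om f i | inr x => om_minors f x end.
pose dg (j : 'I_3 + 'I_3 * 'I_3 * 'I_3) := match j with inl i => 4%N | inr x => 6%N end.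
have [||||||||phi [d p0 H]] := @reflected_elimination _ 2 Q dg 7 f0 sfam1 fam1_indices [::] 0
  fam1_columns fam1_rows _ _ _ cubic_f0 _ _ _ _ fam1_certified _ => //.
- move=> [i|x]; first exact: polyfamM polyfam_leading (polyfam_om i).
  apply: (@polyfam_cross 1 1 (fun l f => (om f x.1.1)^`M(l)) (fun l f => (om f x.1.2)^`M(l))) => l;
    exact/polyfam_deriv/polyfam_om.
- move=> [i|x] f hf; first exact/leadingM_homog/om_homog.
  by apply: (@cross_homog 3 3) => l; apply: dhomog_deriv; exact: om_homog.
- by move=> [i|x].
- by move=> [i|x]; rewrite /Q /= ?leading_f0 ?mul1r; [exact: om_f0|exact: om_minors_f0].
- by rewrite interp_nil dhomog0.
- by move=> P m _; rewrite interp_nil mulr0 mcoeff0.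
exists phi; split=> //; apply: (@confining_of_monomials _ (fun j f => fam1 f j) Q fam1_rows) H.
  by move=> [i|x] f; [exists (leading f)|exists 1; rewrite mul1r].
by vm_compute.
Qed.

Lemma generic_fam2 : exists phi : triple K -> K, [/\ exists d, polyfun d phi, phi f0 != 0 &
  forall f, cubic f -> phi f != 0 -> confining 6 (fam2 f)].
Proof.
pose Q (j : 'I_3 + 'I_3) (f : triple K) := match j with inl i => leading f * om f i | inr x => adjx f x end.
pose dg (j : 'I_3 + 'I_3) := match j with inl i => 4%N | inr x => 5%N end.
have [||||||||phi [d p0 H]] := @reflected_elimination _ 2 Q dg 7 f0 sfam2 fam2_indices [::] 0
  fam2_columns fam2_rows _ _ _ cubic_f0 _ _ _ _ fam2_certified _ => //.
- move=> [i|l]; first exact: polyfamM polyfam_leading (polyfam_om i).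
  by do 2?[apply: polyfamD]; apply: polyfamMl;
    apply: (@polyfam_cross 1 1 (fun l f => (tnth f _)^`M(l)) (fun l f => (tnth f _)^`M(l))) => k; exact: polyfam_grad.
- move=> [i|l] f hf; first exact/leadingM_homog/om_homog.
  do 2?[apply: rpredD]; apply: (@dhomogM _ _ _ 1 _ 4); rewrite ?dhomogX /= ?mdeg1 //;
    by apply: (@cross_homog 2 2) => k; exact: grad_homog.
- by move=> [i|l].
- by move=> [i|l]; rewrite /Q /= ?leading_f0 ?mul1r; [exact: om_f0|exact: adjx_f0].
- by rewrite interp_nil dhomog0.
- by move=> P m _; rewrite interp_nil mulr0 mcoeff0.
exists phi; split=> //; apply: (@confining_of_monomials _ (fun j f => fam2 f j) Q fam2_rows) H.
  by move=> [i|x] f; [exists (leading f)|exists 1; rewrite mul1r].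
by vm_compute.
Qed.

End Certificates.

(** * The generic open set *)

Section GenericMaps.
Variable K : numClosedFieldType.

Definition generic_conditions (f : triple K) :=
  [/\ finite_pencil 5 i0 i1 f, finite_pencil 5 i0 i2 f & nodal 2 i0 f] /\
  [/\ noline f, confining 6 (fam1 f) & confining 6 (fam2 f)].

Lemma generic_conditions_open : exists F : {mpoly K[3 * 10]}, [/\ exists d, F \is d.-homog,
  F.@[coefficients (f0 K) 0] != 0 &
  forall f, cubic f -> F.@[coefficients f 0] != 0 -> generic_conditions f].
Proof.
have [p1 [[e1 [F1 h1 E1]] z1 g1]] := generic_pencil01 K; have [p2 [[e2 [F2 h2 E2]] z2 g2]] := generic_pencil02 K.
have [p3 [[e3 [F3 h3 E3]] z3 g3]] := generic_nodal K; have [p4 [[e4 [F4 h4 E4]] z4 g4]] := generic_noline K.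
have [p5 [[e5 [F5 h5 E5]] z5 g5]] := generic_fam1 K; have [p6 [[e6 [F6 h6 E6]] z6 g6]] := generic_fam2 K.
exists (F1 * F2 * F3 * F4 * F5 * F6); split.
- by exists (e1 + e2 + e3 + e4 + e5 + e6)%N; do 5?[apply: dhomogM => //].
- have c0 := cubic_f0 K; by rewrite !mevalM !mulf_neq0 // -?E1 -?E2 -?E3 -?E4 -?E5 -?E6.
move=> f hf; rewrite !mevalM !mulf_eq0 !negb_or -E1 // -E2 // -E3 // -E4 // -E5 // -E6 //.
case/andP=> /andP[/andP[/andP[/andP[y1 y2] y3] y4] y5] y6.
by split; split; [apply: g1|apply: g2|apply: g3|apply: g4|apply: g5|apply: g6].
Qed.

Lemma generic_normal_form (f : triple K) : Bir3 f -> generic_conditions f ->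
  exists N, normal N f /\ forall i l, (tnth f i)^`M(l).@[v3 (nal N) (nbe N) 1] = 0.
Proof.
move=> [[hf _] [g /inverse_ev[[m hg] [h [h' [h0 h'0 fg gf]]]]]] [[fp1 fp2 nod] _].
have [p p2 hp] := double_point hf h0 fg fp1 fp2 nod.
have pE : v3 (p i0) (p i1) 1 =1 p by apply: ord3P; rewrite /v3 //= p2.
have hD i l : (tnth f i)^`M(l).@[v3 (p i0) (p i1) 1] = 0 by rewrite (meval_eq _ pE).
have [N [Na Nb nf]] := normal_form hf hg gf h'0 hD.
by exists N; split=> // i l; rewrite Na Nb.
Qed.

Lemma interp_meval s x : (interp K s).@[x] =
  \sum_(t <- s) zval K t.1 * (x i0 ^+ t.2.1.1 * x i1 ^+ t.2.1.2 * x i2 ^+ t.2.2).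
Proof.
rewrite /interp raddf_sum; apply: eq_bigr => t _ /=.
by rewrite mevalZ meval_monomial !emnmE.
Qed.

Lemma ev_f0 x : [/\ ev (f0 K) x i0 = - (x i1 ^+ 2 * x i2) - x i0 ^+ 2 * x i1 - x i0 ^+ 2 * x i2,
  ev (f0 K) x i1 = x i0 * x i1 * x i2 + x i0 ^+ 3 + x i0 * x i1 ^+ 2 &
  ev (f0 K) x i2 = - (x i0 ^+ 2 * x i2) + x i1 ^+ 3].
Proof.
have zm : zval K (-1)%BZ = -1 by rewrite (zvalN K 1%BZ) zval1.
by split; rewrite /ev f0E interp_meval /sf0 /v3 /= !big_cons big_nil /= ?zm ?zval1; ring.
Qed.

(** The first row subtracts the last component C of [f0] from y S + C; the other parameters are read
    off S = - y z - x^2 - y^2 and C = - x^2 z + y^3. *)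
Definition normal_f0 : nform K := NForm 0 0 (v3 1 0 (-1)) (v3 0 1 0) (v3 0 0 1)
  0 (-1) (-1) 0 (-1) (-1) 0 0 0 0 0 1.

Lemma normal_f0P : normal normal_f0 (f0 K).
Proof.
split=> [|t0 t1 z]; first by rewrite /dot /cross /v3 /= !(mul0r, mulr0, mulr1, subr0, addr0, add0r) oner_neq0.
have [e0 e1 e2] := ev_f0 (pt 0 0 t0 t1 z).
by rewrite /dot /= e0 e1 e2 /pt /sg /sq /cc /dd /v3 /=; split; ring.
Qed.

Lemma f0_double_point i l : (tnth (f0 K) i)^`M(l).@[v3 0 0 1] = 0.
Proof.
rewrite deriv_f0 interp_meval big_seq big1 // => t ts.
(* Every monomial of the derivatives contains x_0 or x_1, both zero at the double point. *)
have : all (fun t : Z * expo => (0 < eget t.2 i0 + eget t.2 i1)%N) (sder (sf0 i) l).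
  by move: i l {ts}; apply: ord3P; apply: ord3P; vm_compute.
move=> /allP/(_ t ts); rewrite /eget /v3 /= !expr0n addn_gt0 => /orP[] /lt0n_neq0/negPf ->;
  by rewrite ?mul0r ?mulr0 ?mul0r ?mulr0.
Qed.

Lemma Bir3_f0 : generic_conditions (f0 K) -> Bir3 (f0 K).
Proof.
move=> [_ [hline conf1 conf2]]; have hf := cubic_f0 K; split.
  (* On the plane x_2 = 0 the last component is x_1^3, and the middle one becomes x_0^3 where x_1 =
     0, so there is no common zero outside the origin. *)
  split=> //; apply: (@plane_no_common_factor K 3 (f0 K) (v3 1 0 0) (v3 0 1 0) hf) => a b nab.
  have [e0 _ e2] := ev_f0 (fun j => a * v3 1 0 0 j + b * v3 0 1 0 j).
  move: e0 e2; rewrite /v3 /= !(mulr0, mulr1, addr0, add0r, oppr0, mul0r, subr0) => e0 e2.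
  have [b0|b0] := eqVneq b 0; last by exists i2; rewrite e2 expf_neq0.
  have [_ e1 _] := ev_f0 (fun j => a * v3 1 0 0 j + b * v3 0 1 0 j).
  exists i1; rewrite e1 /v3 /= b0 !(mulr0, mulr1, addr0, add0r, oppr0, mul0r, subr0) expr0n mulr0 addr0.
  by move: nab; rewrite /nonzero b0 eqxx orbF => a0; rewrite expf_neq0.
by have [g [fg _]] := inverse_exists hf normal_f0P f0_double_point conf1 conf2 hline; exists g.
Qed.

End GenericMaps.

Theorem mainTheorem20 (R : realType) :
  exists U : triple (complex R) -> Prop,
    [/\ open_in_Bir3 U,
        exists f, U f,
        forall f, U f -> has_generic_singularities f
      & forall f g, U f -> U g -> same_singularities f g -> triple_eq f g].
Proof.
have [F [hF F0 FU]] := generic_conditions_open (complex R).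
exists (fun f => Bir3 f /\ F.@[coefficients f 0] != 0); split.
(* The predicate [eq F] is the singleton of F: one form cuts out the complement. *)
- exists (eq F); split=> [_ <- //|f]; split=> [[bf Ff]|[bf [_ <- Ff]]] //.
  by split=> //; exists F.
- by exists (f0 (complex R)); split=> //; apply: Bir3_f0; apply: FU => //; exact: cubic_f0.
- move=> f [bf Ff]; have [[hf _] _] := bf; have gf := FU f hf Ff.
  have [N [nf hD]] := generic_normal_form bf gf; have [_ [hl c1 c2]] := gf.
  exact: generic_singularities hf nf hD c1 c2 hl.
move=> f g [bf Ff] [bg Fg]; have [[hf _] _] := bf; have [[hg _] _] := bg.
have gf := FU f hf Ff; have gg := FU g hg Fg.
have [N [nf hD]] := generic_normal_form bf gf; have [N' [nf' hD']] := generic_normal_form bg gg.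
have [_ [hl c1 c2]] := gf; have [_ [hl' c1' c2']] := gg.
exact: same_singularities_eq hf nf hD c1 c2 hl hg nf' hD' c1' c2' hl'.
Qed.
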